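(* There is a universal constant $\epsilon>0$ such that for every constant $k\ge 1$ the following hold. 1. Suppose there is a polynomial-time function $f$ such that for every sufficiently large $n$ (say all $n>n_0$) the propositional formula $w^k_n(f)$ is a tautology. If the proof system $\mathrm{EF}+w^k(f)$ is not polynomially bounded, then $\mathrm{SAT}_n\notin \mathrm{Circuit}[n^{\epsilon k}]$ for infinitely many $n$. 2. Suppose there is a polynomial-time function $f$ and a constant $n_0$ such that Buss's theory $S^1_2$ proves $W^k_{n_0}(f)$. If Extended Frege $\mathrm{EF}$ is not polynomially bounded, then $\mathrm{SAT}_n\notin \mathrm{Circuit}[n^{\epsilon k}]$ for infinitely many $n$.
   Context: $\mathrm{EF}$ is the Extended Frege propositional proof system; a proof system is polynomially bounded if every tautology has a proof of size polynomial in its size. $S^1_2$ is Buss's first-order theory of bounded arithmetic formalizing polynomial-time reasoning. $\mathrm{SAT}_n(x,y)$ is a polynomial-time predicate saying that $x$ is an $n$-bit string encoding a propositional formula satisfied by the assignment $y$; as a Boolean function, $\mathrm{SAT}_n(x)=1$ iff $\exists y\,\mathrm{SAT}_n(x,y)$. $\mathrm{Circuit}[s(n)]$ is the set of single-output fan-in-two Boolean circuits with $n$ inputs and size at most $s(n)$. For a function $f$ mapping (descriptions of) circuits to pairs $f(C)=\langle f_1(C),f_2(C)\rangle$, the formula $w^k_n(f)$ is (a natural propositional encoding of) $$[\mathrm{SAT}_n(x,y)\rightarrow \mathrm{SAT}_n(x,C(x))]\vee[\mathrm{SAT}_n(f_1(C),f_2(C))\wedge\neg \mathrm{SAT}_n(f_1(C),C(f_1(C)))],$$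 where the free variables $x,y$ are $n$-bit strings and the free variables $C$ represent a circuit with $n$ inputs, at most $n$ outputs and size $n^k$, with $C(z)$ its output on $z$. If $w^k_n(f)$ is a tautology for all $n>n_0$, the system $\mathrm{EF}+w^k(f)$ consists of $\mathrm{EF}$-proofs which may additionally derive, in one step, any substitution instance of $w^k_n(f)$ for $n>n_0$. $W^k_{n_0}(f)$ is a natural $\forall\Pi^b_1$ bounded-arithmetic formalization of the statement ''for all $n>n_0$, $w^k_n(f)$ holds''. *)

(* Defs.v *)
From Stdlib Require Import List Arith NArith Bool Reals.
Import ListNotations.
Open Scope nat_scope.

(** * Propositional logic and Extended Frege *)

(** Negation is [A -> bot].  The size of a formula is its number of symbols. *)
Inductive pform : Type :=
| pvar (i : nat)
| pbot
| pimp (A B : pform)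
| pand (A B : pform)
| por (A B : pform).

Definition pneg A := pimp A pbot.
Definition ptop := pneg pbot.
Definition piff A B := pand (pimp A B) (pimp B A).
Definition pconj (l : list pform) := fold_right pand ptop l.
Definition pdisj (l : list pform) := fold_right por pbot l.

Fixpoint peval (v : nat -> bool) (A : pform) : bool :=
  match A with
  | pvar i => v i
  | pbot => false
  | pimp A B => implb (peval v A) (peval v B)
  | pand A B => peval v A && peval v B
  | por A B => peval v A || peval v B
  end.

Definition tautology (A : pform) : Prop := forall v, peval v A = true.

Fixpoint psize (A : pform) : nat :=
  match A with
  | pvar _ | pbot => 1
  | pimp A B | pand A B | por A B => S (psize A + psize B)
  end.

Fixpoint psubst (s : nat -> pform) (A : pform) : pform :=
  match A with
  | pvar i => s i
  | pbot => pbot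
  | pimp A B => pimp (psubst s A) (psubst s B)
  | pand A B => pand (psubst s A) (psubst s B)
  | por A B => por (psubst s A) (psubst s B)
  end.

Fixpoint occurs (q : nat) (A : pform) : Prop :=
  match A with
  | pvar i => q = i
  | pbot => False
  | pimp A B | pand A B | por A B => occurs q A \/ occurs q B
  end.

Inductive frege_axiom : pform -> Prop :=
| fr_K A B : frege_axiom (pimp A (pimp B A))
| fr_S A B C :
    frege_axiom (pimp (pimp A (pimp B C)) (pimp (pimp A B) (pimp A C)))
| fr_andI A B : frege_axiom (pimp A (pimp B (pand A B)))
| fr_andE1 A B : frege_axiom (pimp (pand A B) A)
| fr_andE2 A B : frege_axiom (pimp (pand A B) B)
| fr_orI1 A B : frege_axiom (pimp A (por A B))
| fr_orI2 A B : frege_axiom (pimp B (por A B))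
| fr_orE A B C :
    frege_axiom (pimp (pimp A C) (pimp (pimp B C) (pimp (por A B) C)))
| fr_dn A : frege_axiom (pimp (pneg (pneg A)) A).

(** [ef_lines Ax F pi]: the lines [pi], listed from the last one to the first
    one, form a derivation in EF extended by the axioms [Ax], in which no
    extension variable occurs in [F]. *)
Inductive ef_lines (Ax : pform -> Prop) (F : pform) : list pform -> Prop :=
| ef_nil : ef_lines Ax F []
| ef_frege A pi : frege_axiom A -> ef_lines Ax F pi -> ef_lines Ax F (A :: pi)
| ef_axiom A pi : Ax A -> ef_lines Ax F pi -> ef_lines Ax F (A :: pi)
| ef_mp A B pi :
    In (pimp A B) pi -> In A pi -> ef_lines Ax F pi -> ef_lines Ax F (B :: pi)
| ef_extension q A pi :
    ~ occurs q A -> ~ occurs q F -> Forall (fun B => ~ occurs q B) pi ->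
    ef_lines Ax F pi -> ef_lines Ax F (piff (pvar q) A :: pi).

Definition ef_proof (Ax : pform -> Prop) (F : pform) (pi : list pform) : Prop :=
  ef_lines Ax F pi /\ hd_error pi = Some F.

Definition proof_size (pi : list pform) : nat := list_sum (map psize pi).

(** A proof system, given by its relation "[pi] is a proof of [F]". *)
Definition proof_system : Type := pform -> list pform -> Prop.

Definition polynomially_bounded (P : proof_system) : Prop :=
  exists c : nat, forall F, tautology F ->
    exists pi, P F pi /\ proof_size pi <= psize F ^ c + c.

Definition EF : proof_system := ef_proof (fun _ => False).

(** * Satisfiability of propositional formulas coded by [n]-bit strings

    A string is split into [n] tokens of [3 + |n|] bits (it is read as if
    followed by zeros).  The first three bits [o0 o1 o2] of a token give an
    operation, the [|n|] others (most significant bit first) the index of a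
    variable.  The tokens are the reverse Polish notation of the formula; blank
    tokens serve as padding.

      o2 o1 o0 | 000    001  010       011  100  101
               | blank  bot  variable  ->   /\   \/                           *)

(** The length of the binary representation of [n], written [|n|]. *)
Definition blen (n : nat) : nat := N.size_nat (N.of_nat n).

Definition slice (x : list bool) (i len : nat) : list bool :=
  map (fun j => nth (i + j) x false) (seq 0 len).

Definition be_val (l : list bool) : nat :=
  fold_left (fun a b => 2 * a + Nat.b2n b) l 0.

Definition read_token (n : nat) (st : option (list pform)) (t : list bool)
    : option (list pform) :=
  match t with
  | o0 :: o1 :: o2 :: idx =>
    match o2, o1, o0, st with
    | false, false, false, _ => st
    | false, false, true, Some l => Some (pbot :: l)
    | false, true, false, Some l =>
        if be_val idx <? n then Some (pvar (be_val idx) :: l) else None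
    | false, true, true, Some (B :: A :: l) => Some (pimp A B :: l)
    | true, false, false, Some (B :: A :: l) => Some (pand A B :: l)
    | true, false, true, Some (B :: A :: l) => Some (por A B :: l)
    | _, _, _, _ => None
    end
  | _ => None
  end.

Definition decode (n : nat) (x : list bool) : option pform :=
  let w := 3 + blen n in
  match fold_left (read_token n) (map (fun j => slice x (j * w) w) (seq 0 n))
          (Some []) with
  | Some [A] => Some A
  | _ => None
  end.

Definition SAT2 (n : nat) (x y : list bool) : bool :=
  match decode n x with
  | Some A => (length x =? n) && (length y =? n)
              && peval (fun i => nth i y false) A
  | None => false
  end.

Definition SAT (n : nat) (x : list bool) : Prop :=
  exists y, length y = n /\ SAT2 n x y = true.

(** * Circuits *)

(** A gate [(op, i, j)] applies [op] to wires [i] and [j].  The wires of a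
    circuit with [n] inputs are the inputs [0 .. n-1] followed by the gates. *)
Definition gate : Type := ((bool -> bool -> bool) * nat * nat)%type.

Fixpoint wf_gates (m : nat) (gs : list gate) : Prop :=
  match gs with
  | [] => True
  | (_, i, j) :: gs => i < m /\ j < m /\ wf_gates (S m) gs
  end.

Definition wires (gs : list gate) (x : list bool) : list bool :=
  fold_left (fun v '(op, i, j) => v ++ [op (nth i v false) (nth j v false)])
    gs x.

Record circuit (n : nat) : Type := Circuit_ {
  gates : list gate;
  output : nat;
  gates_wf : wf_gates n gates;
  output_wf : output < n + length gates }.

Definition circuit_size {n} (C : circuit n) : nat := length (gates n C).

Definition circuit_eval {n} (C : circuit n) (x : list bool) : bool :=
  nth (output n C) (wires (gates n C) x) false.

(** SAT_n is in Circuit[s]. *)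
Definition SAT_in_Circuit (n : nat) (s : R) : Prop :=
  exists C : circuit n, (INR (circuit_size C) <= s)%R /\
    forall x, length x = n -> (circuit_eval C x = true <-> SAT n x).

(** * Polynomial-time functions: Cobham's algebra

    An argument list is read as if followed by zeros.  [Rec g h b] is limited
    recursion on notation on the first argument [z]:
      F(0, e) = g(e),
      F(z, e) = min (h (F(floor(z/2), e), z, e), b (z, e))   for z > 0. *)
Inductive prog : Type :=
| Proj (i : nat)
| Zero
| Bit (b : bool)                       (* x |-> 2 x + b *)
| Half                                 (* x |-> floor(x / 2) *)
| Odd                                  (* x |-> x mod 2 *)
| Len                                  (* x |-> |x| *)
| Smash                                (* x, y |-> 2 ^ (|x| |y|) *)
| Cond                                 (* c, x, y |-> x if c > 0, else y *)
| Comp (f : prog) (gs : list prog)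
| Rec (g h b : prog).

Fixpoint run (p : prog) (e : list N) : N :=
  let x := nth 0 e 0%N in
  match p with
  | Proj i => nth i e 0
  | Zero => 0
  | Bit b => 2 * x + N.b2n b
  | Half => N.div2 x
  | Odd => N.b2n (N.odd x)
  | Len => N.size x
  | Smash => 2 ^ (N.size x * N.size (nth 1 e 0))
  | Cond => if (x =? 0)%N then nth 2 e 0 else nth 1 e 0
  | Comp f gs => run f (map (fun g => run g e) gs)
  | Rec g h b =>
      match x with
      | N0 => run g (tl e)
      | Npos q =>
          (fix go (q : positive) : N :=
             let prev := match q with
                         | xH => run g (tl e)
                         | xO q' | xI q' => go q'
                         end in
             N.min (run h (prev :: Npos q :: tl e)) (run b (Npos q :: tl e))) q
      end
  end%N.

(** ** Satisfaction and circuit evaluation as polynomial-time functions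

    Bit [i] of a string is bit [i] of the number coding it.  A stack of bits is
    coded by the number with binary representation 1 (a sentinel) followed by
    the bits, the top one last; 0 signals an error.  A number [u] is also used as
    the unary code of its length [|u|]. *)
Definition one := Comp (Bit true) [Zero].
Definition s0 p := Comp (Bit false) [p].
Definition s1 p := Comp (Bit true) [p].
Definition half p := Comp Half [p].
Definition odd p := Comp Odd [p].
Definition smash p q := Comp Smash [p; q].
Definition cond p q r := Comp Cond [p; q; r].
Definition push v b := cond b (s1 v) (s0 v).
(** A number of length [|p| |q|]. *)
Definition times p q := half (smash p q).

(** [x >> |u|] *)
Definition shr u x := Comp (Rec (Proj 0) (half (Proj 0)) (Proj 1)) [u; x].
Definition bit u x := odd (shr u x).

(** A number of length [min (i, |u|)]. *)
Definition unary i u :=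
  Comp (Rec Zero
          (let d := times (Proj 0) (s1 one) in cond (odd (Proj 1)) (s1 d) d)
          (Proj 1)) [i; u].

(** The bits [0 .. |u|-1] of [x], appended in this order below [v]: [v = one]
    gives the stack of these bits, [v = Zero] the number having these bits, the
    most significant one first. *)
Definition read_bits v u x :=
  Comp (Rec v (push (Proj 0) (bit (half (Proj 1)) (Proj 2)))
          (smash one (s1 (Proj 0)))) [u; x].

(** Effect on the stack of truth values [v] of the token at the beginning of
    [t].  Arguments: [v], [t], [N], [y] where [|N| = n]. *)
Definition step_prog : prog :=
  let v := Proj 0 in let t := Proj 1 in let N := Proj 2 in let y := Proj 3 in
  let o0 := odd t in
  let o1 := odd (half t) in
  let o2 := odd (half (half t)) in
  let i := unary (read_bits Zero (Comp Len [N]) (half (half (half t)))) N in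
  let B := odd v in
  let A := odd (half v) in
  let rest := half (half v) in
  let guarded r b := cond r (push r b) Zero in
  cond o2
    (cond o1 Zero
       (guarded rest (cond o0 (cond A one B) (cond A B Zero))))
    (cond o1
       (cond o0 (guarded rest (cond A B one))
          (cond (shr i N) (guarded v (bit i y)) Zero))
       (cond o0 (guarded v Zero) v)).

(** Arguments: [N], [x], [y] where [|N| = n]; the value is 1 if [x] and [y] have
    at most [n] bits and [SAT2 n x y], and 0 otherwise. *)
Definition sat_prog : prog :=
  let stack :=
    Comp (Rec one
      (let w := s1 (s1 (s1 (Comp Len [Proj 2]))) in
       Comp step_prog
         [Proj 0; shr (times (half (Proj 1)) w) (Proj 3); Proj 2; Proj 4])
      (smash one (s1 (Proj 0))))
      [Proj 0; Proj 0; Proj 1; Proj 2] in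
  cond (shr (Proj 0) (Proj 1)) Zero
    (cond (shr (Proj 0) (Proj 2)) Zero
       (Comp (cond (half (half (Proj 0))) Zero
                (cond (odd (half (Proj 0))) (odd (Proj 0)) Zero)) [stack])).

(** A circuit with [n] inputs, [n ^ k] gates and [n] outputs is described by
    [n ^ k] blocks for the gates followed by [n] pointers for the outputs.  A
    pointer consists of [p = |n ^ k| + 1] bits (most significant bit first)
    forming the index of a wire; pointers to wires that are not yet defined read
    the constant 0, so that a string of [descr_len n k] bits always describes a
    circuit, and so that outputs may be left unused.  A block consists of the
    truth table of the gate (four bits, the value at [(a, b)] having index
    [2 a + b]) and of two pointers. *)
Definition descr_len (n k : nat) : nat :=
  let p := blen (n ^ k) + 1 in n ^ k * (4 + 2 * p) + n * p.

(** [|n_power j| = n ^ j] for the argument [N], [|N| = n]. *)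
Fixpoint n_power (j : nat) : prog :=
  match j with
  | 0 => one
  | S j => times (n_power j) (Proj 0)
  end.

(** The value of the wire with index [i], for the stack [v] of wires. *)
Definition wire v i :=
  Comp (let r := shr (unary (Proj 1) (Proj 0)) (half (Proj 0)) in
        cond r (bit (half r) (Proj 0)) Zero) [v; i].

(** The stack of wires [v] extended by the gate described at the beginning of
    [t], for pointers of [|p|] bits.  Arguments: [v], [t], [p]. *)
Definition gate_prog : prog :=
  let v := Proj 0 in let t := Proj 1 in let p := Proj 2 in
  let t1 := half t in let t2 := half t1 in let t3 := half t2 in
  let l := half t3 in
  let r := shr p l in
  push v (cond (wire v (read_bits Zero p l))
            (cond (wire v (read_bits Zero p r)) (odd t3) (odd t2))
            (cond (wire v (read_bits Zero p r)) (odd t1) (odd t))).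

(** Arguments: [N], [C], [z] where [|N| = n]; the value is the string of the [n]
    output bits of the circuit described by [C] on the input [z]. *)
Definition eval_prog (k : nat) : prog :=
  let p := s1 (Comp Len [n_power k]) in
  (* arguments: N, C, z, K with |K| = n ^ k, p, a number of length 4 + 2 |p| *)
  let main :=
    let v0 := read_bits one (Proj 0) (Proj 2) in
    let v :=
      Comp (Rec (Proj 0)
              (Comp gate_prog
                 [Proj 0; shr (times (half (Proj 1)) (Proj 5)) (Proj 3); Proj 4])
              (smash (s1 (Proj 0)) (s1 (Proj 1))))
        [Proj 3; v0; Proj 1; Proj 4; Proj 5] in
    let outs :=
      Comp (Rec Zero
              (push (Proj 0)
                 (wire (Proj 2)
                    (read_bits Zero (Proj 4)
                       (shr (times (half (Proj 1)) (Proj 4)) (Proj 3)))))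
              (smash one (s1 (Proj 0))))
        [Proj 0; v; shr (times (Proj 3) (Proj 5)) (Proj 1); Proj 4] in
    read_bits Zero (Proj 0) outs in
  Comp main
    [Proj 0; Proj 1; Proj 2; n_power k; p; s1 (s1 (s1 (s1 (times p (s1 one)))))].

(** A polynomial-time function from descriptions [C] of circuits with [n] inputs
    to pairs of strings: two programs with arguments [N], [C], where
    [N = 2 ^ n - 1] is [n] in unary. *)
Definition poly_fun : Type := (prog * prog)%type.

(** * Propositional translation

    A number is represented by the list of its bits, least significant bit
    first, every bit being a variable or a constant; leading zeros are allowed.
    A program is translated gate by gate, a new variable [q] and its definition
    [q <-> A] being added for each gate. *)
Definition bits : Type := list pform.
Definition trans (A : Type) : Type :=
  (nat * list pform) -> (A * (nat * list pform)).
Definition ret {A} (a : A) : trans A := fun s => (a, s).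
Definition bind {A B} (m : trans A) (f : A -> trans B) : trans B :=
  fun s => let (a, s') := m s in f a s'.
Notation "x <- m ;; c" := (bind m (fun x => c))
  (at level 61, m at next level, right associativity).

Definition define (A : pform) : trans pform :=
  fun '(q, ds) => (pvar q, (S q, piff (pvar q) A :: ds)).

Definition mapM {A B} (f : A -> trans B) : list A -> trans (list B) :=
  fix go l :=
    match l with
    | [] => ret []
    | a :: l => b <- f a;; bs <- go l;; ret (b :: bs)
    end.

Definition foldM {A B} (f : A -> B -> trans A) : A -> list B -> trans A :=
  fix go a l :=
    match l with
    | [] => ret a
    | b :: l => a' <- f a b;; go a' l
    end.

Definition pconst (b : bool) : pform := if b then ptop else pbot.
Definition nth_bit (x : bits) (i : nat) : pform := nth i x pbot.

(** [|x| = a] *)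
Definition len_is (x : bits) (a : nat) : pform :=
  pand (if a =? 0 then ptop else nth_bit x (a - 1))
       (pconj (map pneg (skipn a x))).

Definition mux (c : pform) (x y : bits) : trans bits :=
  mapM (fun i => define (por (pand c (nth_bit x i)) (pand (pneg c) (nth_bit y i))))
    (seq 0 (Nat.max (length x) (length y))).

Definition less (x y : bits) : trans pform :=
  foldM (fun c i =>
           let a := nth_bit x i in let b := nth_bit y i in
           define (por (pand (pneg a) b) (pand (piff a b) c)))
    pbot (seq 0 (Nat.max (length x) (length y))).

Definition minimum (x y : bits) : trans bits :=
  c <- less x y;; r <- mux c x y;; ret (firstn (length y) r).

Fixpoint translate (p : prog) (e : list bits) : trans bits :=
  let x := nth 0 e [] in
  match p with
  | Proj i => ret (nth i e [])
  | Zero => ret []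
  | Bit b => ret (pconst b :: x)
  | Half => ret (tl x)
  | Odd => ret (firstn 1 x)
  | Len =>
      mapM (fun j => define (pdisj (map (len_is x)
              (filter (fun a => Nat.testbit a j) (seq 0 (S (length x)))))))
        (seq 0 (blen (length x)))
  | Smash =>
      let y := nth 1 e [] in
      mapM (fun j => define (pdisj (map (fun '(a, b) => pand (len_is x a) (len_is y b))
              (filter (fun '(a, b) => a * b =? j)
                 (list_prod (seq 0 (S (length x))) (seq 0 (S (length y))))))))
        (seq 0 (S (length x * length y)))
  | Cond => c <- define (pdisj x);; mux c (nth 1 e []) (nth 2 e [])
  | Comp f gs => xs <- mapM (fun g => translate g e) gs;; translate f xs
  | Rec g h b =>
      v0 <- translate g (tl e);;
      foldM (fun v i =>
               let z := skipn i x in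
               hv <- translate h (v :: z :: tl e);;
               bv <- translate b (z :: tl e);;
               m <- minimum hv bv;;
               c <- define (pdisj z);;
               mux c m v)
        v0 (rev (seq 0 (length x)))
  end.

Definition var_block (i len : nat) : bits := map pvar (seq i len).

(** The formula w^k_n(f).  The variables are those of [x] ([0 .. n-1]), those of
    [y] ([n .. 2n-1]), those of the description of [C], and those introduced by
    the translation. *)
Definition w_formula (k n : nat) (f : poly_fun) : pform :=
  let N := repeat ptop n in
  let x := var_block 0 n in
  let y := var_block n n in
  let C := var_block (2 * n) (descr_len n k) in
  let sat u v := s <- translate sat_prog [N; u; v];; ret (pdisj s) in
  let (matrix, s) :=
    (Cx <- translate (eval_prog k) [N; C; x];;
     f1 <- translate (fst f) [N; C];;
     f2 <- translate (snd f) [N; C];;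
     Cf1 <- translate (eval_prog k) [N; C; f1];;
     a <- sat x y;;
     b <- sat x Cx;;
     c <- sat f1 f2;;
     d <- sat f1 Cf1;;
     ret (por (pimp a b) (pand c (pneg d))))
    (2 * n + descr_len n k, []) in
  pimp (pconj (snd s)) matrix.

Definition EF_plus_w (k : nat) (f : poly_fun) (n0 : nat) : proof_system :=
  ef_proof (fun A => exists n s, n0 < n /\ A = psubst s (w_formula k n f)).

(** * Bounded arithmetic

    Buss's theory S^1_2, in the language enriched by a symbol [tapp p] for every
    polynomial-time function (Buss's language is that of the other symbols). *)
Inductive term : Type :=
| tvar (i : nat)
| tzero
| tsucc (t : term)
| tadd (t u : term)
| tmul (t u : term)
| thalf (t : term)
| tlen (t : term)
| tsmash (t u : term)
| tapp (p : prog) (ts : list term).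

Inductive form : Type :=
| feq (t u : term)
| fle (t u : term)
| fbot
| fimp (A B : form)
| fand (A B : form)
| for_ (A B : form)
| fall (A : form)
| fex (A : form).

Definition fneg A := fimp A fbot.
Definition fiff A B := fand (fimp A B) (fimp B A).

Fixpoint tsubst (s : nat -> term) (t : term) : term :=
  match t with
  | tvar i => s i
  | tzero => tzero
  | tsucc t => tsucc (tsubst s t)
  | tadd t u => tadd (tsubst s t) (tsubst s u)
  | tmul t u => tmul (tsubst s t) (tsubst s u)
  | thalf t => thalf (tsubst s t)
  | tlen t => tlen (tsubst s t)
  | tsmash t u => tsmash (tsubst s t) (tsubst s u)
  | tapp p ts => tapp p (map (tsubst s) ts)
  end.

Definition tlift : term -> term := tsubst (fun i => tvar (S i)).

Definition up (s : nat -> term) (i : nat) : term :=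
  match i with 0 => tvar 0 | S i => tlift (s i) end.

Fixpoint fsubst (s : nat -> term) (A : form) : form :=
  match A with
  | feq t u => feq (tsubst s t) (tsubst s u)
  | fle t u => fle (tsubst s t) (tsubst s u)
  | fbot => fbot
  | fimp A B => fimp (fsubst s A) (fsubst s B)
  | fand A B => fand (fsubst s A) (fsubst s B)
  | for_ A B => for_ (fsubst s A) (fsubst s B)
  | fall A => fall (fsubst (up s) A)
  | fex A => fex (fsubst (up s) A)
  end.

Definition flift : form -> form := fsubst (fun i => tvar (S i)).

Definition inst (t : term) (A : form) : form :=
  fsubst (fun i => match i with 0 => t | S i => tvar i end) A.

(** Classical natural deduction with equality, from the axioms [T] (whose free
    variables are implicitly universally quantified). *)
Inductive prove (T : form -> Prop) : list form -> form -> Prop :=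
| nd_hyp G A : In A G -> prove T G A
| nd_axiom G A : T A -> prove T G A
| nd_impI G A B : prove T (A :: G) B -> prove T G (fimp A B)
| nd_impE G A B : prove T G (fimp A B) -> prove T G A -> prove T G B
| nd_andI G A B : prove T G A -> prove T G B -> prove T G (fand A B)
| nd_andE1 G A B : prove T G (fand A B) -> prove T G A
| nd_andE2 G A B : prove T G (fand A B) -> prove T G B
| nd_orI1 G A B : prove T G A -> prove T G (for_ A B)
| nd_orI2 G A B : prove T G B -> prove T G (for_ A B)
| nd_orE G A B C :
    prove T G (for_ A B) -> prove T (A :: G) C -> prove T (B :: G) C ->
    prove T G C
| nd_raa G A : prove T (fneg A :: G) fbot -> prove T G A
| nd_allI G A : prove T (map flift G) A -> prove T G (fall A)
| nd_allE G A t : prove T G (fall A) -> prove T G (inst t A)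
| nd_exI G A t : prove T G (inst t A) -> prove T G (fex A)
| nd_exE G A B :
    prove T G (fex A) -> prove T (A :: map flift G) (flift B) -> prove T G B
| nd_refl G t : prove T G (feq t t)
| nd_eq G A t u : prove T G (feq t u) -> prove T G (inst t A) -> prove T G (inst u A).

Definition tone := tsucc tzero.
Definition ttwo := tsucc tone.
Definition tdbl t := tmul ttwo t.

Inductive BASIC : form -> Prop :=
| basic1 x y : BASIC (fimp (fle y x) (fle y (tsucc x)))
| basic2 x : BASIC (fneg (feq x (tsucc x)))
| basic3 x : BASIC (fle tzero x)
| basic4 x y : BASIC (fiff (fand (fle x y) (fneg (feq x y))) (fle (tsucc x) y))
| basic5 x : BASIC (fimp (fneg (feq x tzero)) (fneg (feq (tdbl x) tzero)))
| basic6 x y : BASIC (for_ (fle y x) (fle x y))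
| basic7 x y : BASIC (fimp (fand (fle x y) (fle y x)) (feq x y))
| basic8 x y z : BASIC (fimp (fand (fle x y) (fle y z)) (fle x z))
| basic9 : BASIC (feq (tlen tzero) tzero)
| basic10 x : BASIC (fimp (fneg (feq x tzero))
    (fand (feq (tlen (tdbl x)) (tsucc (tlen x)))
          (feq (tlen (tsucc (tdbl x))) (tsucc (tlen x)))))
| basic11 : BASIC (feq (tlen tone) tone)
| basic12 x y : BASIC (fimp (fle x y) (fle (tlen x) (tlen y)))
| basic13 x y : BASIC (feq (tlen (tsmash x y)) (tsucc (tmul (tlen x) (tlen y))))
| basic14 y : BASIC (feq (tsmash tzero y) tone)
| basic15 x : BASIC (fimp (fneg (feq x tzero))
    (fand (feq (tsmash tone (tdbl x)) (tdbl (tsmash tone x)))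
          (feq (tsmash tone (tsucc (tdbl x))) (tdbl (tsmash tone x)))))
| basic16 x y : BASIC (feq (tsmash x y) (tsmash y x))
| basic17 x y z : BASIC (fimp (feq (tlen x) (tlen y)) (feq (tsmash x z) (tsmash y z)))
| basic18 x y u v : BASIC (fimp (feq (tlen x) (tadd (tlen u) (tlen v)))
    (feq (tsmash x y) (tmul (tsmash u y) (tsmash v y))))
| basic19 x y : BASIC (fle x (tadd x y))
| basic20 x y : BASIC (fimp (fand (fle x y) (fneg (feq x y)))
    (fand (fle (tsucc (tdbl x)) (tdbl y)) (fneg (feq (tsucc (tdbl x)) (tdbl y)))))
| basic21 x y : BASIC (feq (tadd x y) (tadd y x))
| basic22 x : BASIC (feq (tadd x tzero) x)
| basic23 x y : BASIC (feq (tadd x (tsucc y)) (tsucc (tadd x y)))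
| basic24 x y z : BASIC (feq (tadd (tadd x y) z) (tadd x (tadd y z)))
| basic25 x y z : BASIC (fiff (fle (tadd x y) (tadd x z)) (fle y z))
| basic26 x : BASIC (feq (tmul x tzero) tzero)
| basic27 x y : BASIC (feq (tmul x (tsucc y)) (tadd (tmul x y) x))
| basic28 x y : BASIC (feq (tmul x y) (tmul y x))
| basic29 x y z : BASIC (feq (tmul x (tadd y z)) (tadd (tmul x y) (tmul x z)))
| basic30 x y z : BASIC (fimp (fle tone x)
    (fiff (fle (tmul x y) (tmul x z)) (fle y z)))
| basic31 x : BASIC (fimp (fneg (feq x tzero)) (feq (tlen x) (tsucc (tlen (thalf x)))))
| basic32 x y : BASIC (fiff (feq x (thalf y))
    (for_ (feq (tdbl x) y) (feq (tsucc (tdbl x)) y))).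

(** Defining axioms of the symbols for polynomial-time functions. *)
Inductive PV_axiom : form -> Prop :=
| pv_proj i ts : PV_axiom (feq (tapp (Proj i) ts) (nth i ts tzero))
| pv_zero ts : PV_axiom (feq (tapp Zero ts) tzero)
| pv_bit0 ts : PV_axiom (feq (tapp (Bit false) ts) (tdbl (nth 0 ts tzero)))
| pv_bit1 ts : PV_axiom (feq (tapp (Bit true) ts) (tsucc (tdbl (nth 0 ts tzero))))
| pv_half ts : PV_axiom (feq (tapp Half ts) (thalf (nth 0 ts tzero)))
| pv_odd ts : PV_axiom
    (feq (nth 0 ts tzero) (tadd (tdbl (thalf (nth 0 ts tzero))) (tapp Odd ts)))
| pv_len ts : PV_axiom (feq (tapp Len ts) (tlen (nth 0 ts tzero)))
| pv_smash ts : PV_axiom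
    (feq (tapp Smash ts) (tsmash (nth 0 ts tzero) (nth 1 ts tzero)))
| pv_cond_else ts : PV_axiom
    (fimp (feq (nth 0 ts tzero) tzero) (feq (tapp Cond ts) (nth 2 ts tzero)))
| pv_cond_then ts : PV_axiom
    (fimp (fneg (feq (nth 0 ts tzero) tzero)) (feq (tapp Cond ts) (nth 1 ts tzero)))
| pv_comp f gs ts : PV_axiom
    (feq (tapp (Comp f gs) ts) (tapp f (map (fun g => tapp g ts) gs)))
| pv_rec0 g h b ts : PV_axiom
    (fimp (feq (nth 0 ts tzero) tzero) (feq (tapp (Rec g h b) ts) (tapp g (tl ts))))
| pv_rec1 g h b z ts :
    let H := tapp h (tapp (Rec g h b) (thalf z :: ts) :: z :: ts) in
    let B := tapp b (z :: ts) in
    PV_axiom (fimp (fand (fneg (feq z tzero)) (fle H B))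
                (feq (tapp (Rec g h b) (z :: ts)) H))
| pv_rec2 g h b z ts :
    let H := tapp h (tapp (Rec g h b) (thalf z :: ts) :: z :: ts) in
    let B := tapp b (z :: ts) in
    PV_axiom (fimp (fand (fneg (feq z tzero)) (fle B H))
                (feq (tapp (Rec g h b) (z :: ts)) B)).

(** [sp_form true A]: [A] is a Sigma^b_1 formula;
    [sp_form false A]: [A] is a Pi^b_1 formula. *)
Definition bounded_ex (t : term) (A : form) := fex (fand (fle (tvar 0) (tlift t)) A).
Definition bounded_all (t : term) (A : form) := fall (fimp (fle (tvar 0) (tlift t)) A).

Inductive sp_form : bool -> form -> Prop :=
| sp_eq c t u : sp_form c (feq t u)
| sp_le c t u : sp_form c (fle t u)
| sp_bot c : sp_form c fbot
| sp_imp c A B : sp_form (negb c) A -> sp_form c B -> sp_form c (fimp A B)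
| sp_and c A B : sp_form c A -> sp_form c B -> sp_form c (fand A B)
| sp_or c A B : sp_form c A -> sp_form c B -> sp_form c (for_ A B)
| sp_sharp_ex c t A : sp_form c A -> sp_form c (bounded_ex (tlen t) A)
| sp_sharp_all c t A : sp_form c A -> sp_form c (bounded_all (tlen t) A)
| sp_ex t A : sp_form true A -> sp_form true (bounded_ex t A)
| sp_all t A : sp_form false A -> sp_form false (bounded_all t A).

Definition Sigma_b1 : form -> Prop := sp_form true.

Inductive S12 : form -> Prop :=
| S12_basic A : BASIC A -> S12 A
| S12_PV A : PV_axiom A -> S12 A
| S12_PIND A : Sigma_b1 A ->
    let A_half :=
      fsubst (fun i => match i with 0 => thalf (tvar 0) | S i => tvar (S i) end) A in
    S12 (fimp (inst tzero A) (fimp (fall (fimp A_half A)) (fall A))).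

Definition proves (T : form -> Prop) (A : form) : Prop := prove T [] A.

Fixpoint numeral (m : nat) : term :=
  match m with 0 => tzero | S m => tsucc (numeral m) end.

Fixpoint tpow (t : term) (k : nat) : term :=
  match k with 0 => tone | S k => tmul (tpow t k) t end.

(** The sentence W^k_{n0}(f): for all [N], [x], [y], [C], if [N = 2 ^ n - 1] with
    [n > n0], [|x|, |y| <= n] and [|C| <= descr_len n k], then the matrix holds. *)
Definition W_sentence (k n0 : nat) (f : poly_fun) : form :=
  let N := tvar 3 in let x := tvar 2 in let y := tvar 1 in let C := tvar 0 in
  let n := tlen N in
  let p := tadd (tlen (tpow n k)) tone in
  let descr := tadd (tmul (tpow n k) (tadd (numeral 4) (tdbl p))) (tmul n p) in
  let sat u v := fneg (feq (tapp sat_prog [N; u; v]) tzero) in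
  let eval z := tapp (eval_prog k) [N; C; z] in
  let f1 := tapp (fst f) [N; C] in
  let f2 := tapp (snd f) [N; C] in
  fall (fall (fall (fall
    (fimp
      (fand (feq (tsucc N) (tsmash tone N))
        (fand (fle (numeral (S n0)) n)
          (fand (fle (tlen x) n)
            (fand (fle (tlen y) n) (fle (tlen C) descr)))))
      (for_ (fimp (sat x y) (sat x (eval x)))
            (fand (sat f1 f2) (fneg (sat f1 (eval f1))))))))).

(* Main.v *)
(** Suppose that SAT has circuits of size [n ^ (k / 8)] for almost all [n], and let
[F i] be tautologies without short proofs. Self-reduction turns the circuits into
circuits [C] of size [n ^ k] that find satisfying assignments. Take [n] polynomial
in the size of [F i], let [x] code [~ F i] and let [y] consist of propositional
variables: the first disjunct of the formula [w] for [x, y, C] says, with short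
proofs, that [F i] holds, and the second one is refuted by evaluating it on
constants. This proves the first part. For the second part, [F i] without short
proofs yields a forcing notion: a condition is a family of sets of axioms from which
no short derivations of [F i] exist, numbers are families of lists of formulas (their
bits), and a formula is forced if it has short derivations. Forcing validates [S^1_2]:
[BASIC] is verified bit by bit, and the induction axioms hold because the witness of
a [Sigma^b_1] formula can be selected from a shortest derivation. So [w] is forced as
above, and [F i] has short proofs. Small [k] need no separate treatment, since a
circuit of sublinear size cannot read all of its input. *)

From Stdlib Require Import List Arith NArith Bool Lia Cantor Reals Lra.
From Stdlib Require Import Classical ClassicalEpsilon Setoid Morphisms FinFun.
Require Import Defs.
Import ListNotations.
Open Scope nat_scope.

Local Notation "# n" := (N.of_nat n) (at level 8, format "# n").
Ltac refl := reflexivity.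
Ltac etrans := etransitivity.

(** The exponent [1/8] pays for the search: the decision instances have [n * n] bits, so a deciding
    circuit has at most [n ^ (k/4)] gates, and [n] copies of it with some wiring must fit into
    [n ^ k].

    Two obstacles shape the rest. Everything concerns families indexed by [i] with one polynomial
    bound for all [i], and an induction of polynomially many steps needs a common bound for its
    steps. That bound comes from the hardest step at every index; this is why hypotheses quantify
    over all selections of one step per index and over all extensions of the axioms.

    Moreover a condition decides little: a number given by formulas has no definite length, and a
    derivable disjunction need have no derivable disjunct. Case distinctions are therefore made
    inside derivations, and disjunction and existence are forced up to double negation. Definite
    values belong only to constants, on which programs are evaluated outright. This is enough,
    because the circuit and the counterexample [f(C)] are constants; only the assignment [y] is
    symbolic. *)

Lemma length_map_seq {A} (f : nat -> A) m n : length (map f (seq m n)) = n.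
Proof. now rewrite length_map, length_seq. Qed.

(** * Frege derivations measured by their number of lines *)

Inductive prf (Ax : pform -> Prop) : list pform -> Prop :=
| prf_nil : prf Ax []
| prf_frege A l : frege_axiom A -> prf Ax l -> prf Ax (A :: l)
| prf_ax A l : Ax A -> prf Ax l -> prf Ax (A :: l)
| prf_mp A B l : In (pimp A B) l -> In A l -> prf Ax l -> prf Ax (B :: l).

(* Only the number of lines is counted: up to a polynomial this is the size of
  an Extended Frege proof, because extension variables can name all formulas. *)
Definition der (Ax : pform -> Prop) (n : nat) (A : pform) : Prop :=
 exists l, prf Ax l /\ In A l /\ length l <= n.

Lemma prf_app Ax l1 l2 : prf Ax l1 -> prf Ax l2 -> prf Ax (l1 ++ l2).
Proof.
 induction 1; simpl; intros; auto.
 - apply prf_frege; auto.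
 - apply prf_ax; auto.
 - apply prf_mp with A; auto using in_or_app.
Qed.

Lemma prf_mono (Ax Ax' : pform -> Prop) l :
 (forall A, Ax A -> Ax' A) -> prf Ax l -> prf Ax' l.
Proof.
 intros H; induction 1.
 - constructor.
 - apply prf_frege; auto.
 - apply prf_ax; auto.
 - eapply prf_mp; eauto.
Qed.

Lemma der_mono (Ax Ax' : pform -> Prop) n n' A :
 (forall A, Ax A -> Ax' A) -> n <= n' -> der Ax n A -> der Ax' n' A.
Proof.
 intros H Hn (l & Hl & Hi & Hs). exists l. split; [|split]; auto; try lia.
 eapply prf_mono; eauto.
Qed.

Lemma der_ax (Ax : pform -> Prop) A : Ax A -> der Ax 1 A.
Proof.
 intros H. exists [A]. split; [|split]; simpl; auto.
 apply prf_ax; [auto|constructor].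
Qed.

Lemma der_mp Ax n m A B : der Ax n (pimp A B) -> der Ax m A -> der Ax (n + m + 1) B.
Proof.
 intros (l & Hl & Hi & Hs) (l' & Hl' & Hi' & Hs').
 exists (B :: l ++ l'). split; [|split].
 - apply prf_mp with A; auto using in_or_app, prf_app.
 - now left.
 - simpl. rewrite length_app. lia.
Qed.

(** Deduction theorem. Every line [B] is replaced by at most five lines ending in [pimp A B], so the
    cost is a constant factor independent of the formulas, and hypotheses can be discharged freely
    inside polynomial bounds. *)
Lemma der_imp Ax n A B :
 der (fun C => C = A \/ Ax C) n B -> der Ax (8 * n) (pimp A B).
Proof.
 intros (l & Hl & Hi & Hn).
 enough (E : exists l', prf Ax l' /\ (forall C, In C l -> In (pimp A C) l') /\ length l' <= 8 * length l).
 { destruct E as (l' & H1 & H2 & H3). exists l'. repeat split; auto. lia. }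
 assert (W : forall B l', prf Ax (B :: l') -> prf Ax (pimp A B :: pimp B (pimp A B) :: B :: l')).
 { intros C l' H. apply prf_mp with C; simpl; auto. apply prf_frege; [constructor|auto]. }
 clear n B Hi Hn. induction Hl as [|B l HB _ IH|B l HB _ IH|B C l HB HC _ IH].
 { exists []. repeat split; [constructor|intros ? []|simpl; lia]. }
 all: destruct IH as (l' & H1 & H2 & H3).
 2: destruct HB as [->|HB].
 - exists (pimp A B :: pimp B (pimp A B) :: B :: l'). repeat split; [now apply W, prf_frege| |simpl; lia].
  intros D [->|HD]; simpl; auto.
 - exists (pimp A A :: pimp A (pimp A A) ::
    pimp (pimp A (pimp A A)) (pimp A A) :: pimp A (pimp (pimp A A) A) ::
    pimp (pimp A (pimp (pimp A A) A)) (pimp (pimp A (pimp A A)) (pimp A A)) :: l').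
  repeat split; [|intros D [->|HD]; simpl; auto 7|simpl; lia].
  apply prf_mp with (pimp A (pimp A A)); simpl; auto. apply prf_frege; [constructor|].
  apply prf_mp with (pimp A (pimp (pimp A A) A)); simpl; auto.
  apply prf_frege; [constructor|]. apply prf_frege; [constructor|auto].
 - exists (pimp A B :: pimp B (pimp A B) :: B :: l'). repeat split; [now apply W, prf_ax| |simpl; lia].
  intros D [->|HD]; simpl; auto.
 - exists (pimp A C :: pimp (pimp A B) (pimp A C) ::
    pimp (pimp A (pimp B C)) (pimp (pimp A B) (pimp A C)) :: l').
  repeat split; [|intros D [->|HD]; simpl; auto|simpl; lia].
  apply prf_mp with (pimp A B); simpl; auto. apply prf_mp with (pimp A (pimp B C)); simpl; auto.
  apply prf_frege; auto. constructor.
Qed.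

(** * Completeness of Frege *)

Definition fr (H : pform -> Prop) A : Prop := exists n, der H n A.

Definition addh (H : pform -> Prop) A : pform -> Prop := fun B => B = A \/ H B.

Lemma fr_hyp (H : pform -> Prop) A : H A -> fr H A.
Proof. exists 1. now apply der_ax. Qed.

Lemma fr_frege H A : frege_axiom A -> fr H A.
Proof. intros HA. exists 1, [A]. repeat split; simpl; auto. apply prf_frege; [auto|constructor]. Qed.

Lemma fr_mp H A B : fr H (pimp A B) -> fr H A -> fr H B.
Proof. intros (n & H1) (m & H2). exists (n + m + 1). now apply der_mp with A. Qed.

Lemma fr_imp H A B : fr (addh H A) B -> fr H (pimp A B).
Proof. intros (n & Hn). exists (8 * n). now apply der_imp. Qed.

Lemma fr_mono (H H' : pform -> Prop) A : (forall B, H B -> H' B) -> fr H A -> fr H' A.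
Proof. intros HH (n & Hn). exists n. now apply (der_mono H H' n n). Qed.

Lemma fr_weak H A B : fr H B -> fr (addh H A) B.
Proof. apply fr_mono. now right. Qed.

Lemma fr_head H A : fr (addh H A) A.
Proof. apply fr_hyp. now left. Qed.

Lemma fr_efq H A : fr H pbot -> fr H A.
Proof.
 intros Hb. eapply fr_mp; [apply fr_frege, fr_dn|].
 apply fr_imp, fr_weak, Hb.
Qed.

Lemma fr_cases H A B : fr (addh H A) B -> fr (addh H (pneg A)) B -> fr H B.
Proof.
 intros H1 H2. apply fr_imp in H1, H2.
 eapply fr_mp; [apply fr_frege, fr_dn|]. apply fr_imp.
 assert (HB : fr (addh H (pneg B)) (pneg B)) by apply fr_head.
 eapply fr_mp; [exact HB|].
 eapply fr_mp; [apply fr_weak; exact H2|].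
 apply fr_imp. eapply fr_mp; [apply fr_weak; exact HB|].
 eapply fr_mp; [apply fr_weak, fr_weak; exact H1|apply fr_head].
Qed.

Definition lit (b : bool) A := if b then A else pneg A.

Fixpoint maxvar (A : pform) : nat :=
 match A with
 | pvar i => S i
 | pbot => 0
 | pimp A B | pand A B | por A B => Nat.max (maxvar A) (maxvar B)
 end.

Lemma occurs_maxvar q A : occurs q A -> q < maxvar A.
Proof. induction A; simpl; intros H; try lia; destruct H as [H|H]; intuition lia. Qed.

Definition lits n v : pform -> Prop := fun B => exists i, i < n /\ B = lit (v i) (pvar i).

(** Kalmar's lemma, the first half of completeness. The second half removes the literals again, one
    variable at a time, by a case distinction on that variable. *)
Lemma kalmar n v A : maxvar A <= n -> fr (lits n v) (lit (peval v A) A).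
Proof.
 set (H := lits n v).
 induction A as [i| |A IHA B IHB|A IHA B IHB|A IHA B IHB]; simpl; intros Hn.
 - apply fr_hyp. exists i. split; auto.
 - apply fr_imp, fr_head.
 - assert (HA := IHA ltac:(lia)); assert (HB := IHB ltac:(lia)).
  destruct (peval v A), (peval v B); simpl in *.
  + apply fr_imp, fr_weak, HB.
  + apply fr_imp. eapply fr_mp; [apply fr_weak, HB|].
   eapply fr_mp; [apply fr_head|apply fr_weak, HA].
  + apply fr_imp, fr_weak, HB.
  + apply fr_imp, fr_efq. eapply fr_mp; [apply fr_weak, HA|apply fr_head].
 - assert (HA := IHA ltac:(lia)); assert (HB := IHB ltac:(lia)).
  destruct (peval v A), (peval v B); simpl in *;
   try (apply fr_imp; eapply fr_mp; [apply fr_weak; eassumption|];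
      eapply fr_mp; [apply fr_frege; constructor|apply fr_head]).
  eapply fr_mp; [eapply fr_mp|]; [apply fr_frege, fr_andI| |]; auto.
 - assert (HA := IHA ltac:(lia)); assert (HB := IHB ltac:(lia)).
  destruct (peval v A), (peval v B); simpl in *;
   try (eapply fr_mp; [apply fr_frege; constructor|eassumption]; fail).
  eapply fr_mp; [eapply fr_mp|]; [apply fr_frege, fr_orE| |]; auto.
Qed.

Lemma fr_complete A : tautology A -> fr (fun _ => False) A.
Proof.
 intros HA.
 assert (K : forall n, (forall v, fr (lits n v) A) -> fr (fun _ => False) A).
 { induction n as [|n IH]; intros Hv.
  - eapply fr_mono; [|apply (Hv (fun _ => true))]. intros B (i & Hi & _); lia.
  - apply IH. intros v.
   apply fr_cases with (pvar n);
   [ eapply fr_mono; [|apply (Hv (fun i => if i =? n then true else v i))]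
   | eapply fr_mono; [|apply (Hv (fun i => if i =? n then false else v i))] ];
   intros B (i & Hi & ->); destruct (Nat.eqb_spec i n) as [->|];
    try (left; refl); right; exists i; split; auto; lia. }
 apply (K (maxvar A)). intros v.
 generalize (kalmar (maxvar A) v A (le_n _)). now rewrite (HA v).
Qed.

Lemma frege_subst s A : frege_axiom A -> frege_axiom (psubst s A).
Proof. destruct 1; simpl; constructor. Qed.

Lemma prf_subst (Ax : pform -> Prop) s l : prf (fun _ => False) l -> prf Ax (map (psubst s) l).
Proof.
 induction 1 as [|A l HA _ IH|A l []|A B l H1 H2 _ IH]; simpl.
 - constructor.
 - apply prf_frege; auto using frege_subst.
 - apply prf_mp with (psubst s A); auto.
  + now apply (in_map (psubst s)) in H1.
  + now apply in_map.
Qed.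

(** A derivation can be substituted into line by line, so all instances of one fixed tautology cost
    the same number of lines. Completeness without any size bound is therefore enough. *)
Lemma der_taut A : tautology A -> exists K, forall Ax s, der Ax K (psubst s A).
Proof.
 intros HA. destruct (fr_complete A HA) as (n & l & Hl & Hi & _).
 exists (length l). intros Ax s. exists (map (psubst s) l).
 rewrite length_map. auto using prf_subst, in_map.
Qed.

(** * Extended Frege simulates short Frege derivations *)

Lemma ef_app_frege Ax F l pi :
 prf (fun _ => False) l -> forall s, ef_lines Ax F pi ->
 ef_lines Ax F (map (psubst s) l ++ pi).
Proof.
 induction 1 as [|A l HA _ IH|A l []|A B l H1 H2 _ IH]; simpl; intros s Hpi; auto.
 - apply ef_frege; auto using frege_subst.
 - apply ef_mp with (psubst s A); auto; apply in_or_app; left.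
  + now apply (in_map (psubst s)) in H1.
  + now apply in_map.
Qed.

Lemma psize_pos A : 1 <= psize A.
Proof. destruct A; simpl; lia. Qed.

Lemma psize_subst s M A :
 1 <= M -> (forall i, psize (s i) <= M) -> psize (psubst s A) <= psize A * M.
Proof.
 intros HM Hs. induction A; simpl; try specialize (Hs i); nia.
Qed.

Lemma proof_size_app l l' : proof_size (l ++ l') = proof_size l + proof_size l'.
Proof. unfold proof_size. now rewrite map_app, list_sum_app. Qed.

Lemma proof_size_subst s M l :
 1 <= M -> (forall i, psize (s i) <= M) ->
 proof_size (map (psubst s) l) <= proof_size l * M.
Proof.
 intros HM Hs. unfold proof_size. induction l as [|A l IH]; simpl; auto.
 assert (H := psize_subst s M A HM Hs). lia.
Qed.

(** A fixed sound inference from [Ps] to [C], measured by size: its cost is linear in the largest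
    substituted formula. It is applied with variables, or formulas of bounded size, in place of the
    schematic letters. *)
Lemma ef_taut Ps C :
 tautology (fold_right pimp C Ps) ->
 exists K, forall Ax F pi s M,
  ef_lines Ax F pi -> (forall P, In P Ps -> In (psubst s P) pi) ->
  1 <= M -> (forall i, psize (s i) <= M) ->
  exists new, ef_lines Ax F (new ++ pi) /\ In (psubst s C) (new ++ pi) /\
   proof_size new <= K * M.
Proof.
 intros HT. destruct (fr_complete _ HT) as (n & l & Hl & Hi & _).
 enough (E : exists K, forall Ax F pi s M,
  ef_lines Ax F pi -> (forall P, In P Ps -> In (psubst s P) pi) ->
  In (psubst s (fold_right pimp C Ps)) pi ->
  1 <= M -> (forall i, psize (s i) <= M) ->
  exists new, ef_lines Ax F (new ++ pi) /\ In (psubst s C) (new ++ pi) /\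
   proof_size new <= K * M).
 { destruct E as (K & E). exists (K + proof_size l).
  intros Ax F pi s M Hpi HP HM Hs.
  destruct (E Ax F (map (psubst s) l ++ pi) s M) as (new & H1 & H2 & H3); auto.
  - now apply ef_app_frege.
  - intros P HPP. apply in_or_app. right. auto.
  - apply in_or_app. left. now apply in_map.
  - exists (new ++ map (psubst s) l). rewrite <- app_assoc. split; [|split]; auto.
   rewrite proof_size_app. assert (H4 := proof_size_subst s M l HM Hs). lia. }
 clear HT l Hl Hi. induction Ps as [|P Ps IH].
 - exists 0. intros. exists []. simpl in *. auto.
 - destruct IH as (K & IH). exists (K + psize (fold_right pimp C Ps)).
  intros Ax F pi s M Hpi HP HT HM Hs. simpl in HT.
  destruct (IH Ax F (psubst s (fold_right pimp C Ps) :: pi) s M)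
   as (new & H1 & H2 & H3); auto.
  + apply ef_mp with (psubst s P); auto. apply HP. now left.
  + intros Q HQ. right. apply HP. now right.
  + now left.
  + exists (new ++ [psubst s (fold_right pimp C Ps)]). rewrite <- app_assoc.
   split; [|split]; auto. rewrite proof_size_app. unfold proof_size at 2; simpl.
   assert (H4 := psize_subst s M (fold_right pimp C Ps) HM Hs). lia.
Qed.

(** The residue modulo 5 records the connective, and codes exceed those of immediate subformulas.
    Codes serve both as numbers of extension variables and as the order of their introduction. *)
Definition pair5 (a b : nat) : nat := 5 * to_nat (a, b).
Arguments pair5 : simpl never.

Fixpoint code (A : pform) : nat :=
 match A with
 | pvar i => 5 * i
 | pbot => 1
 | pimp A B => pair5 (code A) (code B) + 2
 | pand A B => pair5 (code A) (code B) + 3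
 | por A B => pair5 (code A) (code B) + 4
 end.

Lemma code_inj A B : code A = code B -> A = B.
Proof.
 assert (E : forall a b c d r, pair5 a b + r = pair5 c d + r ->
  a = c /\ b = d).
 { intros a b c d r H. assert (H' : to_nat (a, b) = to_nat (c, d)) by (unfold pair5 in H; lia).
  apply (f_equal of_nat) in H'. rewrite !cancel_of_to in H'.
  now injection H'. }
 revert B; induction A as [i| |A IHA A' IHA'|A IHA A' IHA'|A IHA A' IHA'];
  intros [j| |B B'|B B'|B B']; cbn [code]; intros H; auto;
  try (unfold pair5 in H; lia);
  try (f_equal; lia); apply E in H as [H H']; f_equal; auto.
Qed.

Lemma code_lt A B : code A < pair5 (code A) (code B) + 2 /\
 code B < pair5 (code A) (code B) + 2.
Proof. unfold pair5. generalize (Cantor.to_nat_non_decreasing (code A) (code B)). lia. Qed.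

Section Simulation.
Context (Ax : pform -> Prop) (F : pform) (base : nat) (HF : maxvar F <= base).

(** The extension variable naming [A]; [base] lies above all variables of [F], which makes it
    fresh. *)
Definition V (A : pform) : pform := pvar (base + code A).

(** The definition of a name mentions only the names of the immediate subformulas. So [ext A] has
    size at most 11, however large [A] is. *)
Definition top (A : pform) : pform :=
 match A with
 | pvar i => pvar i
 | pbot => pbot
 | pimp A B => pimp (V A) (V B)
 | pand A B => pand (V A) (V B)
 | por A B => por (V A) (V B)
 end.

Definition ext (A : pform) : pform := piff (V A) (top A).

(** An extension variable may not occur in earlier lines, so names of subformulas have to be defined
    after the names that use them are excluded from the past: axioms are introduced in increasing
    order of codes. Derivations are listed from the last line on, hence the decreasing order
    here. *)
Lemma sort_codes (E : list pform) : exists E',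
 (forall A, In A E <-> In A E') /\ length E' <= length E /\
 ForallOrdPairs (fun A B => code B < code A) E'.
Proof.
 assert (Ins : forall A L, ForallOrdPairs (fun A B => code B < code A) L ->
  exists L', (forall B, B = A \/ In B L <-> In B L') /\ length L' <= S (length L) /\
   ForallOrdPairs (fun A B => code B < code A) L').
 { intros A L HL. induction HL as [|C L HC HL IH].
  - exists [A]. split; [|split]; simpl; auto.
   + intuition.
   + constructor; constructor.
  - destruct (Nat.lt_trichotomy (code A) (code C)) as [H|[H|H]].
   + destruct IH as (L' & H1 & H2 & H3). exists (C :: L'). split; [|split].
    * intros B. simpl. rewrite <- H1. intuition.
    * simpl. lia.
    * constructor; auto. apply Forall_forall. intros B HB. apply H1 in HB.
     destruct HB as [->|HB]; auto. rewrite Forall_forall in HC; auto.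
   + apply code_inj in H as ->. exists (C :: L). split; [|split]; auto.
    * simpl; intuition.
    * now constructor.
   + exists (A :: C :: L). split; [|split]; auto.
    * simpl; intuition.
    * constructor; [|now constructor]. constructor; auto.
     eapply Forall_impl; [|exact HC]. intros; simpl in *; lia. }
 induction E as [|A E IH].
 - exists []. split; [|split]; simpl; auto; [intuition|constructor].
 - destruct IH as (E' & H1 & H2 & H3).
  destruct (Ins A E' H3) as (L & H4 & H5 & H6). exists L. split; [|split]; auto.
  + intros B. rewrite <- H4, <- H1. simpl. intuition.
  + simpl. lia.
Qed.

Lemma ext_occurs q A : (forall i, A = pvar i -> i < base) ->
 occurs q (ext A) -> q <= base + code A.
Proof.
 intros HA H.
 destruct A as [i| |A B|A B|A B]; simpl in H; unfold V in H; simpl in H;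
  [specialize (HA i eq_refl)| | | |];
  try generalize (code_lt A B); simpl code; intuition lia.
Qed.

(** A variable at or above [base] could coincide with an extension variable; only smaller ones may
    be named. *)
Lemma ext_lines (E : list pform) :
 (forall i, In (pvar i) E -> i < base) ->
 exists pi, ef_lines Ax F pi /\ (forall A, In A E -> In (ext A) pi) /\
  proof_size pi <= 11 * length E.
Proof.
 intros HE. destruct (sort_codes E) as (L & H1 & H2 & H3).
 exists (map ext L). split; [|split].
 - assert (HL : forall i, In (pvar i) L -> i < base).
  { intros i Hi. apply HE, H1, Hi. }
  clear H1 H2. induction H3 as [|A L HA H3 IH]; simpl; [constructor|].
  apply ef_extension.
  + intros H. destruct A as [i| |A B|A B|A B]; simpl in H;
    try (generalize (HL i (or_introl eq_refl)));
    try (generalize (code_lt A B)); intuition lia.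
  + intros H. apply occurs_maxvar in H. lia.
  + apply Forall_forall. intros B HB. apply in_map_iff in HB as (C & <- & HC).
   intros H. apply ext_occurs in H.
   * rewrite Forall_forall in HA. specialize (HA C HC). lia.
   * intros i ->. apply HL. now right.
  + apply IH. intros i Hi. apply HL. now right.
 - intros A HA. apply in_map, H1, HA.
 - enough (proof_size (map ext L) <= 11 * length L) by lia.
  clear. unfold proof_size. induction L as [|A L IH]; simpl; auto.
  destruct A; simpl in *; lia.
Qed.

End Simulation.

(** The subformulas of the instance [psubst s S] stemming from the schema [S] itself. Their
    extension axioms suffice to unfold the name of the instance down to the names of the substituted
    formulas. *)
Fixpoint nodes (s : nat -> pform) (S : pform) : list pform :=
 match S with
 | pvar i => []
 | pbot => [pbot]
 | pimp A B | pand A B | por A B => psubst s S :: nodes s A ++ nodes s B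
 end.

Lemma nodes_length s S : length (nodes s S) <= psize S.
Proof. induction S; simpl; rewrite ?length_app; lia. Qed.

Lemma nodes_pvar s S i : ~ In (pvar i) (nodes s S).
Proof.
 induction S; simpl; rewrite ?in_app_iff; try tauto;
 intros H; destruct H as [H|H]; try discriminate; tauto.
Qed.

Definition sub4 (a b c d e : pform) (i : nat) : pform :=
 match i with 0 => a | 1 => b | 2 => c | 3 => d | 4 => e | _ => pbot end.

Lemma sub4_size a b c d e M : psize a <= M -> psize b <= M -> psize c <= M ->
 psize d <= M -> psize e <= M -> forall i, psize (sub4 a b c d e i) <= M.
Proof.
 intros. assert (P := psize_pos a).
 do 5 (destruct i as [|i]; auto). simpl. lia.
Qed.

(** The cost depends on the schema and not on the instance, whose formulas appear only through their
    names. The second alternative for [sg], a variable already known to be equivalent to the name,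
    serves to return from names to the formula [F] itself. *)
Lemma unfold_schema : exists K, forall Ax F base S s sg pi,
 ef_lines Ax F pi -> (forall A, In A (nodes s S) -> In (ext base A) pi) ->
 (forall i, psize (sg i) = 1) ->
 (forall i, occurs i S -> sg i = V base (s i) \/ In (piff (V base (s i)) (sg i)) pi) ->
 exists new, ef_lines Ax F (new ++ pi) /\
  In (piff (V base (psubst s S)) (psubst sg S)) (new ++ pi) /\
  proof_size new <= K * (psize S * psize S).
Proof.
 destruct (ef_taut [] (piff (pvar 0) (pvar 0))) as (K0 & H0).
 { intros v. simpl. now destruct (v 0). }
 assert (Hop : forall op : pform -> pform -> pform,
  In op [pimp; pand; por] ->
  exists K, forall Ax F pi A B A' B' q M,
   ef_lines Ax F pi -> In (piff q (op A B)) pi -> In (piff A A') pi ->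
   In (piff B B') pi ->
   psize A <= M -> psize A' <= M -> psize B <= M -> psize B' <= M ->
   psize q <= M ->
   exists new, ef_lines Ax F (new ++ pi) /\ In (piff q (op A' B')) (new ++ pi) /\
    proof_size new <= K * M).
 { intros op Hop.
  destruct (ef_taut [piff (pvar 0) (op (pvar 1) (pvar 2)); piff (pvar 1) (pvar 3);
   piff (pvar 2) (pvar 4)] (piff (pvar 0) (op (pvar 3) (pvar 4)))) as (K & HK).
  { intros v. destruct Hop as [<-|[<-|[<-|[]]]]; simpl;
    destruct (v 0), (v 1), (v 2), (v 3), (v 4); refl. }
  exists K. intros Ax F pi A B A' B' q M Hpi Hq HA HB SA SA' SB SB' Sq.
  destruct (HK Ax F pi (sub4 q A B A' B') M) as (new & H1 & H2 & H3); auto.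
  - intros P HP. destruct HP as [<-|[<-|[<-|[]]]];
    destruct Hop as [<-|[<-|[<-|[]]]]; assumption.
  - generalize (psize_pos A); lia.
  - now apply sub4_size.
  - exists new. split; [|split]; auto.
   destruct Hop as [<-|[<-|[<-|[]]]]; assumption. }
 destruct (Hop pimp) as (K1 & H1); [simpl; auto|].
 destruct (Hop pand) as (K2 & H2); [simpl; auto|].
 destruct (Hop por) as (K3 & H3); [simpl; auto|]. clear Hop.
 assert (Sz : forall sg A, (forall i, psize (sg i) = 1) -> psize (psubst sg A) = psize A).
 { intros sg A Hs. induction A; simpl; auto. }
 exists (K0 + K1 + K2 + K3). intros Ax F base S.
 induction S as [i| |A IHA B IHB|A IHA B IHB|A IHA B IHB];
  intros s sg pi Hpi HN Hs Hl.
 { simpl. destruct (Hl i eq_refl) as [E|E].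
  + destruct (H0 Ax F pi (sub4 (V base (s i)) pbot pbot pbot pbot) 1) as (new & E1 & E2 & E3); auto.
   * intros P [].
   * apply sub4_size; auto.
   * exists new. rewrite E. split; [|split]; auto. lia.
  + exists []. simpl. split; [|split]; auto. unfold proof_size; simpl; lia. }
 { exists []. simpl. split; [|split]; auto.
  + apply (HN pbot). now left.
  + unfold proof_size; simpl; lia. }
 all: destruct (IHA s sg pi) as (n1 & A1 & A2 & A3); auto;
  [ intros C HC; apply HN; simpl; right; apply in_or_app; now left
  | intros i Hi; apply Hl; now left |].
 all: destruct (IHB s sg (n1 ++ pi)) as (n2 & B1 & B2 & B3); auto;
  [ intros C HC; apply in_or_app; right; apply HN; simpl; right; apply in_or_app; now right
  | intros i Hi; destruct (Hl i (or_intror Hi)); [now left|right];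
   apply in_or_app; now right |].
 1: destruct (H1 Ax F (n2 ++ n1 ++ pi) (V base (psubst s A)) (V base (psubst s B)) (psubst sg A)
   (psubst sg B) (V base (psubst s (pimp A B))) (psize A + psize B)) as (n3 & C1 & C2 & C3).
 11: destruct (H2 Ax F (n2 ++ n1 ++ pi) (V base (psubst s A)) (V base (psubst s B)) (psubst sg A)
   (psubst sg B) (V base (psubst s (pand A B))) (psize A + psize B)) as (n3 & C1 & C2 & C3).
 21: destruct (H3 Ax F (n2 ++ n1 ++ pi) (V base (psubst s A)) (V base (psubst s B)) (psubst sg A)
   (psubst sg B) (V base (psubst s (por A B))) (psize A + psize B)) as (n3 & C1 & C2 & C3).
 all: rewrite ?Sz; auto; try (simpl; generalize (psize_pos A); lia).
 all: try (apply in_or_app; right; apply in_or_app; right; apply HN; now left).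
 all: try (apply in_or_app; now right).
 all: exists (n3 ++ n2 ++ n1); rewrite <- !app_assoc; split; [|split]; auto;
  rewrite !proof_size_app; simpl; nia.
Qed.

(** Every line [A], however long, becomes the single variable [V base A]. The formulas [E] to be
    named are collected before anything is simulated, because all extension axioms are placed at the
    beginning. The constant 40 exceeds the size of all Frege schemas. *)
Lemma ef_simulation : exists K, forall (Ax Q : pform -> Prop) F base b l,
 maxvar F <= base ->
 (forall W s, Q W -> Ax (psubst s W)) -> (forall W, Q W -> psize W <= b) ->
 prf (fun A => exists W s, Q W /\ A = psubst s W) l ->
 exists E, (forall i, ~ In (pvar i) E) /\ length E <= length l * (b + 40) /\
  forall pi, ef_lines Ax F pi -> (forall A, In A E -> In (ext base A) pi) ->
  exists new, ef_lines Ax F (new ++ pi) /\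
   (forall A, In A l -> In (V base A) (new ++ pi)) /\
   proof_size new <= length l * (K * ((b + 40) * (b + 40))).
Proof.
 destruct unfold_schema as (K0 & HU).
 destruct (ef_taut [piff (pvar 0) (pvar 1); pvar 1] (pvar 0)) as (K1 & H1).
 { intros v; simpl; destruct (v 0), (v 1); refl. }
 destruct (ef_taut [piff (pvar 0) (pimp (pvar 1) (pvar 2)); pvar 0; pvar 1] (pvar 2))
  as (K2 & H2).
 { intros v; simpl; destruct (v 0), (v 1), (v 2); refl. }
 exists (K0 + K1 + K2 + 1). intros Ax Q F base b l HF HQ Hb Hl.
 assert (Step : forall (pr : pform -> Prop) S s,
   psize S <= b + 40 ->
   (forall pi, ef_lines Ax F pi ->
    ef_lines Ax F (psubst (fun i => V base (s i)) S :: pi)) ->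
   forall pi, ef_lines Ax F pi -> (forall A, In A (nodes s S) -> In (ext base A) pi) ->
   exists new, ef_lines Ax F (new ++ pi) /\ In (V base (psubst s S)) (new ++ pi) /\
    proof_size new <= (K0 + K1 + 1) * ((b + 40) * (b + 40))).
 { intros _ S s HS HA pi Hpi HE.
  set (A' := psubst (fun i => V base (s i)) S) in *.
  assert (SA : psize A' = psize S).
  { unfold A'. clear. induction S; simpl; auto. }
  destruct (HU Ax F base S s (fun i => V base (s i)) (A' :: pi)) as (n1 & C1 & C2 & C3);
   auto; try (intros; right; auto; fail).
  destruct (H1 Ax F (n1 ++ A' :: pi) (sub4 (V base (psubst s S)) A' pbot pbot pbot)
   (psize S)) as (n2 & D1 & D2 & D3); auto.
  - intros P [<-|[<-|[]]]; auto. simpl. apply in_or_app. right. now left.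
  - apply psize_pos.
  - assert (P := psize_pos S). apply sub4_size; rewrite ?SA; simpl; try lia.
  - exists (n2 ++ n1 ++ [A']). rewrite <- !app_assoc. simpl. split; [|split]; auto.
   rewrite !proof_size_app. unfold proof_size at 3; simpl.
   assert (P := psize_pos S). set (x := psize S) in *. set (y := b + 40) in *.
   assert (X1 : x * x <= y * y) by nia. assert (X2 : x <= y * y) by nia.
   set (z := y * y) in *. nia. }
 set (Sim := fun l => exists E, (forall i, ~ In (pvar i) E) /\ length E <= length l * (b + 40) /\
  forall pi, ef_lines Ax F pi -> (forall A, In A E -> In (ext base A) pi) ->
  exists new, ef_lines Ax F (new ++ pi) /\ (forall A, In A l -> In (V base A) (new ++ pi)) /\
   proof_size new <= length l * ((K0 + K1 + K2 + 1) * ((b + 40) * (b + 40)))).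
 assert (Ext : forall S s l, psize S <= b + 40 ->
  (forall pi, ef_lines Ax F pi -> ef_lines Ax F (psubst (fun i => V base (s i)) S :: pi)) -> Sim l -> Sim (psubst s S :: l)).
 { intros S s l0 HS HA (E & E1 & E2 & E3). exists (nodes s S ++ E). repeat split.
  + intros i Hi. apply in_app_or in Hi as [Hi|Hi]; [now apply nodes_pvar in Hi|now apply E1 in Hi].
  + rewrite length_app. generalize (nodes_length s S). simpl. lia.
  + intros pi Hpi HE. destruct (E3 pi) as (n1 & C1 & C2 & C3); auto using in_or_app.
   destruct (Step Q S s HS HA (n1 ++ pi)) as (n2 & D1 & D2 & D3); auto.
   { intros C HC. apply in_or_app. right. auto using in_or_app. }
   exists (n2 ++ n1). rewrite <- app_assoc. repeat split; auto.
   * intros C [<-|HC]; auto. apply in_or_app. right. auto.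
   * rewrite proof_size_app. simpl. nia. }
 change (Sim l). induction Hl as [|A l HA _ IH|A l HA _ IH|A B l HA HB _ IH].
 - exists []. repeat split; [auto|simpl; lia|]. intros pi Hpi _. exists []. repeat split; auto. intros ? [].
 - assert (ES : exists S s, A = psubst s S /\ psize S <= 40 /\ frege_axiom S).
  { destruct HA as [A B|A B C|A B|A B|A B|A B|A B|A B C|A];
   [exists (pimp (pvar 0) (pimp (pvar 1) (pvar 0)))
   |exists (pimp (pimp (pvar 0) (pimp (pvar 1) (pvar 2)))
      (pimp (pimp (pvar 0) (pvar 1)) (pimp (pvar 0) (pvar 2))))
   |exists (pimp (pvar 0) (pimp (pvar 1) (pand (pvar 0) (pvar 1))))
   |exists (pimp (pand (pvar 0) (pvar 1)) (pvar 0))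
   |exists (pimp (pand (pvar 0) (pvar 1)) (pvar 1))
   |exists (pimp (pvar 0) (por (pvar 0) (pvar 1)))
   |exists (pimp (pvar 1) (por (pvar 0) (pvar 1)))
   |exists (pimp (pimp (pvar 0) (pvar 2)) (pimp (pimp (pvar 1) (pvar 2))
      (pimp (por (pvar 0) (pvar 1)) (pvar 2))))
   |exists (pimp (pneg (pneg (pvar 0))) (pvar 0)) ];
   [exists (sub4 A B pbot pbot pbot)|exists (sub4 A B C pbot pbot)
   |exists (sub4 A B pbot pbot pbot)|exists (sub4 A B pbot pbot pbot)
   |exists (sub4 A B pbot pbot pbot)|exists (sub4 A B pbot pbot pbot)
   |exists (sub4 A B pbot pbot pbot)|exists (sub4 A B C pbot pbot)
   |exists (sub4 A pbot pbot pbot pbot)];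
   (split; [refl|]; split; [simpl; lia|constructor]). }
  destruct ES as (S & s & -> & HS & HSA). apply Ext; [lia| |exact IH].
  intros p Hp. apply ef_frege; auto. now apply frege_subst.
 - destruct HA as (S & s & HS & ->). assert (HbS := Hb S HS). apply Ext; [lia| |exact IH].
  intros p Hp. apply ef_axiom; auto.
 - destruct IH as (E & E1 & E2 & E3).
  exists (pimp A B :: E). split; [|split].
  + intros i [Hi|Hi]; [discriminate|now apply E1 in Hi].
  + simpl. lia.
  + intros pi Hpi HE.
   destruct (E3 pi) as (n1 & C1 & C2 & C3); simpl in HE; auto.
   destruct (H2 Ax F (n1 ++ pi) (sub4 (V base (pimp A B)) (V base A) (V base B) pbot pbot) 1)
    as (n2 & D1 & D2 & D3); auto.
   { intros P [<-|[<-|[<-|[]]]]; simpl.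
    - apply in_or_app. right. apply (HE (pimp A B)). auto.
    - now apply C2.
    - now apply C2. }
   { apply sub4_size; auto. }
   exists (n2 ++ n1). rewrite <- app_assoc. split; [|split]; auto.
   * intros C [<-|HC]; auto. apply in_or_app. right. auto.
   * rewrite proof_size_app. simpl. nia.
Qed.

Fixpoint leaves (A : pform) : list pform :=
 match A with
 | pvar i => [pvar i]
 | pbot => []
 | pimp A B | pand A B | por A B => leaves A ++ leaves B
 end.

(** The justification for counting lines: the proof size is polynomial in the number of lines and in
    the sizes of [F] and of the axiom schemas. At the end the name of [F] is unfolded, taking [F] as
    a schema substituted by its own variables. *)
Theorem ef_of_der : exists K, forall (Ax Q : pform -> Prop) F b n,
 (forall W s, Q W -> Ax (psubst s W)) -> (forall W, Q W -> psize W <= b) ->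
 der (fun A => exists W s, Q W /\ A = psubst s W) n F ->
 exists pi, ef_proof Ax F pi /\
  proof_size pi <= K * (S n * (b + 40) * (b + 40) + psize F * psize F).
Proof.
 destruct ef_simulation as (K0 & HK0). destruct unfold_schema as (K1 & HU).
 exists (K0 + K1 + 100). intros Ax Q F b n HQ Hb (l & Hl & HF & Hn).
 destruct (HK0 Ax Q F (maxvar F) b l) as (E & E1 & E2 & E3); auto.
 assert (SF : psubst pvar F = F).
 { clear. induction F; simpl; congruence. }
 assert (HLv : forall i, occurs i F -> In (pvar i) (leaves F)).
 { clear. induction F; simpl; intros j Hj; rewrite ?in_app_iff; subst; intuition subst; auto. }
 assert (HLo : forall A, In A (leaves F) -> exists i, A = pvar i /\ i < maxvar F).
 { clear. induction F; simpl; intros A; rewrite ?in_app_iff.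
  3-5: intros [H|H]; [apply IHF1 in H|apply IHF2 in H]; destruct H as (j & ? & ?); exists j; split; auto; lia.
  - intros [<-|[]]. eauto.
  - intros []. }
 assert (HLl : length (leaves F) <= psize F).
 { clear. induction F; simpl; rewrite ?length_app; lia. }
 destruct (ext_lines Ax F (maxvar F) (le_n _) (leaves F ++ nodes pvar F ++ E))
  as (pi & P1 & P2 & P3).
 { intros i Hi. rewrite !in_app_iff in Hi. destruct Hi as [Hi|[Hi|Hi]].
  - apply HLo in Hi as (j & [= ->] & Hj). auto.
  - now apply nodes_pvar in Hi.
  - now apply E1 in Hi. }
 destruct (E3 pi) as (n1 & C1 & C2 & C3); auto.
 { intros A HA. apply P2. rewrite !in_app_iff. auto. }
 destruct (HU Ax F (maxvar F) F pvar pvar (n1 ++ pi)) as (n2 & D1 & D2 & D3); auto.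
 { intros A HA. apply in_or_app. right. apply P2. rewrite !in_app_iff. auto. }
 { intros i Hi. right. apply in_or_app. right. apply (P2 (pvar i)).
  rewrite !in_app_iff. auto. }
 rewrite SF in D2.
 set (p0 := n2 ++ n1 ++ pi) in *.
 set (VF := V (maxvar F) F) in *.
 exists (F :: pimp VF F :: pimp (piff VF F) (pimp VF F) :: p0).
 split; [split|].
 - apply ef_mp with VF; [now left| |].
  + right. right. apply in_or_app. right. now apply C2.
  + apply ef_mp with (piff VF F); [now left|right; exact D2|].
   apply ef_frege; auto. constructor.
 - refl.
 - assert (Hs : proof_size p0 <= proof_size n2 + proof_size n1 + 11 * (length (leaves F ++ nodes pvar F ++ E))).
  { unfold p0. rewrite !proof_size_app. lia. }
  rewrite !length_app in Hs. assert (Hnl := nodes_length pvar F).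
  rewrite <- (app_nil_l p0).
  change (proof_size (F :: pimp VF F :: pimp (piff VF F) (pimp VF F) :: [] ++ p0))
   with (psize F + (S (1 + psize F) + (psize (pimp (piff VF F) (pimp VF F)) + proof_size p0))).
  cbn [psize piff VF V]. assert (HP := psize_pos F).
  set (m := S n * (b + 40) * (b + 40)) in *. set (f2 := psize F * psize F) in *.
  assert (X1 : proof_size n1 <= K0 * m).
  { etrans; [exact C3|].
   transitivity (S n * (K0 * ((b + 40) * (b + 40)))); [apply Nat.mul_le_mono_r; lia|].
   unfold m. lia. }
  assert (X2 : length E <= m).
  { etrans; [exact E2|]. unfold m.
   transitivity (S n * (b + 40)); [apply Nat.mul_le_mono_r; lia|].
   rewrite <- (Nat.mul_1_r (S n * (b + 40))) at 1. apply Nat.mul_le_mono_l; lia. }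
  assert (X3 : psize F <= f2).
  { unfold f2. rewrite <- (Nat.mul_1_r (psize F)) at 1. apply Nat.mul_le_mono_l; lia. }
  assert (X4 : proof_size n2 <= K1 * f2) by exact D3.
  rewrite Nat.mul_add_distr_l, !Nat.mul_add_distr_r.
  assert (X5 : 0 <= K1 * m) by lia. assert (X6 : 0 <= K0 * f2) by lia. lia.
Qed.

(** * Families of formulas with short derivations *)

(** Polynomial bounds are taken in [scale i], later the size of the tautology with index [i]. Values
    of at least 2 let constants and sums be absorbed into a single power. *)
Class Scale := { scale : nat -> nat; scale_ge : forall i, 2 <= scale i }.

Lemma der_le Ax n n' A : n <= n' -> der Ax n A -> der Ax n' A.
Proof. intros H. apply der_mono; auto. Qed.

Section Families.
Context {SC : Scale}.

Definition pb (h : nat -> nat) : Prop := exists c, forall i, h i <= scale i ^ c.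

Lemma scale_pow i c : 1 <= scale i ^ c.
Proof. generalize (scale_ge i) (Nat.pow_nonzero (scale i) c). lia. Qed.

Lemma scale_pow_le i c d : c <= d -> scale i ^ c <= scale i ^ d.
Proof. generalize (scale_ge i). intros; apply Nat.pow_le_mono_r; lia. Qed.

Lemma pb_le h h' : (forall i, h i <= h' i) -> pb h' -> pb h.
Proof. intros H (c & Hc). exists c. intros i. generalize (H i) (Hc i). lia. Qed.

Lemma pb_const k : pb (fun _ => k).
Proof.
 exists k. intros i. generalize (Nat.pow_gt_lin_r (scale i) k (scale_ge i)). lia.
Qed.

Lemma pb_add h h' : pb h -> pb h' -> pb (fun i => h i + h' i).
Proof.
 intros (c & Hc) (d & Hd). exists (S (c + d)). intros i.
 generalize (Hc i) (Hd i) (scale_pow_le i c (c + d) ltac:(lia))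
  (scale_pow_le i d (c + d) ltac:(lia)) (scale_ge i) (scale_pow i (c + d)).
 simpl. nia.
Qed.

Lemma pb_mul h h' : pb h -> pb h' -> pb (fun i => h i * h' i).
Proof.
 intros (c & Hc) (d & Hd). exists (c + d). intros i.
 rewrite Nat.pow_add_r. apply Nat.mul_le_mono; auto.
Qed.

Lemma pb_S h : pb h -> pb (fun i => S (h i)).
Proof. intros H. apply (pb_add (fun _ => 1)); auto using pb_const. Qed.

Lemma pb_max h h' : pb h -> pb h' -> pb (fun i => Nat.max (h i) (h' i)).
Proof. intros H H'. eapply pb_le; [|exact (pb_add h h' H H')]. simpl; intros; lia. Qed.

Lemma pb_pow h c : pb h -> pb (fun i => h i ^ c).
Proof.
 intros H. induction c as [|c IH]; simpl; [apply pb_const|now apply pb_mul].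
Qed.

Lemma pb_scale : pb scale.
Proof. exists 1. intros i. simpl. lia. Qed.

Definition cond : Type := nat -> pform -> Prop.

(** Derivability with one polynomial bound for the whole family. It plays the part that truth has in
    a model-theoretic argument with a nonstandard index. *)
Definition prv (q : cond) (w : nat -> pform) : Prop :=
 exists h, pb h /\ forall i, der (q i) (h i) (w i).

Definition peq (q : cond) (a b : nat -> pform) : Prop := prv q (fun i => piff (a i) (b i)).

(** At an index that is not live every formula follows in boundedly many lines ([der_dead]). Side
    conditions are therefore demanded at live indices only. *)
Definition live (q : cond) i : Prop := ~ q i pbot.

Definition sub (q q' : cond) : Prop := forall i A, q i A -> q' i A.

Definition addc (q : cond) (w : nat -> pform) : cond := fun i A => A = w i \/ q i A.

(* Indices with [~ P i] become inconsistent, so that they may be ignored. *)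
Definition restrict (q : cond) (P : nat -> Prop) : cond :=
 fun i A => q i A \/ (~ P i /\ A = pbot).

Lemma sub_refl q : sub q q.
Proof. intros i A; auto. Qed.

Lemma sub_trans {q q' q''} : sub q q' -> sub q' q'' -> sub q q''.
Proof. intros H H' i A; auto. Qed.

Lemma sub_addc q w : sub q (addc q w).
Proof. intros i A; right; auto. Qed.

Lemma sub_restrict q P : sub q (restrict q P).
Proof. intros i A; left; auto. Qed.

Lemma live_sub {q q' i} : sub q q' -> live q' i -> live q i.
Proof. intros H H' Hq. apply H', H, Hq. Qed.

Lemma live_restrict q P i : live (restrict q P) i -> P i.
Proof. intros H. apply NNPP. intros HP. apply H. right. auto. Qed.

Lemma prv_sub {q q' w} : sub q q' -> prv q w -> prv q' w.
Proof.
 intros H (h & Hh & Hd). exists h. split; auto. intros i.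
 eapply der_mono; [apply H|apply le_n|apply Hd].
Qed.

Lemma prv_hyp q w : prv (addc q w) w.
Proof.
 exists (fun _ => 1). split; [apply pb_const|]. intros i. apply der_ax. now left.
Qed.

Lemma prv_mp q a b : prv q a -> prv q (fun i => pimp (a i) (b i)) -> prv q b.
Proof.
 intros (h & Hh & Hd) (h' & Hh' & Hd').
 exists (fun i => h' i + h i + 1). split.
 - apply pb_add; [|apply pb_const]. now apply pb_add.
 - intros i. apply der_mp with (a i); auto.
Qed.

Lemma prv_imp q a b : prv (addc q a) b -> prv q (fun i => pimp (a i) (b i)).
Proof.
 intros (h & Hh & Hd). exists (fun i => 8 * h i). split.
 - apply pb_mul; auto using pb_const.
 - intros i. apply der_imp, Hd.
Qed.

Lemma der_dead : exists K, forall (Ax : pform -> Prop) A, Ax pbot -> der Ax K A.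
Proof.
 destruct (der_taut (pimp pbot (pvar 0))) as (K & HK); [intros v; refl|].
 exists (K + 1 + 1). intros Ax A H.
 apply der_mp with pbot; [|now apply der_ax]. apply (HK Ax (fun _ => A)).
Qed.

Lemma prv_taut A q w : tautology A ->
 (forall i, live q i -> exists s, psubst s A = w i) -> prv q w.
Proof.
 intros HA Hw. destruct (der_taut A HA) as (K & HK).
 destruct (der_taut (pimp pbot (pvar 0))) as (K' & HK'); [intros v; refl|].
 exists (fun _ => K + K' + 2). split; [apply pb_const|].
 intros i. destruct (classic (q i pbot)) as [H|H].
 - apply der_le with (n := K' + 1 + 1); [cbv beta; lia|].
  apply der_mp with pbot; [|now apply der_ax]. apply (HK' (q i) (fun _ => w i)).
 - destruct (Hw i H) as (s & <-). eapply der_le; [|apply HK]; auto. cbv beta; lia.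
Qed.

(** Case distinction on an arbitrary property of the index, made outside the derivations. Nothing is
    asked of a family but a common bound, so the two families of derivations can be interleaved. *)
Lemma prv_split q P w :
 prv (restrict q P) w -> prv (restrict q (fun i => ~ P i)) w -> prv q w.
Proof.
 intros (h & Hh & Hd) (h' & Hh' & Hd').
 exists (fun i => h i + h' i). split; [now apply pb_add|].
 intros i. destruct (classic (P i)) as [H|H].
 - eapply der_mono; [| |apply Hd]; [|lia]. intros A [HA|[HA _]]; tauto.
 - eapply der_mono; [| |apply Hd']; [|lia]. intros A [HA|[HA _]]; tauto.
Qed.

(** At every index one position below [m i] is the hardest: any number of lines sufficient for it
    suffices for all others. The hypothesis, applied to this one selection, bounds all positions at
    once. *)
Lemma uniform q (w : nat -> nat -> pform) (m : nat -> nat) :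
 (forall k q', sub q q' -> (forall i, live q' i -> k i < m i) ->
   prv q' (fun i => w i (k i))) ->
 exists h, pb h /\ forall i k, k < m i -> der (q i) (h i) (w i k).
Proof.
 intros H.
 (* No number of lines is singled out: a formula without any derivation also counts as hardest, so
    the choice needs no assumption of derivability. *)
 assert (W : forall i, exists k0, m i = 0 \/
  (k0 < m i /\ forall k n, k < m i -> der (q i) n (w i k0) -> der (q i) n (w i k))).
 { intros i. induction (m i) as [|p (k0 & IH)]; [exists 0; now left|].
  destruct IH as [->|[Hk0 IH]].
  - exists 0. right. split; [lia|]. intros k n Hk. now replace k with 0 by lia.
  - destruct (classic (forall n, der (q i) n (w i k0) -> der (q i) n (w i p))) as [C|C].
   + exists k0. right. split; [lia|]. intros k n Hk Hd.
    destruct (Nat.eq_dec k p) as [->|]; auto. apply IH; auto; lia.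
   + exists p. right. split; [lia|]. intros k n Hk Hd.
    destruct (Nat.eq_dec k p) as [->|]; auto.
    apply not_all_ex_not in C as (nn & C). apply imply_to_and in C as (C1 & C2).
    apply IH; [lia|]. eapply der_le; [|exact C1]; auto.
    destruct (Nat.le_gt_cases nn n); auto. exfalso. apply C2.
    eapply der_le; [|exact Hd]; auto. lia. }
 apply (fun H => choice (fun i k0 => _) H) in W as (k0 & W).
 (* Where [m i = 0] there is no position to select; these indices are made inconsistent. *)
 destruct (H k0 (restrict q (fun i => 0 < m i))) as (h & Hh & Hd).
 - apply sub_restrict.
 - intros i Hi. apply live_restrict in Hi. destruct (W i); [lia|tauto].
 - exists h. split; auto. intros i k Hk.
  destruct (W i) as [E|[E1 E2]]; [lia|]. apply E2; auto.
  eapply der_mono; [| |apply Hd]; auto. intros A [HA|[HA _]]; auto. lia.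
Qed.

(** Induction of polynomial length. The implications from [k] to [S k] get a common bound by
    [uniform], and at most [m i] of them are chained. The step is assumed for extensions [q'] so
    that the induction hypothesis can be added as an axiom and discharged. *)
Theorem prv_ind q (P : nat -> nat -> pform) m :
 pb m -> prv q (fun i => P i 0) ->
 (forall k q', sub q q' -> (forall i, live q' i -> k i < m i) ->
   prv q' (fun i => P i (k i)) -> prv q' (fun i => P i (S (k i)))) ->
 forall k, (forall i, live q i -> k i <= m i) -> prv q (fun i => P i (k i)).
Proof.
 intros Hm (h0 & Hh0 & H0) HS.
 destruct (uniform q (fun i k => pimp (P i k) (P i (S k))) m) as (h & Hh & Hd).
 { intros k q' Hq Hk. apply prv_imp. apply HS.
  - eapply sub_trans; [exact Hq|apply sub_addc].
  - intros i Hi. apply Hk. eapply live_sub; [apply sub_addc|exact Hi].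
  - apply prv_hyp. }
 destruct (der_taut (pimp pbot (pvar 0))) as (K & HK); [intros v; refl|].
 intros k Hk. exists (fun i => h0 i + m i * (h i + 1) + (K + 2)). split.
 - repeat first [apply pb_add|apply pb_mul|apply pb_const]; auto.
 - intros i. destruct (classic (q i pbot)) as [Hb|Hb].
  + apply der_le with (n := K + 1 + 1); [cbv beta; lia|].
   apply der_mp with pbot; [|now apply der_ax]. apply (HK (q i) (fun _ => P i (k i))).
  + specialize (Hk i Hb).
   assert (E : forall j, j <= m i -> der (q i) (h0 i + j * (h i + 1)) (P i j)).
   { induction j as [|j IH]; intros Hj.
    - eapply der_le; [|apply H0]; auto. lia.
    - eapply der_le; [|eapply der_mp; [apply (Hd i j)|apply IH]]; auto; lia. }
   eapply der_le; [|apply (E _ Hk)]; auto. nia.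
Qed.

Theorem prv_ind_down q (P : nat -> nat -> pform) m :
 pb m -> prv q (fun i => P i (m i)) ->
 (forall k q', sub q q' -> (forall i, live q' i -> k i < m i) ->
   prv q' (fun i => P i (S (k i))) -> prv q' (fun i => P i (k i))) ->
 forall k, (forall i, live q i -> k i <= m i) -> prv q (fun i => P i (k i)).
Proof.
 intros Hm H0 HS k Hk.
 assert (E : forall q w w', (forall i, live q i -> w i = w' i) -> prv q w -> prv q w').
 { clear. intros q w w' E (h & Hh & Hd). destruct der_dead as (K & HK).
  exists (fun i => h i + K). split; [apply pb_add; auto using pb_const|].
  intros i. destruct (classic (q i pbot)) as [Hb|Hb].
  - eapply der_le; [|apply (HK _ _ Hb)]; cbv beta; lia.
  - rewrite <- (E i Hb). eapply der_le; [|apply Hd]; cbv beta; lia. }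
 apply (E q (fun i => P i (m i - (m i - k i)))).
 { intros i Hi. f_equal. specialize (Hk i Hi). lia. }
 apply (prv_ind q (fun i k => P i (m i - k)) m Hm).
 - apply (E q (fun i => P i (m i))); auto. intros. f_equal. lia.
 - intros l q' Hq Hl Hp. apply (HS (fun i => m i - S (l i))); auto.
  + intros i Hi. specialize (Hl i Hi). lia.
  + eapply E; [|exact Hp]. intros i Hi. specialize (Hl i Hi). simpl. f_equal. lia.
 - intros i Hi. specialize (Hk i Hi). lia.
Qed.

(** ** Tautologies *)

(** Truth tables by computation, for checking reified tautologies by reflection. *)
Fixpoint tcheck (n : nat) (v : nat -> bool) (A : pform) : bool :=
 match n with
 | 0 => peval v A
 | S n => tcheck n (fun i => if i =? n then true else v i) A
      && tcheck n (fun i => if i =? n then false else v i) A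
 end.

Lemma peval_ext v v' A : (forall i, i < maxvar A -> v i = v' i) -> peval v A = peval v' A.
Proof.
 induction A; simpl; intros H; auto; rewrite IHA1, IHA2; auto; intros; apply H; lia.
Qed.

Lemma tcheck_sound A : tcheck (maxvar A) (fun _ => false) A = true -> tautology A.
Proof.
 intros H v.
 assert (E : forall n v0, tcheck n v0 A = true -> peval (fun i => if i <? n then v i else v0 i) A = true).
 { induction n as [|n IH]; intros v0 H0.
  - rewrite <- H0. apply peval_ext. intros i _. now destruct i.
  - simpl in H0. apply andb_true_iff in H0 as [H1 H2].
   destruct (v n) eqn:En; [apply IH in H1; rewrite <- H1|apply IH in H2; rewrite <- H2];
    apply peval_ext; intros i _;
    destruct (Nat.ltb_spec i (S n)), (Nat.ltb_spec i n), (Nat.eqb_spec i n);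
     subst; auto; lia. }
 rewrite <- (E _ _ H). apply peval_ext. intros i Hi.
 destruct (Nat.ltb_spec i (maxvar A)); auto; lia.
Qed.
End Families.

(** * Reflective derivation of instances of tautologies *)

Ltac fm_lookup t env :=
 lazymatch env with
 | t :: _ => constr:(0)
 | _ :: ?e => let n := fm_lookup t e in constr:(S n)
 end.

Ltac fm_mem t env :=
 lazymatch env with
 | nil => constr:(false)
 | t :: _ => constr:(true)
 | _ :: ?e => fm_mem t e
 end.

Ltac fm_collect env t :=
 lazymatch t with
 | pimp ?a ?b => let e := fm_collect env a in fm_collect e b
 | pand ?a ?b => let e := fm_collect env a in fm_collect e b
 | por ?a ?b => let e := fm_collect env a in fm_collect e b
 | piff ?a ?b => let e := fm_collect env a in fm_collect e b
 | pneg ?a => fm_collect env a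
 | pbot => env
 | ptop => env
 | pconst true => env
 | pconst false => env
 | _ => lazymatch fm_mem t env with
     | true => env
     | false => constr:(t :: env)
     end
 end.

Ltac fm_reify env t :=
 lazymatch t with
 | pimp ?a ?b => let x := fm_reify env a in let y := fm_reify env b in constr:(pimp x y)
 | pand ?a ?b => let x := fm_reify env a in let y := fm_reify env b in constr:(pand x y)
 | por ?a ?b => let x := fm_reify env a in let y := fm_reify env b in constr:(por x y)
 | piff ?a ?b => let x := fm_reify env a in let y := fm_reify env b in constr:(piff x y)
 | pneg ?a => let x := fm_reify env a in constr:(pneg x)
 | pbot => constr:(pbot)
 | ptop => constr:(ptop)
 | pconst true => constr:(ptop)
 | pconst false => constr:(pbot)
 | _ => let n := fm_lookup t env in constr:(pvar n)
 end.

Ltac fm_close :=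
 lazymatch goal with
 | |- exists s, psubst s ?A = ?t =>
  let env := fm_collect (@nil pform) t in
  let r := fm_reify env t in
  unify A r; exists (fun n => nth n env pbot); refl
 end.

Ltac puse H := try unfold peq in *; refine (prv_mp _ _ _ H _).
Ltac puses t :=
 lazymatch t with
 | (?a, ?b) => puses a; puse b
 | _ => puse t
 end.

(* One instance of a fixed tautology is derived with a constant number of lines,
  hence the formula is reified before the bounds are considered. *)
Ltac ptaut_core tac :=
 let A := open_constr:(_ : pform) in
 try unfold peq in *; refine (prv_taut A _ _ _ _);
 cycle 1; [ tac; fm_close | apply tcheck_sound; vm_compute; refl ].

Ltac ptaut0 := ptaut_core ltac:(intros ? _; cbv beta).
Ltac split_case := intros i Hi; apply live_restrict in Hi.
Ltac extend r S :=
 match goal with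
 | |- context [restrict ?q ?P] =>
  set (r := restrict q P); assert (S : sub q r) by apply sub_restrict
 | |- context [addc ?q ?w] => set (r := addc q w); assert (S : sub q r) by apply sub_addc
 end.
Tactic Notation "ptaut_by" tactic0(t) := ptaut_core ltac:(intros i Hi; cbv beta; t).
Tactic Notation "ptaut_on" tactic0(t) := ptaut_core ltac:(split_case; cbv beta; t).
Tactic Notation "ptaut" := ptaut0.
Tactic Notation "ptaut" constr(t) := puses t; ptaut0.

Section Families2.
Context {SC : Scale}.

Lemma prv_eq q w w' : (forall i, live q i -> w i = w' i) -> prv q w -> prv q w'.
Proof.
 intros E H. puse H. ptaut_by (rewrite (E i Hi)).
Qed.

Lemma prv_bot q w : prv q (fun _ => pbot) -> prv q w.
Proof. intros H. ptaut H. Qed.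

Lemma prv_top q : prv q (fun _ => ptop).
Proof. ptaut. Qed.

Lemma prv_cases q a w : prv (addc q a) w -> prv (addc q (fun i => pneg (a i))) w -> prv q w.
Proof. intros H1 H2. apply prv_imp in H1, H2. ptaut (H1, H2). Qed.

Lemma prv_raa q w : prv (addc q (fun i => pneg (w i))) (fun _ => pbot) -> prv q w.
Proof. intros H. apply prv_imp in H. ptaut H. Qed.

Lemma prv_and q a b : prv q a -> prv q b -> prv q (fun i => pand (a i) (b i)).
Proof. intros H1 H2. ptaut (H1, H2). Qed.

Lemma prv_and1 q a b : prv q (fun i => pand (a i) (b i)) -> prv q a.
Proof. intros H. ptaut H. Qed.

Lemma prv_and2 q a b : prv q (fun i => pand (a i) (b i)) -> prv q b.
Proof. intros H. ptaut H. Qed.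

(** As in the next three lemmas, the number of lines depends on the length of the list only, not on
    the size of its formulas. *)
Lemma conj_elim : exists K, forall Ax l A, In A l ->
 der Ax (K * length l) (pimp (pconj l) A).
Proof.
 destruct (der_taut (pimp (pand (pvar 0) (pvar 1)) (pvar 0))) as (K1 & H1).
 { intros v; simpl; destruct (v 0), (v 1); refl. }
 destruct (der_taut (pimp (pimp (pvar 1) (pvar 2)) (pimp (pand (pvar 0) (pvar 1)) (pvar 2)))) as (K2 & H2).
 { intros v; simpl; destruct (v 0), (v 1), (v 2); refl. }
 exists (K1 + K2 + 1). intros Ax l A. induction l as [|B l IH]; intros Hi; [destruct Hi|].
 destruct Hi as [->|Hi].
 - eapply der_le; [|apply (H1 Ax (fun i => match i with 0 => A | _ => pconj l end))]; auto.
  simpl. nia.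
 - eapply der_le; [|eapply der_mp;
   [apply (H2 Ax (fun i => match i with 0 => B | 1 => pconj l | _ => A end))|apply (IH Hi)]];
   auto. simpl. nia.
Qed.

Lemma conj_intro : exists K, forall Ax l n, (forall A, In A l -> der Ax n A) ->
 der Ax ((K + n) * S (length l)) (pconj l).
Proof.
 destruct (der_taut ptop) as (K1 & H1); [intros v; refl|].
 destruct (der_taut (pimp (pvar 0) (pimp (pvar 1) (pand (pvar 0) (pvar 1))))) as (K2 & H2).
 { intros v; simpl; destruct (v 0), (v 1); refl. }
 exists (K1 + K2 + 2). intros Ax l n. induction l as [|B l IH]; intros Hl.
 - eapply der_le; [|apply (H1 Ax pvar)]; auto. simpl; nia.
 - eapply der_le; [|eapply der_mp; [eapply der_mp;
   [apply (H2 Ax (fun i => match i with 0 => B | _ => pconj l end))|apply Hl; now left]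
   |apply IH; intros; apply Hl; now right]]; auto.
  cbn [length]. nia.
Qed.

Lemma disj_intro : exists K, forall Ax l A, In A l ->
 der Ax (K * length l) (pimp A (pdisj l)).
Proof.
 destruct (der_taut (pimp (pvar 0) (por (pvar 0) (pvar 1)))) as (K1 & H1).
 { intros v; simpl; destruct (v 0), (v 1); refl. }
 destruct (der_taut (pimp (pimp (pvar 2) (pvar 1)) (pimp (pvar 2) (por (pvar 0) (pvar 1))))) as (K2 & H2).
 { intros v; simpl; destruct (v 0), (v 1), (v 2); refl. }
 exists (K1 + K2 + 1). intros Ax l A. induction l as [|B l IH]; intros Hi; [destruct Hi|].
 destruct Hi as [->|Hi].
 - eapply der_le; [|apply (H1 Ax (fun i => match i with 0 => A | _ => pdisj l end))]; auto.
  simpl. nia.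
 - eapply der_le; [|eapply der_mp;
   [apply (H2 Ax (fun i => match i with 0 => B | 1 => pdisj l | _ => A end))|apply (IH Hi)]];
   auto. simpl. nia.
Qed.

Lemma disj_elim : exists K, forall Ax l n C, (forall A, In A l -> der Ax n (pimp A C)) ->
 der Ax ((K + n) * S (length l)) (pimp (pdisj l) C).
Proof.
 destruct (der_taut (pimp pbot (pvar 0))) as (K1 & H1); [intros v; refl|].
 destruct (der_taut (pimp (pimp (pvar 0) (pvar 2)) (pimp (pimp (pvar 1) (pvar 2))
  (pimp (por (pvar 0) (pvar 1)) (pvar 2))))) as (K2 & H2).
 { intros v; simpl; destruct (v 0), (v 1), (v 2); refl. }
 exists (K1 + K2 + 2). intros Ax l n C. induction l as [|B l IH]; intros Hl.
 - eapply der_le; [|apply (H1 Ax (fun _ => C))]; auto. simpl; nia.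
 - eapply der_le; [|eapply der_mp; [eapply der_mp;
   [apply (H2 Ax (fun i => match i with 0 => B | 1 => pdisj l | _ => C end))|apply Hl; now left]
   |apply IH; intros; apply Hl; now right]]; auto.
  cbn [length]. nia.
Qed.

Lemma prv_intro q w h : pb h -> (forall i, live q i -> der (q i) (h i) (w i)) -> prv q w.
Proof.
 intros Hh Hd. destruct der_dead as (K & HK).
 exists (fun i => h i + K). split; [apply pb_add; auto using pb_const|].
 intros i. destruct (classic (q i pbot)) as [Hb|Hb].
 - eapply der_le; [|apply (HK _ _ Hb)]; auto; lia.
 - eapply der_le; [|apply (Hd i Hb)]; auto; lia.
Qed.

Lemma uniform_list q (l : nat -> list pform) :
 (forall A q', sub q q' -> (forall i, live q' i -> In (A i) (l i)) -> prv q' A) ->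
 exists h, pb h /\ forall i A, In A (l i) -> der (q i) (h i) A.
Proof.
 intros H.
 destruct (uniform q (fun i k => nth k (l i) pbot) (fun i => length (l i))) as (h & Hh & Hd).
 { intros k q' Hq Hk. apply H; auto. intros i Hi. apply nth_In; auto. }
 exists h. split; auto. intros i A HA.
 apply (In_nth _ _ pbot) in HA as (k & Hk & <-). now apply Hd.
Qed.

Lemma pconj_intro q (l : nat -> list pform) :
 pb (fun i => length (l i)) ->
 (forall A q', sub q q' -> (forall i, live q' i -> In (A i) (l i)) -> prv q' A) ->
 prv q (fun i => pconj (l i)).
Proof.
 intros Hl H. apply uniform_list in H as (h & Hh & Hd).
 destruct conj_intro as (K & HK).
 exists (fun i => (K + h i) * S (length (l i))). split.
 - apply pb_mul; auto using pb_S. apply pb_add; auto using pb_const.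
 - auto.
Qed.

Lemma pconj_elim q (l : nat -> list pform) A :
 pb (fun i => length (l i)) -> (forall i, live q i -> In (A i) (l i)) ->
 prv q (fun i => pconj (l i)) -> prv q A.
Proof.
 intros Hl HA H. puse H. destruct conj_elim as (K & HK).
 apply prv_intro with (fun i => K * length (l i)); auto.
 apply pb_mul; auto using pb_const.
Qed.

Lemma pdisj_intro q (l : nat -> list pform) A :
 pb (fun i => length (l i)) -> (forall i, live q i -> In (A i) (l i)) ->
 prv q A -> prv q (fun i => pdisj (l i)).
Proof.
 intros Hl HA H. puse H. destruct disj_intro as (K & HK).
 apply prv_intro with (fun i => K * length (l i)); auto.
 apply pb_mul; auto using pb_const.
Qed.

(** It suffices to treat one disjunct selected at each index: [uniform_list] turns this into a
    common bound for all the polynomially many disjuncts. *)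
Lemma pdisj_elim q (l : nat -> list pform) w :
 pb (fun i => length (l i)) -> prv q (fun i => pdisj (l i)) ->
 (forall A q', sub q q' -> (forall i, live q' i -> In (A i) (l i)) -> prv q' A -> prv q' w) ->
 prv q w.
Proof.
 intros Hl H HA. puse H.
 destruct (uniform_list q (fun i => map (fun A => pimp A (w i)) (l i))) as (h & Hh & Hd).
 { intros B q' Hq HB.
  (* The disjunct is only determined at live indices; the default elsewhere is arbitrary. *)
  assert (HC : forall i, exists A, live q' i -> In A (l i) /\ B i = pimp A (w i)).
  { intros i. destruct (classic (live q' i)) as [Hi|Hi].
   - generalize (HB i Hi). rewrite in_map_iff. intros (A & <- & HA'). eauto.
   - exists pbot. tauto. }
  apply (fun H => choice (fun i A => _) H) in HC as (A & HC).
  apply prv_eq with (fun i => pimp (A i) (w i)).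
  { intros i Hi. symmetry. now apply HC. }
  apply prv_imp. apply (HA A).
  - eapply sub_trans; [exact Hq|apply sub_addc].
  - intros i Hi. apply HC. eapply live_sub; [apply sub_addc|exact Hi].
  - apply prv_hyp. }
 destruct disj_elim as (K & HK).
 exists (fun i => (K + h i) * S (length (l i))). split.
 - apply pb_mul; auto using pb_S. apply pb_add; auto using pb_const.
 - intros i. apply HK. intros A HA'. apply Hd.
  apply (in_map (fun A => pimp A (w i))); auto.
Qed.

(** The shape of the formula may depend on the index, as long as only finitely many tautologies
    arise. This is the situation after a case distinction on Booleans attached to the index. *)
Lemma prv_taut_fin (As : list pform) q w :
 forallb (fun A => tcheck (maxvar A) (fun _ => false) A) As = true ->
 (forall i, live q i -> exists A s, In A As /\ psubst s A = w i) -> prv q w.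
Proof.
 intros HAs Hw.
 assert (E : exists K, forall A, In A As -> forall Ax s, der Ax K (psubst s A)).
 { clear Hw. induction As as [|A As IH]; [exists 0; intros A []|].
  simpl in HAs. apply andb_true_iff in HAs as [HA HAs].
  destruct (IH HAs) as (K & HK). destruct (der_taut A (tcheck_sound A HA)) as (K' & HK').
  exists (K + K'). intros B [<-|HB] Ax s;
   [eapply der_le; [|apply HK']; lia|eapply der_le; [|apply (HK B HB)]; lia]. }
 destruct E as (K & HK). apply prv_intro with (fun _ => K); [apply pb_const|].
 intros i Hi. destruct (Hw i Hi) as (A & s & HA & <-). now apply HK.
Qed.
End Families2.

Ltac fm_in :=
 lazymatch goal with
 | |- In ?x ?l => tryif is_evar l then apply in_eq else (apply in_cons; fm_in)
 end.

Ltac fm_nil l :=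
 lazymatch l with
 | _ :: ?t => fm_nil t
 | _ => unify l (@nil pform)
 end.

(* Like [ptaut_core], but [tac] may make case distinctions on Booleans. *)
Ltac ptaut_fin tac :=
 let As := open_constr:(_ : list pform) in
 try unfold peq in *; refine (prv_taut_fin As _ _ _ _);
 cycle 1; [ intros i Hi; cbv beta; tac;
  lazymatch goal with
  | |- exists A s, In A _ /\ psubst s A = ?t =>
   let env := fm_collect (@nil pform) t in
   let r := fm_reify env t in
   exists r; exists (fun n => nth n env pbot); split; [fm_in|refl]
  end
 | lazymatch goal with |- forallb _ ?l = true => fm_nil l end;
  vm_compute; refl ].
Tactic Notation "ptaut_fin_by" tactic0(t) := ptaut_fin t.

(** * Numbers as families of lists of formulas *)

Notation xor3 a b c := (piff a (piff b c)).
Notation maj a b c := (por (pand a b) (pand c (por a b))).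

(** The carry into position [k] of a ripple-carry adder. The incoming carry [c] covers the successor
    and makes inductions over the tails of the arguments possible. *)
Fixpoint carry (c : pform) (x y : bits) (k : nat) : pform :=
 match k with
 | 0 => c
 | S k => maj (nth_bit x k) (nth_bit y k) (carry c x y k)
 end.

Definition addp (c : pform) (x y : bits) : bits :=
 map (fun k => xor3 (nth_bit x k) (nth_bit y k) (carry c x y k))
  (seq 0 (S (Nat.max (length x) (length y)))).

Definition scal (a : pform) (x : bits) : bits := map (pand a) x.

Definition mulp (x y : bits) : bits :=
 fold_right (fun a acc => addp pbot (scal a y) (pbot :: acc)) [] x.

Lemma nth_bit_map (f : nat -> pform) n k : k < n -> nth_bit (map f (seq 0 n)) k = f k.
Proof.
 intros H. unfold nth_bit. rewrite nth_indep with (d' := f 0) by now rewrite length_map_seq.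
 rewrite map_nth, seq_nth; auto.
Qed.

Lemma nth_bit_over x k : length x <= k -> nth_bit x k = pbot.
Proof. apply nth_overflow. Qed.

Lemma nth_bit_tl x k : nth_bit (tl x) k = nth_bit x (S k).
Proof. destruct x; [now destruct k|refl]. Qed.

Lemma nth_bit_skipn x k j : nth_bit (skipn k x) j = nth_bit x (k + j).
Proof. unfold nth_bit. now rewrite nth_skipn. Qed.

Lemma tl_skipn {A} (x : list A) k : tl (skipn k x) = skipn (S k) x.
Proof. revert x; induction k as [|k IH]; intros [|a x]; auto. exact (IH x). Qed.

Lemma carry_tl c x y k :
 carry (maj (nth_bit x 0) (nth_bit y 0) c) (tl x) (tl y) k = carry c x y (S k).
Proof. induction k; simpl; auto. rewrite IHk, !nth_bit_tl. refl. Qed.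

Lemma addp_length c x y : length (addp c x y) = S (Nat.max (length x) (length y)).
Proof. unfold addp. now rewrite length_map_seq. Qed.

Lemma mulp_length x y : length (mulp x y) <= length x * (length y + 2).
Proof.
 induction x as [|a x IH]; [simpl; lia|].
 cbn [mulp fold_right]. fold (mulp x y). rewrite addp_length. unfold scal.
 rewrite length_map. cbn [length]. nia.
Qed.

Ltac nth_cons := repeat match goal with
 | |- context [nth_bit (?a :: ?l) 0] => change (nth_bit (a :: l) 0) with a
 | |- context [nth_bit (?a :: ?l) (S ?j)] => change (nth_bit (a :: l) (S j)) with (nth_bit l j)
 end.

Section Numbers.
Context {SC : Scale}.

Record elt := Elt { fam :> nat -> bits; fam_pb : pb (fun i => length (fam i)) }.

(** Comparison up to the longer list, reading missing bits as [pbot]: leading zeros do not affect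
    equality. *)
Definition eqw (x y : bits) : pform :=
 pconj (map (fun k => piff (nth_bit x k) (nth_bit y k))
  (seq 0 (Nat.max (length x) (length y)))).

Definition meq (q : cond) (x y : elt) : Prop := prv q (fun i => eqw (x i) (y i)).

Lemma meq_sub {q q' x y} : sub q q' -> meq q x y -> meq q' x y.
Proof. apply prv_sub. Qed.

Lemma eqw_pb (x y : elt) : pb (fun i => length
 (map (fun k => piff (nth_bit (x i) k) (nth_bit (y i) k))
  (seq 0 (Nat.max (length (x i)) (length (y i)))))).
Proof.
 eapply pb_le; [|apply pb_max; [apply (fam_pb x)|apply (fam_pb y)]].
 intros i. now rewrite length_map_seq.
Qed.

Lemma meq_intro q (x y : elt) :
 (forall k q', sub q q' ->
   (forall i, live q' i -> k i < Nat.max (length (x i)) (length (y i))) ->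
   prv q' (fun i => piff (nth_bit (x i) (k i)) (nth_bit (y i) (k i)))) -> meq q x y.
Proof.
 intros H. apply pconj_intro; [apply eqw_pb|].
 intros A q' Hq HA.
 assert (HC : forall i, exists k, live q' i ->
  k < Nat.max (length (x i)) (length (y i)) /\
  A i = piff (nth_bit (x i) k) (nth_bit (y i) k)).
 { intros i. destruct (classic (live q' i)) as [Hi|Hi]; [|exists 0; tauto].
  generalize (HA i Hi). rewrite in_map_iff. intros (k & <- & Hk).
  apply in_seq in Hk. exists k. intros _. split; auto. lia. }
 apply (fun H => choice (fun i k => _) H) in HC as (k & HC).
 apply prv_eq with (fun i => piff (nth_bit (x i) (k i)) (nth_bit (y i) (k i))).
 { intros i Hi. symmetry. now apply HC. }
 apply H; auto. intros i Hi. now apply HC.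
Qed.

Lemma meq_bit q (x y : elt) : meq q x y -> forall k,
 peq q (fun i => nth_bit (x i) (k i)) (fun i => nth_bit (y i) (k i)).
Proof.
 intros H k. unfold peq.
 apply prv_split with (fun i => k i < Nat.max (length (x i)) (length (y i))).
 - eapply pconj_elim; [apply eqw_pb| |eapply prv_sub; [apply sub_restrict|exact H]].
  split_case.
  apply (in_map (fun k => piff (nth_bit (x i) k) (nth_bit (y i) k))), in_seq. lia.
 - ptaut_on (rewrite !nth_bit_over by lia).
Qed.

Lemma meq_eq q (x y : elt) : (forall i, live q i -> x i = y i) -> meq q x y.
Proof.
 intros H. apply meq_intro. intros k q' Hq _.
 ptaut_by (rewrite (H i (live_sub Hq Hi))).
Qed.

#[global] Instance peq_equiv q : Equivalence (peq q).
Proof.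
 split.
 - intros a. ptaut.
 - intros a b H. ptaut H.
 - intros a b c H1 H2. ptaut (H1, H2).
Qed.

#[global] Instance meq_equiv q : Equivalence (meq q).
Proof.
 split.
 - intros x. now apply meq_eq.
 - intros x y H. apply meq_intro. intros k q' Hq _.
  assert (E := meq_bit _ _ _ (meq_sub Hq H) k). ptaut E.
 - intros x y z H1 H2. apply meq_intro. intros k q' Hq _.
  assert (E1 := meq_bit _ _ _ (meq_sub Hq H1) k).
  assert (E2 := meq_bit _ _ _ (meq_sub Hq H2) k).
  ptaut (E1, E2).
Qed.

Definition fbot_ : nat -> pform := fun _ => pbot.
Definition ftop_ : nat -> pform := fun _ => ptop.

Definition mnil : elt := Elt (fun _ => []) (pb_const 0).

Definition mcons (a : nat -> pform) (x : elt) : elt :=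
 Elt (fun i => a i :: x i) (pb_S _ (fam_pb x)).

Lemma mtl_pb (x : elt) : pb (fun i => length (tl (x i))).
Proof.
 eapply pb_le; [|apply (fam_pb x)]. intros i. cbv beta. destruct (fam x i); cbn [tl length]; lia.
Qed.

Definition mtl (x : elt) : elt := Elt (fun i => tl (x i)) (mtl_pb x).

Lemma mskip_pb (k : nat -> nat) (x : elt) : pb (fun i => length (skipn (k i) (x i))).
Proof.
 eapply pb_le; [|apply (fam_pb x)]. intros i. cbv beta. rewrite length_skipn. lia.
Qed.

Definition mskip (k : nat -> nat) (x : elt) : elt := Elt (fun i => skipn (k i) (x i)) (mskip_pb k x).

Lemma mscal_pb (a : nat -> pform) (x : elt) : pb (fun i => length (scal (a i) (x i))).
Proof.
 eapply pb_le; [|apply (fam_pb x)]. intros i. cbv beta. unfold scal.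
 now rewrite length_map.
Qed.

Definition mscal (a : nat -> pform) (x : elt) : elt := Elt (fun i => scal (a i) (x i)) (mscal_pb a x).

Lemma madd_pb (c : nat -> pform) (x y : elt) : pb (fun i => length (addp (c i) (x i) (y i))).
Proof.
 eapply pb_le; [|apply pb_S, pb_max; [apply (fam_pb x)|apply (fam_pb y)]].
 intros i. cbv beta. now rewrite addp_length.
Qed.

Definition madd (c : nat -> pform) (x y : elt) : elt := Elt (fun i => addp (c i) (x i) (y i)) (madd_pb c x y).

Lemma mmul_pb (x y : elt) : pb (fun i => length (mulp (x i) (y i))).
Proof.
 eapply pb_le; [|apply pb_mul; [apply (fam_pb x)|apply pb_add;
  [apply (fam_pb y)|apply (pb_const 2)]]].
 intros i. apply mulp_length.
Qed.

Definition mmul (x y : elt) : elt := Elt (fun i => mulp (x i) (y i)) (mmul_pb x y).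

Lemma add_bit q c (x y : nat -> bits) k :
 peq q (fun i => nth_bit (addp (c i) (x i) (y i)) (k i))
  (fun i => xor3 (nth_bit (x i) (k i)) (nth_bit (y i) (k i)) (carry (c i) (x i) (y i) (k i))).
Proof.
 apply prv_split with (fun i => k i < S (Nat.max (length (x i)) (length (y i)))).
 - ptaut_on (unfold addp; rewrite nth_bit_map by auto).
 - ptaut_on (rewrite !nth_bit_over by (rewrite ?addp_length; lia); destruct (k i) as [|j]; [lia|]; cbn [carry]; rewrite !(nth_bit_over _ j) by lia).
Qed.

Lemma scal_bit q a (x : nat -> bits) k :
 peq q (fun i => nth_bit (scal (a i) (x i)) (k i)) (fun i => pand (a i) (nth_bit (x i) (k i))).
Proof.
 apply prv_split with (fun i => k i < length (x i)).
 - assert (E : forall a x k, k < length x -> nth_bit (scal a x) k = pand a (nth_bit x k)).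
  { intros b z j Hj. unfold nth_bit, scal.
   rewrite nth_indep with (d' := pand b pbot) by now rewrite length_map.
   apply map_nth. }
  ptaut_on (rewrite E by auto).
 - ptaut_on (rewrite !nth_bit_over by (unfold scal; rewrite ?length_map; lia)).
Qed.

Lemma meq_cons q a b x y : peq q a b -> meq q x y -> meq q (mcons a x) (mcons b y).
Proof.
 intros H1 H2. apply meq_intro. intros k q' Hq _. simpl.
 apply prv_split with (fun i => k i = 0).
 - apply (prv_sub Hq) in H1. apply (prv_sub (sub_restrict q' (fun i => k i = 0))) in H1.
  puse H1. ptaut_on (rewrite Hi; unfold nth_bit; cbn [nth]).
 - apply (meq_sub Hq) in H2.
  apply (meq_sub (sub_restrict q' (fun i => k i <> 0))) in H2.
  apply meq_bit with (k := fun i => k i - 1) in H2. puse H2.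
  ptaut_on (destruct (k i) as [|j]; [tauto|]; rewrite Nat.sub_succ, Nat.sub_0_r; unfold nth_bit; cbn [nth mcons fam]).
Qed.

#[global] Instance mcons_proper q : Proper (peq q ==> meq q ==> meq q) mcons.
Proof. intros a b H x y H'. now apply meq_cons. Qed.

#[global] Instance mtl_proper q : Proper (meq q ==> meq q) mtl.
Proof.
 intros x y H. apply meq_intro. intros k q' Hq _.
 apply (meq_sub Hq) in H. apply meq_bit with (k := fun i => S (k i)) in H.
 puse H.
 ptaut_by (cbn [fam mtl]; rewrite !nth_bit_tl).
Qed.

#[global] Instance mscal_proper q : Proper (peq q ==> meq q ==> meq q) mscal.
Proof.
 intros a b H1 x y H2. apply meq_intro. intros k q' Hq _.
 apply (prv_sub Hq) in H1. apply (meq_sub Hq) in H2.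
 apply meq_bit with (k := k) in H2.
 assert (E1 := scal_bit q' a x k). assert (E2 := scal_bit q' b y k).
 cbn [fam mscal]. ptaut (H1, H2, E1, E2).
Qed.

Lemma carry_cong q c c' (x x' y y' : elt) : peq q c c' -> meq q x x' -> meq q y y' ->
 forall m k, pb m -> (forall i, live q i -> k i <= m i) ->
 peq q (fun i => carry (c i) (x i) (y i) (k i)) (fun i => carry (c' i) (x' i) (y' i) (k i)).
Proof.
 intros H1 H2 H3 m k Hm Hk.
 apply (prv_ind q (fun i k => piff (carry (c i) (x i) (y i) k) (carry (c' i) (x' i) (y' i) k)) m);
  auto.
 intros l q' Hq _ IH.
 apply (meq_sub Hq), (fun H => meq_bit _ _ _ H l) in H2, H3.
 puses (IH, H2, H3). ptaut_by (cbn [carry]).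
Qed.

#[global] Instance madd_proper q : Proper (peq q ==> meq q ==> meq q ==> meq q) madd.
Proof.
 intros c c' H1 x x' H2 y y' H3. apply meq_intro. intros k q' Hq Hk.
 apply (prv_sub Hq) in H1. apply (meq_sub Hq) in H2, H3.
 assert (E := carry_cong q' c c' x x' y y' H1 H2 H3 _ k
  (pb_max _ _ (fam_pb (madd c x y)) (fam_pb (madd c' x' y')))
  (fun i Hi => Nat.lt_le_incl _ _ (Hk i Hi))).
 apply meq_bit with (k := k) in H2, H3.
 assert (E1 := add_bit q' c x y k). assert (E2 := add_bit q' c' x' y' k).
 cbn [fam madd]. ptaut (E, H2, H3, E1, E2).
Qed.

Lemma bit_bound q' (x y : elt) k :
 (forall i, live q' i -> k i < Nat.max (length (x i)) (length (y i))) ->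
 exists m, pb m /\ forall i, live q' i -> k i <= m i.
Proof.
 intros H. exists (fun i => Nat.max (length (x i)) (length (y i))). split.
 - apply pb_max; apply fam_pb.
 - intros i Hi. apply Nat.lt_le_incl; auto.
Qed.

Lemma madd_comm q c x y : meq q (madd c x y) (madd c y x).
Proof.
 apply meq_intro. intros k q' Hq Hk. apply bit_bound in Hk as (m & Hm & Hk).
 assert (E : peq q' (fun i => carry (c i) (x i) (y i) (k i)) (fun i => carry (c i) (y i) (x i) (k i))).
 { apply (prv_ind q' (fun i k => piff (carry (c i) (x i) (y i) k) (carry (c i) (y i) (x i) k)) m); auto.
  - ptaut_by (cbn [carry]).
  - intros l q'' Hq' _ IH. puse IH. ptaut_by (cbn [carry]). }
 assert (E1 := add_bit q' c x y k). assert (E2 := add_bit q' c y x k).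
 cbn [fam madd]. ptaut (E, E1, E2).
Qed.

(** Each side runs two adders. The invariant is that the two carries on the left have the same sum
    as those on the right, that is the same parity and the same conjunction; the hypothesis states
    it for the incoming carries. *)
Lemma madd_assoc q c1 c2 d1 d2 (x y z : elt) :
 prv q (fun i => pand (piff (piff (c1 i) (c2 i)) (piff (d1 i) (d2 i)))
            (piff (pand (c1 i) (c2 i)) (pand (d1 i) (d2 i)))) ->
 meq q (madd c2 (madd c1 x y) z) (madd d2 x (madd d1 y z)).
Proof.
 intros H0. apply meq_intro. intros k q' Hq Hk. apply bit_bound in Hk as (m & Hm & Hk).
 assert (E : prv q' (fun i =>
  pand (piff (piff (carry (c1 i) (x i) (y i) (k i)) (carry (c2 i) (addp (c1 i) (x i) (y i)) (z i) (k i)))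
        (piff (carry (d1 i) (y i) (z i) (k i)) (carry (d2 i) (x i) (addp (d1 i) (y i) (z i)) (k i))))
     (piff (pand (carry (c1 i) (x i) (y i) (k i)) (carry (c2 i) (addp (c1 i) (x i) (y i)) (z i) (k i)))
        (pand (carry (d1 i) (y i) (z i) (k i)) (carry (d2 i) (x i) (addp (d1 i) (y i) (z i)) (k i)))))).
 { apply (prv_ind q' (fun i k =>
  pand (piff (piff (carry (c1 i) (x i) (y i) k) (carry (c2 i) (addp (c1 i) (x i) (y i)) (z i) k))
        (piff (carry (d1 i) (y i) (z i) k) (carry (d2 i) (x i) (addp (d1 i) (y i) (z i)) k)))
     (piff (pand (carry (c1 i) (x i) (y i) k) (carry (c2 i) (addp (c1 i) (x i) (y i)) (z i) k))
        (pand (carry (d1 i) (y i) (z i) k) (carry (d2 i) (x i) (addp (d1 i) (y i) (z i)) k)))) m); auto.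
  - eapply prv_sub; [exact Hq|exact H0].
  - intros l q'' Hq' _ IH.
   assert (E1 := add_bit q'' c1 x y l). assert (E2 := add_bit q'' d1 y z l).
   puses (IH, E1, E2). ptaut_by (cbn [carry]). }
 assert (E1 := add_bit q' c1 x y k). assert (E2 := add_bit q' d1 y z k).
 assert (E3 := add_bit q' c2 (madd c1 x y) z k). assert (E4 := add_bit q' d2 x (madd d1 y z) k).
 cbn [fam madd] in *. ptaut (E, E1, E2, E3, E4).
Qed.

Lemma madd_0 q x : meq q (madd fbot_ x mnil) x.
Proof.
 apply meq_intro. intros k q' Hq Hk. apply bit_bound in Hk as (m & Hm & Hk).
 assert (E : prv q' (fun i => pneg (carry pbot (x i) [] (k i)))).
 { apply (prv_ind q' (fun i k => pneg (carry pbot (x i) [] k)) m); auto.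
  - ptaut_by (cbn [carry]).
  - intros l q'' Hq' _ IH. puse IH.
   ptaut_by (cbn [carry]; rewrite (nth_bit_over []) by (simpl; lia)). }
 assert (E1 := add_bit q' fbot_ x mnil k). cbn [fam madd mnil fbot_] in *.
 puses (E, E1).
 ptaut_by (rewrite (nth_bit_over []) by (simpl; lia); unfold fbot_).
Qed.

Lemma madd_unfold q c (x y : elt) :
 meq q (madd c x y)
  (mcons (fun i => xor3 (nth_bit (x i) 0) (nth_bit (y i) 0) (c i))
   (madd (fun i => maj (nth_bit (x i) 0) (nth_bit (y i) 0) (c i)) (mtl x) (mtl y))).
Proof.
 apply meq_intro. intros k q' Hq _.
 apply prv_split with (fun i => k i = 0).
 - assert (E := add_bit (restrict q' (fun i => k i = 0)) c x y k). puse E.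
  ptaut_on (cbn [fam madd mcons]; rewrite Hi; nth_cons; cbn [carry]).
 - set (q2 := restrict q' (fun i => k i <> 0)).
  assert (E := add_bit q2 c x y k).
  assert (E' := add_bit q2 (fun i => maj (nth_bit (x i) 0) (nth_bit (y i) 0) (c i))
   (mtl x) (mtl y) (fun i => k i - 1)).
  assert (G : forall i, live q2 i -> exists j, k i = S j).
  { split_case. exists (k i - 1). lia. }
  puses (E, E').
  ptaut_by (destruct (G i Hi) as (j & Hj); cbn [fam madd mcons mtl]; rewrite Hj, !nth_bit_tl, carry_tl, Nat.sub_succ, Nat.sub_0_r; nth_cons).
Qed.

Lemma mcons_tl q (x : elt) : meq q x (mcons (fun i => nth_bit (x i) 0) (mtl x)).
Proof.
 apply meq_intro. intros k q' Hq _.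
 assert (E : forall x k, nth_bit (nth_bit x 0 :: tl x) k = nth_bit x k).
 { intros [|a z] [|j]; simpl; auto. now destruct j. }
 ptaut_by (cbn [fam mcons mtl]; rewrite E).
Qed.

Lemma mcons_bot_nil q : meq q (mcons fbot_ mnil) mnil.
Proof.
 apply meq_intro. intros k q' Hq _.
 assert (E : forall k, nth_bit [pbot] k = nth_bit [] k).
 { intros [|[|j]]; refl. }
 ptaut_by (cbn [fam mcons mnil]; unfold fbot_; rewrite E).
Qed.

Lemma madd_cons0 q p u v : meq q (madd fbot_ (mcons p u) (mcons fbot_ v)) (mcons p (madd fbot_ u v)).
Proof.
 rewrite madd_unfold. apply meq_cons.
 - ptaut_by (cbn [fam mcons]; unfold nth_bit, fbot_; cbn [nth]).
 - apply madd_proper; [|now apply meq_eq|now apply meq_eq].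
  ptaut_by (cbn [fam mcons]; unfold nth_bit, fbot_; cbn [nth]).
Qed.

Lemma madd_AC q x y z : meq q (madd fbot_ x (madd fbot_ y z)) (madd fbot_ y (madd fbot_ x z)).
Proof.
 assert (A : forall x y z, meq q (madd fbot_ (madd fbot_ x y) z) (madd fbot_ x (madd fbot_ y z))).
 { intros. apply madd_assoc. ptaut. }
 now rewrite <- !A, (madd_comm q _ x y).
Qed.

Lemma madd_assoc0 q x y z : meq q (madd fbot_ (madd fbot_ x y) z) (madd fbot_ x (madd fbot_ y z)).
Proof. apply madd_assoc. ptaut. Qed.

Lemma madd_0l q x : meq q (madd fbot_ mnil x) x.
Proof. rewrite madd_comm. apply madd_0. Qed.

Lemma mscal_bot q a x : prv q (fun i => pneg (a i)) -> meq q (mscal a x) mnil.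
Proof.
 intros H. apply meq_intro. intros k q' Hq _. apply (prv_sub Hq) in H.
 assert (E := scal_bit q' a x k). puses (H, E).
 ptaut_by (cbn [fam mscal mnil]; rewrite (nth_bit_over []) by (simpl; lia)).
Qed.

Lemma mscal_top q a x : prv q a -> meq q (mscal a x) x.
Proof.
 intros H. apply meq_intro. intros k q' Hq _. apply (prv_sub Hq) in H.
 assert (E := scal_bit q' a x k). cbn [fam mscal]. ptaut (H, E).
Qed.

Lemma mmul_cons q a x y : meq q (mmul (mcons a x) y) (madd fbot_ (mscal a y) (mcons fbot_ (mmul x y))).
Proof. now apply meq_eq. Qed.

Lemma mmul_nil q y : meq q (mmul mnil y) mnil.
Proof. now apply meq_eq. Qed.

Lemma mmul_unfold q (x y : elt) : meq q (mmul x y)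
 (madd fbot_ (mscal (fun i => nth_bit (x i) 0) y) (mcons fbot_ (mmul (mtl x) y))).
Proof.
 unfold meq. apply prv_split with (fun i => x i = []).
 - set (q' := restrict q (fun i => x i = [])).
  assert (E : forall i, live q' i -> x i = []) by (split_case; auto).
  change (meq q' (mmul x y) (madd fbot_ (mscal (fun i => nth_bit (x i) 0) y) (mcons fbot_ (mmul (mtl x) y)))).
  transitivity mnil; [apply meq_eq; intros i Hi; cbn [fam mmul]; now rewrite E|].
  symmetry. transitivity (madd fbot_ mnil (mcons fbot_ mnil)).
  + apply madd_proper; [refl|apply mscal_bot|].
   * ptaut_by (rewrite E by auto; rewrite (nth_bit_over []) by (simpl; lia)).
   * apply meq_cons; [refl|]. apply meq_eq. intros i Hi. cbn [fam mmul mtl]. now rewrite E.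
  + now rewrite mcons_bot_nil, madd_0.
 - set (q' := restrict q (fun i => x i <> [])).
  assert (E : forall i, live q' i -> x i <> []) by (split_case; auto).
  change (meq q' (mmul x y) (madd fbot_ (mscal (fun i => nth_bit (x i) 0) y) (mcons fbot_ (mmul (mtl x) y)))).
  apply meq_eq. intros i Hi. cbn [fam mmul madd mscal mcons mtl].
  specialize (E i Hi). destruct (x i); [tauto|refl].
Qed.

Lemma mskip_unfold q k (x : elt) :
 meq q (mskip k x) (mcons (fun i => nth_bit (x i) (k i)) (mskip (fun i => S (k i)) x)).
Proof.
 rewrite (mcons_tl q (mskip k x)). apply meq_cons.
 - ptaut_by (cbn [fam mskip]; rewrite nth_bit_skipn, Nat.add_0_r).
 - apply meq_eq. intros i _. apply tl_skipn.
Qed.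

Lemma mskip_over q k (x : elt) : (forall i, live q i -> length (x i) <= k i) -> meq q (mskip k x) mnil.
Proof. intros H. apply meq_eq. intros i Hi. cbn [fam mskip mnil]. apply skipn_all2; auto. Qed.

Lemma mskip_0 q x : meq q (mskip (fun _ => 0) x) x.
Proof. now apply meq_eq. Qed.

(* Induction on the notation of numbers: [P] goes from the tails [skipn (S k)] to [skipn k]. *)
Lemma meq_ind_down (f g : nat -> nat -> bits) (F G : (nat -> nat) -> elt) q m :
 (forall k i, F k i = f i (k i)) -> (forall k i, G k i = g i (k i)) ->
 pb m -> meq q (F m) (G m) ->
 (forall k q', sub q q' -> (forall i, live q' i -> k i < m i) ->
   meq q' (F (fun i => S (k i))) (G (fun i => S (k i))) -> meq q' (F k) (G k)) ->
 meq q (F (fun _ => 0)) (G (fun _ => 0)).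
Proof.
 intros HF HG Hm H0 HS.
 assert (E : forall q k, meq q (F k) (G k) <-> prv q (fun i => eqw (f i (k i)) (g i (k i)))).
 { intros q' k. split; apply prv_eq; intros i _; now rewrite HF, HG. }
 apply E. apply (prv_ind_down q (fun i k => eqw (f i k) (g i k)) m); auto.
 - now apply E.
 - intros k q' Hq Hk IH. apply E, HS; auto. now apply E.
 - intros; lia.
Qed.

Lemma mmul_cong_l q x x' y : meq q x x' -> meq q (mmul x y) (mmul x' y).
Proof.
 intros H. rewrite <- (mskip_0 q x) at 1 || idtac.
 change (meq q (mmul (mskip (fun _ => 0) x) y) (mmul (mskip (fun _ => 0) x') y)).
 apply (meq_ind_down (fun i k => mulp (skipn k (x i)) (y i)) (fun i k => mulp (skipn k (x' i)) (y i))
  (fun k => mmul (mskip k x) y) (fun k => mmul (mskip k x') y) q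
  (fun i => Nat.max (length (x i)) (length (x' i)))); try refl.
 - apply pb_max; apply fam_pb.
 - apply meq_eq. intros i _. cbn [fam mmul mskip]. rewrite !skipn_all2 by lia. refl.
 - intros k q' Hq Hk IH. etrans; [apply mmul_unfold|].
  etrans; [|symmetry; apply mmul_unfold].
  apply madd_proper; [refl|apply mscal_proper|apply meq_cons]; try refl.
  + apply (meq_sub Hq), (fun H => meq_bit _ _ _ H k) in H. puse H.
   ptaut_by (cbn [fam mskip]; rewrite !nth_bit_skipn, !Nat.add_0_r).
  + assert (T : forall x, meq q' (mmul (mtl (mskip k x)) y) (mmul (mskip (fun i => S (k i)) x) y)).
   { intros z. apply meq_eq. intros i _. cbn [fam mmul mtl mskip]. now rewrite tl_skipn. }
   now rewrite !T.
Qed.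

Lemma mmul_skip q k (x y : elt) : meq q (mmul (mskip k x) y)
 (madd fbot_ (mscal (fun i => nth_bit (x i) (k i)) y) (mcons fbot_ (mmul (mskip (fun i => S (k i)) x) y))).
Proof. rewrite (mmul_cong_l _ _ _ _ (mskip_unfold q k x)). apply mmul_cons. Qed.

Lemma mmul_cong_r q x y y' : meq q y y' -> meq q (mmul x y) (mmul x y').
Proof.
 intros H.
 change (meq q (mmul (mskip (fun _ => 0) x) y) (mmul (mskip (fun _ => 0) x) y')).
 apply (meq_ind_down (fun i k => mulp (skipn k (x i)) (y i)) (fun i k => mulp (skipn k (x i)) (y' i))
  (fun k => mmul (mskip k x) y) (fun k => mmul (mskip k x) y') q
  (fun i => length (x i))); try refl.
 - apply fam_pb.
 - apply meq_eq. intros i _. cbn [fam mmul mskip]. rewrite !skipn_all2 by lia. refl.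
 - intros k q' Hq Hk IH. etrans; [apply mmul_skip|].
  etrans; [|symmetry; apply mmul_skip].
  apply madd_proper; [refl|apply mscal_proper|apply meq_cons]; try refl; auto.
  eapply meq_sub; [exact Hq|exact H].
Qed.

#[global] Instance mmul_proper q : Proper (meq q ==> meq q ==> meq q) mmul.
Proof.
 intros x x' H y y' H'. rewrite (mmul_cong_l q x x') by auto. now apply mmul_cong_r.
Qed.

Lemma mmul_nil_r q x : meq q (mmul x mnil) mnil.
Proof.
 change (meq q (mmul (mskip (fun _ => 0) x) mnil) ((fun _ => mnil) (fun _ : nat => 0))).
 apply (meq_ind_down (fun i k => mulp (skipn k (x i)) []) (fun i k => [])
  (fun k => mmul (mskip k x) mnil) (fun k => mnil) q (fun i => length (x i))); try refl.
 - apply fam_pb.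
 - apply meq_eq. intros i _. cbn [fam mmul mskip]. rewrite !skipn_all2 by lia. refl.
 - intros k q' Hq Hk IH. rewrite mmul_skip, IH, mcons_bot_nil, madd_0. now apply meq_eq.
Qed.

Lemma mmul_cons_r q x b y :
 meq q (mmul x (mcons b y)) (madd fbot_ (mscal b x) (mcons fbot_ (mmul x y))).
Proof.
 change (meq q (mmul (mskip (fun _ => 0) x) (mcons b y))
  (madd fbot_ (mscal b (mskip (fun _ => 0) x)) (mcons fbot_ (mmul (mskip (fun _ => 0) x) y)))).
 apply (meq_ind_down (fun i k => mulp (skipn k (x i)) (b i :: y i))
  (fun i k => addp pbot (scal (b i) (skipn k (x i))) (pbot :: mulp (skipn k (x i)) (y i)))
  (fun k => mmul (mskip k x) (mcons b y))
  (fun k => madd fbot_ (mscal b (mskip k x)) (mcons fbot_ (mmul (mskip k x) y)))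
  q (fun i => length (x i))); try refl.
 - apply fam_pb.
 - transitivity mnil.
  + apply meq_eq. intros i _. cbn [fam mmul mskip]. rewrite !skipn_all2 by lia. refl.
  + symmetry. transitivity (madd fbot_ mnil (mcons fbot_ mnil)).
   * apply meq_eq. intros i _. cbn [fam mmul mskip madd mscal mcons].
    rewrite !skipn_all2 by lia. refl.
   * now rewrite mcons_bot_nil, madd_0.
 - intros k q' Hq Hk IH. rewrite mmul_skip, IH.
  rewrite (mmul_skip q' k x y), (mskip_unfold q' k x).
  set (a := fun i => nth_bit (x i) (k i)). set (x' := mskip (fun i => S (k i)) x).
  assert (S1 : meq q' (mscal a (mcons b y)) (mcons (fun i => pand (a i) (b i)) (mscal a y)))
   by now apply meq_eq.
  assert (S2 : meq q' (mscal b (mcons a x')) (mcons (fun i => pand (a i) (b i)) (mscal b x'))).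
  { transitivity (mcons (fun i => pand (b i) (a i)) (mscal b x')); [now apply meq_eq|].
   apply meq_cons; [|refl]. ptaut. }
  rewrite S1, S2, !madd_cons0. apply meq_cons; [refl|]. apply madd_AC.
Qed.

Lemma mmul_comm q x y : meq q (mmul x y) (mmul y x).
Proof.
 change (meq q (mmul (mskip (fun _ => 0) x) y) (mmul y (mskip (fun _ => 0) x))).
 apply (meq_ind_down (fun i k => mulp (skipn k (x i)) (y i)) (fun i k => mulp (y i) (skipn k (x i)))
  (fun k => mmul (mskip k x) y) (fun k => mmul y (mskip k x)) q (fun i => length (x i))); try refl.
 - apply fam_pb.
 - rewrite !mskip_over by auto. now rewrite mmul_nil, mmul_nil_r.
 - intros k q' Hq Hk IH. now rewrite (mskip_unfold q' k x), mmul_cons, mmul_cons_r, IH.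
Qed.

(** The identity of a full adder, read for multiples of [y]. A case distinction on [a], [b], [c]
    turns every multiple into 0 or [y], and then only the fact that [y + y] is a shift of [y] is
    used. *)
Lemma mscal_full_adder q a b c y :
 meq q (madd fbot_ (mscal (fun i => xor3 (a i) (b i) (c i)) y)
      (mcons fbot_ (mscal (fun i => maj (a i) (b i) (c i)) y)))
    (madd fbot_ (madd fbot_ (mscal a y) (mscal b y)) (mscal c y)).
Proof.
 assert (D : forall q, meq q (madd fbot_ y y) (mcons fbot_ y)).
 { intros q0. apply meq_intro. intros k q' Hq Hk. apply bit_bound in Hk as (m & Hm & Hk).
  assert (E : prv q' (fun i => piff (carry pbot (y i) (y i) (k i)) (nth_bit (pbot :: y i) (k i)))).
  { apply (prv_ind q' (fun i k => piff (carry pbot (y i) (y i) k) (nth_bit (pbot :: y i) k)) m); auto.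
   - ptaut_by (unfold nth_bit; cbn [carry nth]).
   - intros l q'' Hq' _ IH. ptaut_by (cbn [carry]; change (nth_bit (pbot :: y i) (S (l i))) with (nth_bit (y i) (l i))). }
  assert (E1 := add_bit q' fbot_ y y k). cbn [fam madd mcons].
  unfold fbot_ in *. ptaut (E, E1). }
 assert (T : forall q (t : nat -> pform), prv q t \/ prv q (fun i => pneg (t i)) ->
  meq q (mscal t y) mnil \/ meq q (mscal t y) y).
 { intros q' t [H|H]; [right; now apply mscal_top|left; now apply mscal_bot]. }
 unfold meq.
 apply prv_cases with a; apply prv_cases with b; apply prv_cases with c;
  match goal with |- prv ?q0 _ =>
   change (meq q0 (madd fbot_ (mscal (fun i => xor3 (a i) (b i) (c i)) y)
      (mcons fbot_ (mscal (fun i => maj (a i) (b i) (c i)) y)))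
    (madd fbot_ (madd fbot_ (mscal a y) (mscal b y)) (mscal c y)));
   set (q' := q0) end;
  match goal with q' := addc (addc (addc _ ?u) ?v) ?w |- _ =>
   assert (U : prv q' u) by (eapply prv_sub; [apply sub_addc|]; eapply prv_sub; [apply sub_addc|apply prv_hyp]);
   assert (V : prv q' v) by (eapply prv_sub; [apply sub_addc|apply prv_hyp]);
   assert (W : prv q' w) by apply prv_hyp
  end; clearbody q'; cbv beta in U, V, W;
  repeat match goal with |- context [mscal ?t y] =>
   first [ rewrite (mscal_bot q' t y) by (ptaut (U, V, W))
      | rewrite (mscal_top q' t y) by (ptaut (U, V, W)) ] end;
  rewrite ?mcons_bot_nil, ?madd_0, ?madd_0l; try refl; rewrite ?D; try refl.
 now rewrite madd_comm.
Qed.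

(** Distributivity has to be generalized to a sum with an incoming carry: in the induction on the
    tails, the carry into position [k] contributes one more multiple of [y], and the full adder
    identity accounts for it. *)
Lemma mmul_add_l q c x x' y :
 meq q (mmul (madd c x x') y)
  (madd fbot_ (madd fbot_ (mmul x y) (mmul x' y)) (mscal c y)).
Proof.
 assert (P1 : forall k, pb (fun i => length (addp (carry (c i) (x i) (x' i) (k i))
  (skipn (k i) (x i)) (skipn (k i) (x' i))))).
 { intros k. exact (fam_pb (madd (fun i => carry (c i) (x i) (x' i) (k i)) (mskip k x) (mskip k x'))). }
 set (cc := fun (k : nat -> nat) i => carry (c i) (x i) (x' i) (k i)).
 change (meq q (mmul (madd (cc (fun _ => 0)) (mskip (fun _ => 0) x) (mskip (fun _ => 0) x')) y)
  (madd fbot_ (madd fbot_ (mmul (mskip (fun _ => 0) x) y) (mmul (mskip (fun _ => 0) x') y))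
   (mscal (cc (fun _ => 0)) y))).
 apply (meq_ind_down
  (fun i k => mulp (addp (carry (c i) (x i) (x' i) k) (skipn k (x i)) (skipn k (x' i))) (y i))
  (fun i k => addp pbot (addp pbot (mulp (skipn k (x i)) (y i)) (mulp (skipn k (x' i)) (y i)))
    (scal (carry (c i) (x i) (x' i) k) (y i)))
  (fun k => mmul (madd (cc k) (mskip k x) (mskip k x')) y)
  (fun k => madd fbot_ (madd fbot_ (mmul (mskip k x) y) (mmul (mskip k x') y)) (mscal (cc k) y))
  q (fun i => Nat.max (length (x i)) (length (x' i)))); try refl.
 - apply pb_max; apply fam_pb.
 - set (k := fun i => Nat.max (length (x i)) (length (x' i))).
  rewrite (mskip_over q k x), (mskip_over q k x') by (intros; unfold k; lia).
  rewrite mmul_nil, madd_0, madd_0l, madd_unfold, mmul_cons.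
  transitivity (madd fbot_ (mscal (cc k) y) mnil); [|apply madd_0].
  apply madd_proper; [refl| |].
  + apply mscal_proper; [|refl]. unfold peq.
   ptaut_by (cbn [fam mnil]; unfold nth_bit; cbn [nth]).
  + transitivity (mcons fbot_ mnil); [|apply mcons_bot_nil].
   apply meq_cons; [refl|].
   transitivity (mmul mnil y); [|apply mmul_nil]. apply mmul_proper; [|refl].
   transitivity (madd fbot_ mnil mnil); [|apply madd_0].
   apply madd_proper; [|now apply meq_eq|now apply meq_eq]. unfold peq.
   ptaut_by (cbn [fam mnil]; unfold nth_bit, fbot_; cbn [nth]).
 - intros k q' Hq Hk IH.
  set (a := fun i => nth_bit (x i) (k i)). set (b := fun i => nth_bit (x' i) (k i)).
  set (k' := fun i => S (k i)) in *.
  assert (U : meq q' (madd (cc k) (mskip k x) (mskip k x'))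
   (mcons (fun i => xor3 (a i) (b i) (cc k i)) (madd (cc k') (mskip k' x) (mskip k' x')))).
  { rewrite madd_unfold. apply meq_eq. intros i _. cbn [fam mcons madd mtl mskip].
   rewrite !tl_skipn, !nth_bit_skipn, !Nat.add_0_r. refl. }
  rewrite U, mmul_cons, IH, !(mmul_skip q' k). fold a b k'.
  set (A := mmul (mskip k' x) y). set (B := mmul (mskip k' x') y).
  assert (D : forall u v, meq q' (mcons fbot_ (madd fbot_ u v)) (madd fbot_ (mcons fbot_ u) (mcons fbot_ v))).
  { intros u v. now rewrite madd_cons0. }
  rewrite !D.
  assert (FA := mscal_full_adder q' a b (cc k) y).
  change (fun i => maj (a i) (b i) (cc k i)) with (cc k') in FA.
  rewrite (madd_comm q' _ (madd fbot_ (mcons fbot_ A) (mcons fbot_ B))).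
  rewrite <- madd_assoc0, FA. rewrite !madd_assoc0.
  apply madd_proper; [refl|refl|].
  rewrite (madd_AC q' (mscal (cc k) y)), (madd_AC q' (mscal b y) (mcons fbot_ A)).
  apply madd_proper; [refl|refl|].
  apply madd_proper; [refl|refl|]. apply madd_comm.
Qed.
End Numbers.

(** ** Order *)

Fixpoint lessn (x y : bits) (k : nat) : pform :=
 match k with
 | 0 => pbot
 | S k => let a := nth_bit x k in let b := nth_bit y k in
      por (pand (pneg a) b) (pand (piff a b) (lessn x y k))
 end.

Definition lessp (x y : bits) : pform := lessn x y (Nat.max (length x) (length y)).

Definition bitsN (n : N) : bits := map (fun k => pconst (N.testbit n #k)) (seq 0 (N.size_nat n)).

Section Order.
Context {SC : Scale}.

Definition lt_ (q : cond) (x y : elt) : Prop := prv q (fun i => lessp (x i) (y i)).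
Definition le_ (q : cond) (x y : elt) : Prop := prv q (fun i => pneg (lessp (y i) (x i))).

Lemma lessn_over x y k : Nat.max (length x) (length y) <= k ->
 nth_bit x k = pbot /\ nth_bit y k = pbot.
Proof. intros H. split; apply nth_bit_over; lia. Qed.

(** Running a comparator beyond the lengths changes nothing. All comparators in a proof can thus be
    run to one common length, which permits a simultaneous invariant. *)
Lemma lessp_at q (x y : elt) m : pb m ->
 (forall i, live q i -> Nat.max (length (x i)) (length (y i)) <= m i) ->
 peq q (fun i => lessp (x i) (y i)) (fun i => lessn (x i) (y i) (m i)).
Proof.
 intros Hm Hk.
 assert (E : prv q (fun i => piff (lessp (x i) (y i)) (lessn (x i) (y i)
  (m i - Nat.max (length (x i)) (length (y i)) + Nat.max (length (x i)) (length (y i)))))).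
 { apply (prv_ind q (fun i k => piff (lessp (x i) (y i)) (lessn (x i) (y i) (k + Nat.max (length (x i)) (length (y i))))) m); auto.
  - ptaut_by (cbn [Nat.add]; unfold lessp).
  - intros k q' Hq _ IH. puse IH.
   ptaut_by (cbn [Nat.add lessn]; destruct (lessn_over (x i) (y i) (k i + Nat.max (length (x i)) (length (y i)))) as [-> ->]; [lia|]).
  - intros i Hi. lia. }
 eapply prv_eq; [|exact E]. intros i Hi. cbv beta. do 3 f_equal. all: try (specialize (Hk i Hi); lia).
Qed.

(* Comparisons are carried out bit by bit: to prove a statement about several of
  them, one proves an invariant of the states of the comparators (and adders). *)
Lemma less_ind q (P : nat -> nat -> pform) m : pb m ->
 prv q (fun i => P i 0) ->
 (forall k q', sub q q' -> prv q' (fun i => P i (k i)) -> prv q' (fun i => P i (S (k i)))) ->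
 prv q (fun i => P i (m i)).
Proof. intros Hm H0 HS. apply (prv_ind q P m); auto. Qed.

Definition bd3 (x y z : elt) (i : nat) : nat :=
 S (S (S (length (x i) + length (y i) + length (z i)))).

Lemma bd3_pb x y z : pb (bd3 x y z).
Proof. repeat first [apply pb_S|apply pb_add|apply fam_pb]. Qed.

Lemma lessn_cong q (x x' y y' : elt) m : pb m -> meq q x x' -> meq q y y' ->
 peq q (fun i => lessn (x i) (y i) (m i)) (fun i => lessn (x' i) (y' i) (m i)).
Proof.
 intros Hm H1 H2.
 apply (less_ind q (fun i k => piff (lessn (x i) (y i) k) (lessn (x' i) (y' i) k))); auto.
 - ptaut_by (cbn [lessn]).
 - intros l q' Hq IH. apply (meq_sub Hq), (fun H => meq_bit _ _ _ H l) in H1, H2.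
  puses (IH, H1, H2). ptaut_by (cbn [lessn]).
Qed.

Lemma lessp_cong q (x x' y y' : elt) : meq q x x' -> meq q y y' ->
 peq q (fun i => lessp (x i) (y i)) (fun i => lessp (x' i) (y' i)).
Proof.
 intros H1 H2. set (m := fun i => length (x i) + length (y i) + (length (x' i) + length (y' i))).
 assert (Hm : pb m) by (repeat first [apply pb_add|apply fam_pb]).
 rewrite (lessp_at q x y m), (lessp_at q x' y' m); auto; try (intros; unfold m; lia).
 now apply lessn_cong.
Qed.

#[global] Instance lt_proper q : Proper (meq q ==> meq q ==> iff) (lt_ q).
Proof.
 assert (G : forall x x' y y', meq q x x' -> meq q y y' -> lt_ q x y -> lt_ q x' y').
 { intros x x' y y' H1 H2 H. assert (E := lessp_cong q x x' y y' H1 H2). unfold lt_ in *. ptaut (E, H). }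
 intros x x' H1 y y' H2. split; intros H; [now apply (G x x' y y')|].
 apply (G x' x y' y); auto; now symmetry.
Qed.

#[global] Instance le_proper q : Proper (meq q ==> meq q ==> iff) (le_ q).
Proof.
 assert (G : forall x x' y y', meq q x x' -> meq q y y' -> le_ q x y -> le_ q x' y').
 { intros x x' y y' H1 H2 H. assert (E := lessp_cong q y y' x x' H2 H1). unfold le_ in *. ptaut (E, H). }
 intros x x' H1 y y' H2. split; intros H; [now apply (G x x' y y')|].
 apply (G x' x y' y); auto; now symmetry.
Qed.

Lemma less_irrefl q (x : elt) : prv q (fun i => pneg (lessp (x i) (x i))).
Proof.
 assert (E := lessp_at q x x (bd3 x x x) (bd3_pb x x x)).
 puse (E ltac:(intros; unfold bd3; lia)).
 assert (F : prv q (fun i => pneg (lessn (x i) (x i) (bd3 x x x i)))).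
 { apply (less_ind q (fun i k => pneg (lessn (x i) (x i) k))); [apply bd3_pb| |].
  - ptaut_by (cbn [lessn]).
  - intros l q' Hq IH. puse IH. ptaut_by (cbn [lessn]). }
 ptaut F.
Qed.

Lemma less_asym q (x y : elt) : prv q (fun i => pneg (pand (lessp (x i) (y i)) (lessp (y i) (x i)))).
Proof.
 assert (E1 := lessp_at q x y _ (bd3_pb x y x) ltac:(intros; unfold bd3; lia)).
 assert (E2 := lessp_at q y x _ (bd3_pb x y x) ltac:(intros; unfold bd3; lia)).
 assert (F : prv q (fun i => pneg (pand (lessn (x i) (y i) (bd3 x y x i)) (lessn (y i) (x i) (bd3 x y x i))))).
 { apply (less_ind q (fun i k => pneg (pand (lessn (x i) (y i) k) (lessn (y i) (x i) k)))); [apply bd3_pb| |].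
  - ptaut_by (cbn [lessn]).
  - intros l q' Hq IH. puse IH. ptaut_by (cbn [lessn]). }
 ptaut (E1, E2, F).
Qed.

Lemma less_cotrans q (x y z : elt) :
 prv q (fun i => pimp (lessp (x i) (z i)) (por (lessp (x i) (y i)) (lessp (y i) (z i)))).
Proof.
 assert (E1 := lessp_at q x z _ (bd3_pb x y z) ltac:(intros; unfold bd3; lia)).
 assert (E2 := lessp_at q x y _ (bd3_pb x y z) ltac:(intros; unfold bd3; lia)).
 assert (E3 := lessp_at q y z _ (bd3_pb x y z) ltac:(intros; unfold bd3; lia)).
 assert (F : prv q (fun i => pimp (lessn (x i) (z i) (bd3 x y z i)) (por (lessn (x i) (y i) (bd3 x y z i)) (lessn (y i) (z i) (bd3 x y z i))))).
 { apply (less_ind q (fun i k => pimp (lessn (x i) (z i) k) (por (lessn (x i) (y i) k) (lessn (y i) (z i) k)))); [apply bd3_pb| |].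
  - ptaut_by (cbn [lessn]).
  - intros l q' Hq IH. puse IH. ptaut_by (cbn [lessn]). }
 ptaut (E1, E2, E3, F).
Qed.

Lemma le_trans q (x y z : elt) : le_ q x y -> le_ q y z -> le_ q x z.
Proof. intros H1 H2. assert (E := less_cotrans q z y x). unfold le_ in *. ptaut (H1, H2, E). Qed.

Lemma le_refl q (x : elt) : le_ q x x.
Proof. apply less_irrefl. Qed.

Lemma lt_le q (x y : elt) : lt_ q x y -> le_ q x y.
Proof. intros H. assert (E := less_asym q x y). unfold le_, lt_ in *. ptaut (H, E). Qed.

(** Downward from the top: if neither full comparison succeeds, then the top bits agree and neither
    comparison of the lower bits succeeds. *)
Lemma le_antisym q (x y : elt) : le_ q x y -> le_ q y x -> meq q x y.
Proof.
 intros H1 H2. apply meq_intro. intros k q' Hq Hk.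
 apply (prv_sub Hq) in H1, H2.
 assert (E1 := lessp_at q' x y _ (bd3_pb x y x) ltac:(intros; unfold bd3; lia)).
 assert (E2 := lessp_at q' y x _ (bd3_pb x y x) ltac:(intros; unfold bd3; lia)).
 assert (F : prv q' (fun i => pand (pneg (lessn (x i) (y i) (S (k i)))) (pneg (lessn (y i) (x i) (S (k i)))))).
 { apply (prv_ind_down q' (fun i k => pand (pneg (lessn (x i) (y i) k)) (pneg (lessn (y i) (x i) k))) (bd3 x y x)).
  - apply bd3_pb.
  - ptaut (E1, E2, H1, H2).
  - intros l q'' Hq' _ IH. puse IH. ptaut_by (cbn [lessn]).
  - intros i Hi. specialize (Hk i Hi). unfold bd3. lia. }
 puse F. ptaut_by (cbn [lessn]).
Qed.

Lemma less_zero q (x : elt) : le_ q mnil x.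
Proof.
 unfold le_. assert (E := lessp_at q x mnil _ (bd3_pb x x x) ltac:(intros; unfold bd3; simpl; lia)).
 assert (F : prv q (fun i => pneg (lessn (x i) [] (bd3 x x x i)))).
 { apply (less_ind q (fun i k => pneg (lessn (x i) [] k))); [apply bd3_pb| |].
  - ptaut_by (cbn [lessn]).
  - intros l q' Hq IH. puse IH. ptaut_by (cbn [lessn]; rewrite (nth_bit_over []) by (simpl; lia)). }
 cbn [fam mnil] in *. ptaut (E, F).
Qed.

Definition msucc (x : elt) : elt := madd ftop_ x mnil.

#[global] Instance msucc_proper q : Proper (meq q ==> meq q) msucc.
Proof. intros x y H. unfold msucc. now apply madd_proper. Qed.

(* While the carry of [x + 1] is 1, the low bits of [x] are all 1. *)
Lemma less_succ q (x y : elt) :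
 prv q (fun i => piff (lessp (y i) (msucc x i)) (pneg (lessp (x i) (y i)))).
Proof.
 set (m := bd3 x y x).
 assert (E1 := lessp_at q y (msucc x) _ (bd3_pb x y x) ltac:(intros; unfold bd3; cbn [fam msucc madd mnil]; rewrite addp_length; simpl; lia)).
 assert (E2 := lessp_at q x y _ (bd3_pb x y x) ltac:(intros; unfold bd3; lia)).
 assert (F : prv q (fun i => pand (pimp (carry ptop (x i) [] (m i))
         (pand (pneg (lessn (y i) (msucc x i) (m i))) (pneg (lessn (x i) (y i) (m i)))))
   (pimp (pneg (carry ptop (x i) [] (m i))) (piff (lessn (y i) (msucc x i) (m i)) (pneg (lessn (x i) (y i) (m i))))))).
 { apply (less_ind q (fun i k => pand (pimp (carry ptop (x i) [] k)
         (pand (pneg (lessn (y i) (msucc x i) k)) (pneg (lessn (x i) (y i) k))))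
   (pimp (pneg (carry ptop (x i) [] k)) (piff (lessn (y i) (msucc x i) k) (pneg (lessn (x i) (y i) k)))))); [apply bd3_pb| |].
  - ptaut_by (cbn [lessn carry]).
  - intros l q' Hq IH. assert (A := add_bit q' ftop_ x mnil l). cbn [fam msucc madd mnil ftop_] in *.
   unfold ftop_ in *. puses (IH, A). ptaut_by (cbn [lessn carry]; rewrite (nth_bit_over []) by (simpl; lia)). }
 assert (C : prv q (fun i => pneg (carry ptop (x i) [] (m i)))).
 { unfold m, bd3. ptaut_by (cbn [carry]; rewrite !nth_bit_over by (simpl; lia)). }
 fold m in E1, E2. ptaut (E1, E2, F, C).
Qed.

Lemma lt_succ_le q (x y : elt) : le_ q (msucc x) y <-> lt_ q x y.
Proof.
 assert (E := less_succ q x y). unfold le_, lt_. split; intros H; ptaut (E, H).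
Qed.

(* The invariant compares the carries of [x + y] and [x + z]. *)
Lemma less_add q (x y z : elt) :
 peq q (fun i => lessp (madd fbot_ x y i) (madd fbot_ x z i)) (fun i => lessp (y i) (z i)).
Proof.
 set (m := bd3 x y z).
 assert (E1 := lessp_at q (madd fbot_ x y) (madd fbot_ x z) _ (bd3_pb x y z) ltac:(intros; unfold bd3; cbn [fam madd]; rewrite !addp_length; simpl; lia)).
 assert (E2 := lessp_at q y z _ (bd3_pb x y z) ltac:(intros; unfold bd3; lia)).
 fold m in E1, E2.
 set (P := fun i k => let d := carry pbot (x i) (y i) k in let d' := carry pbot (x i) (z i) k in
   let c1 := lessn (y i) (z i) k in let c2 := lessn (madd fbot_ x y i) (madd fbot_ x z i) k in
   por (pand (piff d d') (piff c1 c2)) (por (pand (pand d (pneg d')) (pand (pneg c1) c2))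
    (pand (pand (pneg d) d') (pand c1 (pneg c2))))).
 assert (F : prv q (fun i => P i (m i))).
 { apply less_ind; [apply bd3_pb| |].
  - unfold P. ptaut_by (cbn [lessn carry]).
  - intros l q' Hq IH. assert (A := add_bit q' fbot_ x y l). assert (B := add_bit q' fbot_ x z l).
   cbn [fam madd] in *. unfold P, fbot_ in *. puses (IH, A, B).
   ptaut_by (cbn [lessn carry fam madd]). }
 assert (C : forall y, (forall i, length (y i) < m i) -> prv q (fun i => pneg (carry pbot (x i) (y i) (m i)))).
 { intros y' Hy. unfold m, bd3 in *.
  ptaut_by (cbn [carry]; rewrite !nth_bit_over by (simpl; specialize (Hy i); lia)). }
 assert (C1 := C y ltac:(intros; unfold m, bd3; lia)). assert (C2 := C z ltac:(intros; unfold m, bd3; lia)).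
 unfold P in F. cbv beta zeta in F. ptaut (E1, E2, F, C1, C2).
Qed.

Lemma less_cons q a b (x y : elt) :
 peq q (fun i => lessp (mcons a x i) (mcons b y i))
  (fun i => por (lessp (x i) (y i)) (pand (pneg (lessp (y i) (x i))) (pand (pneg (a i)) (b i)))).
Proof.
 set (m := bd3 x y x).
 assert (E1 := lessp_at q (mcons a x) (mcons b y) (fun i => S (m i)) ltac:(apply pb_S, bd3_pb) ltac:(intros; unfold m, bd3; cbn [fam mcons length]; lia)).
 assert (E2 := lessp_at q x y _ (bd3_pb x y x) ltac:(intros; unfold bd3; lia)).
 assert (E3 := lessp_at q y x _ (bd3_pb x y x) ltac:(intros; unfold bd3; lia)).
 assert (F : prv q (fun i => piff (lessn (mcons a x i) (mcons b y i) (S (m i)))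
  (por (lessn (x i) (y i) (m i)) (pand (pneg (lessn (y i) (x i) (m i))) (pand (pneg (a i)) (b i)))))).
 {assert (F : prv q (fun i => pand (pneg (pand (lessn (x i) (y i) (m i)) (lessn (y i) (x i) (m i)))) (piff (lessn (mcons a x i) (mcons b y i) (S (m i)))
   (por (lessn (x i) (y i) (m i)) (pand (pneg (lessn (y i) (x i) (m i))) (pand (pneg (a i)) (b i))))))).
  { apply (less_ind q (fun i k => pand (pneg (pand (lessn (x i) (y i) k) (lessn (y i) (x i) k))) (piff (lessn (mcons a x i) (mcons b y i) (S k))
   (por (lessn (x i) (y i) k) (pand (pneg (lessn (y i) (x i) k)) (pand (pneg (a i)) (b i))))))); [apply bd3_pb| |].
   - ptaut_by (cbn [lessn fam mcons]; nth_cons).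
   - intros l q' Hq IH. puse IH. ptaut_by (cbn [lessn fam mcons]; nth_cons). }
  ptaut F. }
 fold m in E1, E2, E3. ptaut (E1, E2, E3, F).
Qed.

(* [y - z]: the borrow is the comparison of the low bits. *)
Definition subp (y z : bits) : bits :=
 map (fun k => xor3 (nth_bit y k) (nth_bit z k) (lessn y z k)) (seq 0 (Nat.max (length y) (length z))).

Lemma msub_pb (y z : elt) : pb (fun i => length (subp (y i) (z i))).
Proof.
 eapply pb_le; [|apply pb_max; [apply (fam_pb y)|apply (fam_pb z)]].
 intros i. unfold subp. now rewrite length_map_seq.
Qed.

Definition msub (y z : elt) : elt := Elt (fun i => subp (y i) (z i)) (msub_pb y z).

(** The carry of [z + (y - z)] agrees with the borrow at every position. Beyond both lengths the
    borrow vanishes because [z <= y], so no bit is lost by cutting off the difference there. *)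
Lemma le_sub q (y z : elt) : le_ q z y -> meq q (madd fbot_ z (msub y z)) y.
Proof.
 intros H. apply meq_intro. intros k q' Hq Hk. apply (prv_sub Hq) in H.
 apply bit_bound in Hk as (m0 & Hm0 & Hk).
 set (m := fun i => m0 i + bd3 y z y i).
 assert (Hm : pb m) by (apply pb_add; auto using bd3_pb).
 assert (SB : forall q k, peq q (fun i => nth_bit (msub y z i) (k i))
   (fun i => if k i <? Nat.max (length (y i)) (length (z i)) then
    xor3 (nth_bit (y i) (k i)) (nth_bit (z i) (k i)) (lessn (y i) (z i) (k i)) else pbot)).
 { intros q0 l. unfold peq. apply prv_split with (fun i => l i < Nat.max (length (y i)) (length (z i))).
  - ptaut_on (cbn [fam msub]; unfold subp; rewrite nth_bit_map by auto; destruct (Nat.ltb_spec (l i) (Nat.max (length (y i)) (length (z i)))); [|lia]).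
  - ptaut_on (cbn [fam msub]; unfold subp; rewrite nth_bit_over by (rewrite length_map_seq; lia); destruct (Nat.ltb_spec (l i) (Nat.max (length (y i)) (length (z i)))); [lia|]). }
 assert (L : forall q1 l, sub q' q1 -> (forall i, live q1 i -> l i <= m i) -> (forall i, live q1 i -> Nat.max (length (y i)) (length (z i)) <= l i) ->
  prv q1 (fun i => pneg (lessn (y i) (z i) (l i)))).
 { intros q1 l Hq1 Hl Hl'. apply (prv_sub Hq1) in H. unfold le_ in H.
  assert (E := lessp_at q1 y z (fun i => Nat.min (l i) (m i)) ltac:(eapply pb_le; [|exact Hm]; intros; cbv beta; lia)
   ltac:(intros i Hi; cbv beta; specialize (Hl i Hi); specialize (Hl' i Hi); lia)).
  assert (E' : prv q1 (fun i => piff (lessp (y i) (z i)) (lessn (y i) (z i) (l i)))).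
  { eapply prv_eq; [|exact E]. intros i Hi. cbv beta. rewrite Nat.min_l by auto. refl. }
  ptaut (H, E'). }
 assert (F : prv q' (fun i => piff (carry pbot (z i) (msub y z i) (k i)) (lessn (y i) (z i) (k i)))).
 { apply (prv_ind q' (fun i k => piff (carry pbot (z i) (msub y z i) k) (lessn (y i) (z i) k)) m); auto.
  - ptaut_by (cbn [lessn carry]).
  - intros l q1 Hq1 Hl IH. apply prv_split with (fun i => l i < Nat.max (length (y i)) (length (z i))).
   + extend q2 S2.
    apply (prv_sub S2) in IH. assert (A := SB q2 l). puses (IH, A).
    ptaut_on (cbn [lessn carry]; destruct (Nat.ltb_spec (l i) (Nat.max (length (y i)) (length (z i)))); [|lia]).
   + extend q2 S2.
    apply (prv_sub S2) in IH. assert (A := SB q2 l).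
    assert (B : prv q2 (fun i => pneg (lessn (y i) (z i) (l i)))).
    { apply L; [eapply sub_trans; eauto| |]; intros i Hi.
     - specialize (Hl i (live_sub S2 Hi)). lia.
     - apply live_restrict in Hi. lia. }
    puses (IH, A, B).
    ptaut_on (cbn [lessn carry]; rewrite (nth_bit_over (z i)), (nth_bit_over (y i)) by lia; destruct (Nat.ltb_spec (l i) (Nat.max (length (y i)) (length (z i)))); [lia|]).
  - intros i Hi. specialize (Hk i Hi). unfold m. lia. }
 assert (A := SB q' k). assert (B := add_bit q' fbot_ z (msub y z) k). cbn [fam madd] in *. unfold fbot_ in *.
 apply prv_split with (fun i => k i < Nat.max (length (y i)) (length (z i))).
 - extend q2 S2.
  apply (prv_sub S2) in A, B, F. puses (A, B, F).
  ptaut_on (cbn [fam msub]; destruct (Nat.ltb_spec (k i) (Nat.max (length (y i)) (length (z i)))); [|lia]).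
 - extend q2 S2.
  apply (prv_sub S2) in A, B, F.
  assert (C : prv q2 (fun i => pneg (lessn (y i) (z i) (k i)))).
  { apply L; auto; intros i Hi.
   - specialize (Hk i (live_sub S2 Hi)). unfold m. lia.
   - apply live_restrict in Hi. lia. }
  puses (A, B, C, F).
  ptaut_on (rewrite (nth_bit_over (z i)), (nth_bit_over (y i)) by lia; destruct (Nat.ltb_spec (k i) (Nat.max (length (y i)) (length (z i)))); [lia|]).
Qed.

Lemma le_add q (x y z : elt) : le_ q (madd fbot_ x y) (madd fbot_ x z) <-> le_ q y z.
Proof.
 assert (E := less_add q x z y). unfold le_ in *. split; intros H; ptaut (E, H).
Qed.

Lemma le_add_r q (x y : elt) : le_ q x (madd fbot_ x y).
Proof. rewrite <- (madd_0 q x) at 1. apply le_add, less_zero. Qed.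

Lemma le_bit_over q (x y : elt) k : le_ q x y -> (forall i, live q i -> length (y i) <= k i) ->
 prv q (fun i => pneg (nth_bit (x i) (k i))).
Proof.
 intros H Hk. unfold le_ in H.
 apply prv_split with (fun i => k i < length (x i)).
 - extend q' S1.
  apply (prv_sub S1) in H.
  assert (G : forall i, live q' i -> length (y i) <= k i < length (x i)).
  { intros i Hi. split; [apply Hk; eapply live_sub; eauto|]. now apply live_restrict in Hi. }
  clearbody q'. set (m := bd3 x y x).
  assert (E := lessp_at q' y x _ (bd3_pb x y x) ltac:(intros; unfold bd3; lia)). fold m in E.
  apply prv_raa. extend q2 S2.
  assert (A : prv q2 (fun i => nth_bit (x i) (k i))).
  { assert (A : prv q2 (fun i => pneg (pneg (nth_bit (x i) (k i))))) by apply prv_hyp. ptaut A. }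
  apply (prv_sub S2) in E, H.
  assert (G2 : forall i, live q2 i -> length (y i) <= k i < length (x i)).
  { intros i Hi. apply G. eapply live_sub; eauto. }
  clearbody q2.
  assert (F : prv q2 (fun i => lessn (y i) (x i) (S (k i) + (m i - S (k i))))).
  { apply (prv_ind q2 (fun i j => lessn (y i) (x i) (S (k i) + j)) m); [apply bd3_pb| | |].
   - puse A. ptaut_by (rewrite Nat.add_0_r; cbn [lessn]; destruct (G2 i Hi); rewrite (nth_bit_over (y i)) by auto).
   - intros l q3 Hq3 _ IH. puse IH.
    ptaut_by (destruct (G2 i (live_sub Hq3 Hi)); rewrite Nat.add_succ_r; cbn [lessn]; rewrite (nth_bit_over (y i)) by lia).
   - intros i Hi. lia. }
  assert (F' : prv q2 (fun i => lessn (y i) (x i) (m i))).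
  { eapply prv_eq; [|exact F]. intros i Hi. destruct (G2 i Hi). cbv beta. f_equal. unfold m, bd3. lia. }
  ptaut (E, H, F').
 - ptaut_on (rewrite nth_bit_over by lia).
Qed.
End Order.

(** ** Constants *)

Lemma size_size_nat n : N.size n = #(N.size_nat n).
Proof.
 destruct n as [|p]; auto. simpl. induction p as [p IH|p IH|]; simpl; auto; f_equal; lia.
Qed.

Lemma size_nat_le n k : N.size_nat n <= k <-> (n < 2 ^ #k)%N.
Proof.
 destruct (N.eq_dec n 0) as [->|Hn].
 - simpl. split; intros; [|lia]. assert (H' := N.pow_nonzero 2 #k). lia.
 - assert (E := N.size_log2 n Hn). rewrite size_size_nat in E.
  rewrite N.log2_lt_pow2 by lia. lia.
Qed.

Lemma size_nat_gt n : (n < 2 ^ #(N.size_nat n))%N.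
Proof. now apply size_nat_le. Qed.

Lemma testbit_over n k : N.size_nat n <= k -> N.testbit n #k = false.
Proof.
 intros H. apply size_nat_le in H. destruct (N.eq_dec n 0) as [->|Hn]; [apply N.bits_0|].
 apply N.bits_above_log2. apply N.log2_lt_pow2; lia.
Qed.

Lemma size_nat_mono a b : (a <= b)%N -> N.size_nat a <= N.size_nat b.
Proof. intros H. apply size_nat_le. generalize (size_nat_gt b). lia. Qed.

Lemma size_nat_add a b : N.size_nat (a + b) <= S (Nat.max (N.size_nat a) (N.size_nat b)).
Proof.
 apply size_nat_le. rewrite Nat2N.inj_succ, N.pow_succ_r'.
 set (m := Nat.max _ _).
 assert (Ha : (a < 2 ^ #m)%N) by (apply size_nat_le; lia).
 assert (Hb : (b < 2 ^ #m)%N) by (apply size_nat_le; lia). lia.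
Qed.

Lemma size_nat_mul a b : N.size_nat (a * b) <= N.size_nat a + N.size_nat b.
Proof.
 apply size_nat_le. rewrite Nat2N.inj_add, N.pow_add_r.
 generalize (size_nat_gt a) (size_nat_gt b). nia.
Qed.

Lemma size_nat_pow2 k : N.size_nat (2 ^ #k) = S k.
Proof.
 apply Nat.le_antisymm.
 - apply size_nat_le. apply N.pow_lt_mono_r; lia.
 - destruct (Nat.le_gt_cases (S k) (N.size_nat (2 ^ #k))) as [H|H]; auto.
  assert (H' : N.size_nat (2 ^ #k) <= k) by lia.
  apply size_nat_le in H'. lia.
Qed.

Lemma size_nat_double n b : N.size_nat (2 * n + N.b2n b) <= S (N.size_nat n).
Proof.
 apply size_nat_le. rewrite Nat2N.inj_succ, N.pow_succ_r'.
 generalize (size_nat_gt n). destruct b; simpl N.b2n; lia.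
Qed.

Lemma size_nat_of_nat n : N.size_nat #n <= n.
Proof. apply size_nat_le. apply N.pow_gt_lin_r. lia. Qed.

Lemma testbit_double n b k :
 N.testbit (2 * n + N.b2n b) #k = match k with 0 => b | S k => N.testbit n #k end.
Proof.
 destruct k as [|k].
 - apply N.testbit_0_r.
 - rewrite Nat2N.inj_succ. apply N.testbit_succ_r.
Qed.

Lemma bitsN_bit n k : nth_bit (bitsN n) k = pconst (N.testbit n #k).
Proof.
 destruct (Nat.lt_ge_cases k (N.size_nat n)) as [H|H].
 - unfold bitsN. now rewrite nth_bit_map.
 - rewrite nth_bit_over by (unfold bitsN; now rewrite length_map_seq).
  now rewrite testbit_over.
Qed.

Lemma bitsN_length n : length (bitsN n) = N.size_nat n.
Proof. unfold bitsN. now rewrite length_map_seq. Qed.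

Section Constants.
Context {SC : Scale}.

Definition pbN (n : nat -> N) : Prop := pb (fun i => N.size_nat (n i)).

Lemma cst_pb (n : nat -> N) : pbN n -> pb (fun i => length (bitsN (n i))).
Proof. apply pb_le. intros i. now rewrite bitsN_length. Qed.

Definition cst n (H : pbN n) : elt := Elt (fun i => bitsN (n i)) (cst_pb n H).

(** The bits of [x] are provably the digits of an actual number at each index. All operations
    preserve this property, which reduces derivations about constants to computation. *)
Definition isc (q : cond) (x : elt) (n : nat -> N) : Prop :=
 exists H : pbN n, meq q x (cst n H).

Lemma isc_cst q n H : isc q (cst n H) n.
Proof. exists H. refl. Qed.

Lemma isc_sub {q q' x n} : sub q q' -> isc q x n -> isc q' x n.
Proof. intros Hq (H & E). exists H. eapply meq_sub; eauto. Qed.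

Lemma isc_bit q x n k : isc q x n ->
 peq q (fun i => nth_bit (x i) (k i)) (fun i => pconst (N.testbit (n i) #(k i))).
Proof.
 intros (H & E). apply meq_bit with (k := k) in E. puse E.
 ptaut_fin_by (cbn [fam cst]; rewrite bitsN_bit; destruct (N.testbit (n i) #(k i))).
Qed.

Lemma isc_intro q (x : elt) n : pbN n ->
 (forall k m q', sub q q' -> pb m -> (forall i, live q' i -> k i <= m i) ->
  peq q' (fun i => nth_bit (x i) (k i)) (fun i => pconst (N.testbit (n i) #(k i)))) ->
 isc q x n.
Proof.
 intros H Hk. exists H. apply meq_intro. intros k q' Hq Hb.
 apply bit_bound in Hb as (m & Hm & Hb). specialize (Hk k m q' Hq Hm Hb).
 eapply prv_eq; [|exact Hk]. intros i _. cbn [fam cst]. now rewrite bitsN_bit.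
Qed.

Lemma isc_meq q x y n : meq q x y -> isc q y n -> isc q x n.
Proof. intros E (H & E'). exists H. now rewrite E. Qed.

#[global] Instance isc_proper q : Proper (meq q ==> eq ==> iff) (isc q).
Proof.
 intros x y H n m <-. split; apply isc_meq; auto. now symmetry.
Qed.

Lemma isc_unique q x y n : isc q x n -> isc q y n -> meq q x y.
Proof. intros (H & E) (H' & E'). rewrite E, E'. now apply meq_eq. Qed.

Lemma isc_ext q x n m : (forall i, live q i -> n i = m i) -> pbN m -> isc q x n -> isc q x m.
Proof.
 intros E Hm (H & E'). exists Hm. rewrite E'. apply meq_eq. intros i Hi.
 cbn [fam cst]. now rewrite E.
Qed.

Lemma isc_agree {q x y n m} : isc q x n -> isc q y m -> (forall i, live q i -> m i = n i) -> meq q x y.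
Proof. intros H1 H2 H. eapply isc_unique; [exact H1|]. now apply isc_ext with m; [|destruct H1|]. Qed.

Lemma isc_pb {q x n} : isc q x n -> pbN n.
Proof. now intros (H & _). Qed.

Lemma isc_add q c x y n m : isc q x n -> isc q y m ->
 isc q (madd (fun i => pconst (c i)) x y) (fun i => n i + m i + N.b2n (c i))%N.
Proof.
 intros H1 H2.
 (* The number [d i] collects the carries of the actual addition; each bit of it is the value of the
    corresponding [carry] formula. *)
 assert (HC : forall i, exists d, (n i + m i + N.b2n (c i))%N = N.lxor (N.lxor (n i) (m i)) d /\
  (N.div2 d = N.lor (N.land (n i) (m i)) (N.land d (N.lor (n i) (m i))))%N /\ N.testbit d 0 = c i).
 { intros i. destruct (N.add_carry_bits (n i) (m i) (c i)) as (d & D1 & D2 & D3).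
  exists d. rewrite N.div2_div. auto. }
 apply (fun H => choice (fun i d => _) H) in HC as (d & HC).
 apply isc_intro.
 - eapply pb_le; [|apply pb_S, pb_S, pb_max; [exact (isc_pb H1)|exact (isc_pb H2)]].
  intros i. rewrite size_nat_add.
  assert (N.size_nat (N.b2n (c i)) <= 1) by (destruct (c i); simpl; lia).
  generalize (size_nat_add (n i) (m i)). lia.
 - intros k b q' Hq Hb Hk. apply (isc_sub Hq) in H1, H2.
  assert (F : peq q' (fun i => carry (pconst (c i)) (x i) (y i) (k i))
   (fun i => pconst (N.testbit (d i) #(k i)))).
  { apply (prv_ind q' (fun i k => piff (carry (pconst (c i)) (x i) (y i) k)
    (pconst (N.testbit (d i) #k))) b); auto.
   - ptaut_fin_by (cbn [carry]; destruct (HC i) as (_ & _ & E); cbn [N.of_nat]; rewrite E; destruct (c i)).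
   - intros l q2 Hq2 _ IH. apply (isc_sub Hq2) in H1, H2.
    apply (isc_bit _ _ _ l) in H1, H2. puses (IH, H1, H2).
    ptaut_fin_by (cbn [carry]; destruct (HC i) as (_ & E & _); apply (f_equal (fun z => N.testbit z #(l i))) in E; rewrite N.lor_spec, !N.land_spec, N.lor_spec, N.div2_spec, N.shiftr_spec' in E; rewrite N.add_1_r, <- Nat2N.inj_succ in E; rewrite E; destruct (N.testbit (n i) #(l i)), (N.testbit (m i) #(l i)), (N.testbit (d i) #(l i)); cbn [andb orb]). }
  apply (isc_bit _ _ _ k) in H1, H2.
  assert (A := add_bit q' (fun i => pconst (c i)) x y k). cbn [fam madd].
  puses (F, H1, H2, A).
  ptaut_fin_by (destruct (HC i) as (E & _ & _); rewrite E, !N.lxor_spec; destruct (N.testbit (n i) #(k i)), (N.testbit (m i) #(k i)), (N.testbit (d i) #(k i)); cbn [xorb]).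
Qed.

Lemma isc_add0 q x y n m : isc q x n -> isc q y m -> isc q (madd fbot_ x y) (fun i => n i + m i)%N.
Proof.
 intros H1 H2. assert (H := isc_add q (fun _ => false) x y n m H1 H2).
 apply isc_ext with (m := fun i => (n i + m i)%N) in H; auto.
 - intros i _. simpl N.b2n. lia.
 - eapply pb_le; [|exact (isc_pb H)]. intros i. apply size_nat_mono. simpl N.b2n. lia.
Qed.

Lemma isc_nil q : isc q mnil (fun _ => 0%N).
Proof.
 apply isc_intro; [apply (pb_const 0)|]. intros k _ q' _ _ _.
 ptaut_by (cbn [fam mnil]; rewrite (nth_bit_over []) by (simpl; lia); rewrite N.bits_0).
Qed.

Lemma isc_succ q x n : isc q x n -> isc q (msucc x) (fun i => N.succ (n i)).
Proof.
 intros H. assert (H' := isc_add q (fun _ => true) x mnil n _ H (isc_nil q)).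
 apply isc_ext with (m := fun i => N.succ (n i)) in H'; auto.
 - intros i _. simpl N.b2n. lia.
 - eapply pb_le; [|exact (isc_pb H')]. intros i. apply size_nat_mono. simpl N.b2n. lia.
Qed.

Lemma isc_cons q b x n : isc q x n ->
 isc q (mcons (fun i => pconst (b i)) x) (fun i => 2 * n i + N.b2n (b i))%N.
Proof.
 intros H. apply isc_intro.
 - eapply pb_le; [|apply pb_S; exact (isc_pb H)]. intros i. apply size_nat_double.
 - intros k m q' Hq _ _. apply (isc_sub Hq) in H.
  apply (isc_bit _ _ _ (fun i => k i - 1)) in H. puse H.
  ptaut_fin_by (cbn [fam mcons]; rewrite testbit_double; destruct (k i) as [|j]; [nth_cons; destruct (b i), (N.testbit (n i) #(0 - 1)) |rewrite Nat.sub_succ, Nat.sub_0_r; nth_cons; destruct (N.testbit (n i) #j)]).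
Qed.

Lemma isc_tl q x n : isc q x n -> isc q (mtl x) (fun i => N.div2 (n i)).
Proof.
 intros H. apply isc_intro.
 - eapply pb_le; [|exact (isc_pb H)]. intros i. apply size_nat_mono.
  rewrite N.div2_div. apply N.Div0.div_le_upper_bound. lia.
 - intros k m q' Hq _ _. apply (isc_sub Hq) in H.
  apply (isc_bit _ _ _ (fun i => S (k i))) in H. puse H.
  ptaut_fin_by (cbn [fam mtl]; rewrite nth_bit_tl, N.div2_spec, N.shiftr_spec', N.add_1_r, <- Nat2N.inj_succ; destruct (N.testbit (n i) (#(S (k i))))).
Qed.

Lemma isc_skip q k x n : isc q x n -> isc q (mskip k x) (fun i => N.shiftr (n i) #(k i)).
Proof.
 intros H. apply isc_intro.
 - eapply pb_le; [|exact (isc_pb H)]. intros i. apply size_nat_mono.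
  rewrite N.shiftr_div_pow2. apply N.Div0.div_le_upper_bound.
  assert (E := N.pow_nonzero 2 #(k i)). nia.
 - intros j m q' Hq _ _. apply (isc_sub Hq) in H.
  apply (isc_bit _ _ _ (fun i => k i + j i)) in H. puse H.
  ptaut_fin_by (cbn [fam mskip]; rewrite nth_bit_skipn, N.shiftr_spec', N.add_comm, <- Nat2N.inj_add; destruct (N.testbit (n i) #(k i + j i))).
Qed.

Lemma isc_scal q b x n : isc q x n ->
 isc q (mscal (fun i => pconst (b i)) x) (fun i => if b i then n i else 0%N).
Proof.
 intros H. apply isc_intro.
 - eapply pb_le; [|exact (isc_pb H)]. intros i. destruct (b i); simpl; lia.
 - intros k m q' Hq _ _. apply (isc_sub Hq) in H. apply (isc_bit _ _ _ k) in H.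
  assert (A := scal_bit q' (fun i => pconst (b i)) x k). puses (H, A).
  ptaut_fin_by (cbn [fam mscal]; destruct (b i); rewrite ?N.bits_0; destruct (N.testbit (n i) #(k i))).
Qed.

Lemma isc_mul q x y n m : isc q x n -> isc q y m -> isc q (mmul x y) (fun i => n i * m i)%N.
Proof.
 intros H1 H2.
 assert (Hp : pbN (fun i => n i * m i)%N).
 { eapply pb_le; [|apply pb_add; [exact (isc_pb H1)|exact (isc_pb H2)]].
  intros i. apply size_nat_mul. }
 assert (Hk : forall k, pbN (fun i => N.shiftr (n i) #(k i) * m i)%N).
 { intros k. eapply pb_le; [|exact Hp]. intros i. apply size_nat_mono. apply N.mul_le_mono_r.
  rewrite N.shiftr_div_pow2. apply N.Div0.div_le_upper_bound.
  assert (E := N.pow_nonzero 2 #(k i)). nia. }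
 exists Hp. transitivity (cst _ (Hk (fun _ => 0))); [|apply meq_eq; intros i _; refl].
 change (meq q (mmul (mskip (fun _ => 0) x) y) (cst _ (Hk (fun _ => 0)))).
 apply (meq_ind_down (fun i k => mulp (skipn k (x i)) (y i)) (fun i k => bitsN (N.shiftr (n i) #k * m i))
  (fun k => mmul (mskip k x) y) (fun k => cst _ (Hk k)) q
  (fun i => length (x i) + N.size_nat (n i))); try refl.
 - apply pb_add; [apply fam_pb|exact (isc_pb H1)].
 - rewrite mskip_over by (intros; lia). rewrite mmul_nil. apply meq_eq. intros i _. cbn [fam cst mnil].
  replace (N.shiftr _ _) with 0%N; [refl|].
  symmetry. rewrite N.shiftr_div_pow2. apply N.div_small. apply size_nat_le. lia.
 - intros k q' Hq _ IH. apply (isc_sub Hq) in H1, H2.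
  etrans; [apply mmul_skip|].
  assert (E : isc q' (mmul (mskip (fun i => S (k i)) x) y) (fun i => N.shiftr (n i) (#(S (k i))) * m i)%N).
  { eexists. exact IH. }
  apply isc_cons with (b := fun _ => false) in E.
  assert (B := isc_bit _ _ _ k H1).
  assert (F := isc_scal _ (fun i => N.testbit (n i) #(k i)) _ _ H2).
  assert (G := isc_add0 _ _ _ _ _ F E).
  eapply isc_unique; [|apply isc_cst].
  assert (G' : isc q' (madd fbot_ (mscal (fun i => nth_bit (x i) (k i)) y) (mcons fbot_ (mmul (mskip (fun i => S (k i)) x) y)))
    (fun i => (if N.testbit (n i) #(k i) then m i else 0) + (2 * (N.shiftr (n i) (#(S (k i))) * m i) + N.b2n false))%N).
  { eapply isc_meq; [|exact G]. apply madd_proper; [refl| |refl].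
   apply mscal_proper; [exact B|refl]. }
  eapply isc_ext; [|apply Hk|exact G']. intros i _. cbv beta.
  rewrite Nat2N.inj_succ, <- N.add_1_r, <- N.shiftr_shiftr, <- N.div2_spec.
  rewrite (N.div2_odd (N.shiftr (n i) #(k i))) at 2.
  replace (N.odd (N.shiftr (n i) #(k i))) with (N.testbit (n i) #(k i)).
  + simpl (N.b2n false). destruct (N.testbit (n i) #(k i)); simpl N.b2n; lia.
  + rewrite <- N.bit0_odd, N.shiftr_spec'. f_equal.
Qed.

Lemma ltb_mod_step a b k :
 (a mod 2 ^ #(S k) <? b mod 2 ^ #(S k))%N =
 let x := N.testbit a #k in let y := N.testbit b #k in
 orb (negb x && y) (eqb x y && (a mod 2 ^ #k <? b mod 2 ^ #k)%N).
Proof.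
 assert (E : forall a, (a mod 2 ^ #(S k) =
   2 ^ #k * N.b2n (N.testbit a #k) + a mod 2 ^ #k)%N).
 { intros n. rewrite N.testbit_spec' , Nat2N.inj_succ, N.pow_succ_r', (N.mul_comm 2).
  rewrite N.Div0.mod_mul_r. lia. }
 rewrite !E. cbv zeta.
 assert (P := N.pow_nonzero 2 #k ltac:(lia)).
 assert (Ha := N.mod_lt a _ P). assert (Hb := N.mod_lt b _ P).
 set (p := (2 ^ #k)%N) in *. set (u := (a mod p)%N) in *. set (v := (b mod p)%N) in *.
 apply eq_true_iff_eq. rewrite orb_true_iff, !andb_true_iff, negb_true_iff, !N.ltb_lt.
 destruct (N.testbit a #k), (N.testbit b #k); simpl N.b2n; cbn [eqb];
  rewrite ?N.mul_0_r, ?N.mul_1_r; intuition (try discriminate; lia).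
Qed.

Lemma isc_less q x y n m : isc q x n -> isc q y m ->
 peq q (fun i => lessp (x i) (y i)) (fun i => pconst (n i <? m i)%N).
Proof.
 intros H1 H2.
 set (b := fun i => bd3 x y x i + (N.size_nat (n i) + N.size_nat (m i))).
 assert (Hb : pb b).
 { apply pb_add; [apply bd3_pb|apply pb_add; [exact (isc_pb H1)|exact (isc_pb H2)]]. }
 assert (E := lessp_at q x y b Hb ltac:(intros; unfold b, bd3; lia)).
 assert (F : peq q (fun i => lessn (x i) (y i) (b i))
  (fun i => pconst (n i mod 2 ^ #(b i) <? m i mod 2 ^ #(b i))%N)).
 { apply (less_ind q (fun i k => piff (lessn (x i) (y i) k)
   (pconst (n i mod 2 ^ #k <? m i mod 2 ^ #k)%N))); auto.
  - ptaut_by (cbn [lessn]; simpl N.of_nat; rewrite N.pow_0_r, !N.mod_1_r; change (0 <? 0)%N with false).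
  - intros l q' Hq IH. apply (isc_sub Hq), (isc_bit _ _ _ l) in H1, H2.
   puses (IH, H1, H2).
   ptaut_fin_by (cbn [lessn]; rewrite ltb_mod_step; cbv zeta; destruct (N.testbit (n i) #(l i)), (N.testbit (m i) #(l i)), (n i mod 2 ^ #(l i) <? m i mod 2 ^ #(l i))%N; cbn [negb andb orb eqb]). }
 puses (E, F).
 ptaut_fin_by (rewrite !N.mod_small by (apply size_nat_le; unfold b; lia); destruct (n i <? m i)%N).
Qed.

Lemma isc_le q x y n m : isc q x n -> isc q y m -> (forall i, live q i -> (n i <= m i)%N) -> le_ q x y.
Proof.
 intros H1 H2 H. assert (E := isc_less q y x m n H2 H1). unfold le_ in *. puse E.
 ptaut_by (replace (m i <? n i)%N with false by (specialize (H i Hi); symmetry; apply N.ltb_ge; lia)).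
Qed.

Lemma isc_lt q x y n m : isc q x n -> isc q y m -> (forall i, live q i -> (n i < m i)%N) -> lt_ q x y.
Proof.
 intros H1 H2 H. assert (E := isc_less q x y n m H1 H2). unfold lt_ in *. puse E.
 ptaut_by (replace (n i <? m i)%N with true by (specialize (H i Hi); symmetry; apply N.ltb_lt; lia)).
Qed.
End Constants.

(** ** Lengths *)

Definition lenp (x : bits) : bits :=
 map (fun j => pdisj (map (len_is x) (filter (fun a => Nat.testbit a j) (seq 0 (S (length x))))))
  (seq 0 (blen (length x))).

Definition smashp (x y : bits) : bits :=
 map (fun j => pdisj (map (fun '(a, b) => pand (len_is x a) (len_is y b))
     (filter (fun '(a, b) => a * b =? j)
      (list_prod (seq 0 (S (length x))) (seq 0 (S (length y)))))))
  (seq 0 (S (length x * length y))).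

Lemma of_nat_testbit a k : N.testbit #a #k = Nat.testbit a k.
Proof.
 revert a; induction k as [|k IH]; intros a.
 - simpl N.of_nat. rewrite N.bit0_odd, Nat.bit0_odd.
  assert (E1 := Nat.div2_odd a). assert (E2 := N.div2_odd #a).
  rewrite <- Nat2N.inj_div2 in E2.
  destruct (Nat.odd a), (N.odd #a); simpl Nat.b2n in *; simpl N.b2n in *; auto; lia.
 - rewrite Nat2N.inj_succ, <- N.add_1_r, <- N.shiftr_spec', <- N.div2_spec, <- Nat2N.inj_div2.
  apply IH.
Qed.

Lemma blen_le n : blen n <= n.
Proof. apply size_nat_of_nat. Qed.

Lemma lenp_length x : length (lenp x) = blen (length x).
Proof. unfold lenp. now rewrite length_map_seq. Qed.

Lemma smashp_length x y : length (smashp x y) = S (length x * length y).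
Proof. unfold smashp. now rewrite length_map_seq. Qed.

Section Lengths.
Context {SC : Scale}.

Lemma mlen_pb (x : elt) : pb (fun i => length (lenp (x i))).
Proof.
 eapply pb_le; [|apply (fam_pb x)]. intros i. rewrite lenp_length. apply blen_le.
Qed.

Definition mlen (x : elt) : elt := Elt (fun i => lenp (x i)) (mlen_pb x).

Lemma msmash_pb (x y : elt) : pb (fun i => length (smashp (x i) (y i))).
Proof.
 eapply pb_le; [|apply pb_S, pb_mul; [apply (fam_pb x)|apply (fam_pb y)]].
 intros i. now rewrite smashp_length.
Qed.

Definition msmash (x y : elt) : elt := Elt (fun i => smashp (x i) (y i)) (msmash_pb x y).

Lemma len_top q (x : elt) a : prv q (fun i => len_is (x i) (a i)) ->
 (forall i, live q i -> a i <> 0) -> prv q (fun i => nth_bit (x i) (a i - 1)).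
Proof.
 intros H Ha. puse H. ptaut_by (unfold len_is; destruct (Nat.eqb_spec (a i) 0); [now apply Ha in Hi|]).
Qed.

Lemma len_over q (x : elt) a k : prv q (fun i => len_is (x i) (a i)) ->
 (forall i, live q i -> a i <= k i) -> prv q (fun i => pneg (nth_bit (x i) (k i))).
Proof.
 intros H Hk. apply prv_split with (fun i => k i < length (x i)).
 - extend q' S1.
  apply (prv_sub S1) in H.
  assert (H' : prv q' (fun i => pconj (map pneg (skipn (a i) (x i))))).
  { puse H. ptaut_by (unfold len_is). }
  apply pconj_elim with (l := fun i => map pneg (skipn (a i) (x i))); auto.
  + eapply pb_le; [|apply (fam_pb x)]. intros i. rewrite length_map, length_skipn. lia.
  + intros i Hi. apply in_map. assert (K1 := Hk i (live_sub S1 Hi)).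
   apply live_restrict in Hi.
   replace (nth_bit (x i) (k i)) with (nth_bit (skipn (a i) (x i)) (k i - a i))
    by (rewrite nth_bit_skipn; f_equal; lia).
   apply nth_In. rewrite length_skipn. lia.
 - ptaut_on (rewrite nth_bit_over by lia).
Qed.

Lemma len_intro q (x : elt) a :
 prv (restrict q (fun i => a i <> 0)) (fun i => nth_bit (x i) (a i - 1)) ->
 (forall k q', sub q q' -> (forall i, live q' i -> a i <= k i < length (x i)) ->
   prv q' (fun i => pneg (nth_bit (x i) (k i)))) ->
 prv q (fun i => len_is (x i) (a i)).
Proof.
 intros H1 H2.
 assert (H : prv q (fun i => pconj (map pneg (skipn (a i) (x i))))).
 { apply pconj_intro.
  - eapply pb_le; [|apply (fam_pb x)]. intros i. rewrite length_map, length_skipn. lia.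
  - intros A q' Hq HA.
   assert (HC : forall i, exists k, live q' i -> a i <= k < length (x i) /\ A i = pneg (nth_bit (x i) k)).
   { intros i. destruct (classic (live q' i)) as [Hi|Hi]; [|exists 0; tauto].
    generalize (HA i Hi). rewrite in_map_iff. intros (B & <- & HB).
    apply (In_nth _ _ pbot) in HB as (k & Hk & <-). rewrite length_skipn in Hk.
    exists (a i + k). intros _. split; [lia|]. f_equal. apply nth_bit_skipn. }
   apply (fun H => choice (fun i k => _) H) in HC as (k & HC).
   apply prv_eq with (fun i => pneg (nth_bit (x i) (k i))).
   + intros i Hi. symmetry. now apply HC.
   + apply H2; auto. intros i Hi. now apply HC. }
 apply prv_split with (fun i => a i <> 0).
 - apply (prv_sub (sub_restrict q (fun i => a i <> 0))) in H. puses (H, H1).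
  ptaut_on (unfold len_is; destruct (Nat.eqb_spec (a i) 0); [tauto|]).
 - apply (prv_sub (sub_restrict q (fun i => ~ a i <> 0))) in H. puse H.
  ptaut_on (unfold len_is; destruct (Nat.eqb_spec (a i) 0); [|tauto]).
Qed.

(** To derive [w], the length of [x] may be assumed to be some definite [a]. Otherwise all bits are
    refuted from the top down, the current bit being the top one after those above it have vanished,
    and then the length is 0. Lengths and smashes thereby become constants, although their arguments
    are not. *)
Lemma len_decide q (x : elt) w :
 (forall a q', sub q q' -> (forall i, a i <= length (x i)) ->
   prv q' (fun i => len_is (x i) (a i)) -> prv q' w) -> prv q w.
Proof.
 intros H. apply prv_raa. extend q0 S0.
 assert (N0 : prv q0 (fun i => pneg (w i))) by apply prv_hyp.
 assert (N : forall a, (forall i, a i <= length (x i)) -> prv q0 (fun i => pneg (len_is (x i) (a i)))).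
 { intros a Ha. apply prv_imp. assert (S1 := sub_addc q0 (fun i => len_is (x i) (a i))).
  assert (W := H a _ (sub_trans S0 S1) Ha (prv_hyp _ _)).
  apply (prv_sub S1) in N0. ptaut (W, N0). }
 assert (E : prv q0 (fun i => pconj (map pneg (skipn 0 (x i))))).
 { apply (prv_ind_down q0 (fun i k => pconj (map pneg (skipn k (x i)))) (fun i => length (x i))) with (k := fun _ => 0).
  - apply fam_pb.
  - ptaut_by (rewrite skipn_all; cbn [map pconj fold_right]).
  - intros k q' Hq Hk IH.
   assert (A := N (fun i => Nat.min (S (k i)) (length (x i))) ltac:(intros; cbv beta; lia)).
   apply (prv_sub Hq) in A. puses (A, IH).
   assert (Sk : forall (l : bits) j, j < length l -> skipn j l = nth_bit l j :: skipn (S j) l).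
   { clear. induction l as [|b l IH]; intros j Hj; simpl in Hj; [lia|].
    destruct j as [|j]; [refl|]. apply IH. lia. }
   ptaut_by (specialize (Hk i Hi); rewrite Nat.min_l by lia; rewrite (Sk (x i) (k i)) by auto; unfold len_is; cbn [Nat.eqb]; rewrite Nat.sub_succ, Nat.sub_0_r; unfold pconj; cbn [map fold_right]).
  - intros; lia. }
 assert (A := N (fun _ => 0) ltac:(intros; cbv beta; lia)). puses (E, A).
 ptaut_by (unfold len_is; cbn [Nat.eqb]).
Qed.

Lemma len_uniq q (x : elt) a b : prv q (fun i => len_is (x i) (a i)) ->
 prv q (fun i => len_is (x i) (b i)) -> (forall i, live q i -> a i <> b i) ->
 prv q (fun _ => pbot).
Proof.
 intros H1 H2 Hab.
 assert (G : forall q a b, prv q (fun i => len_is (x i) (a i)) -> prv q (fun i => len_is (x i) (b i)) ->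
  (forall i, live q i -> a i < b i) -> prv q (fun _ => pbot)).
 { clear. intros q a b H1 H2 Hab. apply len_top in H2; [|intros i Hi; specialize (Hab i Hi); lia].
  apply len_over with (k := fun i => b i - 1) in H1; [|intros i Hi; specialize (Hab i Hi); lia].
  ptaut (H1, H2). }
 apply prv_split with (fun i => a i < b i).
 - apply (G _ a b); try (eapply prv_sub; [apply sub_restrict|]; assumption).
  now split_case.
 - apply (G _ b a); try (eapply prv_sub; [apply sub_restrict|]; assumption).
  intros i Hi. specialize (Hab i (live_sub (sub_restrict _ _) Hi)).
  apply live_restrict in Hi. lia.
Qed.

Lemma pdisj_map_elim {X} (x0 : X) q (f : nat -> X -> pform) (l : nat -> list X) w :
 pb (fun i => length (l i)) -> prv q (fun i => pdisj (map (f i) (l i))) ->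
 (forall x q', sub q q' -> (forall i, live q' i -> In (x i) (l i)) ->
   prv q' (fun i => f i (x i)) -> prv q' w) -> prv q w.
Proof.
 intros Hl H HA. apply pdisj_elim with (l := fun i => map (f i) (l i)); auto.
 { eapply pb_le; [|exact Hl]. intros i. now rewrite length_map. }
 intros A q' Hq HI HP.
 assert (HC : forall i, exists y, live q' i -> In y (l i) /\ A i = f i y).
 { intros i. destruct (classic (live q' i)) as [Hi|Hi]; [|exists x0; tauto].
  generalize (HI i Hi). rewrite in_map_iff. intros (y & <- & Hy). eauto. }
 apply (fun H => choice (fun i y => _) H) in HC as (y & HC).
 apply (HA y); auto; [intros i Hi; now apply HC|].
 eapply prv_eq; [|exact HP]. intros i Hi. now apply HC.
Qed.

Lemma len_isc q (x : elt) a : (forall i, a i <= length (x i)) ->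
 prv q (fun i => len_is (x i) (a i)) -> isc q (mlen x) (fun i => #(a i)).
Proof.
 intros Ha H.
 assert (TB := of_nat_testbit).
 assert (Bd : forall n k, blen n <= k -> forall a, a <= n -> Nat.testbit a k = false).
 { intros n k Hk b Hb. rewrite <- TB. apply testbit_over.
  transitivity (blen n); auto. apply size_nat_mono. lia. }
 apply isc_intro.
 - eapply pb_le; [|apply (fam_pb x)]. intros i. etrans; [apply size_nat_of_nat|apply Ha].
 - intros k m q' Hq _ _. apply (prv_sub Hq) in H.
  set (l := fun i => filter (fun a => Nat.testbit a (k i)) (seq 0 (S (length (x i))))).
  assert (Hl : pb (fun i => length (l i))).
  { eapply pb_le; [|apply pb_S; apply (fam_pb x)]. intros i.
   unfold l. etrans; [apply filter_length_le|]. now rewrite length_seq. }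
  assert (E : prv q' (fun i => piff (nth_bit (lenp (x i)) (k i)) (pdisj (map (len_is (x i)) (l i))))).
  { apply prv_split with (fun i => k i < blen (length (x i))).
   - ptaut_on (unfold lenp; rewrite nth_bit_map by auto; unfold l).
   - assert (Hn : forall i, blen (length (x i)) <= k i -> l i = []).
    { intros i Hi. unfold l. rewrite (filter_ext_in _ (fun _ => false)).
     - now rewrite filter_false.
     - intros b Hb. apply in_seq in Hb. apply (Bd (length (x i))); auto. lia. }
    ptaut_on (rewrite nth_bit_over by (rewrite lenp_length; lia); rewrite Hn by lia; cbn [map pdisj fold_right]). }
  unfold peq. apply prv_split with (fun i => Nat.testbit (a i) (k i) = true).
  + extend q1 S1.
   apply (prv_sub S1) in E, H.
   assert (D : prv q1 (fun i => pdisj (map (len_is (x i)) (l i)))).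
   { apply pdisj_intro with (A := fun i => len_is (x i) (a i)); auto.
    - eapply pb_le; [|exact Hl]. intros i. now rewrite length_map.
    - split_case. apply in_map. unfold l. apply filter_In.
     split; auto. apply in_seq. specialize (Ha i). lia. }
   puses (E, D). ptaut_on (rewrite TB, Hi; cbn [fam mlen]).
  + extend q1 S1.
   apply (prv_sub S1) in E, H.
   assert (D : prv q1 (fun i => pneg (pdisj (map (len_is (x i)) (l i))))).
   { apply prv_imp. extend q2 S2.
    apply (pdisj_map_elim 0 q2 (fun i => len_is (x i)) l); auto; [apply prv_hyp|].
    intros b q3 S3 Hb Hp. apply (prv_sub (sub_trans S2 S3)) in H.
    apply (len_uniq q3 x a b); auto. intros i Hi E'.
    assert (K := live_restrict _ _ _ (live_sub (sub_trans S2 S3) Hi)).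
    specialize (Hb i Hi). unfold l in Hb. apply filter_In in Hb as [_ Hb]. congruence. }
   puses (E, D). ptaut_on (apply not_true_is_false in Hi; rewrite TB, Hi; cbn [fam mlen]).
Qed.

Lemma smash_isc q (x y : elt) a b : (forall i, a i <= length (x i)) -> (forall i, b i <= length (y i)) ->
 prv q (fun i => len_is (x i) (a i)) -> prv q (fun i => len_is (y i) (b i)) ->
 isc q (msmash x y) (fun i => 2 ^ #(a i * b i))%N.
Proof.
 intros Ha Hb H1 H2.
 assert (TB : forall c k, N.testbit (2 ^ #c) #k = (c =? k)).
 { intros c k. destruct (Nat.eqb_spec c k) as [->|Hn].
  - apply N.pow2_bits_true.
  - apply N.pow2_bits_false. lia. }
 apply isc_intro.
 - eapply pb_le; [|apply pb_S, pb_mul; [apply (fam_pb x)|apply (fam_pb y)]]. intros i.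
  rewrite size_nat_pow2. specialize (Ha i). specialize (Hb i). nia.
 - intros k m q' Hq _ _. apply (prv_sub Hq) in H1, H2.
  set (l := fun i => filter (fun '(a, b) => a * b =? k i)
      (list_prod (seq 0 (S (length (x i)))) (seq 0 (S (length (y i)))))).
  set (f := fun i '(a, b) => pand (len_is (x i) a) (len_is (y i) b)).
  assert (Hl : pb (fun i => length (l i))).
  { eapply pb_le; [|apply pb_mul; apply pb_S; [apply (fam_pb x)|apply (fam_pb y)]]. intros i.
   unfold l. etrans; [apply filter_length_le|]. rewrite length_prod, !length_seq. refl. }
  assert (E : prv q' (fun i => piff (nth_bit (smashp (x i) (y i)) (k i)) (pdisj (map (f i) (l i))))).
  { apply prv_split with (fun i => k i < S (length (x i) * length (y i))).
   - ptaut_on (unfold smashp; rewrite nth_bit_map by auto; unfold f, l).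
   - assert (Hn : forall i, S (length (x i) * length (y i)) <= k i -> l i = []).
    { intros i Hi. unfold l. rewrite (filter_ext_in _ (fun _ => false)).
     - now rewrite filter_false.
     - intros [c d] Hc. apply in_prod_iff in Hc as [Hc Hd]. apply in_seq in Hc, Hd.
      apply Nat.eqb_neq. nia. }
    ptaut_on (rewrite nth_bit_over by (rewrite smashp_length; lia); rewrite Hn by lia; cbn [map pdisj fold_right]). }
  unfold peq. apply prv_split with (fun i => (a i * b i =? k i) = true).
  + extend q1 S1.
   apply (prv_sub S1) in E, H1, H2.
   assert (D : prv q1 (fun i => pdisj (map (f i) (l i)))).
   { apply pdisj_intro with (A := fun i => pand (len_is (x i) (a i)) (len_is (y i) (b i))).
    - eapply pb_le; [|exact Hl]. intros i. now rewrite length_map.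
    - split_case.
     apply (in_map (f i) (l i) (a i, b i)). unfold l. apply filter_In.
     split; auto. apply in_prod; apply in_seq; specialize (Ha i); specialize (Hb i); lia.
    - now apply prv_and. }
   puses (E, D). ptaut_on (rewrite TB, Hi; cbn [fam msmash]).
  + extend q1 S1.
   apply (prv_sub S1) in E, H1, H2.
   assert (D : prv q1 (fun i => pneg (pdisj (map (f i) (l i))))).
   { apply prv_imp. extend q2 S2.
    apply (pdisj_map_elim (0, 0) q2 f l); auto; [apply prv_hyp|].
    intros c q3 S3 Hc Hp. assert (S4 := sub_trans S2 S3).
    apply (prv_sub S4) in H1, H2.
    assert (P1 : prv q3 (fun i => len_is (x i) (fst (c i)))).
    { puse Hp. ptaut_by (unfold f; destruct (c i); cbn [fst]). }
    assert (P2 : prv q3 (fun i => len_is (y i) (snd (c i)))).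
    { puse Hp. ptaut_by (unfold f; destruct (c i); cbn [snd]). }
    assert (G : forall i, live q3 i -> fst (c i) <> a i \/ snd (c i) <> b i).
    { intros i Hi.
     assert (K := live_restrict _ _ _ (live_sub S4 Hi)). specialize (Hc i Hi).
     unfold l in Hc. apply filter_In in Hc as [_ Hc]. destruct (c i) as [c1 c2]. simpl.
     destruct (Nat.eq_dec c1 (a i)) as [->|]; auto. destruct (Nat.eq_dec c2 (b i)) as [->|]; auto. }
    apply prv_split with (fun i => fst (c i) <> a i).
    - apply (len_uniq _ x (fun i => fst (c i)) a); try (eapply prv_sub; [apply sub_restrict|]; assumption).
     now split_case.
    - apply (len_uniq _ y (fun i => snd (c i)) b); try (eapply prv_sub; [apply sub_restrict|]; assumption).
     intros i Hi. assert (Gi := G i (live_sub (sub_restrict _ _) Hi)).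
     apply live_restrict in Hi. tauto. }
   puses (E, D). ptaut_on (apply not_true_is_false in Hi; rewrite TB, Hi; cbn [fam msmash]).
Qed.

Lemma isc_len_is q (x : elt) n : isc q x n -> prv q (fun i => len_is (x i) (N.size_nat (n i))).
Proof.
 intros H. apply len_intro.
 - apply (isc_sub (sub_restrict q (fun i => N.size_nat (n i) <> 0))) in H.
  apply (isc_bit _ _ _ (fun i => N.size_nat (n i) - 1)) in H. puse H.
  assert (T : forall m, N.size_nat m <> 0 -> N.testbit m #(N.size_nat m - 1) = true).
  { intros m Hm. destruct (N.eq_dec m 0) as [->|Hn]; [now destruct Hm|].
   assert (E := N.size_log2 m Hn). rewrite size_size_nat in E.
   replace #(N.size_nat m - 1) with (N.log2 m) by lia. now apply N.bit_log2. }
  ptaut_on (rewrite T by auto).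
 - intros k q' Hq Hk. apply (isc_sub Hq), (isc_bit _ _ _ k) in H. puse H.
  ptaut_by (rewrite testbit_over by (apply Hk; auto)).
Qed.

Lemma len_is_meq q (x y : elt) a : meq q x y -> prv q (fun i => len_is (x i) (a i)) ->
 prv q (fun i => len_is (y i) (a i)).
Proof.
 intros E H. apply len_intro.
 - extend q1 S1.
  apply (prv_sub S1) in H. apply (meq_sub S1) in E.
  apply len_top in H; [|now split_case].
  apply (meq_bit _ _ _) with (k := fun i => a i - 1) in E. ptaut (E, H).
 - intros k q' Hq Hk. apply (prv_sub Hq) in H. apply (meq_sub Hq) in E.
  apply (meq_bit _ _ _) with (k := k) in E. apply len_over with (k := k) in H; [|intros i Hi; now apply Hk].
  ptaut (E, H).
Qed.

(* A list of length [l] with [len_is x a] may satisfy [a <= l] only for live indices. *)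
Lemma len_is_le q (x : elt) a : prv q (fun i => len_is (x i) (a i)) ->
 prv q (fun i => len_is (x i) (Nat.min (a i) (length (x i)))).
Proof.
 intros H. apply prv_split with (fun i => a i <= length (x i)).
 - extend q1 S1.
  apply (prv_sub S1) in H. puse H.
  ptaut_on (rewrite Nat.min_l by auto).
 - extend q1 S1.
  apply (prv_sub S1) in H. apply len_top in H.
  + puse H. ptaut_on (rewrite nth_bit_over by lia).
  + split_case. lia.
Qed.

Lemma isc_len q (x : elt) n : isc q x n -> isc q (mlen x) (fun i => N.size (n i)).
Proof.
 intros H. assert (L := len_is_le _ _ _ (isc_len_is _ _ _ H)).
 apply len_isc in L; [|intros; lia].
 unfold isc. assert (Hp : pbN (fun i => N.size (n i))).
 { eapply pb_le; [|exact (isc_pb H)]. intros i. rewrite size_size_nat. apply size_nat_of_nat. }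
 exists Hp. unfold meq. apply prv_split with (fun i => N.size_nat (n i) <= length (x i)).
 - extend q1 S1.
  apply (isc_sub S1) in L. destruct L as (HL & E).
  change (meq q1 (mlen x) (cst _ Hp)). rewrite E. apply meq_eq. intros i Hi.
  apply live_restrict in Hi. cbn [fam cst]. now rewrite size_size_nat, Nat.min_l.
 - extend q1 S1.
  assert (L' := isc_len_is _ _ _ (isc_sub S1 H)).
  apply prv_bot. apply len_top in L'.
  + puse L'. ptaut_on (rewrite nth_bit_over by lia).
  + split_case. lia.
Qed.

Lemma mlen_isc_of q (x : elt) a : prv q (fun i => len_is (x i) (a i)) -> pb a ->
 isc q (mlen x) (fun i => #(a i)).
Proof.
 intros H Ha.
 assert (Hp : pbN (fun i => #(a i))).
 { eapply pb_le; [|exact Ha]. intros i. apply size_nat_of_nat. }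
 assert (L := len_isc _ _ _ ltac:(intros; apply Nat.le_min_r) (len_is_le _ _ _ H)).
 exists Hp. unfold meq. apply prv_split with (fun i => a i <= length (x i)).
 - extend q1 S1.
  apply (isc_sub S1) in L. destruct L as (HL & E).
  change (meq q1 (mlen x) (cst _ Hp)). rewrite E. apply meq_eq. intros i Hi.
  apply live_restrict in Hi. cbn [fam cst]. now rewrite Nat.min_l.
 - extend q1 S1.
  apply (prv_sub S1) in H. apply prv_bot. apply len_top in H.
  + puse H. ptaut_on (rewrite nth_bit_over by lia).
  + split_case. lia.
Qed.

Lemma msmash_isc_of q (x y : elt) a b : prv q (fun i => len_is (x i) (a i)) ->
 prv q (fun i => len_is (y i) (b i)) -> pb a -> pb b ->
 isc q (msmash x y) (fun i => 2 ^ #(a i * b i))%N.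
Proof.
 intros H1 H2 Ha Hb.
 assert (Hp : pbN (fun i => 2 ^ #(a i * b i))%N).
 { eapply pb_le; [|apply pb_S, pb_mul; [exact Ha|exact Hb]]. intros i. now rewrite size_nat_pow2. }
 assert (L := smash_isc _ _ _ _ _ ltac:(intros; apply Nat.le_min_r) ltac:(intros; apply Nat.le_min_r)
  (len_is_le _ _ _ H1) (len_is_le _ _ _ H2)).
 assert (G : forall (z : elt) c, prv q (fun i => len_is (z i) (c i)) ->
  prv (restrict q (fun i => ~ c i <= length (z i))) (fun _ => pbot)).
 { intros z c H. extend q1 S1.
  apply (prv_sub S1) in H. apply len_top in H.
  + puse H. ptaut_on (rewrite nth_bit_over by lia).
  + split_case. lia. }
 exists Hp. unfold meq. apply prv_split with (fun i => a i <= length (x i)); [|apply prv_bot, G, H1].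
 apply prv_split with (fun i => b i <= length (y i)).
 - set (q1 := restrict (restrict q _) _).
  assert (S1 : sub q q1) by (eapply sub_trans; apply sub_restrict).
  apply (isc_sub S1) in L. destruct L as (HL & E).
  change (meq q1 (msmash x y) (cst _ Hp)). rewrite E. apply meq_eq. intros i Hi.
  assert (K := live_restrict _ _ _ Hi). apply (live_sub (q := restrict q (fun i => a i <= length (x i)))) in Hi;
   [|apply sub_restrict]. apply live_restrict in Hi. cbn [fam cst]. now rewrite !Nat.min_l.
 - apply prv_bot. eapply prv_sub; [|apply G, H2]. intros i A [HA|HA]; [left; now left|now right].
Qed.

#[global] Instance mlen_proper q : Proper (meq q ==> meq q) mlen.
Proof.
 intros x y E. unfold meq. apply (len_decide q x). intros a q' Hq Ha H.
 apply (meq_sub Hq) in E.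
 assert (Hp : pb a) by (eapply pb_le; [|apply (fam_pb x)]; apply Ha).
 apply isc_unique with (n := fun i => #(a i)); apply mlen_isc_of; auto.
 now apply (len_is_meq q' x y).
Qed.

#[global] Instance msmash_proper q : Proper (meq q ==> meq q ==> meq q) msmash.
Proof.
 intros x x' E y y' E'. unfold meq.
 apply (len_decide q x). intros a q1 H1 Ha L1. apply (len_decide q1 y). intros b q2 H2 Hb L2.
 assert (Hpa : pb a) by (eapply pb_le; [|apply (fam_pb x)]; apply Ha).
 assert (Hpb : pb b) by (eapply pb_le; [|apply (fam_pb y)]; apply Hb).
 apply (prv_sub H2) in L1. assert (S2 := sub_trans H1 H2).
 apply (meq_sub S2) in E, E'.
 apply isc_unique with (n := fun i => (2 ^ #(a i * b i))%N); apply msmash_isc_of; auto.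
 - now apply (len_is_meq q2 x x').
 - now apply (len_is_meq q2 y y').
Qed.
End Lengths.

(** * Programs as circuits *)

Definition muxp (c : pform) (x y : bits) : bits :=
 map (fun i => por (pand c (nth_bit x i)) (pand (pneg c) (nth_bit y i)))
  (seq 0 (Nat.max (length x) (length y))).

Definition minp (x y : bits) : bits := firstn (length y) (muxp (lessp x y) x y).

(* [translate] with the extension variables replaced by what they abbreviate. *)
Fixpoint ttrans (p : prog) (e : list bits) : bits :=
 let x := nth 0 e [] in
 match p with
 | Proj i => nth i e []
 | Zero => []
 | Bit b => pconst b :: x
 | Half => tl x
 | Odd => firstn 1 x
 | Len => lenp x
 | Smash => smashp x (nth 1 e [])
 | Cond => muxp (pdisj x) (nth 1 e []) (nth 2 e [])
 | Comp f gs => ttrans f (map (fun g => ttrans g e) gs)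
 | Rec g h b =>
   fold_left (fun v i =>
     let z := skipn i x in
     muxp (pdisj z) (minp (ttrans h (v :: z :: tl e)) (ttrans b (z :: tl e))) v)
    (rev (seq 0 (length x))) (ttrans g (tl e))
 end.

(** For [Rec] the program [h] is absent, since its value is cut off at that of [b]. This is how
    limited recursion keeps lengths polynomial. *)
Fixpoint outlen (p : prog) (L : nat) : nat :=
 match p with
 | Proj _ | Half | Len | Cond => L
 | Zero => 0
 | Bit _ => S L
 | Odd => 1
 | Smash => S (L * L)
 | Comp f gs => outlen f (list_sum (map (fun g => outlen g L) gs))
 | Rec g h b => outlen g L + outlen b L
 end.

Fixpoint prog_nested_ind (P : prog -> Prop)
 (HProj : forall i, P (Proj i)) (HZero : P Zero) (HBit : forall b, P (Bit b)) (HHalf : P Half)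
 (HOdd : P Odd) (HLen : P Len) (HSmash : P Smash) (HCond : P Cond)
 (HComp : forall f gs, P f -> Forall P gs -> P (Comp f gs))
 (HRec : forall g h b, P g -> P h -> P b -> P (Rec g h b)) (p : prog) : P p :=
 let F := prog_nested_ind P HProj HZero HBit HHalf HOdd HLen HSmash HCond HComp HRec in
 match p with
 | Proj i => HProj i
 | Zero => HZero
 | Bit b => HBit b
 | Half => HHalf
 | Odd => HOdd
 | Len => HLen
 | Smash => HSmash
 | Cond => HCond
 | Comp f gs => HComp f gs (F f) ((fix G (l : list prog) : Forall P l :=
   match l with [] => Forall_nil P | g :: l => Forall_cons g (F g) (G l) end) gs)
 | Rec g h b => HRec g h b (F g) (F h) (F b)
 end.

Lemma muxp_length c x y : length (muxp c x y) = Nat.max (length x) (length y).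
Proof. unfold muxp. now rewrite length_map_seq. Qed.

Lemma minp_length x y : length (minp x y) = length y.
Proof. unfold minp. rewrite length_firstn, muxp_length. lia. Qed.

Lemma list_sum_le_in {A} (f : A -> nat) l a : In a l -> f a <= list_sum (map f l).
Proof.
 induction l as [|b l IH]; simpl; intros H; [tauto|].
 destruct H as [->|H]; [lia|]. apply IH in H. lia.
Qed.

Lemma nth_bound {A} (f : A -> nat) (l : list A) d L i : f d = 0 -> (forall x, In x l -> f x <= L) ->
 f (nth i l d) <= L.
Proof. intros Hd H. destruct (nth_in_or_default i l d) as [E| ->]; [auto|lia]. Qed.

Lemma in_tl {A} (x : A) l : In x (tl l) -> In x l.
Proof. destruct l; simpl; auto. Qed.

Lemma ttrans_length p : forall e L, (forall x, In x e -> length x <= L) ->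
 length (ttrans p e) <= outlen p L.
Proof.
 induction p as [j| | | | | | | |f gs IHf IHgs|g h b IHg IHh IHb] using prog_nested_ind;
  intros e L He;
  assert (N : forall j, length (nth j e []) <= L) by (intros; apply nth_bound; auto);
  cbn [ttrans outlen].
 - auto.
 - simpl; lia.
 - cbn [length]. apply le_n_S, N.
 - etrans; [|apply (N 0)]. rewrite length_tl. apply Nat.le_sub_l.
 - rewrite length_firstn. lia.
 - rewrite lenp_length. rewrite blen_le. auto.
 - rewrite smashp_length. apply le_n_S, Nat.mul_le_mono; apply N.
 - rewrite muxp_length. apply Nat.max_lub; apply N.
 - apply IHf. intros x Hx. apply in_map_iff in Hx as (g & <- & Hg).
  rewrite Forall_forall in IHgs. etrans; [apply (IHgs g Hg e L He)|].
  now apply (list_sum_le_in (fun g => outlen g L)).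
 - set (x := nth 0 e []) in *.
  assert (HT : forall y, In y (tl e) -> length y <= L) by (intros; apply He; now apply in_tl).
  assert (G : forall l v, length v <= outlen g L + outlen b L ->
   length (fold_left (fun v i =>
     muxp (pdisj (skipn i x)) (minp (ttrans h (v :: skipn i x :: tl e)) (ttrans b (skipn i x :: tl e))) v) l v)
    <= outlen g L + outlen b L).
  { induction l as [|i l IHl]; intros v Hv; simpl; auto. apply IHl.
   rewrite muxp_length, minp_length.
   assert (Hb : length (ttrans b (skipn i x :: tl e)) <= outlen b L).
   { apply IHb. intros y [<-|Hy]; auto. rewrite length_skipn.
    etrans; [apply Nat.le_sub_l|apply (N 0)]. }
   lia. }
  apply G. exact (Nat.le_trans _ _ _ (IHg (tl e) L HT) (Nat.le_add_r _ _)).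
Qed.

Lemma run_rec g h b z e : run (Rec g h b) (z :: e) =
 if (z =? 0)%N then run g e
 else N.min (run h (run (Rec g h b) (N.div2 z :: e) :: z :: e)) (run b (z :: e)).
Proof. destruct z as [|[q|q|]]; refl. Qed.

Lemma run_size p : forall e L, (forall x, In x e -> N.size_nat x <= L) ->
 N.size_nat (run p e) <= outlen p L.
Proof.
 induction p as [j| | | | | | | |f gs IHf IHgs|g h b IHg IHh IHb] using prog_nested_ind;
  intros e L He;
  assert (N : forall j, N.size_nat (nth j e 0%N) <= L) by (intros; apply nth_bound; auto);
  assert (N0 := N 0); assert (N1 := N 1); assert (N2 := N 2);
  lazymatch goal with |- context [Rec] => idtac | _ => cbn [run outlen] end.
 - auto.
 - simpl; lia.
 - etrans; [apply size_nat_double|]. lia.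
 - etrans; [|exact N0]. apply size_nat_mono. rewrite N.div2_div.
  apply N.Div0.div_le_upper_bound. lia.
 - destruct (N.odd _); simpl; lia.
 - rewrite size_size_nat. etrans; [apply size_nat_of_nat|auto].
 - rewrite !size_size_nat, <- Nat2N.inj_mul, size_nat_pow2. nia.
 - destruct (_ =? 0)%N; auto.
 - apply IHf. intros x Hx. apply in_map_iff in Hx as (g & <- & Hg).
  rewrite Forall_forall in IHgs. etrans; [apply (IHgs g Hg e L He)|].
  now apply (list_sum_le_in (fun g => outlen g L)).
 - assert (HT : forall y, In y (tl e) -> N.size_nat y <= L) by (intros; apply He; now apply in_tl).
  assert (Hg := IHg (tl e) L HT). cbn [outlen].
  destruct e as [|z e]; [exact (Nat.le_trans _ _ _ Hg (Nat.le_add_r _ _))|].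
  rewrite run_rec. destruct (N.eqb_spec z 0) as [->|Hz]; [simpl in Hg; lia|].
  assert (Hb := IHb (z :: e) L He). etrans; [apply size_nat_mono, N.le_min_r|lia].
Qed.

Lemma fold_tails {V A} (F : V -> list A -> V) v a l :
 fold_left (fun v i => F v (skipn i (a :: l))) (rev (seq 0 (S (length l)))) v =
 F (fold_left (fun v i => F v (skipn i l)) (rev (seq 0 (length l))) v) (a :: l).
Proof.
 change (seq 0 (S (length l))) with ([0] ++ seq 1 (length l)).
 rewrite rev_app_distr, <- seq_shift, <- map_rev, fold_left_app. simpl. f_equal.
 generalize (rev (seq 0 (length l))). intros l0. revert v.
 induction l0 as [|i l0 IH]; intros v; simpl; auto.
Qed.

Lemma ttrans_rec g h b a l ts :
 ttrans (Rec g h b) ((a :: l) :: ts) =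
 let z := a :: l in
 muxp (pdisj z) (minp (ttrans h (ttrans (Rec g h b) (l :: ts) :: z :: ts)) (ttrans b (z :: ts)))
  (ttrans (Rec g h b) (l :: ts)).
Proof.
 exact (fold_tails (fun v z => muxp (pdisj z)
  (minp (ttrans h (v :: z :: ts)) (ttrans b (z :: ts))) v) (ttrans g ts) a l).
Qed.

Section Programs.
Context {SC : Scale}.

Lemma outlen_pb p : forall h, pb h -> pb (fun i => outlen p (h i)).
Proof.
 induction p as [| | | | | | | |f gs IHf IHgs|g h b IHg IHh IHb] using prog_nested_ind;
  intros L H; simpl; auto using pb_const, pb_S.
 - apply pb_S. now apply pb_mul.
 - apply (IHf (fun i => list_sum (map (fun g => outlen g (L i)) gs))).
  induction IHgs as [|g gs Hg _ IH]; simpl; [apply pb_const|].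
  apply pb_add; auto.
 - apply pb_add; auto.
Qed.

Definition args (es : list elt) (i : nat) : list bits := map (fun x : elt => x i) es.

Lemma args_pb (es : list elt) : exists L, pb L /\ forall i x, In x (args es i) -> length x <= L i.
Proof.
 induction es as [|x es (L & HL & IH)].
 - exists (fun _ => 0). split; [apply pb_const|]. intros i y [].
 - exists (fun i => length (x i) + L i). split; [apply pb_add; auto using fam_pb|].
  intros i y [<-|Hy]; [lia|]. specialize (IH i y Hy). lia.
Qed.

Lemma papp_pb p (es : list elt) : pb (fun i => length (ttrans p (args es i))).
Proof.
 destruct (args_pb es) as (L & HL & H). eapply pb_le; [|exact (outlen_pb p L HL)].
 intros i. apply ttrans_length. apply H.
Qed.

Definition papp p (es : list elt) : elt := Elt (fun i => ttrans p (args es i)) (papp_pb p es).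

Lemma mmux_pb c (x y : elt) : pb (fun i => length (muxp (c i) (x i) (y i))).
Proof.
 eapply pb_le; [|apply pb_max; [apply (fam_pb x)|apply (fam_pb y)]].
 intros i. now rewrite muxp_length.
Qed.

Definition mmux c (x y : elt) : elt := Elt (fun i => muxp (c i) (x i) (y i)) (mmux_pb c x y).

Lemma mmin_pb (x y : elt) : pb (fun i => length (minp (x i) (y i))).
Proof.
 eapply pb_le; [|apply (fam_pb y)]. intros i. now rewrite minp_length.
Qed.

Definition mmin (x y : elt) : elt := Elt (fun i => minp (x i) (y i)) (mmin_pb x y).

Definition nz (x : elt) : nat -> pform := fun i => pdisj (x i).

Lemma mux_bit q c (x y : nat -> bits) k :
 peq q (fun i => nth_bit (muxp (c i) (x i) (y i)) (k i))
  (fun i => por (pand (c i) (nth_bit (x i) (k i))) (pand (pneg (c i)) (nth_bit (y i) (k i)))).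
Proof.
 apply prv_split with (fun i => k i < Nat.max (length (x i)) (length (y i))).
 - ptaut_on (unfold muxp; rewrite nth_bit_map by auto).
 - ptaut_on (rewrite !nth_bit_over by (rewrite ?muxp_length; lia)).
Qed.

Lemma mmux_true q c x y : prv q c -> meq q (mmux c x y) x.
Proof.
 intros H. apply meq_intro. intros k q' Hq _. apply (prv_sub Hq) in H.
 assert (A := mux_bit q' c x y k). cbn [fam mmux]. ptaut (H, A).
Qed.

Lemma mmux_false q c x y : prv q (fun i => pneg (c i)) -> meq q (mmux c x y) y.
Proof.
 intros H. apply meq_intro. intros k q' Hq _. apply (prv_sub Hq) in H.
 assert (A := mux_bit q' c x y k). cbn [fam mmux]. ptaut (H, A).
Qed.

#[global] Instance mmux_proper q : Proper (peq q ==> meq q ==> meq q ==> meq q) mmux.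
Proof.
 intros c c' H1 x x' H2 y y' H3. apply meq_intro. intros k q' Hq _.
 apply (prv_sub Hq) in H1. apply (meq_sub Hq), (fun H => meq_bit _ _ _ H k) in H2, H3.
 assert (A := mux_bit q' c x y k). assert (B := mux_bit q' c' x' y' k).
 cbn [fam mmux]. ptaut (H1, H2, H3, A, B).
Qed.

Lemma nz_bit q (x : elt) : (forall k q', sub q q' -> (forall i, live q' i -> k i < length (x i)) ->
  prv q' (fun i => pneg (nth_bit (x i) (k i)))) -> prv q (fun i => pneg (nz x i)).
Proof.
 intros H. apply prv_imp. extend q' S1.
 apply pdisj_elim with (l := x); [apply fam_pb|apply prv_hyp|].
 intros A q2 S2 HA HP.
 assert (HC : forall i, exists k, live q2 i -> k < length (x i) /\ A i = nth_bit (x i) k).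
 { intros i. destruct (classic (live q2 i)) as [Hi|Hi]; [|exists 0; tauto].
  apply (HA i) in Hi. apply (In_nth _ _ pbot) in Hi as (k & Hk & <-). exists k; auto. }
 apply (fun H => choice (fun i k => _) H) in HC as (k & HC).
 assert (B := H k q2 (sub_trans S1 S2) (fun i Hi => proj1 (HC i Hi))).
 puses (HP, B). ptaut_by (destruct (HC i Hi) as [_ ->]).
Qed.

Lemma nz_false q x : prv q (fun i => pneg (nz x i)) <-> meq q x mnil.
Proof.
 split; intros H.
 - apply meq_intro. intros k q' Hq Hk. apply (prv_sub Hq) in H.
  assert (A : prv q' (fun i => pneg (nth_bit (x i) (k i)))).
  { apply prv_imp. extend q2 S2.
   assert (B : prv q2 (fun i => pdisj (x i))).
   { apply pdisj_intro with (A := fun i => nth_bit (x i) (k i)); [apply fam_pb| |apply prv_hyp].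
    intros i Hi. apply nth_In. specialize (Hk i (live_sub S2 Hi)). simpl in Hk. lia. }
   apply (prv_sub S2) in H. unfold nz in H. ptaut (B, H). }
  puse A. ptaut_by (cbn [fam mnil]; rewrite (nth_bit_over []) by (simpl; lia)).
 - apply nz_bit. intros k q' Hq Hk. apply (meq_sub Hq), (fun H => meq_bit _ _ _ H k) in H.
  puse H. ptaut_by (cbn [fam mnil]; rewrite (nth_bit_over []) by (simpl; lia)).
Qed.

#[global] Instance nz_proper q : Proper (meq q ==> peq q) nz.
Proof.
 assert (G : forall q x y, meq q x y -> prv q (fun i => pimp (nz x i) (nz y i))).
 { intros q0 x y H.
  assert (E : prv q0 (fun i => pimp (pneg (nz y i)) (pneg (nz x i)))).
  { apply prv_imp. apply nz_false. set (q' := addc q0 _).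
   rewrite (meq_sub (sub_addc _ _ : sub q0 q') H). apply nz_false, prv_hyp. }
  ptaut E. }
 intros x y H. assert (A := G q x y H). assert (B := G q y x ltac:(now symmetry)).
 ptaut (A, B).
Qed.

Lemma nz_isc q x n : isc q x n -> (forall i, live q i -> n i <> 0%N) -> prv q (nz x).
Proof.
 intros H Hn. assert (L := isc_len_is _ _ _ H).
 assert (G : forall m, m <> 0%N -> N.size_nat m <> 0).
 { intros [|[p|p|]]; simpl; try discriminate; tauto. }
 apply len_top in L; [|intros i Hi; now apply G, Hn].
 apply prv_raa. extend q' S1.
 assert (E : meq q' x mnil) by apply nz_false, prv_hyp.
 apply (prv_sub S1) in L.
 apply meq_bit with (k := fun i => N.size_nat (n i) - 1) in E. puses (E, L).
 ptaut_by (cbn [fam mnil]; rewrite (nth_bit_over []) by (simpl; lia)).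
Qed.

Lemma nz_cases q x w : (forall q', sub q q' -> meq q' x mnil -> prv q' w) ->
 (forall q', sub q q' -> prv q' (nz x) -> prv q' w) -> prv q w.
Proof.
 intros H1 H2. apply prv_cases with (nz x).
 - apply H2; [apply sub_addc|apply prv_hyp].
 - apply H1; [apply sub_addc|]. apply nz_false, prv_hyp.
Qed.

Lemma firstn_bit (x : bits) n k : nth_bit (firstn n x) k = if k <? n then nth_bit x k else pbot.
Proof.
 unfold nth_bit. revert n k; induction x as [|a x IH]; intros [|n] [|k]; simpl; auto.
 - now destruct (_ <? _).
 - rewrite IH. refl.
Qed.

(** Cutting the minimum off at the length of [y] is harmless once the bits beyond it are refuted,
    which holds because the minimum is at most [y]. *)
Lemma mmin_over q (x y : elt) : (forall k q', sub q q' -> (forall i, live q' i -> length (y i) <= k i) ->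
   prv q' (fun i => pneg (nth_bit (mmux (fun i => lessp (x i) (y i)) x y i) (k i)))) ->
 meq q (mmin x y) (mmux (fun i => lessp (x i) (y i)) x y).
Proof.
 intros H. apply meq_intro. intros k q' Hq _.
 apply prv_split with (fun i => k i < length (y i)).
 - ptaut_on (cbn [fam mmin mmux]; unfold minp; rewrite firstn_bit; apply Nat.ltb_lt in Hi; rewrite Hi).
 - extend q1 S1.
  assert (A := H k q1 (sub_trans Hq S1) ltac:(split_case; lia)).
  puse A. ptaut_on (cbn [fam mmin mmux]; unfold minp; rewrite firstn_bit; apply Nat.ltb_nlt in Hi; rewrite Hi).
Qed.

Lemma mmin_lt q x y : lt_ q x y -> meq q (mmin x y) x.
Proof.
 intros H. assert (E : meq q (mmux (fun i => lessp (x i) (y i)) x y) x) by now apply mmux_true.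
 rewrite mmin_over; auto. intros k q' Hq Hk.
 apply (meq_sub Hq), (fun H => meq_bit _ _ _ H k) in E. apply (prv_sub Hq) in H.
 assert (A := le_bit_over q' x y k (lt_le _ _ _ H) Hk). ptaut (E, A).
Qed.

Lemma mmin_ge q x y : le_ q y x -> meq q (mmin x y) y.
Proof.
 intros H. assert (E : meq q (mmux (fun i => lessp (x i) (y i)) x y) y) by now apply mmux_false.
 rewrite mmin_over; auto. intros k q' Hq Hk.
 apply (meq_sub Hq), (fun H => meq_bit _ _ _ H k) in E. puse E.
 ptaut_by (rewrite (nth_bit_over (y i)) by (apply Hk; auto)).
Qed.

Lemma less_cases q (x y : elt) w : (forall q', sub q q' -> lt_ q' x y -> prv q' w) ->
 (forall q', sub q q' -> le_ q' y x -> prv q' w) -> prv q w.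
Proof.
 intros H1 H2. apply prv_cases with (fun i => lessp (x i) (y i)).
 - apply H1; [apply sub_addc|apply prv_hyp].
 - apply H2; [apply sub_addc|apply prv_hyp].
Qed.

Lemma mmin_le q x y : le_ q x y -> meq q (mmin x y) x.
Proof.
 intros H. unfold meq. apply (less_cases q x y); intros q' Hq H'; [now apply mmin_lt|].
 apply (prv_sub Hq) in H. change (meq q' (mmin x y) x). rewrite mmin_ge; auto.
 now apply le_antisym.
Qed.

#[global] Instance mmin_proper q : Proper (meq q ==> meq q ==> meq q) mmin.
Proof.
 intros x x' H1 y y' H2. unfold meq. apply (less_cases q x y); intros q' Hq H;
  apply (meq_sub Hq) in H1, H2; change (meq q' (mmin x y) (mmin x' y')).
 - rewrite (mmin_lt q' x y H). rewrite H1, H2 in H. now rewrite (mmin_lt q' x' y' H).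
 - rewrite (mmin_ge q' x y H). rewrite H1, H2 in H. now rewrite (mmin_ge q' x' y' H).
Qed.

Lemma isc_min q x y n m : isc q x n -> isc q y m -> isc q (mmin x y) (fun i => N.min (n i) (m i)).
Proof.
 intros H1 H2.
 assert (Hp : pbN (fun i => N.min (n i) (m i))).
 { eapply pb_le; [|exact (isc_pb H1)]. intros i. apply size_nat_mono. lia. }
 exists Hp. unfold meq. apply prv_split with (fun i => (n i <= m i)%N);
  match goal with |- prv ?q0 _ => change (meq q0 (mmin x y) (cst _ Hp)); set (q1 := q0) end;
  assert (S1 : sub q q1) by apply sub_restrict; apply (isc_sub S1) in H1, H2.
 - rewrite mmin_le by (apply (isc_le _ _ _ _ _ H1 H2); now split_case).
  apply (isc_agree H1 (isc_cst _ _ _)).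
  split_case. cbv beta. lia.
 - rewrite mmin_ge by (apply (isc_le _ _ _ _ _ H2 H1); split_case; lia).
  apply (isc_agree H2 (isc_cst _ _ _)).
  split_case. cbv beta. lia.
Qed.

(** A nonempty list may still represent 0. The multiplexer then passes on the value for the tail, so
    that leading zeros do not count as recursion steps. *)
Lemma rec_unfold q g h b (x : elt) ts :
 meq q (papp (Rec g h b) (x :: ts))
  (mmux (nz x) (mmin (papp h (papp (Rec g h b) (mtl x :: ts) :: x :: ts)) (papp b (x :: ts)))
    (papp (Rec g h b) (mtl x :: ts))).
Proof.
 unfold meq. apply prv_split with (fun i => x i = []);
  match goal with |- prv ?q0 _ =>
   change (meq q0 (papp (Rec g h b) (x :: ts)) (mmux (nz x)
    (mmin (papp h (papp (Rec g h b) (mtl x :: ts) :: x :: ts)) (papp b (x :: ts)))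
    (papp (Rec g h b) (mtl x :: ts)))); set (q1 := q0) end.
 - rewrite mmux_false.
  + apply meq_eq. split_case. cbn [fam papp args map mtl]. now rewrite Hi.
  + unfold nz. ptaut_on (rewrite Hi; cbn [pdisj fold_right]).
 - apply meq_eq. split_case. cbn [fam papp args map mtl mmux mmin].
  unfold nz. destruct (x i) as [|a l]; [tauto|]. rewrite ttrans_rec. refl.
Qed.

Lemma papp_meq_nil q g h b (x : elt) ts : (forall i, live q i -> x i = []) ->
 meq q (papp (Rec g h b) (x :: ts)) (papp g ts).
Proof. intros H. apply meq_eq. intros i Hi. cbn [fam papp args map]. now rewrite H. Qed.

Lemma Forall2_sub q q' es es' : sub q q' -> Forall2 (meq q) es es' -> Forall2 (meq q') es es'.
Proof. intros H. induction 1; constructor; auto. eapply meq_sub; eauto. Qed.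

Lemma papp_nth q es es' j : Forall2 (meq q) es es' -> meq q (nth j es mnil) (nth j es' mnil).
Proof.
 intros H. revert j. induction H; intros [|j]; simpl; auto; refl.
Qed.

Lemma args_nth es j i : nth j (args es i) [] = nth j es mnil i.
Proof. unfold args. change ([] : bits) with ((fun x : elt => x i) mnil) at 1. apply map_nth. Qed.

Lemma papp_proper p : forall q es es', Forall2 (meq q) es es' -> meq q (papp p es) (papp p es').
Proof.
 induction p as [j| |c| | | | | |f gs IHf IHgs|g h b IHg IHh IHb] using prog_nested_ind;
  intros q es es' H;
  assert (N0 := papp_nth q es es' 0 H); assert (N1 := papp_nth q es es' 1 H);
  assert (N2 := papp_nth q es es' 2 H).
 - transitivity (nth j es mnil); [apply meq_eq; intros i _; apply args_nth|].
  transitivity (nth j es' mnil); [now apply papp_nth|apply meq_eq; intros i _; symmetry; apply args_nth].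
 - now apply meq_eq.
 - transitivity (mcons (fun _ => pconst c) (nth 0 es mnil));
   [apply meq_eq; intros i _; cbn [fam papp ttrans mcons]; now rewrite args_nth|].
  rewrite N0. apply meq_eq; intros i _; cbn [fam papp ttrans mcons]; now rewrite args_nth.
 - transitivity (mtl (nth 0 es mnil));
   [apply meq_eq; intros i _; cbn [fam papp ttrans mtl]; now rewrite args_nth|].
  rewrite N0. apply meq_eq; intros i _; cbn [fam papp ttrans mtl]; now rewrite args_nth.
 - assert (E : forall es, meq q (papp Odd es) (mcons (fun i => nth_bit (nth 0 es mnil i) 0) mnil)).
  { intros l. apply meq_intro. intros k q' Hq _.
   assert (G : forall x k, nth_bit (firstn 1 x) k = nth_bit [nth_bit x 0] k).
   { intros [|a x] [|[|k0]]; refl. }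
   ptaut_by (cbn [fam papp ttrans mcons mnil]; rewrite args_nth, G). }
  rewrite !E. apply meq_cons; [|refl]. exact (meq_bit _ _ _ N0 (fun _ => 0)).
 - transitivity (mlen (nth 0 es mnil));
   [apply meq_eq; intros i _; cbn [fam papp ttrans mlen]; now rewrite args_nth|].
  rewrite N0. apply meq_eq; intros i _; cbn [fam papp ttrans mlen]; now rewrite args_nth.
 - transitivity (msmash (nth 0 es mnil) (nth 1 es mnil));
   [apply meq_eq; intros i _; cbn [fam papp ttrans msmash]; now rewrite !args_nth|].
  rewrite N0, N1. apply meq_eq; intros i _; cbn [fam papp ttrans msmash]; now rewrite !args_nth.
 - transitivity (mmux (nz (nth 0 es mnil)) (nth 1 es mnil) (nth 2 es mnil));
   [apply meq_eq; intros i _; unfold nz; cbn [fam papp ttrans mmux]; now rewrite !args_nth|].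
  rewrite N0, N1, N2. apply meq_eq; intros i _; unfold nz; cbn [fam papp ttrans mmux]; now rewrite !args_nth.
 - assert (E : forall es, meq q (papp (Comp f gs) es) (papp f (map (fun g => papp g es) gs))).
  { intros l. apply meq_eq. intros i _. cbn [fam papp ttrans]. f_equal. unfold args. now rewrite map_map. }
  rewrite !E. apply IHf. clear E. induction IHgs; simpl; constructor; auto.
 - destruct H as [|x x' ts ts' Hx Hts]; [now apply meq_eq|]. clear N0 N1 N2.
  change (meq q (papp (Rec g h b) (mskip (fun _ => 0) x :: ts)) (papp (Rec g h b) (mskip (fun _ => 0) x' :: ts'))).
  apply (meq_ind_down (fun i k => ttrans (Rec g h b) (skipn k (x i) :: args ts i))
   (fun i k => ttrans (Rec g h b) (skipn k (x' i) :: args ts' i))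
   (fun k => papp (Rec g h b) (mskip k x :: ts)) (fun k => papp (Rec g h b) (mskip k x' :: ts')) q
   (fun i => Nat.max (length (x i)) (length (x' i)))); try refl.
  + apply pb_max; apply fam_pb.
  + rewrite !papp_meq_nil by (intros i _; cbn [fam mskip]; apply skipn_all2; lia). now apply IHg.
  + intros k q' Hq Hk IH. apply (Forall2_sub _ _ _ _ Hq) in Hts.
   assert (Hs : meq q' (mskip k x) (mskip k x')).
   { apply meq_intro. intros j q2 Hq2 _.
    assert (E := meq_bit _ _ _ (meq_sub (sub_trans Hq Hq2) Hx) (fun i => k i + j i)).
    puse E. ptaut_by (cbn [fam mskip]; rewrite !nth_bit_skipn). }
   assert (T : forall x ts, meq q' (papp (Rec g h b) (mtl (mskip k x) :: ts)) (papp (Rec g h b) (mskip (fun i => S (k i)) x :: ts))).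
   { intros y l. apply meq_eq. intros i _. cbn [fam papp args map mtl mskip]. now rewrite tl_skipn. }
   assert (T' : meq q' (papp (Rec g h b) (mtl (mskip k x) :: ts)) (papp (Rec g h b) (mtl (mskip k x') :: ts'))).
   { etrans; [apply T|]. etrans; [exact IH|]. symmetry. apply T. }
   etrans; [apply rec_unfold|]. etrans; [|symmetry; apply rec_unfold].
   apply mmux_proper; [now apply nz_proper|apply mmin_proper|exact T'].
   * apply IHh. constructor; auto.
   * apply IHb. constructor; auto.
Qed.

Lemma papp_comp q f gs es : meq q (papp (Comp f gs) es) (papp f (map (fun g => papp g es) gs)).
Proof. apply meq_eq. intros i _. cbn [fam papp ttrans]. f_equal. unfold args. now rewrite map_map. Qed.

Lemma papp_proj q j es : meq q (papp (Proj j) es) (nth j es mnil).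
Proof. apply meq_eq. intros i _. apply args_nth. Qed.

Lemma papp_cond q es : meq q (papp Cond es) (mmux (nz (nth 0 es mnil)) (nth 1 es mnil) (nth 2 es mnil)).
Proof. apply meq_eq. intros i _. unfold nz. cbn [fam papp ttrans mmux]. now rewrite !args_nth. Qed.

Lemma papp_bit q b es : meq q (papp (Bit b) es) (mcons (fun _ => pconst b) (nth 0 es mnil)).
Proof. apply meq_eq. intros i _. cbn [fam papp ttrans mcons]. now rewrite args_nth. Qed.

Lemma papp_half q es : meq q (papp Half es) (mtl (nth 0 es mnil)).
Proof. apply meq_eq. intros i _. cbn [fam papp ttrans mtl]. now rewrite args_nth. Qed.

Lemma papp_odd q es : meq q (papp Odd es) (mcons (fun i => nth_bit (nth 0 es mnil i) 0) mnil).
Proof.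
 apply meq_intro. intros k q' Hq _.
 assert (G : forall x k, nth_bit (firstn 1 x) k = nth_bit [nth_bit x 0] k).
 { intros [|a x] [|[|k0]]; refl. }
 ptaut_by (cbn [fam papp ttrans mcons mnil]; rewrite args_nth, G).
Qed.

Lemma papp_len q es : meq q (papp Len es) (mlen (nth 0 es mnil)).
Proof. apply meq_eq. intros i _. cbn [fam papp ttrans mlen]. now rewrite args_nth. Qed.

Lemma papp_smash q es : meq q (papp Smash es) (msmash (nth 0 es mnil) (nth 1 es mnil)).
Proof. apply meq_eq. intros i _. cbn [fam papp ttrans msmash]. now rewrite !args_nth. Qed.

Lemma rec_zero q g h b x ts : meq q x mnil -> meq q (papp (Rec g h b) (x :: ts)) (papp g ts).
Proof.
 intros H. transitivity (papp (Rec g h b) (mnil :: ts)).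
 - apply papp_proper. constructor; auto. clear; induction ts; constructor; auto; refl.
 - now apply papp_meq_nil.
Qed.

Lemma rec_step q g h b x ts : prv q (nz x) ->
 meq q (papp (Rec g h b) (x :: ts))
  (mmin (papp h (papp (Rec g h b) (mtl x :: ts) :: x :: ts)) (papp b (x :: ts))).
Proof. intros H. rewrite rec_unfold. now apply mmux_true. Qed.

Lemma Forall2_isc_sub q q' es ns : sub q q' -> Forall2 (isc q) es ns -> Forall2 (isc q') es ns.
Proof. intros H. induction 1; constructor; auto. eapply isc_sub; eauto. Qed.

Definition vals (ns : list (nat -> N)) (i : nat) : list N := map (fun n => n i) ns.

Lemma vals_nth ns j i : nth j (vals ns i) 0%N = nth j ns (fun _ => 0%N) i.
Proof. unfold vals. change 0%N with ((fun n : nat -> N => n i) (fun _ => 0%N)) at 1. apply map_nth. Qed.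

Lemma isc_nth q es ns j : Forall2 (isc q) es ns -> isc q (nth j es mnil) (nth j ns (fun _ => 0%N)).
Proof. intros H. revert j. induction H; intros [|j]; simpl; auto using isc_nil. Qed.

Lemma run_pb q p es ns : Forall2 (isc q) es ns -> pbN (fun i => run p (vals ns i)).
Proof.
 intros H. assert (E : exists L, pb L /\ forall i x, In x (vals ns i) -> N.size_nat x <= L i).
 { induction H as [|x n es ns Hx _ (L & HL & IH)].
  - exists (fun _ => 0). split; [apply pb_const|]. intros i y [].
  - exists (fun i => N.size_nat (n i) + L i). split; [apply pb_add; auto; exact (isc_pb Hx)|].
   intros i y [<-|Hy]; [lia|]. specialize (IH i y Hy). lia. }
 destruct E as (L & HL & E). eapply pb_le; [|exact (outlen_pb p L HL)].
 intros i. apply run_size, E.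
Qed.

(** A program on constant arguments provably has the value computed by [run]. This settles all
    statements about the circuit and about [f1], [f2], whatever the programs of [f] are. *)
Theorem closed_run p : forall q es ns, Forall2 (isc q) es ns ->
 isc q (papp p es) (fun i => run p (vals ns i)).
Proof.
 induction p as [j| |c| | | | | |f gs IHf IHgs|g h b IHg IHh IHb] using prog_nested_ind;
  intros q es ns H; assert (Hp := fun p => run_pb q p es ns H);
  assert (N0 := isc_nth q es ns 0 H); assert (N1 := isc_nth q es ns 1 H);
  assert (N2 := isc_nth q es ns 2 H).
 - rewrite papp_proj. eapply isc_ext; [|apply (Hp (Proj j))|apply (isc_nth _ _ _ j H)].
  intros i _. symmetry. apply vals_nth.
 - eapply isc_meq; [|apply isc_nil]. now apply meq_eq.
 - rewrite papp_bit. eapply isc_ext; [|apply (Hp (Bit c))|apply (isc_cons _ (fun _ => c)); exact N0].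
  intros i _. cbn [run]. now rewrite vals_nth.
 - rewrite papp_half. eapply isc_ext; [|apply (Hp Half)|apply isc_tl; exact N0].
  intros i _. cbn [run]. now rewrite vals_nth.
 - rewrite papp_odd.
  assert (E : isc q (mcons (fun i => pconst (N.testbit (nth 0 ns (fun _ => 0%N) i) 0)) mnil)
   (fun i => 2 * 0 + N.b2n (N.testbit (nth 0 ns (fun _ => 0%N) i) 0))%N) by apply isc_cons, isc_nil.
  eapply isc_ext; [|apply (Hp Odd)|].
  2: { eapply isc_meq; [|exact E]. apply meq_cons; [|refl].
     exact (isc_bit _ _ _ (fun _ => 0) N0). }
  intros i _. cbn [run]. rewrite vals_nth, N.bit0_odd. now destruct (N.odd _).
 - rewrite papp_len. eapply isc_ext; [|apply (Hp Len)|apply isc_len; exact N0].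
  intros i _. cbn [run]. now rewrite vals_nth.
 - rewrite papp_smash. eapply isc_ext; [|apply (Hp Smash)|
   apply msmash_isc_of; [apply isc_len_is, N0|apply isc_len_is, N1|exact (isc_pb N0)|exact (isc_pb N1)]].
  intros i _. cbn [run]. rewrite !vals_nth, !size_size_nat. now rewrite Nat2N.inj_mul.
 - rewrite papp_cond. exists (Hp Cond). unfold meq.
  apply prv_split with (fun i => nth 0 ns (fun _ => 0%N) i = 0%N);
   match goal with |- prv ?q0 _ => change (meq q0 (mmux (nz (nth 0 es mnil)) (nth 1 es mnil) (nth 2 es mnil)) (cst _ (Hp Cond))); set (q1 := q0) end;
   assert (S1 : sub q q1) by apply sub_restrict; apply (isc_sub S1) in N0, N1, N2.
  + rewrite mmux_false.
   * apply (isc_agree N2 (isc_cst _ _ _)).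
    split_case. cbn [run]. rewrite !vals_nth, Hi. refl.
   * apply nz_false. eapply isc_unique; [|apply isc_nil]. eapply isc_ext; [|apply (pb_const 0)|exact N0].
    now split_case.
  + rewrite mmux_true.
   * apply (isc_agree N1 (isc_cst _ _ _)).
    split_case. cbn [run]. rewrite !vals_nth.
    destruct (N.eqb_spec (nth 0 ns (fun _ => 0%N) i) 0); tauto.
   * apply (nz_isc _ _ _ N0). now split_case.
 - rewrite papp_comp.
  assert (E : Forall2 (isc q) (map (fun g => papp g es) gs) (map (fun g i => run g (vals ns i)) gs)).
  { clear IHf Hp N0 N1 N2. induction IHgs; simpl; constructor; auto. }
  eapply isc_ext; [|apply (Hp (Comp f gs))|apply (IHf _ _ _ E)].
  intros i _. cbn [run]. f_equal. unfold vals. now rewrite map_map.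
 - destruct H as [|x n ts ms Hx Hts].
  { eapply isc_ext; [|apply (Hp (Rec g h b))|eapply isc_meq; [|apply (IHg q [] []); constructor]].
   - refl.
   - now apply meq_eq. }
  clear N0 N1 N2.
  assert (Hk : forall k, pbN (fun i => run (Rec g h b) (N.shiftr (n i) #(k i) :: vals ms i))).
  { intros k. exact (run_pb q (Rec g h b) _ _ (Forall2_cons _ _ (isc_skip _ k _ _ Hx) Hts)). }
  exists (Hp (Rec g h b)).
  change (meq q (papp (Rec g h b) (mskip (fun _ => 0) x :: ts)) (cst _ (Hk (fun _ => 0)))).
  apply (meq_ind_down (fun i k => ttrans (Rec g h b) (skipn k (x i) :: args ts i))
   (fun i k => bitsN (run (Rec g h b) (N.shiftr (n i) #k :: vals ms i)))
   (fun k => papp (Rec g h b) (mskip k x :: ts)) (fun k => cst _ (Hk k)) q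
   (fun i => length (x i) + N.size_nat (n i))); try refl.
  + apply pb_add; [apply fam_pb|exact (isc_pb Hx)].
  + rewrite papp_meq_nil by (intros i _; cbn [fam mskip]; apply skipn_all2; lia).
   eapply isc_unique; [apply (IHg _ _ _ Hts)|]. eapply isc_ext; [|exact (run_pb q g _ _ Hts)|apply isc_cst].
   intros i _. cbv beta. rewrite run_rec.
   replace (N.shiftr (n i) _) with 0%N; [refl|].
   symmetry. rewrite N.shiftr_div_pow2. apply N.div_small. apply size_nat_le. lia.
  + intros k q' Hq Hk' IH. apply (isc_sub Hq) in Hx. apply (Forall2_isc_sub _ _ _ _ Hq) in Hts.
   assert (Hz := isc_skip _ k _ _ Hx).
   assert (T : isc q' (papp (Rec g h b) (mtl (mskip k x) :: ts)) (fun i => run (Rec g h b) (N.shiftr (n i) (#(S (k i))) :: vals ms i))).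
   { exists (Hk (fun i => S (k i))). etrans; [|exact IH].
    apply meq_eq. intros i _. cbn [fam papp args map mtl mskip]. now rewrite tl_skipn. }
   etrans; [apply rec_unfold|].
   assert (D : forall i, N.shiftr (n i) (#(S (k i))) = N.div2 (N.shiftr (n i) #(k i))).
   { intros i. rewrite N.div2_spec, N.shiftr_shiftr, N.add_1_r. now rewrite Nat2N.inj_succ. }
   unfold meq. apply prv_split with (fun i => N.shiftr (n i) #(k i) = 0%N);
   match goal with |- prv ?q0 _ => change (meq q0 (mmux (nz (mskip k x)) (mmin (papp h (papp (Rec g h b) (mtl (mskip k x) :: ts) :: mskip k x :: ts)) (papp b (mskip k x :: ts))) (papp (Rec g h b) (mtl (mskip k x) :: ts))) (cst _ (Hk k))); set (q1 := q0) end;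
   assert (S1 : sub q' q1) by apply sub_restrict; apply (isc_sub S1) in Hz, T;
   apply (Forall2_isc_sub _ _ _ _ S1) in Hts.
   * rewrite mmux_false.
    { apply (isc_agree T (isc_cst _ _ _)).
     split_case. cbv beta. rewrite D, Hi. refl. }
    { apply nz_false. eapply isc_unique; [|apply isc_nil]. eapply isc_ext; [|apply (pb_const 0)|exact Hz].
     now split_case. }
   * rewrite mmux_true by (apply (nz_isc _ _ _ Hz); now split_case).
    assert (A := IHh q1 _ _ (Forall2_cons _ _ T (Forall2_cons _ _ Hz Hts))).
    assert (B := IHb q1 _ _ (Forall2_cons _ _ Hz Hts)).
    apply (isc_agree (isc_min _ _ _ _ _ A B) (isc_cst _ _ _)).
    split_case. cbv beta. rewrite run_rec, <- D.
    destruct (N.eqb_spec (N.shiftr (n i) #(k i)) 0); [tauto|]. refl.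
Qed.
End Programs.

(** * Forcing bounded arithmetic *)

Fixpoint term_nested_ind (P : term -> Prop)
 (Hv : forall i, P (tvar i)) (H0 : P tzero) (HS : forall t, P t -> P (tsucc t))
 (Ha : forall t u, P t -> P u -> P (tadd t u)) (Hm : forall t u, P t -> P u -> P (tmul t u))
 (Hh : forall t, P t -> P (thalf t)) (Hl : forall t, P t -> P (tlen t))
 (Hs : forall t u, P t -> P u -> P (tsmash t u))
 (Hp : forall p ts, Forall P ts -> P (tapp p ts)) (t : term) : P t :=
 let F := term_nested_ind P Hv H0 HS Ha Hm Hh Hl Hs Hp in
 match t with
 | tvar i => Hv i
 | tzero => H0
 | tsucc t => HS t (F t)
 | tadd t u => Ha t u (F t) (F u)
 | tmul t u => Hm t u (F t) (F u)
 | thalf t => Hh t (F t)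
 | tlen t => Hl t (F t)
 | tsmash t u => Hs t u (F t) (F u)
 | tapp p ts => Hp p ts ((fix G (l : list term) : Forall P l :=
   match l with [] => Forall_nil P | t :: l => Forall_cons t (F t) (G l) end) ts)
 end.

Section Forcing.
Context {SC : Scale}.

Definition env := nat -> elt.
Definition scons (x : elt) (r : env) : env := fun i => match i with 0 => x | S i => r i end.

Fixpoint tv (r : env) (t : term) : elt :=
 match t with
 | tvar i => r i
 | tzero => mnil
 | tsucc t => msucc (tv r t)
 | tadd t u => madd fbot_ (tv r t) (tv r u)
 | tmul t u => mmul (tv r t) (tv r u)
 | thalf t => mtl (tv r t)
 | tlen t => mlen (tv r t)
 | tsmash t u => msmash (tv r t) (tv r u)
 | tapp p ts => papp p (map (tv r) ts)
 end.

Definition bad (q : cond) : Prop := prv q (fun _ => pbot).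

(** Forcing with a built-in double-negation translation. A condition with short derivations of
    [pbot] forces absurdity, rather than being excluded, and disjunction and existence say that
    their refutation would make the condition bad. Classical logic is sound for this reading. *)
Fixpoint force (q : cond) (r : env) (A : form) : Prop :=
 match A with
 | feq t u => meq q (tv r t) (tv r u)
 | fle t u => le_ q (tv r t) (tv r u)
 | fbot => bad q
 | fimp A B => forall q', sub q q' -> force q' r A -> force q' r B
 | fand A B => force q r A /\ force q r B
 | for_ A B => forall q', sub q q' ->
   (forall q2, sub q' q2 -> force q2 r A -> bad q2) ->
   (forall q2, sub q' q2 -> force q2 r B -> bad q2) -> bad q'
 | fall A => forall x, force q (scons x r) A
 | fex A => forall q', sub q q' ->
   (forall x q2, sub q' q2 -> force q2 (scons x r) A -> bad q2) -> bad q'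
 end.

Lemma bad_sub q q' : sub q q' -> bad q -> bad q'.
Proof. apply prv_sub. Qed.

Lemma force_sub A : forall q q' r, sub q q' -> force q r A -> force q' r A.
Proof.
 induction A; simpl; intros q q' r Hq H.
 - eapply meq_sub; eauto.
 - eapply prv_sub; eauto.
 - eapply bad_sub; eauto.
 - intros q2 H2. apply H. eapply sub_trans; eauto.
 - destruct H; eauto.
 - intros q2 H2. apply H. eapply sub_trans; eauto.
 - intros x. eauto.
 - intros q2 H2. apply H. eapply sub_trans; eauto.
Qed.

(** The atomic case of stability: the negation of [w] is itself added as an axiom. This uses that
    conditions may be extended by arbitrary families of formulas. *)
Lemma prv_stable q w : (forall q', sub q q' -> (forall q2, sub q' q2 -> prv q2 w -> bad q2) -> bad q') ->
 prv q w.
Proof.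
 intros H. apply prv_raa. apply H; [apply sub_addc|]. intros q2 S2 H2.
 assert (N := prv_sub S2 (prv_hyp q (fun i => pneg (w i)))). unfold bad. ptaut (H2, N).
Qed.

(** Every formula is stable under double negation. Hence reductio ad absurdum is sound, and the weak
    disjunction and existential quantifier still admit their elimination rules. *)
Lemma force_stable A : forall q r,
 (forall q', sub q q' -> (forall q2, sub q' q2 -> force q2 r A -> bad q2) -> bad q') -> force q r A.
Proof.
 induction A as [t u|t u| |A IHA B IHB|A IHA B IHB|A IHA B IHB|A IHA|A IHA]; simpl; intros q r H.
 - now apply prv_stable.
 - now apply prv_stable.
 - apply H; [apply sub_refl|]. auto.
 - intros q1 H1 HA. apply IHB. intros q2 H2 HB. apply H; [eapply sub_trans; eauto|].
  intros q3 H3 HAB. apply (HB q3 H3). apply HAB; [apply sub_refl|].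
  eapply force_sub; [|exact HA]. eapply sub_trans; eauto.
 - split; [apply IHA|apply IHB]; intros q1 H1 HA; apply H; auto; intros q2 H2 [H3 H4]; auto.
 - intros q1 H1 HA HB. apply H; auto. intros q2 H2 H3. apply H3; [apply sub_refl| |];
   intros q3 H4; [apply HA|apply HB]; eapply sub_trans; eauto.
 - intros x. apply IHA. intros q1 H1 HA. apply H; auto.
 - intros q1 H1 HA. apply H; auto. intros q2 H2 H3. apply H3; [apply sub_refl|].
  intros x q3 H4. apply HA. eapply sub_trans; eauto.
Qed.

Lemma bad_force A q r : bad q -> force q r A.
Proof. intros H. apply force_stable. intros q' H' _. eapply bad_sub; eauto. Qed.

Lemma tv_proper t q r r' : (forall v, meq q (r v) (r' v)) -> meq q (tv r t) (tv r' t).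
Proof.
 intros H. induction t using term_nested_ind; simpl; auto.
 - refl.
 - now rewrite IHt.
 - now rewrite IHt1, IHt2.
 - now rewrite IHt1, IHt2.
 - now rewrite IHt.
 - now rewrite IHt.
 - now rewrite IHt1, IHt2.
 - apply papp_proper. induction H0; simpl; constructor; auto.
Qed.

Lemma force_proper A : forall q (r r' : env), (forall v, meq q (r v) (r' v)) -> force q r A -> force q r' A.
Proof.
 assert (SY : forall q (r r' : env), (forall v, meq q (r v) (r' v)) -> forall v, meq q (r' v) (r v)).
 { intros q r r' H v. symmetry. apply H. }
 assert (SU : forall q q' (r r' : env), sub q q' -> (forall v, meq q (r v) (r' v)) -> forall v, meq q' (r v) (r' v)).
 { intros q q' r r' Hq H v. eapply meq_sub; eauto. }
 assert (SC' : forall q x (r r' : env), (forall v, meq q (r v) (r' v)) -> forall v, meq q (scons x r v) (scons x r' v)).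
 { intros q x r r' H [|v]; simpl; [refl|apply H]. }
 induction A as [t u|t u| |A IHA B IHB|A IHA B IHB|A IHA B IHB|A IHA|A IHA]; simpl; intros q r r' E H.
 - rewrite <- !(tv_proper _ q r r' E). exact H.
 - rewrite <- !(tv_proper _ q r r' E). exact H.
 - exact H.
 - intros q' Hq HA. apply (IHB q' r r'); [eauto|]. apply H; [auto|]. apply (IHA q' r' r); eauto.
 - destruct H; eauto.
 - intros q' Hq HA HB. apply H; auto; intros q2 H2 H3; [apply HA|apply HB]; auto;
   [apply (IHA q2 r r')|apply (IHB q2 r r')]; eauto using sub_trans.
 - intros x. apply (IHA q (scons x r)); auto.
 - intros q' Hq HA. apply H; auto. intros x q2 H2 H3. apply (HA x q2 H2).
  apply (IHA q2 (scons x r)); eauto using sub_trans.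
Qed.

Lemma tv_subst t r s : tv r (tsubst s t) = tv (fun i => tv r (s i)) t.
Proof.
 induction t using term_nested_ind; simpl; congruence || auto.
 f_equal. rewrite map_map. induction H; simpl; congruence.
Qed.

Lemma force_ext A q r r' : (forall v, r v = r' v) -> force q r A -> force q r' A.
Proof. intros H. apply force_proper. intros v. now rewrite H. Qed.

Lemma force_subst A : forall q r s, force q r (fsubst s A) <-> force q (fun i => tv r (s i)) A.
Proof.
 assert (U : forall x r s v, tv (scons x r) (up s v) = scons x (fun i => tv r (s i)) v).
 { intros x r s [|v]; simpl; auto. unfold tlift. now rewrite tv_subst. }
 induction A as [t u|t u| |A IHA B IHB|A IHA B IHB|A IHA B IHB|A IHA|A IHA]; simpl; intros q r s.
 - now rewrite !tv_subst.
 - now rewrite !tv_subst.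
 - refl.
 - split; intros H q' Hq HA; apply IHB, H, IHA; auto.
 - now rewrite IHA, IHB.
 - split; intros H q' Hq HA HB; apply H; auto; intros q2 H2 H3; [apply HA|apply HB|apply HA|apply HB]; auto;
   now (apply IHA || apply IHB).
 - split; intros H x; specialize (H x).
  + apply IHA in H. eapply force_ext; [|exact H]. apply U.
  + apply IHA. eapply force_ext; [|exact H]. intros v. symmetry. apply U.
 - split; intros H q' Hq HA; apply H; auto; intros x q2 H2 H3; apply (HA x q2 H2).
  + apply IHA in H3. eapply force_ext; [|exact H3]. apply U.
  + apply IHA. eapply force_ext; [|exact H3]. intros v. symmetry. apply U.
Qed.

Lemma force_lift A q x r : force q (scons x r) (flift A) <-> force q r A.
Proof. unfold flift. rewrite force_subst. refl. Qed.

Lemma force_inst A q r t : force q r (inst t A) <-> force q (scons (tv r t) r) A.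
Proof.
 unfold inst. rewrite force_subst. split; apply force_ext; intros [|v]; refl.
Qed.

Theorem soundness (T : form -> Prop) G A : prove T G A ->
 (forall A, T A -> forall q r, force q r A) ->
 forall q r, (forall B, In B G -> force q r B) -> force q r A.
Proof.
 intros H HT.
 assert (CS : forall (G : list form) q q' r A, sub q q' -> (forall B, In B G -> force q r B) -> force q' r A ->
  forall B, In B (A :: G) -> force q' r B).
 { intros G0 q q' r A0 Hq HG HA B [<-|HB]; auto. eapply force_sub; eauto. }
 induction H as [G A HA|G A HA|G A B _ IH|G A B _ IH1 _ IH2|G A B _ IH1 _ IH2|G A B _ IH|G A B _ IH
  |G A B _ IH|G A B _ IH|G A B C _ IH1 _ IH2 _ IH3|G A _ IH|G A _ IH|G A t _ IH|G A t _ IH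
  |G A B _ IH1 _ IH2|G t|G A t u _ IH1 _ IH2]; intros q r HG.
 - auto.
 - now apply HT.
 - intros q' Hq HA. apply IH. eapply CS; eauto.
 - exact (IH1 q r HG q (sub_refl q) (IH2 q r HG)).
 - exact (conj (IH1 q r HG) (IH2 q r HG)).
 - apply (IH q r HG).
 - apply (IH q r HG).
 - intros q' Hq HA HB. exact (HA q' (sub_refl q') (force_sub _ _ _ _ Hq (IH q r HG))).
 - intros q' Hq HA HB. exact (HB q' (sub_refl q') (force_sub _ _ _ _ Hq (IH q r HG))).
 - apply force_stable. intros q' Hq HC. apply (IH1 q r HG q' Hq); intros q2 H2 HA; apply (HC q2 H2).
  + apply IH2. exact (CS G q q2 r A (sub_trans Hq H2) HG HA).
  + apply IH3. exact (CS G q q2 r B (sub_trans Hq H2) HG HA).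
 - apply force_stable. intros q' Hq HA. apply (IH q' r). eapply CS; eauto.
 - intros x. apply IH. intros B HB. apply in_map_iff in HB as (C & <- & HC).
  apply force_lift. auto.
 - apply force_inst. apply (IH q r HG).
 - intros q' Hq HA. apply (HA (tv r t) q' (sub_refl _)). apply force_inst.
  eapply force_sub; [exact Hq|auto].
 - apply force_stable. intros q' Hq HB. apply (IH1 q r HG q' Hq). intros x q2 H2 HA.
  apply (HB q2 H2). apply (force_lift B q2 x). apply IH2. intros C [<-|HC]; auto.
  apply in_map_iff in HC as (D & <- & HD). apply force_lift.
  eapply force_sub; [exact (sub_trans Hq H2)|auto].
 - simpl. refl.
 - apply force_inst. assert (E := IH1 q r HG). simpl in E. assert (HA := IH2 q r HG).
  apply force_inst in HA. eapply force_proper; [|exact HA]. intros [|v]; simpl; auto. refl.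
Qed.

(** ** The axioms *)

Lemma mdbl q (x : elt) : meq q (mmul (msucc (msucc mnil)) x) (mcons fbot_ x).
Proof.
 assert (E : meq q (msucc (msucc mnil)) (mcons fbot_ (mcons ftop_ mnil))).
 { assert (H := isc_succ _ _ _ (isc_succ _ _ _ (isc_nil q))).
  assert (H' := isc_cons _ (fun _ => false) _ _ (isc_cons _ (fun _ => true) _ _ (isc_nil q))).
  eapply isc_unique; [exact H|]. eapply isc_ext; [|exact (isc_pb H)|exact H']. refl. }
 rewrite E, !mmul_cons, mmul_nil.
 rewrite (mscal_bot q fbot_ x), (mscal_top q ftop_ x), mcons_bot_nil, madd_0, madd_0l; [refl| |];
  unfold ftop_, fbot_; ptaut.
Qed.

Lemma msucc_dbl q (x : elt) : meq q (msucc (mcons fbot_ x)) (mcons ftop_ x).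
Proof.
 unfold msucc. rewrite madd_unfold. apply meq_cons.
 - ptaut_by (cbn [fam mcons mnil]; nth_cons; unfold fbot_, ftop_, nth_bit; cbn [nth]).
 - transitivity (madd fbot_ x mnil); [|apply madd_0]. apply madd_proper; [|now apply meq_eq|now apply meq_eq].
  ptaut_by (cbn [fam mcons mnil]; nth_cons; unfold fbot_, ftop_, nth_bit; cbn [nth]).
Qed.

Lemma le_succ q (x : elt) : lt_ q x (msucc x).
Proof. apply lt_succ_le, le_refl. Qed.

Lemma lt_bad q (x : elt) : lt_ q x x -> bad q.
Proof. intros H. assert (E := less_irrefl q x). unfold lt_, bad in *. ptaut (H, E). Qed.

Lemma le_lt_bad q (x y : elt) : le_ q x y -> lt_ q y x -> bad q.
Proof. intros H E. unfold lt_, le_, bad in *. ptaut (H, E). Qed.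

Lemma le_neq_lt q (x y : elt) : le_ q x y -> (forall q', sub q q' -> meq q' x y -> bad q') -> lt_ q x y.
Proof.
 intros H N. apply (less_cases q x y); intros q' Hq H'; auto.
 apply prv_bot, N; auto. apply le_antisym; auto. eapply prv_sub; eauto.
Qed.

Lemma neq_nz q (x : elt) : (forall q', sub q q' -> meq q' x mnil -> bad q') -> prv q (nz x).
Proof.
 intros N. apply (nz_cases q x); intros q' Hq H'; auto. apply prv_bot. now apply N.
Qed.

Lemma nz_nil_bad q (x : elt) : prv q (nz x) -> meq q x mnil -> bad q.
Proof. intros H E. apply nz_false in E. unfold bad. ptaut (H, E). Qed.

Lemma isc_neq_bad q x n m : isc q x n -> isc q x m -> (forall i, live q i -> n i <> m i) -> bad q.
Proof.
 intros H1 H2 N.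
 assert (G : forall q, (forall i, live q i -> (n i < m i)%N) -> isc q x n -> isc q x m -> bad q).
 { intros q0 Hl E1 E2. apply (lt_bad q0 x). now apply (isc_lt q0 x x n m). }
 assert (G' : forall q, (forall i, live q i -> (m i < n i)%N) -> isc q x n -> isc q x m -> bad q).
 { intros q0 Hl E1 E2. apply (lt_bad q0 x). now apply (isc_lt q0 x x m n). }
 apply prv_split with (fun i => (n i < m i)%N); [apply G|apply G'];
  try (eapply isc_sub; [apply sub_restrict|assumption]);
  intros i Hi; assert (K := N i (live_sub (sub_restrict _ _) Hi)); apply live_restrict in Hi; auto. lia.
Qed.

Lemma len_pb (x : elt) a : (forall i, a i <= length (x i)) -> pb a.
Proof. intros H. eapply pb_le; [exact H|apply fam_pb]. Qed.

Lemma len_decide_nz q (x : elt) w : prv q (nz x) ->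
 (forall a q', sub q q' -> pb a -> (forall i, live q' i -> a i <> 0) ->
   prv q' (fun i => len_is (x i) (a i)) -> prv q' w) -> prv q w.
Proof.
 intros Hz H. apply (len_decide q x). intros a q' Hq Ha L.
 apply prv_split with (fun i => a i <> 0);
  extend q1 S1;
  apply (prv_sub S1) in L.
 - apply (H a); auto; [eapply sub_trans; eauto|now apply (len_pb x)|].
  now split_case.
 - apply prv_bot. apply (nz_nil_bad q1 x); [eapply prv_sub; [|exact Hz]; eapply sub_trans; eauto|].
  apply nz_false, nz_bit. intros k q2 S2 Hk. apply (prv_sub S2) in L.
  apply (len_over _ _ _ k L). intros i Hi.
  assert (K := live_restrict _ _ _ (live_sub S2 Hi)). cbv beta in K. lia.
Qed.

Lemma len_cons q b (x : elt) a : prv q (fun i => len_is (x i) (a i)) -> (forall i, live q i -> a i <> 0) ->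
 prv q (fun i => len_is (mcons b x i) (S (a i))).
Proof.
 intros L Ha. apply len_intro.
 - extend q1 S1.
  apply (prv_sub S1) in L. apply len_top in L; [|intros i Hi; apply Ha; eapply live_sub; eauto].
  puse L. ptaut_by (rewrite Nat.sub_succ, Nat.sub_0_r; cbn [fam mcons]; assert (K := Ha i (live_sub S1 Hi)); destruct (a i) as [|c]; [tauto|]; nth_cons; rewrite Nat.sub_succ, Nat.sub_0_r).
 - intros k q' Hq Hk. apply (prv_sub Hq) in L.
  apply len_over with (k := fun i => k i - 1) in L; [|intros i Hi; specialize (Hk i Hi); lia].
  puse L. ptaut_by (specialize (Hk i Hi); cbn [fam mcons]; destruct (k i) as [|c]; [lia|]; nth_cons; rewrite Nat.sub_succ, Nat.sub_0_r).
Qed.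

Lemma len_tl q (x : elt) a : prv q (fun i => len_is (x i) (a i)) -> (forall i, live q i -> a i <> 0) ->
 prv q (fun i => len_is (mtl x i) (a i - 1)).
Proof.
 intros L Ha. apply len_intro.
 - extend q1 S1.
  apply (prv_sub S1) in L. apply len_top in L; [|intros i Hi; apply Ha; eapply live_sub; eauto].
  puse L. ptaut_on (cbn [fam mtl]; rewrite nth_bit_tl; replace (S (a i - 1 - 1)) with (a i - 1) by lia).
 - intros k q' Hq Hk. apply (prv_sub Hq) in L.
  apply len_over with (k := fun i => S (k i)) in L; [|intros i Hi; specialize (Hk i Hi); lia].
  puse L. ptaut_by (cbn [fam mtl]; rewrite nth_bit_tl).
Qed.

Definition mtake (k : nat -> nat) (x : elt) : elt.
Proof.
 refine (Elt (fun i => firstn (k i) (x i)) _).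
 eapply pb_le; [|apply (fam_pb x)]. intros i. cbv beta. rewrite length_firstn. lia.
Defined.

Lemma mtake_len q (x : elt) a : prv q (fun i => len_is (x i) (a i)) -> meq q x (mtake a x).
Proof.
 intros L. apply meq_intro. intros k q' Hq _. apply (prv_sub Hq) in L.
 apply prv_split with (fun i => k i < a i).
 - ptaut_by (apply live_restrict, Nat.ltb_lt in Hi; cbn [fam mtake]; rewrite firstn_bit, Hi).
 - extend q1 S1. apply (prv_sub S1) in L.
  apply len_over with (k := k) in L; [|split_case; lia]. puse L.
  ptaut_by (apply live_restrict, Nat.ltb_nlt in Hi; cbn [fam mtake]; rewrite firstn_bit, Hi).
Qed.

(** Once both lengths are definite, [y] equals its truncation. If [x] were longer, its top bit would
    lie above that truncation, contradicting [x <= y]. *)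
Lemma le_len q (x y : elt) : le_ q x y -> le_ q (mlen x) (mlen y).
Proof.
 intros H. apply (len_decide q x). intros a q1 H1 Ha L1. apply (len_decide q1 y). intros b q2 H2 Hb L2.
 apply (prv_sub H2) in L1. apply (prv_sub (sub_trans H1 H2)) in H.
 apply prv_split with (fun i => a i <= b i); extend q3 S3; apply (prv_sub S3) in L1, L2, H.
 - apply (isc_le q3 (mlen x) (mlen y) (fun i => #(a i)) (fun i => #(b i))).
  + apply mlen_isc_of; auto. now apply (len_pb x).
  + apply mlen_isc_of; auto. now apply (len_pb y).
  + split_case. lia.
 - apply prv_bot. fold (le_ q3 x y) in H. rewrite (mtake_len q3 y b L2) in H.
  apply le_bit_over with (k := fun i => a i - 1) in H.
  + apply len_top in L1; [ptaut (H, L1)|]. split_case. lia.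
  + split_case. cbn [fam mtake]. rewrite length_firstn. lia.
Qed.

(** From [z < y] follows [x * z + x <= x * y], which is strictly above [x * z] since [x] is
    positive. *)
Lemma mmul_le q (x y z : elt) : lt_ q mnil x -> (le_ q (mmul x y) (mmul x z) <-> le_ q y z).
Proof.
 assert (M : forall q c u v x, meq q (mmul x (madd c u v)) (madd fbot_ (madd fbot_ (mmul x u) (mmul x v)) (mscal c x))).
 { intros q0 c u v w. rewrite mmul_comm, mmul_add_l. now rewrite (mmul_comm q0 u), (mmul_comm q0 v). }
 assert (G : forall q x y z, le_ q y z -> le_ q (mmul x y) (mmul x z)).
 { intros q0 u v w H. apply le_sub in H. rewrite <- H, M, (mscal_bot q0 fbot_ u), madd_0 by (unfold fbot_; ptaut).
  apply le_add_r. }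
 intros Hx. split; auto. intros H.
 apply (less_cases q z y); intros q' Hq H'; [|exact H'].
 apply (prv_sub Hq) in Hx, H. apply prv_bot.
 apply (le_lt_bad q' (mmul x y) (mmul x z) H). apply lt_succ_le in H', Hx. apply lt_succ_le.
 apply le_trans with (mmul x (msucc z)); [|now apply G].
 unfold msucc at 2. rewrite M, mmul_nil_r, madd_0, mscal_top by (unfold ftop_; ptaut).
 assert (E : meq q' (msucc (mmul x z)) (madd fbot_ (mmul x z) (msucc mnil))).
 { unfold msucc. rewrite <- (madd_0 q' (mmul x z)) at 1. apply madd_assoc. unfold fbot_, ftop_. ptaut. }
 rewrite E. apply le_add. exact Hx.
Qed.

(** The axioms on length and smash become identities between actual numbers after the lengths have
    been fixed by [len_decide]. The others are the laws of addition, multiplication and order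
    verified above. *)
Lemma force_basic A : BASIC A -> forall q r, force q r A.
Proof.
 destruct 1; intros q r; cbn [force fiff fneg tdbl ttwo tone tv];
  repeat match goal with t : term |- _ => let e := fresh t "0" in set (e := tv r t) in *; clearbody e; clear t end.
 - intros q1 _ H. eapply le_trans; [exact H|]. apply lt_le, le_succ.
 - intros q1 _ H. apply (lt_bad q1 x0). rewrite H at 2. apply le_succ.
 - apply less_zero.
 - split; intros q1 _.
  + intros [H1 H2]. apply lt_succ_le. now apply le_neq_lt.
  + intros H. apply lt_succ_le in H. split; [now apply lt_le|]. intros q2 Hq E.
   apply (prv_sub Hq) in H. apply (lt_bad q2 x0). unfold lt_ in *. fold (lt_ q2 x0 y0) in H.
   fold (lt_ q2 x0 x0). rewrite E at 2. exact H.
 - intros q1 _ H q2 H2 E. apply H; auto. rewrite mdbl in E.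
  transitivity (mtl (mcons fbot_ x0)); [now apply meq_eq|]. rewrite E. now apply meq_eq.
 - intros q1 _ H1 H2. apply (less_cases q1 x0 y0); intros q2 Hq H.
  + apply H2; auto. now apply lt_le.
  + apply H1; auto.
 - intros q1 _ [H1 H2]. now apply le_antisym.
 - intros q1 _ [H1 H2]. eapply le_trans; eauto.
 - eapply isc_unique; [apply isc_len, isc_nil|apply isc_nil].
 - intros q1 _ H. apply neq_nz in H. rewrite mdbl.
  assert (G : forall b, meq q1 (mlen (mcons b x0)) (msucc (mlen x0))).
  { intros b. unfold meq. apply (len_decide_nz q1 x0 _ H). intros a q2 H2 Ha Hz L.
   assert (E1 := mlen_isc_of _ _ _ (len_cons q2 b x0 a L Hz) (pb_S _ Ha)).
   apply (isc_agree E1 (isc_succ _ _ _ (mlen_isc_of _ _ _ L Ha))).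
   intros i _. cbv beta. lia. }
  split; [apply G|]. rewrite msucc_dbl. apply G.
 - assert (H := isc_succ _ _ _ (isc_nil q)).
  eapply isc_unique; [apply isc_len; exact H|exact H].
 - intros q1 _ H. now apply le_len.
 - unfold meq. apply (len_decide q x0). intros a q1 H1 Ha L1. apply (len_decide q1 y0). intros b q2 H2 Hb L2.
  apply (prv_sub H2) in L1. apply len_pb in Ha, Hb.
  assert (E1 := isc_succ _ _ _ (isc_mul _ _ _ _ _ (mlen_isc_of _ _ _ L1 Ha) (mlen_isc_of _ _ _ L2 Hb))).
  apply (isc_agree (isc_len _ _ _ (msmash_isc_of _ _ _ _ _ L1 L2 Ha Hb)) E1).
  intros i _. cbv beta. rewrite size_size_nat, size_nat_pow2. lia.
 - unfold meq. apply (len_decide q y0). intros b q2 H2 Hb L2. apply len_pb in Hb.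
  apply (isc_agree (msmash_isc_of q2 mnil y0 (fun _ => 0) b (isc_len_is _ _ _ (isc_nil q2)) L2 (pb_const 0) Hb)
   (isc_succ _ _ _ (isc_nil q2))). refl.
 - intros q1 _ H. apply neq_nz in H. rewrite !mdbl, msucc_dbl.
  assert (One : forall q, isc q (msucc mnil) (fun _ => 1%N)) by (intros q0; exact (isc_succ _ _ _ (isc_nil q0))).
  assert (G : forall b, meq q1 (msmash (msucc mnil) (mcons b x0)) (mcons fbot_ (msmash (msucc mnil) x0))).
  { intros b. unfold meq. apply (len_decide_nz q1 x0 _ H). intros a q2 H2 Ha Hz L.
   assert (E1 := msmash_isc_of q2 (msucc mnil) _ (fun _ => 1) _ (isc_len_is _ _ _ (One q2))
    (len_cons q2 b x0 a L Hz) (pb_const 1) (pb_S _ Ha)).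
   assert (E2 := isc_cons q2 (fun _ => false) _ _ (msmash_isc_of q2 (msucc mnil) _ (fun _ => 1) _ (isc_len_is _ _ _ (One q2))
    L (pb_const 1) Ha)).
   apply (isc_agree E1 E2).
   intros i _. cbv beta. rewrite !Nat.mul_1_l, Nat2N.inj_succ, N.pow_succ_r'. simpl N.b2n. lia. }
  split; apply G.
 - unfold meq. apply (len_decide q x0). intros a q1 H1 Ha L1. apply (len_decide q1 y0). intros b q2 H2 Hb L2.
  apply (prv_sub H2) in L1. apply len_pb in Ha, Hb.
  assert (E1 := msmash_isc_of q2 x0 y0 a b L1 L2 Ha Hb). assert (E2 := msmash_isc_of q2 y0 x0 b a L2 L1 Hb Ha).
  apply (isc_agree E1 E2).
  intros i _. cbv beta. now rewrite Nat.mul_comm.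
 - intros q1 _ H. unfold meq. apply (len_decide q1 x0). intros a q2 H2 Ha L1. apply (len_decide q2 y0). intros b q3 H3 Hb L2.
  apply (len_decide q3 z0). intros c q4 H4 Hc L3.
  apply (prv_sub (sub_trans H3 H4)) in L1. apply (prv_sub H4) in L2.
  apply (meq_sub (sub_trans H2 (sub_trans H3 H4))) in H. apply len_pb in Ha, Hb, Hc.
  assert (E1 := mlen_isc_of _ _ _ L1 Ha). assert (E2 := mlen_isc_of _ _ _ L2 Hb). rewrite <- H in E2.
  apply prv_split with (fun i => a i = b i); extend q5 S5.
  + apply (prv_sub S5) in L1, L2, L3.
   assert (F1 := msmash_isc_of q5 x0 z0 a c L1 L3 Ha Hc). assert (F2 := msmash_isc_of q5 y0 z0 b c L2 L3 Hb Hc).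
   apply (isc_agree F1 F2).
   split_case. cbv beta. now rewrite Hi.
  + apply prv_bot. apply (isc_neq_bad q5 (mlen x0) _ _ (isc_sub S5 E1) (isc_sub S5 E2)).
   split_case. lia.
 - intros q1 _ H. unfold meq. apply (len_decide q1 x0). intros a q2 H2 Ha L1. apply (len_decide q2 u0). intros b q3 H3 Hb L2.
  apply (len_decide q3 v0). intros c q4 H4 Hc L3. apply (len_decide q4 y0). intros d q5 H5 Hd L4.
  apply (prv_sub (sub_trans H3 (sub_trans H4 H5))) in L1.
  apply (prv_sub (sub_trans H4 H5)) in L2. apply (prv_sub H5) in L3.
  apply (meq_sub (sub_trans H2 (sub_trans H3 (sub_trans H4 H5)))) in H. apply len_pb in Ha, Hb, Hc, Hd.
  assert (E1 := mlen_isc_of _ _ _ L1 Ha).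
  assert (E2 := isc_add0 _ _ _ _ _ (mlen_isc_of _ _ _ L2 Hb) (mlen_isc_of _ _ _ L3 Hc)). rewrite <- H in E2.
  apply prv_split with (fun i => a i = b i + c i); extend q6 S6.
  + apply (prv_sub S6) in L1, L2, L3, L4.
   assert (F1 := msmash_isc_of q6 x0 y0 a d L1 L4 Ha Hd).
   assert (F2 := isc_mul _ _ _ _ _ (msmash_isc_of q6 u0 y0 b d L2 L4 Hb Hd) (msmash_isc_of q6 v0 y0 c d L3 L4 Hc Hd)).
   apply (isc_agree F1 F2).
   split_case. cbv beta. rewrite Hi, <- N.pow_add_r. f_equal. lia.
  + apply prv_bot. apply (isc_neq_bad q6 (mlen x0) _ _ (isc_sub S6 E1) (isc_sub S6 E2)).
   split_case. lia.
 - apply le_add_r.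
 - intros q1 _ [H1 H2]. assert (H := le_neq_lt q1 _ _ H1 H2).
  assert (E : lt_ q1 (mcons ftop_ x0) (mcons fbot_ y0)).
  { assert (E := less_cons q1 ftop_ fbot_ x0 y0). unfold lt_ in *. ptaut (E, H). }
  rewrite !mdbl, msucc_dbl. split; [now apply lt_le|].
  intros q2 Hq E2. apply (prv_sub Hq) in E. fold (lt_ q2 (mcons ftop_ x0) (mcons fbot_ y0)) in E.
  rewrite mdbl, msucc_dbl, mdbl in E2. rewrite E2 in E. now apply lt_bad in E.
 - apply madd_comm.
 - apply madd_0.
 - symmetry. unfold msucc. apply madd_assoc. unfold fbot_, ftop_. ptaut.
 - apply madd_assoc0.
 - split; intros q1 _ H; now apply le_add in H || apply le_add.
 - apply mmul_nil_r.
 - rewrite mmul_comm. unfold msucc. rewrite mmul_add_l, mmul_nil, madd_0, mscal_top by (unfold ftop_; ptaut).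
  now rewrite mmul_comm.
 - apply mmul_comm.
 - rewrite mmul_comm, mmul_add_l, (mscal_bot q fbot_), madd_0 by (unfold fbot_; ptaut).
  now rewrite (mmul_comm q y0), (mmul_comm q z0).
 - intros q1 _ H. apply lt_succ_le in H. split; intros q2 Hq; apply (mmul_le q2); eapply prv_sub; eauto.
 - intros q1 _ H. apply neq_nz in H. unfold meq. apply (len_decide_nz q1 x0 _ H). intros a q2 H2 Ha Hz L.
  assert (E1 := mlen_isc_of _ _ _ L Ha).
  assert (Ha' : pb (fun i => a i - 1)) by (eapply pb_le; [|exact Ha]; intros; cbv beta; lia).
  assert (E2 := isc_succ _ _ _ (mlen_isc_of _ _ _ (len_tl q2 x0 a L Hz) Ha')).
  apply (isc_agree E1 E2).
  intros i Hi. specialize (Hz i Hi). cbv beta. lia.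
 - split; intros q1 _ H.
  + intros q2 Hq HA HB. apply (meq_sub Hq) in H. set (b := fun i => nth_bit (y0 i) 0).
   apply prv_cases with b; extend q3 S3; apply (meq_sub S3) in H.
   * apply (HB q3 S3). rewrite mdbl, msucc_dbl, H. symmetry. etrans; [apply mcons_tl|]. apply meq_cons; [|refl].
    assert (P := prv_hyp q2 b). unfold ftop_. fold q3 in P. unfold b in P. ptaut P.
   * apply (HA q3 S3). rewrite mdbl, H. symmetry. etrans; [apply mcons_tl|]. apply meq_cons; [|refl].
    assert (P := prv_hyp q2 (fun i => pneg (b i))). unfold fbot_. fold q3 in P. unfold b in P. ptaut P.
  + apply prv_stable. intros q2 Hq HN. apply (H q2 Hq); intros q3 Hq3 E; apply (HN q3 Hq3);
    change (meq q3 x0 (mtl y0)); rewrite <- E, ?mdbl, ?msucc_dbl; now apply meq_eq.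
Qed.

Lemma tv_nth r ts j : tv r (nth j ts tzero) = nth j (map (tv r) ts) mnil.
Proof. change mnil with (tv r tzero). symmetry. apply map_nth. Qed.

Lemma force_PV A : PV_axiom A -> forall q r, force q r A.
Proof.
 destruct 1; intros q r; cbn [force fneg tdbl ttwo tone tv]; rewrite ?tv_nth.
 - apply papp_proj.
 - now apply meq_eq.
 - rewrite mdbl. apply papp_bit.
 - rewrite mdbl, msucc_dbl. apply papp_bit.
 - apply papp_half.
 - rewrite papp_odd, mdbl. rewrite madd_comm, madd_cons0, madd_0l. apply mcons_tl.
 - apply papp_len.
 - apply papp_smash.
 - intros q1 _ H. rewrite papp_cond. apply mmux_false, nz_false, H.
 - intros q1 _ H. rewrite papp_cond. apply mmux_true, neq_nz, H.
 - rewrite papp_comp, !map_map. refl.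
 - intros q1 _ H. destruct ts as [|t ts]; simpl in *; [now apply meq_eq|]. now apply rec_zero.
 - intros q1 _ [H1 H2]. apply neq_nz in H1. unfold B, H in *. clear B H. cbn [tv map] in *. rewrite rec_step by exact H1. now apply mmin_le.
 - intros q1 _ [H1 H2]. apply neq_nz in H1. unfold B, H in *. clear B H. cbn [tv map] in *. rewrite rec_step by exact H1. now apply mmin_ge.
Qed.
End Forcing.

(** * Induction for Sigma^b_1 formulas *)

Lemma der_cut (Ax Ax' : pform -> Prop) n n' A : (forall B, Ax B -> der Ax' n' B) ->
 der Ax n A -> der Ax' (n * S n') A.
Proof.
 intros H (l & Hl & Hi & Hn).
 assert (E : exists l', prf Ax' l' /\ (forall B, In B l -> In B l') /\ length l' <= length l * S n').
 { clear Hi Hn. induction Hl as [|B l HB _ IH|B l HB _ IH|B C l HB HC _ IH].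
  - exists []. repeat split; [constructor|auto|simpl; lia].
  - destruct IH as (l' & H1 & H2 & H3). exists (B :: l'). repeat split.
   + now apply prf_frege.
   + intros D [->|HD]; simpl; auto.
   + simpl. lia.
  - destruct IH as (l' & H1 & H2 & H3). destruct (H B HB) as (l2 & H4 & H5 & H6).
   exists (l2 ++ l'). repeat split.
   + now apply prf_app.
   + intros D [->|HD]; apply in_or_app; auto.
   + rewrite length_app. simpl. lia.
  - destruct IH as (l' & H1 & H2 & H3). exists (C :: l'). repeat split.
   + apply prf_mp with B; auto.
   + intros D [->|HD]; simpl; auto.
   + simpl. lia. }
 destruct E as (l' & H1 & H2 & H3). exists l'. repeat split; auto.
 etrans; [exact H3|]. now apply Nat.mul_le_mono_r.
Qed.

(** A derivation uses at most as many instances of an axiom scheme as it has lines. Applied to the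
    refutation of all possible witnesses, it leaves a short list of candidates. *)
Lemma prf_instances {X} (Q : pform -> Prop) (f : X -> pform) (P : X -> Prop) l :
 prf (fun A => Q A \/ exists z, P z /\ A = f z) l ->
 exists zs, length zs <= length l /\ (forall z, In z zs -> P z) /\
  prf (fun A => Q A \/ exists z, In z zs /\ A = f z) l.
Proof.
 induction 1 as [|B l HB _ IH|B l HB _ IH|B C l HB HC _ IH].
 - exists []. repeat split; [auto|intros ? []|constructor].
 - destruct IH as (zs & H1 & H2 & H3). exists zs. repeat split; simpl; auto. now apply prf_frege.
 - destruct IH as (zs & H1 & H2 & H3). destruct HB as [HB|(z & HP & ->)].
  + exists zs. repeat split; simpl; auto. apply prf_ax; auto.
  + exists (z :: zs). repeat split; simpl; [lia| |].
   * intros y [<-|Hy]; auto.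
   * apply prf_ax; [right; exists z; auto|]. eapply prf_mono; [|exact H3].
    intros A [HA|(y & Hy & ->)]; [now left|right; exists y; auto].
 - destruct IH as (zs & H1 & H2 & H3). exists zs. repeat split; simpl; auto. now apply prf_mp with B.
Qed.

Section Sigma.
Context {SC : Scale}.

(** The value of a term at a single index. It makes sense for environments that depend on a further
    parameter, where no family has been selected yet. *)
Fixpoint traw (r : nat -> bits) (t : term) : bits :=
 match t with
 | tvar i => r i
 | tzero => []
 | tsucc t => addp ptop (traw r t) []
 | tadd t u => addp pbot (traw r t) (traw r u)
 | tmul t u => mulp (traw r t) (traw r u)
 | thalf t => tl (traw r t)
 | tlen t => lenp (traw r t)
 | tsmash t u => smashp (traw r t) (traw r u)
 | tapp p ts => ttrans p (map (traw r) ts)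
 end.

Lemma tv_raw (r : env) t i : tv r t i = traw (fun v => r v i) t.
Proof.
 induction t using term_nested_ind; cbn [tv fam msucc madd mmul mtl mlen msmash papp mnil traw];
  unfold fbot_, ftop_ in *; try congruence.
 f_equal. unfold args. rewrite map_map. induction H; simpl; congruence.
Qed.

Section Families.
Context {J : Type} (D : nat -> J -> Prop) (E : nat -> J -> nat -> bits).

(** The length bound is uniform in the parameter [j], so each selection of a [j] per index gives an
    environment. The parameter will range over values of quantified variables and over positions in
    an induction. *)
Definition bnd : Prop := forall v, exists l, pb l /\ forall i j, D i j -> length (E i j v) <= l i.

Lemma env_pb (jf : nat -> J) : bnd -> (forall i, D i (jf i)) -> forall v, pb (fun i => length (E i (jf i) v)).
Proof. intros H HD v. destruct (H v) as (l & Hl & Hb). eapply pb_le; [|exact Hl]. intros i. now apply Hb. Qed.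

Definition env_of (jf : nat -> J) (H : bnd) (HD : forall i, D i (jf i)) : env :=
 fun v => Elt (fun i => E i (jf i) v) (env_pb jf H HD v).

Lemma traw_bnd t : bnd -> exists l, pb l /\ forall i j, D i j -> length (traw (E i j) t) <= l i.
Proof.
 intros HB. induction t as [v| |t (l & Hl & IH)|t u (l & Hl & IHt) (m & Hm & IHu)
  |t u (l & Hl & IHt) (m & Hm & IHu)|t (l & Hl & IH)|t (l & Hl & IH)
  |t u (l & Hl & IHt) (m & Hm & IHu)|p ts IH] using term_nested_ind; cbn [traw].
 - apply HB.
 - exists (fun _ => 0). split; [apply pb_const|auto].
 - exists (fun i => S (l i)). split; [now apply pb_S|]. intros i j Hj. rewrite addp_length.
  specialize (IH i j Hj). simpl. lia.
 - exists (fun i => S (Nat.max (l i) (m i))). split; [now apply pb_S, pb_max|]. intros i j Hj.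
  rewrite addp_length. specialize (IHt i j Hj). specialize (IHu i j Hj). lia.
 - exists (fun i => l i * (m i + 2)). split; [apply pb_mul; auto; apply pb_add; auto using pb_const|].
  intros i j Hj. rewrite mulp_length. specialize (IHt i j Hj). specialize (IHu i j Hj).
  apply Nat.mul_le_mono; lia.
 - exists l. split; auto. intros i j Hj. rewrite length_tl. specialize (IH i j Hj). lia.
 - exists l. split; auto. intros i j Hj. rewrite lenp_length, blen_le. auto.
 - exists (fun i => S (l i * m i)). split; [now apply pb_S, pb_mul|]. intros i j Hj.
  rewrite smashp_length. apply le_n_S, Nat.mul_le_mono; auto.
 - assert (G : exists L, pb L /\ forall i j x, D i j -> In x (map (traw (E i j)) ts) -> length x <= L i).
  { induction IH as [|t ts (l & Hl & Ht) _ (L & HL & IHts)].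
   - exists (fun _ => 0). split; [apply pb_const|]. intros i j x _ [].
   - exists (fun i => l i + L i). split; [now apply pb_add|].
    intros i j x Hj [<-|Hx]; [specialize (Ht i j Hj); lia|specialize (IHts i j x Hj Hx); lia]. }
  destruct G as (L & HL & G). exists (fun i => outlen p (L i)). split; [now apply outlen_pb|].
  intros i j Hj. apply ttrans_length. intros x Hx. now apply (G i j).
Qed.

(** Lists with provably equal bits are different parameters as far as [R] is concerned, so
    invariance under provable equality has to be required. *)
Definition congruent (H : bnd) (R : nat -> J -> bits -> pform) : Prop :=
 forall jf jf' HD HD' (z z' : elt) q,
  (forall v, meq q (env_of jf H HD v) (env_of jf' H HD' v)) -> meq q z z' ->
  prv q (fun i => R i (jf i) (z i)) -> prv q (fun i => R i (jf' i) (z' i)).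

(* [exists z, R z] with [z] of at most [m] bits, in double-negated (forcing) form. *)
Definition exR (q : cond) (m : nat -> nat) (R : nat -> J -> bits -> pform) (jf : nat -> J) : Prop :=
 forall q', sub q q' ->
  (forall (z : elt) q2, (forall i, length (z i) <= m i) -> sub q' q2 ->
    prv q2 (fun i => R i (jf i) (z i)) -> bad q2) -> bad q'.

(** A normal form for forced formulas: a witness of polynomial length for a relation [R] of
    formulas. [R] is given pointwise and is the same for all selections [jf] and conditions [q];
    without this, [select] could not work uniformly in a parameter. *)
Definition sigma (H : bnd) (P : forall jf, (forall i, D i (jf i)) -> cond -> Prop) : Prop :=
 exists m R, pb m /\ congruent H R /\ forall jf HD q, P jf HD q <-> exR q m R jf.
End Families.

Arguments env_of {J D E} jf H HD.

Lemma exR_intro {J} q m (R : nat -> J -> bits -> pform) jf (z : elt) :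
 (forall i, length (z i) <= m i) -> prv q (fun i => R i (jf i) (z i)) -> exR q m R jf.
Proof.
 intros Hz H q' Hq N. apply (N z q' Hz (sub_refl _)). eapply prv_sub; eauto.
Qed.

Fixpoint choose_first (R : bits -> pform) (zs : list bits) : bits :=
 match zs with
 | [] => []
 | z :: zs => muxp (R z) z (choose_first R zs)
 end.

Lemma choose_first_length R zs m : (forall z, In z zs -> length z <= m) -> length (choose_first R zs) <= m.
Proof.
 induction zs as [|z zs IH]; simpl; intros H; [lia|]. rewrite muxp_length.
 apply Nat.max_lub; auto.
Qed.

Definition mkelt (f : nat -> bits) (m : nat -> nat) (Hm : pb m) (H : forall i, length (f i) <= m i) : elt :=
 Elt f (pb_le _ _ H Hm).

(* The witness is read off from a shortest refutation of [forall z, ~ R z]; since the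
  choice is made separately for every index [k], it is uniform in [k]. *)
Lemma select {K} (Q : nat -> K -> pform -> Prop) (R : nat -> K -> bits -> pform) m : pb m ->
 exists Z : nat -> K -> bits, (forall i k, length (Z i k) <= m i) /\
  forall kf, (forall (z z' : elt) q, meq q z z' -> prv q (fun i => R i (kf i) (z i)) ->
         prv q (fun i => R i (kf i) (z' i))) ->
   exR (fun i => Q i (kf i)) m R kf -> prv (fun i => Q i (kf i)) (fun i => R i (kf i) (Z i (kf i))).
Proof.
 intros Hm.
 (* The axioms state that every string of at most [m i] bits fails to be a witness. If a witness
    exists in the forcing sense, these axioms are contradictory with short derivations. *)
 set (Ax := fun i k A => Q i k A \/ exists z, length z <= m i /\ A = pneg (R i k z)).
 assert (HZ : forall ik : nat * K, exists zs, (forall z, In z zs -> length z <= m (fst ik)) /\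
  forall n, der (Ax (fst ik) (snd ik)) n pbot -> length zs <= n /\
   der (fun A => Q (fst ik) (snd ik) A \/ exists z, In z zs /\ A = pneg (R (fst ik) (snd ik) z)) n pbot).
 { intros [i k]. simpl. destruct (classic (exists n, der (Ax i k) n pbot)) as [(n & Hn)|N].
  - assert (Hmin : exists n, der (Ax i k) n pbot /\ forall n', der (Ax i k) n' pbot -> n <= n').
   { induction n as [n IH] using lt_wf_ind.
    destruct (classic (exists n', n' < n /\ der (Ax i k) n' pbot)) as [(n' & H1 & H2)|N]; eauto.
    exists n. split; auto. intros n' Hn'. destruct (Nat.le_gt_cases n n'); auto.
    exfalso; eauto. }
   clear n Hn. destruct Hmin as (n & (l & Hl & Hi & Hn) & Hmin).
   apply (prf_instances _ (fun z => pneg (R i k z)) (fun z => length z <= m i)) in Hl as (zs & H1 & H2 & H3).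
   exists zs. split; auto. intros n' Hn'. apply Hmin in Hn'.
   split; [exact (Nat.le_trans _ _ _ H1 (Nat.le_trans _ _ _ Hn Hn'))|].
   exists l. repeat split; auto. lia.
  - exists []. split; [intros ? []|]. intros n Hn. exfalso; eauto. }
 apply (fun H => choice (fun ik zs => _) H) in HZ as (zs & HZ).
 exists (fun i k => choose_first (R i k) (zs (i, k))). split.
 - intros i k. apply choose_first_length. apply (HZ (i, k)).
 - intros kf HR Hex. set (q := fun i => Q i (kf i)) in *.
  assert (HB : bad (fun i => Ax i (kf i))).
  { apply Hex; [intros i A HA; now left|]. intros z q2 Hz Hq H.
   assert (N : prv q2 (fun i => pneg (R i (kf i) (z i)))).
   { eapply prv_sub; [exact Hq|]. exists (fun _ => 1). split; [apply pb_const|].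
    intros i. apply der_ax. right. exists (z i). auto. }
   unfold bad. ptaut (H, N). }
  destruct HB as (h & Hh & Hd).
  set (zl := fun i => zs (i, kf i)).
  assert (Hzl : forall i, length (zl i) <= h i) by (intros i; apply (HZ (i, kf i)), Hd).
  assert (Pz : pb (fun i => length (zl i))) by (eapply pb_le; [exact Hzl|exact Hh]).
  apply prv_raa. extend q' S1.
  assert (N0 : prv q' (fun i => pneg (R i (kf i) (choose_first (R i (kf i)) (skipn 0 (zl i)))))) by apply prv_hyp.
  assert (HzA : forall l i, length (nth (l i) (zl i) []) <= m i).
  { intros l i. apply nth_bound; auto. intros z Hz. now apply (HZ (i, kf i)). }
  assert (HsA : forall l i, length (choose_first (R i (kf i)) (skipn (l i) (zl i))) <= m i).
  { intros l i. apply choose_first_length. intros z Hz. apply (HZ (i, kf i)).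
   unfold zl in Hz. rewrite <- (firstn_skipn (l i) (zs (i, kf i))). apply in_or_app. now right. }
  set (ze := fun l => mkelt (fun i => nth (l i) (zl i) []) m Hm (HzA l)).
  set (se := fun l => mkelt (fun i => choose_first (R i (kf i)) (skipn (l i) (zl i))) m Hm (HsA l)).
  (* If the first success among the candidates from [l] on fails, then candidate [l] fails, since
     otherwise it would be the one chosen, and so does the choice from the remaining candidates. *)
  assert (Step : forall l q2, sub q' q2 -> (forall i, live q2 i -> l i < length (zl i)) ->
   prv q2 (fun i => pneg (R i (kf i) (se l i))) ->
   prv q2 (fun i => pneg (R i (kf i) (ze l i))) /\
   prv q2 (fun i => pneg (R i (kf i) (se (fun i => S (l i)) i)))).
  { intros l q2 S2 Hl H.
   assert (U : meq q2 (se l) (mmux (fun i => R i (kf i) (ze l i)) (ze l) (se (fun i => S (l i))))).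
   { apply meq_eq. intros i Hi. cbn [fam se mkelt mmux ze]. specialize (Hl i Hi).
    rewrite <- (tl_skipn (zl i) (l i)).
    assert (Sk : forall (L : list bits) j, j < length L -> skipn j L = nth j L [] :: tl (skipn j L)).
    { clear. induction L as [|b L IH]; intros j Hj; simpl in Hj; [lia|].
     destruct j as [|j]; [refl|]. simpl. apply IH. lia. }
    rewrite (Sk (zl i) (l i) Hl) at 1. refl. }
   assert (A : prv q2 (fun i => pneg (R i (kf i) (ze l i)))).
   { apply prv_imp. extend q3 S3.
    assert (P : prv q3 (fun i => R i (kf i) (ze l i))) by apply prv_hyp.
    apply (meq_sub S3) in U. rewrite mmux_true in U by exact P.
    assert (B := HR (ze l) (se l) q3 ltac:(now symmetry) P). apply (prv_sub S3) in H. ptaut (B, H). }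
   split; auto. apply prv_imp. extend q3 S3.
   assert (P : prv q3 (fun i => R i (kf i) (se (fun i => S (l i)) i))) by apply prv_hyp.
   apply (meq_sub S3) in U. apply (prv_sub S3) in A, H. rewrite mmux_false in U by exact A.
   assert (B := HR (se (fun i => S (l i))) (se l) q3 ltac:(now symmetry) P). ptaut (B, H). }
  assert (All : forall l q2, sub q' q2 -> (forall i, live q2 i -> l i < length (zl i)) ->
   prv q2 (fun i => pneg (R i (kf i) (nth (l i) (zl i) [])))).
  { intros l q2 S2 Hl. apply (Step l q2 S2 Hl).
   apply (prv_ind q2 (fun i l => pneg (R i (kf i) (choose_first (R i (kf i)) (skipn l (zl i))))) (fun i => length (zl i))); auto.
   - eapply prv_sub; [exact S2|exact N0].
   - intros k q3 S3 Hk IH. exact (proj2 (Step k q3 (sub_trans S2 S3) Hk IH)).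
   - intros i Hi. apply Nat.lt_le_incl; auto. }
  destruct (uniform q' (fun i l => pneg (R i (kf i) (nth l (zl i) []))) (fun i => length (zl i))) as (h' & Hh' & Hd').
  { intros l q2 S2 Hl. now apply All. }
  (* All candidates having been refuted with a common bound, these refutations replace the
     corresponding axioms in the derivation of [pbot]. *)
  exists (fun i => h i * S (S (h' i))). split; [apply pb_mul; auto; now apply pb_S, pb_S|].
  intros i. destruct (HZ (i, kf i)) as [_ HZi]. specialize (HZi _ (Hd i)) as [_ HZi]. simpl in HZi.
  eapply der_cut; [|exact HZi]. intros B [HB|(z & Hz & ->)].
  + eapply der_le; [|apply der_ax; right; exact HB]. lia.
  + apply (In_nth _ _ []) in Hz as (l & Hl & <-).
   eapply der_le; [|apply (Hd' i l Hl)]. cbv beta; lia.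
Qed.

(** ** Closure properties *)

(** Witnesses are paired by concatenation; padding the first one to a fixed length makes both
    recoverable. *)
Definition pad (n : nat) (x : bits) : bits := x ++ repeat pbot (n - length x).

Lemma pad_bit n x k : nth_bit (pad n x) k = nth_bit x k.
Proof.
 unfold pad, nth_bit. destruct (Nat.lt_ge_cases k (length x)) as [H|H].
 - now rewrite app_nth1.
 - rewrite app_nth2, (nth_overflow x) by auto. apply nth_repeat.
Qed.

Lemma pad_length n x : length x <= n -> length (pad n x) = n.
Proof. intros H. unfold pad. rewrite length_app, repeat_length. lia. Qed.

Lemma firstn_pad n x y : length x <= n -> firstn n (pad n x ++ y) = pad n x.
Proof.
 intros H. rewrite firstn_app, pad_length, Nat.sub_diag, firstn_O, app_nil_r by auto.
 apply firstn_all2. rewrite pad_length; auto.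
Qed.

Lemma skipn_pad n x y : length x <= n -> skipn n (pad n x ++ y) = y.
Proof.
 intros H. rewrite skipn_app, pad_length, Nat.sub_diag by auto.
 rewrite skipn_all2 by (rewrite pad_length; auto). refl.
Qed.

Lemma meq_bits q (x y : elt) : (forall i k, live q i -> nth_bit (x i) k = nth_bit (y i) k) -> meq q x y.
Proof.
 intros H. apply meq_intro. intros k q' Hq _.
 ptaut_by (rewrite (H i (k i) (live_sub Hq Hi))).
Qed.

Lemma mtake_proper q k x y : meq q x y -> meq q (mtake k x) (mtake k y).
Proof.
 intros H. apply meq_intro. intros l q' Hq _. apply (meq_sub Hq), (fun H => meq_bit _ _ _ H l) in H.
 puse H.
 ptaut_fin_by (cbn [fam mtake]; rewrite !firstn_bit; destruct (l i <? k i)).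
Qed.

Lemma mskip_proper q k x y : meq q x y -> meq q (mskip k x) (mskip k y).
Proof.
 intros H. apply meq_intro. intros l q' Hq _.
 apply (meq_sub Hq), (fun H => meq_bit _ _ _ H (fun i => k i + l i)) in H.
 puse H. ptaut_by (cbn [fam mskip]; rewrite !nth_bit_skipn).
Qed.

Section Closure.
Context {J : Type} (D : nat -> J -> Prop) (E : nat -> J -> nat -> bits) (H : bnd D E).

Lemma congr1 R jf : congruent D E H R -> (forall i, D i (jf i)) -> forall (z z' : elt) q, meq q z z' ->
 prv q (fun i => R i (jf i) (z i)) -> prv q (fun i => R i (jf i) (z' i)).
Proof. intros HR HD z z' q Ez. apply (HR jf jf HD HD); auto. intros v. refl. Qed.

Lemma sigma_iff P P' :
 (forall jf HD q, P jf HD q <-> P' jf HD q) -> sigma D E H P -> sigma D E H P'.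
Proof.
 intros HPP (m & R & Hm & HR & HP). exists m, R. split; [auto|]. split; [auto|].
 intros jf HD q. rewrite <- HPP. apply HP.
Qed.

Lemma sigma_atom (w : nat -> J -> pform) :
 (forall jf jf' HD HD' q, (forall v, meq q (env_of jf H HD v) (env_of jf' H HD' v)) ->
   prv q (fun i => w i (jf i)) -> prv q (fun i => w i (jf' i))) ->
 sigma D E H (fun jf _ q => prv q (fun i => w i (jf i))).
Proof.
 intros Hw. exists (fun _ => 0), (fun i j _ => w i j). split; [apply pb_const|].
 split; [intros jf jf' HD HD' z z' q Ev _; apply (Hw jf jf' HD HD' q Ev)|].
 intros jf HD q. split; intros Hq.
 - apply (exR_intro q _ (fun i j _ => w i j) jf mnil); auto.
 - apply prv_stable. intros q' S1 N. apply (Hq q' S1). intros z0 q2 _ H2 H3. now apply (N q2).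
Qed.

Lemma sigma_and P P' :
 sigma D E H P -> sigma D E H P' -> sigma D E H (fun jf HD q => P jf HD q /\ P' jf HD q).
Proof.
 intros (m & R & Hm & HR & HP) (m' & R' & Hm' & HR' & HP').
 exists (fun i => m i + m' i), (fun i j z => pand (R i j (firstn (m i) z)) (R' i j (skipn (m i) z))).
 split; [now apply pb_add|]. split.
 - intros jf jf' HD HD' z z' q Ev Ez Hz. apply prv_and.
  + apply (HR jf jf' HD HD' (mtake m z) (mtake m z') q); [auto|now apply mtake_proper|]. cbn [fam mtake]. ptaut Hz.
  + apply (HR' jf jf' HD HD' (mskip m z) (mskip m z') q); [auto|now apply mskip_proper|]. cbn [fam mskip]. ptaut Hz.
 - intros jf HD q. rewrite HP, HP'. split.
  + intros [H1 H2] q' Hq N. apply (H1 q' Hq). intros z q2 Hz S2 Ez.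
   apply (H2 q2 (sub_trans Hq S2)). intros z' q3 Hz' S3 Ez'.
   assert (HL : forall i, length (pad (m i) (z i) ++ z' i) <= m i + m' i).
   { intros i. specialize (Hz' i). rewrite length_app, pad_length by auto. lia. }
   apply (N (mkelt _ _ (pb_add _ _ Hm Hm') HL) q3 HL (sub_trans S2 S3)).
   apply (prv_sub S3) in Ez. cbn [fam mkelt].
   assert (HL' : forall i, length (pad (m i) (z i)) <= m i) by (intros; rewrite pad_length; auto).
   apply (congr1 R jf HR HD z (mkelt _ m Hm HL')) in Ez; [|apply meq_bits; intros i k _; cbn [fam mkelt]; now rewrite pad_bit].
   cbn [fam mkelt] in Ez. puses (Ez, Ez').
   ptaut_by (rewrite firstn_pad, skipn_pad by auto).
  + intros HA. split; intros q' Hq N; apply (HA q' Hq); intros z q2 Hz S2 Ez.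
   * apply (N (mtake m z) q2); auto; [intros i; cbn [fam mtake]; rewrite length_firstn; lia|].
    cbn [fam mtake]. ptaut Ez.
   * apply (N (mskip m z) q2); auto; [intros i; cbn [fam mskip]; rewrite length_skipn; specialize (Hz i); lia|].
    cbn [fam mskip]. ptaut Ez.
Qed.

(** The same string is offered to both disjuncts, each reading the part it can use. Nothing records
    which disjunct holds: the relation is itself a disjunction. *)
Lemma sigma_or P P' :
 sigma D E H P -> sigma D E H P' -> sigma D E H (fun jf HD q => forall q', sub q q' ->
  (forall q2, sub q' q2 -> P jf HD q2 -> bad q2) -> (forall q2, sub q' q2 -> P' jf HD q2 -> bad q2) -> bad q').
Proof.
 intros (m & R & Hm & HR & HP) (m' & R' & Hm' & HR' & HP').
 exists (fun i => m i + m' i), (fun i j z => por (R i j (firstn (m i) z)) (R' i j (firstn (m' i) z))).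
 split; [now apply pb_add|]. split.
 - intros jf jf' HD HD' z z' q Ev Ez Hz.
  assert (G : forall q0, sub q q0 -> prv q0 (fun i => R i (jf i) (firstn (m i) (z i))) -> prv q0 (fun i => R i (jf' i) (firstn (m i) (z' i)))).
  { intros q0 S0. apply (HR jf jf' HD HD' (mtake m z) (mtake m z') q0); [intros v; eapply meq_sub; eauto|].
   apply mtake_proper. eapply meq_sub; eauto. }
  assert (G' : forall q0, sub q q0 -> prv q0 (fun i => R' i (jf i) (firstn (m' i) (z i))) -> prv q0 (fun i => R' i (jf' i) (firstn (m' i) (z' i)))).
  { intros q0 S0. apply (HR' jf jf' HD HD' (mtake m' z) (mtake m' z') q0); [intros v; eapply meq_sub; eauto|].
   apply mtake_proper. eapply meq_sub; eauto. }
  assert (A := prv_imp _ _ _ (G _ (sub_addc _ _) (prv_hyp _ _))).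
  assert (B := prv_imp _ _ _ (G' _ (sub_addc _ _) (prv_hyp _ _))). ptaut (Hz, A, B).
 - intros jf HD q. split.
  + intros HA q' Hq N. apply (HA q' Hq); intros q2 S2 Ez.
   * apply HP in Ez. apply (Ez q2 (sub_refl _)). intros z q3 Hz S3 E3.
    apply (N z q3); [intros i; specialize (Hz i); lia|eapply sub_trans; eauto|].
    puse E3. ptaut_by (rewrite (firstn_all2 (n := m i)) by auto).
   * apply HP' in Ez. apply (Ez q2 (sub_refl _)). intros z q3 Hz S3 E3.
    apply (N z q3); [intros i; specialize (Hz i); lia|eapply sub_trans; eauto|].
    puse E3. ptaut_by (rewrite (firstn_all2 (n := m' i)) by auto).
  + intros HA q' Hq N N'. apply (HA q' Hq). intros z q2 Hz S2 Ez.
   assert (A : prv q2 (fun i => pneg (R i (jf i) (firstn (m i) (z i))))).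
   { apply prv_imp. apply (N _ (sub_trans S2 (sub_addc _ _))). apply HP.
    apply (exR_intro _ m R jf (mtake m z)); [intros i; cbn [fam mtake]; rewrite length_firstn; lia|apply prv_hyp]. }
   assert (B : prv q2 (fun i => pneg (R' i (jf i) (firstn (m' i) (z i))))).
   { apply prv_imp. apply (N' _ (sub_trans S2 (sub_addc _ _))). apply HP'.
    apply (exR_intro _ m' R' jf (mtake m' z)); [intros i; cbn [fam mtake]; rewrite length_firstn; lia|apply prv_hyp]. }
   unfold bad. ptaut (Ez, A, B).
Qed.

Lemma scons_bnd {X} (f : nat -> X -> bits) (DX : nat -> X -> Prop) l :
 pb l -> (forall i x, DX i x -> length (f i x) <= l i) ->
 bnd (fun i (jx : J * X) => D i (fst jx) /\ DX i (snd jx))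
  (fun i jx v => match v with 0 => f i (snd jx) | S v => E i (fst jx) v end).
Proof.
 intros Hl Hf [|v].
 - exists l. split; auto. intros i [j x] [_ Hx]. now apply Hf.
 - destruct (H v) as (l' & Hl' & HE). exists l'. split; auto. intros i [j x] [Hj _]. now apply HE.
Qed.
End Closure.

Definition polar (c : bool) (A : form) : form := if c then A else fneg A.

(* What we prove of Sigma^b_1 formulas ([c = true]) and of the negations of
  Pi^b_1 formulas ([c = false]). *)
Definition sigma_form (c : bool) (A : form) : Prop :=
 forall (J : Type) (D : nat -> J -> Prop) (E : nat -> J -> nat -> bits) (H : bnd D E),
  sigma D E H (fun jf HD q => force q (env_of jf H HD) (polar c A)).

Lemma le_tv {J} (D : nat -> J -> Prop) E H (jf : nat -> J) HD q (x : elt) t :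
 le_ q x (tv (@env_of J D E jf H HD) t) <->
 prv q (fun i => pneg (lessp (traw (E i (jf i)) t) (x i))).
Proof. unfold le_. split; apply prv_eq; intros i _; rewrite tv_raw; refl. Qed.

Lemma le_take q (x y : elt) l : le_ q x y -> (forall i, length (y i) <= l i) -> meq q x (mtake l x).
Proof.
 intros Hxy Hl. apply meq_intro. intros k q' Hq _. apply (prv_sub Hq) in Hxy.
 apply prv_split with (fun i => k i < l i).
 - ptaut_by (apply live_restrict, Nat.ltb_lt in Hi; cbn [fam mtake]; rewrite firstn_bit, Hi).
 - extend q1 S1. apply (prv_sub S1) in Hxy.
  apply le_bit_over with (k := k) in Hxy; [|split_case; specialize (Hl i); lia].
  puse Hxy. ptaut_by (apply live_restrict, Nat.ltb_nlt in Hi; cbn [fam mtake]; rewrite firstn_bit, Hi).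
Qed.

(** The quantified value becomes the front part of the witness. Being bounded by [t], it may be
    truncated to the length of the value of [t] without changing it. *)
Lemma sigma_ex c t A : sigma_form c A ->
 forall J D E (H : @bnd J D E), sigma D E H (fun jf HD q => forall q', sub q q' ->
  (forall x q2, sub q' q2 -> le_ q2 x (tv (env_of jf H HD) t) ->
    force q2 (scons x (env_of jf H HD)) (polar c A) -> bad q2) -> bad q').
Proof.
 intros HA J D E H.
 destruct (traw_bnd D E t H) as (l & Hl & Ht).
 assert (H' := scons_bnd D E H (fun _ x => x) (fun i x => length x <= l i) l Hl (fun i x Hx => Hx)).
 destruct (HA _ _ _ H') as (m & R & Hm & HR & HP).
 exists (fun i => l i + m i), (fun i j z => pand (pneg (lessp (traw (E i j) t) (firstn (l i) z)))
  (R i (j, firstn (l i) z) (skipn (l i) z))).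
 assert (HDx : forall jf (HD : forall i, D i (jf i)) (x : elt), (forall i, length (x i) <= l i) ->
  forall i, (fun i (jx : J * bits) => D i (fst jx) /\ length (snd jx) <= l i) i ((fun i => (jf i, x i)) i)).
 { intros jf HD x Hx i. simpl. auto. }
 assert (HF : forall jf HD (x : elt) (Hx : forall i, length (x i) <= l i) q,
  force q (scons x (env_of jf H HD)) (polar c A) <-> exR q m R (fun i => (jf i, x i))).
 { intros jf HD x Hx q. rewrite <- (HP _ (HDx jf HD x Hx)).
  split; apply force_proper; intros [|v]; apply meq_eq; refl. }
 assert (HR1 : forall jf jf' HD HD' (x x' z z' : elt) q,
  (forall i, length (x i) <= l i) -> (forall i, length (x' i) <= l i) ->
  (forall v, meq q (env_of jf H HD v) (env_of jf' H HD' v)) -> meq q x x' -> meq q z z' ->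
  prv q (fun i => R i (jf i, x i) (z i)) -> prv q (fun i => R i (jf' i, x' i) (z' i))).
 { intros jf jf' HD HD' x x' z z' q Hx Hx' Ev Ex Ez.
  apply (HR (fun i => (jf i, x i)) (fun i => (jf' i, x' i)) (HDx jf HD x Hx) (HDx jf' HD' x' Hx') z z' q); auto.
  intros [|v].
  - transitivity x; [now apply meq_eq|]. rewrite Ex. now apply meq_eq.
  - transitivity (env_of jf H HD v); [now apply meq_eq|]. rewrite Ev. now apply meq_eq. }
 assert (Tk : forall (z : elt) i, length (mtake l z i) <= l i) by (intros; cbn [fam mtake]; rewrite length_firstn; lia).
 split; [now apply pb_add|]. split.
 - intros jf jf' HD HD' z z' q Ev Ez Hz.
  assert (Hz1 : prv q (fun i => pneg (lessp (traw (E i (jf i)) t) (mtake l z i)))) by exact (prv_and1 _ _ _ Hz).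
  assert (Hz2 : prv q (fun i => R i (jf i, mtake l z i) (mskip l z i))) by exact (prv_and2 _ _ _ Hz).
  assert (Et := mtake_proper q l z z' Ez).
  apply (le_tv D E H jf HD) in Hz1. rewrite Et, (tv_proper t q _ _ Ev) in Hz1. apply le_tv in Hz1.
  apply prv_and; [exact Hz1|].
  apply (HR1 jf jf' HD HD' (mtake l z) (mtake l z') (mskip l z) (mskip l z') q); auto. now apply mskip_proper.
 - intros jf HD q. split.
  + intros HP' q' Hq N. apply (HP' q' Hq). intros x q2 S2 Hx HAx.
   assert (Ex : meq q2 x (mtake l x)).
   { apply (le_take q2 x _ l Hx). intros i. rewrite tv_raw. apply (Ht i (jf i) (HD i)). }
   rewrite Ex in Hx. apply le_tv in Hx.
   assert (HAx' : force q2 (scons (mtake l x) (env_of jf H HD)) (polar c A)).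
   { eapply force_proper; [|exact HAx]. intros [|v]; simpl; [exact Ex|refl]. }
   apply HF in HAx'; auto. apply (HAx' q2 (sub_refl _)). intros z q3 Hz S3 Ez.
   assert (HL : forall i, length (pad (l i) (mtake l x i) ++ z i) <= l i + m i).
   { intros i. specialize (Hz i). rewrite length_app, pad_length by auto. lia. }
   apply (N (mkelt _ _ (pb_add _ _ Hl Hm) HL) q3 HL (sub_trans S2 S3)).
   apply (prv_sub S3) in Hx. cbn [fam mkelt].
   assert (HL' : forall i, length (pad (l i) (mtake l x i)) <= l i) by (intros; rewrite pad_length; auto).
   set (x' := mkelt _ l Hl HL').
   assert (Ex' : meq q3 (mtake l x) x').
   { apply meq_bits; intros i k _. cbn [fam x' mkelt]. now rewrite pad_bit. }
   fold (le_ q3 (mtake l x) (tv (env_of jf H HD) t)) in Hx.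
   apply (le_tv D E H jf HD q3 (mtake l x) t) in Hx. rewrite Ex' in Hx. apply le_tv in Hx.
   apply (HR1 jf jf HD HD (mtake l x) x' z z q3) in Ez; auto; try refl.
   eapply prv_eq; [|exact (prv_and _ _ _ Hx Ez)].
   intros i _. cbn [fam x' mkelt]. rewrite firstn_pad, skipn_pad by apply Tk. refl.
  + intros HE q' Hq N. apply (HE q' Hq). intros z q2 Hz S2 Ez.
   apply (N (mtake l z) q2 S2).
   * apply le_tv. exact (prv_and1 _ _ _ Ez).
   * apply HF; auto. apply (exR_intro q2 m R _ (mskip l z)).
    -- intros i. cbn [fam mskip]. rewrite length_skipn. specialize (Hz i). lia.
    -- exact (prv_and2 _ _ _ Ez).
Qed.

(** A number that differs from every constant up to the length of [y] is pushed above all of them by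
    induction, against [x <= |y|]. So a sharply bounded variable can be replaced by constants. *)
Lemma small_decide q (x y : elt) w : le_ q x (mlen y) ->
 (forall k q', sub q q' -> (forall i, k i <= length (y i)) -> isc q' x (fun i => #(k i)) -> prv q' w) ->
 prv q w.
Proof.
 intros Hx HW.
 apply prv_raa. extend q0 S0.
 assert (N0 : prv q0 (fun i => pneg (w i))) by apply prv_hyp.
 apply (prv_sub S0) in Hx. fold (le_ q0 x (mlen y)) in Hx.
 set (m := fun i => S (length (y i))).
 assert (Hm : pb m) by (apply pb_S, fam_pb).
 assert (Pk : forall k, (forall i, k i <= m i) -> pbN (fun i => #(k i))).
 { intros k Hk. eapply pb_le; [|exact Hm]. intros i. etrans; [apply size_nat_of_nat|apply Hk]. }
 assert (G : forall k q', sub q0 q' -> (forall i, live q' i -> k i <= m i) ->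
  prv q' (fun i => pneg (lessp (x i) (bitsN #(k i))))).
 { intros k q' S1 Hk. apply (prv_ind q' (fun i k => pneg (lessp (x i) (bitsN #k))) m); auto.
  - exact (less_zero q' x).
  - intros j q2 S2 Hj IH. set (j' := fun i => Nat.min (j i) (length (y i))).
   assert (Hj' : forall i, j' i <= length (y i)) by (intros; unfold j'; lia).
   assert (P1 := Pk j' ltac:(intros i; specialize (Hj' i); unfold m; lia)).
   assert (P2 := Pk (fun i => S (j' i)) ltac:(intros i; specialize (Hj' i); unfold m; lia)).
   assert (EJ : forall i, live q2 i -> j i = j' i) by (intros i Hi; specialize (Hj i Hi); unfold m, j' in *; lia).
   assert (IH' : le_ q2 (cst _ P1) x).
   { eapply prv_eq; [|exact IH]. intros i Hi. cbn [fam cst]. now rewrite EJ. }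
   assert (L : lt_ q2 (cst _ P1) x).
   { apply le_neq_lt; auto. intros q3 S3 E3.
    assert (W : prv q3 w).
    { apply (HW j' q3); auto; [exact (sub_trans S0 (sub_trans S1 (sub_trans S2 S3)))|].
     rewrite <- E3. apply isc_cst. }
    assert (N3 := prv_sub (sub_trans S1 (sub_trans S2 S3)) N0). unfold bad. ptaut (W, N3). }
   apply lt_succ_le in L.
   assert (E2 : meq q2 (msucc (cst _ P1)) (cst _ P2)).
   { apply (isc_agree (isc_succ _ _ _ (isc_cst q2 _ P1)) (isc_cst _ _ _)).
    intros i _. cbv beta. lia. }
   rewrite E2 in L. eapply prv_eq; [|exact L]. intros i Hi. cbn [fam cst]. now rewrite (EJ i Hi). }
 assert (A := G m q0 (sub_refl _) (fun i _ => le_n _)).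
 apply (len_decide q0 y). intros a q1 S1 Ha L. apply (prv_sub S1) in Hx, A.
 assert (Pm := Pk m (fun i => le_n _)).
 apply (le_lt_bad q1 x (mlen y)); auto.
 apply lt_succ_le. apply le_trans with (cst _ Pm); [|exact A].
 apply (isc_le _ _ _ _ _ (isc_succ _ _ _ (len_isc _ _ _ Ha L)) (isc_cst _ _ Pm)).
 intros i _. specialize (Ha i). unfold m. lia.
Qed.

Definition block (m : nat) (k : nat) (Z : bits) : bits := firstn m (skipn (k * m) Z).

Lemma block_concat m (f : nat -> bits) n k : (forall k, length (f k) = m) -> k < n ->
 block m k (concat (map f (seq 0 n))) = f k.
Proof.
 intros Hf Hk. unfold block.
 assert (G : forall n s k, k < n -> firstn m (skipn (k * m) (concat (map f (seq s n)))) = f (s + k)).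
 { clear n k Hk. induction n as [|n IH]; intros s k Hk; [lia|]. simpl. destruct k as [|k].
  - simpl. rewrite firstn_app, firstn_all2 by (rewrite Hf; auto).
   rewrite Hf, Nat.sub_diag, firstn_O, app_nil_r. f_equal. lia.
  - rewrite skipn_app, skipn_all2 by (rewrite Hf; simpl; lia).
   replace (S k * m - length (f s)) with (k * m) by (rewrite Hf; simpl; lia).
   simpl. rewrite IH by lia. f_equal. lia. }
 apply (G n 0 k Hk).
Qed.

Lemma length_concat_const m (f : nat -> bits) n s : (forall k, length (f k) = m) ->
 length (concat (map f (seq s n))) = n * m.
Proof. intros Hf. revert s. induction n as [|n IH]; intros s; simpl; auto. rewrite length_app, Hf, IH. lia. Qed.

(** The replacement principle for sharply bounded quantifiers: witnesses for the polynomially many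
    values [k] are padded to equal length and concatenated. A separate choice for each [k] must
    still have one common bound, which [select] provides. *)
Lemma sigma_sharp_all c t A : sigma_form c A ->
 forall J D E (H : @bnd J D E), sigma D E H (fun jf HD q =>
  forall x q', sub q q' -> le_ q' x (mlen (tv (env_of jf H HD) t)) ->
    force q' (scons x (env_of jf H HD)) (polar c A)).
Proof.
 intros HA J D E H.
 destruct (traw_bnd D E t H) as (l & Hl & Ht).
 assert (Hlk : forall i k, k <= l i -> length (bitsN #k) <= l i).
 { intros i k Hk. rewrite bitsN_length, size_nat_of_nat. exact Hk. }
 assert (H' := scons_bnd D E H (fun _ k => bitsN #k) (fun i k => k <= l i) l Hl Hlk).
 destruct (HA _ _ _ H') as (m & R & Hm & HR & HP).
 set (W := fun i j k Z => pimp (pneg (lessp (lenp (traw (E i j) t)) (bitsN #k))) (R i (j, k) (block (m i) k Z))).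
 exists (fun i => S (l i) * m i), (fun i j Z => pconj (map (fun k => W i j k Z) (seq 0 (S (l i))))).
 assert (HDx : forall jf (HD : forall i, D i (jf i)) (k : nat -> nat), (forall i, k i <= l i) ->
  forall i, (fun i (jx : J * nat) => D i (fst jx) /\ snd jx <= l i) i ((fun i => (jf i, k i)) i)).
 { intros jf HD k Hk i. simpl. auto. }
 assert (Hpk : forall k, (forall i, k i <= l i) -> pbN (fun i => #(k i))).
 { intros k Hk. eapply pb_le; [|exact Hl]. intros i. etrans; [apply size_nat_of_nat|apply Hk]. }
 assert (HF : forall jf HD k (Hk : forall i, k i <= l i) q,
  force q (scons (cst _ (Hpk k Hk)) (env_of jf H HD)) (polar c A) <-> exR q m R (fun i => (jf i, k i))).
 { intros jf HD k Hk q. rewrite <- (HP _ (HDx jf HD k Hk)).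
  split; apply force_proper; intros [|v]; apply meq_eq; refl. }
 assert (LE : forall jf HD q (x : elt), le_ q x (mlen (tv (env_of jf H HD) t)) <->
  prv q (fun i => pneg (lessp (lenp (traw (E i (jf i)) t)) (x i)))).
 { intros jf HD q x. exact (le_tv D E H jf HD q x (tlen t)). }
 assert (Pl : forall i j Z, length (map (fun k => W i j k Z) (seq 0 (S (l i)))) = S (l i)).
 { intros. now rewrite length_map_seq. }
 assert (PW : forall (jf : nat -> J) (Z : elt), pb (fun i => length (map (fun k => W i (jf i) k (Z i)) (seq 0 (S (l i)))))).
 { intros jf Z. eapply pb_le; [|exact (pb_S _ Hl)]. intros i. now rewrite Pl. }
 assert (Blk : forall k (Z Z' : elt) q, meq q Z Z' ->
  meq q (mtake m (mskip (fun i => k i * m i) Z)) (mtake m (mskip (fun i => k i * m i) Z'))).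
 { intros k Z Z' q EZ. now apply mtake_proper, mskip_proper. }
 split; [apply pb_mul; auto; now apply pb_S|]. split.
 - intros jf jf' HD HD' Z Z' q Ev EZ HZ. apply pconj_intro; [apply PW|].
  intros B q' Hq HB.
  assert (HC : forall i, exists k, k <= l i /\ (live q' i -> B i = W i (jf' i) k (Z' i))).
  { intros i. destruct (classic (live q' i)) as [Hi|Hi]; [|exists 0; split; [lia|tauto]].
   specialize (HB i Hi). apply in_map_iff in HB as (k & <- & Hk). apply in_seq in Hk.
   exists k. split; auto. lia. }
  apply (fun H => choice (fun i k => _) H) in HC as (k & HC).
  apply prv_eq with (fun i => W i (jf' i) (k i) (Z' i)); [intros i Hi; symmetry; now apply HC|].
  assert (Hk : forall i, k i <= l i) by apply HC.
  apply (prv_sub Hq) in HZ.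
  apply pconj_elim with (A := fun i => W i (jf i) (k i) (Z i)) in HZ; [|apply PW|].
  2: { intros i _. apply (in_map (fun k => W i (jf i) k (Z i))), in_seq. assert (Hki := Hk i). lia. }
  apply prv_imp. extend q2 S2.
  assert (Ev2 : forall v, meq q2 (env_of jf H HD v) (env_of jf' H HD' v)).
  { intros v. eapply meq_sub; [exact (sub_trans Hq S2)|auto]. }
  assert (P : prv q2 (fun i => pneg (lessp (lenp (traw (E i (jf' i)) t)) (bitsN #(k i))))) by apply prv_hyp.
  apply (LE jf' HD' q2 (cst _ (Hpk k Hk))) in P. rewrite <- (tv_proper t q2 _ _ Ev2) in P.
  apply LE in P. apply (prv_sub S2) in HZ. unfold W in HZ. cbn [fam cst] in P.
  assert (HZ2 : prv q2 (fun i => R i (jf i, k i) (block (m i) (k i) (Z i)))) by (ptaut (P, HZ)).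
  apply (HR (fun i => (jf i, k i)) (fun i => (jf' i, k i)) (HDx jf HD k Hk) (HDx jf' HD' k Hk)
   (mtake m (mskip (fun i => k i * m i) Z)) (mtake m (mskip (fun i => k i * m i) Z')) q2); auto.
  + intros [|v]; [now apply meq_eq|]. transitivity (env_of jf H HD v); [now apply meq_eq|]. rewrite Ev2. now apply meq_eq.
  + apply Blk. eapply meq_sub; [exact (sub_trans Hq S2)|auto].
 - intros jf HD q. split.
  + intros HAll.
   (* The bound on [k] is among the axioms from which the witness is selected, so that the witness
      for [k] is available only under this assumption. *)
   destruct (select (fun i (k : nat) B => B = pneg (lessp (lenp (traw (E i (jf i)) t)) (bitsN #k)) \/ q i B)
    (fun i k z => R i (jf i, k) z) m Hm) as (Z & HZl & HZ).
   set (big := fun i => concat (map (fun k => pad (m i) (Z i k)) (seq 0 (S (l i))))).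
   assert (Hpad : forall i k, length (pad (m i) (Z i k)) = m i) by (intros; now apply pad_length).
   assert (HL : forall i, length (big i) <= S (l i) * m i).
   { intros i. unfold big. rewrite (length_concat_const (m i)); auto. }
   apply (exR_intro q _ _ jf (mkelt big _ (pb_mul _ _ (pb_S _ Hl) Hm) HL)); auto.
   cbn [fam mkelt]. apply pconj_intro.
   { eapply pb_le; [|exact (pb_S _ Hl)]. intros i. now rewrite Pl. }
   intros B q' Hq HB.
   assert (HC : forall i, exists k, k <= l i /\ (live q' i -> B i = W i (jf i) k (big i))).
   { intros i. destruct (classic (live q' i)) as [Hi|Hi]; [|exists 0; split; [lia|tauto]].
    specialize (HB i Hi). apply in_map_iff in HB as (k & <- & Hk). apply in_seq in Hk.
    exists k. split; auto. lia. }
   apply (fun H => choice (fun i k => _) H) in HC as (k & HC).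
   apply prv_eq with (fun i => W i (jf i) (k i) (big i)); [intros i Hi; symmetry; now apply HC|].
   assert (Hk : forall i, k i <= l i) by apply HC.
   eapply prv_sub; [exact Hq|]. apply prv_imp.
   extend q2 S2.
   assert (P : prv q2 (fun i => pneg (lessp (lenp (traw (E i (jf i)) t)) (bitsN #(k i))))) by apply prv_hyp.
   apply (LE jf HD q2 (cst _ (Hpk k Hk))) in P.
   assert (HE := HAll _ q2 S2 P). apply HF in HE.
   assert (HZk : prv q2 (fun i => R i (jf i, k i) (Z i (k i)))).
   { apply (HZ k).
    - intros z z' q0 Ez. apply (congr1 _ _ H' R (fun i => (jf i, k i)) HR (HDx jf HD k Hk) z z' q0 Ez).
    - exact HE. }
   assert (HLz : forall i, length (Z i (k i)) <= m i) by auto.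
   assert (HLp : forall i, length (pad (m i) (Z i (k i))) <= m i) by (intros; rewrite Hpad; auto).
   apply (congr1 _ _ H' R (fun i => (jf i, k i)) HR (HDx jf HD k Hk) (mkelt _ m Hm HLz) (mkelt _ m Hm HLp)) in HZk.
   2: { apply meq_bits. intros i j _. cbn [fam mkelt]. now rewrite pad_bit. }
   eapply prv_eq; [|exact HZk]. intros i _. cbn [fam mkelt]. unfold big.
   rewrite (block_concat (m i) (fun k => pad (m i) (Z i k))); auto. assert (Hki := Hk i). lia.
  + intros HE x q' Hq Hx. apply force_stable.
   intros q2 S2 N. apply (HE q2 (sub_trans Hq S2)). intros Z q3 HZl S3 HZ.
   apply (prv_sub (sub_trans S2 S3)) in Hx.
   apply (small_decide q3 x _ _ Hx). intros k q4 S4 Hk Hxk.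
   assert (Hk' : forall i, k i <= l i).
   { intros i. etrans; [apply Hk|]. rewrite tv_raw. apply (Ht i (jf i) (HD i)). }
   apply (N q4 (sub_trans S3 S4)).
   assert (Ex : meq q4 (cst _ (Hpk k Hk')) x) by (eapply isc_unique; [apply isc_cst|exact Hxk]).
   apply force_proper with (r := scons (cst _ (Hpk k Hk')) (env_of jf H HD)).
   { intros [|v]; simpl; [exact Ex|refl]. }
   apply HF. apply (exR_intro q4 m R _ (mtake m (mskip (fun i => k i * m i) Z))).
   { intros i. cbn [fam mtake]. rewrite length_firstn. lia. }
   apply (prv_sub S4) in HZ, Hx. fold (le_ q4 x (mlen (tv (env_of jf H HD) t))) in Hx.
   rewrite <- Ex in Hx. apply LE in Hx.
   apply pconj_elim with (A := fun i => W i (jf i) (k i) (Z i)) in HZ; [|apply PW|].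
   2: { intros i _. apply (in_map (fun k => W i (jf i) k (Z i))), in_seq. assert (Hki := Hk' i). lia. }
   unfold W in HZ. cbn [fam cst] in Hx. cbn [fam mtake mskip]. unfold block in HZ. ptaut (Hx, HZ).
Qed.

Lemma force_neg q r A : force q r (fneg A) <-> forall q', sub q q' -> force q' r A -> bad q'.
Proof. refl. Qed.

Lemma force_imp_or q r A B : force q r (fimp A B) <->
 forall q', sub q q' -> (forall q2, sub q' q2 -> force q2 r (fneg A) -> bad q2) ->
  (forall q2, sub q' q2 -> force q2 r B -> bad q2) -> bad q'.
Proof.
 split.
 - intros H q' Hq HA HB. apply (HB q' (sub_refl _)). apply H; auto.
  apply force_stable. intros q2 S2 N. apply (HA q2 S2). exact N.
 - intros H q' Hq HA. apply force_stable. intros q2 S2 N. apply (H q2 (sub_trans Hq S2)).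
  + intros q3 S3 HnA. apply (HnA q3 (sub_refl _)). eapply force_sub; [|exact HA]. exact (sub_trans S2 S3).
  + exact N.
Qed.

Lemma force_nimp q r A B : force q r (fneg (fimp A B)) <-> force q r A /\ force q r (fneg B).
Proof.
 split.
 - intros H. split.
  + apply force_stable. intros q' Hq N. apply (H q' Hq). intros q2 S2 HA. apply bad_force, N; auto.
  + intros q' Hq HB. apply (H q' Hq). intros q2 S2 _. eapply force_sub; eauto.
 - intros [HA HB] q' Hq HAB. apply (HB q' Hq). apply HAB; [apply sub_refl|]. eapply force_sub; eauto.
Qed.

Lemma force_nand q r A B : force q r (fneg (fand A B)) <->
 forall q', sub q q' -> (forall q2, sub q' q2 -> force q2 r (fneg A) -> bad q2) ->
  (forall q2, sub q' q2 -> force q2 r (fneg B) -> bad q2) -> bad q'.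
Proof.
 split.
 - intros H q' Hq HA HB. apply (H q' Hq). split; apply force_stable; auto.
 - intros H q' Hq [HA HB]. apply (H q' Hq); intros q2 S2 N; apply (N q2 (sub_refl _)); eapply force_sub; eauto.
Qed.

Lemma force_nor q r A B : force q r (fneg (for_ A B)) <-> force q r (fneg A) /\ force q r (fneg B).
Proof.
 split.
 - intros H. split; intros q' Hq HA; apply (H q' Hq); intros q2 S2 N N'; [apply (N q2 (sub_refl _))|apply (N' q2 (sub_refl _))];
   eapply force_sub; eauto.
 - intros [HA HB] q' Hq HAB. apply (HAB q' (sub_refl _)); intros q2 S2 HX; [apply HA|apply HB]; auto; eapply sub_trans; eauto.
Qed.

Lemma tv_lift x r t : tv (scons x r) (tlift t) = tv r t.
Proof. unfold tlift. rewrite tv_subst. refl. Qed.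

Lemma force_bex q r t A : force q r (bounded_ex t A) <->
 forall q', sub q q' -> (forall x q2, sub q' q2 -> le_ q2 x (tv r t) -> force q2 (scons x r) A -> bad q2) -> bad q'.
Proof.
 unfold bounded_ex. cbn [force]. split; intros H q' Hq N; apply (H q' Hq).
 - intros x q2 S2 [Hx HA]. rewrite tv_lift in Hx. now apply (N x q2).
 - intros x q2 S2 Hx HA. apply (N x q2 S2). rewrite tv_lift. auto.
Qed.

Lemma force_nball q r t A : force q r (fneg (bounded_all t A)) <->
 forall q', sub q q' -> (forall x q2, sub q' q2 -> le_ q2 x (tv r t) -> force q2 (scons x r) (fneg A) -> bad q2) -> bad q'.
Proof.
 unfold bounded_all. rewrite force_neg. cbn [force]. split; intros H q' Hq N; apply (H q' Hq).
 - intros x q2 S2 Hx. rewrite tv_lift in Hx. apply force_stable. intros q3 S3 N3.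
  apply (N x q3 (sub_trans S2 S3)); [eapply prv_sub; eauto|exact N3].
 - intros x q2 S2 Hx HA. apply (HA q2 (sub_refl _)). apply N; auto. rewrite tv_lift. auto.
Qed.

Lemma force_ball q r t A : force q r (bounded_all t A) <->
 forall x q', sub q q' -> le_ q' x (tv r t) -> force q' (scons x r) A.
Proof.
 unfold bounded_all. cbn [force]. split; intros H x q' Hq Hx; apply H; auto.
 - rewrite tv_lift. auto.
 - rewrite tv_lift in Hx. auto.
Qed.

Lemma force_nbex q r t A : force q r (fneg (bounded_ex t A)) <->
 forall x q', sub q q' -> le_ q' x (tv r t) -> force q' (scons x r) (fneg A).
Proof.
 rewrite force_neg. split.
 - intros H x q' Hq Hx q2 S2 HA. apply H; [exact (sub_trans Hq S2)|].
  apply force_bex. intros q3 S3 N. apply (N x q3 (sub_refl _)).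
  + eapply prv_sub; [|exact Hx]. exact (sub_trans S2 S3).
  + eapply force_sub; eauto.
 - intros H q' Hq HE. rewrite force_bex in HE. apply (HE q' (sub_refl _)). intros x q2 S2 Hx HA.
  apply (H x q2 (sub_trans Hq S2) Hx q2 (sub_refl _) HA).
Qed.

Lemma sigma_decide {J} D E (H : @bnd J D E) (c : bool) (w : nat -> J -> pform) :
 (forall jf jf' HD HD' q, (forall v, meq q (env_of jf H HD v) (env_of jf' H HD' v)) ->
   prv q (fun i => piff (w i (jf i)) (w i (jf' i)))) ->
 sigma D E H (fun jf _ q => if c then prv q (fun i => w i (jf i))
   else forall q', sub q q' -> prv q' (fun i => w i (jf i)) -> bad q').
Proof.
 intros Hw. destruct c.
 - apply sigma_atom. intros jf jf' HD HD' q Ev HA. assert (A := Hw jf jf' HD HD' q Ev). ptaut (HA, A).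
 - apply sigma_iff with (P := fun jf _ q => prv q (fun i => pneg (w i (jf i)))).
  + intros jf HD q. split.
   * intros N q' Hq HA. apply (prv_sub Hq) in N. unfold bad. ptaut (N, HA).
   * intros N. apply prv_imp. apply N; [apply sub_addc|apply prv_hyp].
  + apply (sigma_atom D E H (fun i j => pneg (w i j))).
   intros jf jf' HD HD' q Ev HA. assert (A := Hw jf jf' HD HD' q Ev). ptaut (HA, A).
Qed.

(** Both polarities are treated together because implication exchanges them, and a negated bounded
    quantifier behaves like the dual one. *)
Lemma sigma_main c A : sp_form c A -> sigma_form c A.
Proof.
 assert (EQ : forall q (x x' y y' : elt), meq q x x' -> meq q y y' ->
  prv q (fun i => piff (eqw (x i) (y i)) (eqw (x' i) (y' i)))).
 { assert (G : forall q (x x' y y' : elt), meq q x x' -> meq q y y' -> prv q (fun i => pimp (eqw (x i) (y i)) (eqw (x' i) (y' i)))).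
  { intros q x x' y y' H H'. apply prv_imp. extend q' S1.
   apply (meq_sub S1) in H, H'. change (meq q' x' y'). rewrite <- H, <- H'.
   exact (prv_hyp q (fun i => eqw (x i) (y i))). }
  intros q x x' y y' H H'. assert (A1 := G q x x' y y' H H').
  assert (A2 := G q x' x y' y ltac:(now symmetry) ltac:(now symmetry)). ptaut (A1, A2). }
 induction 1 as [c t u|c t u|c|c A B _ IHA _ IHB|c A B _ IHA _ IHB|c A B _ IHA _ IHB
  |c t A _ IH|c t A _ IH|t A _ IH|t A _ IH]; intros J D E H.
 - apply sigma_iff with (2 := sigma_decide D E H c (fun i j => eqw (traw (E i j) t) (traw (E i j) u))
   ltac:(intros jf jf' HD HD' q Ev; eapply prv_eq;
    [|exact (EQ q _ _ _ _ (tv_proper t q _ _ Ev) (tv_proper u q _ _ Ev))];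
    intros i _; cbv beta; rewrite !tv_raw; refl)).
  intros jf HD q.
  assert (X : forall q, prv q (fun i => eqw (traw (E i (jf i)) t) (traw (E i (jf i)) u)) <->
    meq q (tv (env_of jf H HD) t) (tv (env_of jf H HD) u)).
  { intros q0. split; apply prv_eq; intros i _; rewrite !tv_raw; refl. }
  destruct c; cbn [polar force fneg]; [apply X|].
  split; intros N q' Hq HA; apply (N q' Hq); now apply X.
 - apply sigma_iff with (2 := sigma_decide D E H c (fun i j => pneg (lessp (traw (E i j) u) (traw (E i j) t)))
   ltac:(intros jf jf' HD HD' q Ev;
    assert (A1 := lessp_cong q _ _ _ _ (tv_proper u q _ _ Ev) (tv_proper t q _ _ Ev)); unfold peq in A1;
    assert (A2 : prv q (fun i => piff (lessp (traw (E i (jf i)) u) (traw (E i (jf i)) t)) (lessp (traw (E i (jf' i)) u) (traw (E i (jf' i)) t))));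
    [eapply prv_eq; [|exact A1]; intros i _; cbv beta; rewrite !tv_raw; refl|ptaut A2])).
  intros jf HD q.
  assert (X : forall q, prv q (fun i => pneg (lessp (traw (E i (jf i)) u) (traw (E i (jf i)) t))) <->
    le_ q (tv (env_of jf H HD) t) (tv (env_of jf H HD) u)).
  { intros q0. rewrite le_tv. split; apply prv_eq; intros i _; rewrite !tv_raw; refl. }
  destruct c; cbn [polar force fneg]; [apply X|].
  split; intros N q' Hq HA; apply (N q' Hq); now apply X.
 - apply sigma_iff with (2 := sigma_decide D E H c (fun i j => pbot) ltac:(intros; ptaut)).
  intros jf HD q. destruct c; refl.
 - destruct c.
  + apply sigma_iff with (2 := sigma_or D E H _ _ (IHA J D E H) (IHB J D E H)).
   intros jf HD q. symmetry. apply force_imp_or.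
  + apply sigma_iff with (2 := sigma_and D E H _ _ (IHA J D E H) (IHB J D E H)).
   intros jf HD q. symmetry. apply force_nimp.
 - destruct c.
  + apply sigma_iff with (2 := sigma_and D E H _ _ (IHA J D E H) (IHB J D E H)).
   intros jf HD q. refl.
  + apply sigma_iff with (2 := sigma_or D E H _ _ (IHA J D E H) (IHB J D E H)).
   intros jf HD q. symmetry. apply force_nand.
 - destruct c.
  + apply sigma_iff with (2 := sigma_or D E H _ _ (IHA J D E H) (IHB J D E H)).
   intros jf HD q. refl.
  + apply sigma_iff with (2 := sigma_and D E H _ _ (IHA J D E H) (IHB J D E H)).
   intros jf HD q. symmetry. apply force_nor.
 - destruct c.
  + apply sigma_iff with (2 := sigma_ex true (tlen t) A IH J D E H).
   intros jf HD q. symmetry. apply force_bex.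
  + apply sigma_iff with (2 := sigma_sharp_all false t A IH J D E H).
   intros jf HD q. symmetry. apply force_nbex.
 - destruct c.
  + apply sigma_iff with (2 := sigma_sharp_all true t A IH J D E H).
   intros jf HD q. symmetry. apply force_ball.
  + apply sigma_iff with (2 := sigma_ex false (tlen t) A IH J D E H).
   intros jf HD q. symmetry. apply force_nball.
 - apply sigma_iff with (2 := sigma_ex true t A IH J D E H).
  intros jf HD q. symmetry. apply force_bex.
 - apply sigma_iff with (2 := sigma_ex false t A IH J D E H).
  intros jf HD q. symmetry. apply force_nball.
Qed.

Lemma prv_live q q' P w : sub q q' -> (forall i, live q' i -> P i) -> prv (restrict q P) w -> prv q' w.
Proof.
 intros Hq HP (h & Hh & Hd). apply prv_intro with h; auto. intros i Hi.
 eapply der_mono; [|apply le_n|apply Hd]. intros A [HA|[HA _]]; [now apply Hq|]. exfalso; auto.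
Qed.

(* Starting from a witness for [A 0], the witnesses for the initial segments of [x]
  are selected one after the other; every step has a short proof, uniformly. *)
Lemma force_PIND A q r : Sigma_b1 A ->
 let A_half := fsubst (fun i => match i with 0 => thalf (tvar 0) | S i => tvar (S i) end) A in
 force q r (fimp (inst tzero A) (fimp (fall (fimp A_half A)) (fall A))).
Proof.
 intros HA A_half q1 S1 H0 q2 S2 HS x. apply (force_sub _ _ _ _ S2) in H0. apply force_inst in H0.
 assert (HS' : forall y q3, sub q2 q3 -> force q3 (scons (mtl y) r) A -> force q3 (scons y r) A).
 { intros y q3 S3 HY. apply (HS y q3 S3). unfold A_half. apply force_subst.
  eapply force_ext; [|exact HY]. intros [|v]; refl. }
 clear HS A_half. apply force_stable. intros q3 S3 N. apply (force_sub _ _ _ _ S3) in H0.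
 (* The parameter [j] is the number of leading bits of [x] that are kept. Passing from [S j] to [j]
    is one halving. *)
 set (E := fun i (j : nat) v => match v with 0 => skipn (length (x i) - j) (x i) | S v => r v i end).
 set (D := fun (i j : nat) => True).
 assert (H : bnd D E).
 { intros [|v].
  - exists (fun i => length (x i)). split; [apply fam_pb|]. intros i j _. cbn [E]. rewrite length_skipn. lia.
  - exists (fun i => length (r v i)). split; [apply fam_pb|]. auto. }
 destruct (sigma_main true A HA nat D E H) as (m & R & Hm & HR & HP).
 assert (HDt : forall jf : nat -> nat, forall i, D i (jf i)) by (intros; exact I).
 assert (HE : forall jf (y : elt) q', (forall i, live q' i -> y i = skipn (length (x i) - jf i) (x i)) ->
  force q' (scons y r) A <-> exR q' m R jf).
 { intros jf y q' Hy. rewrite <- (HP jf (HDt jf) q'). cbn [polar].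
  split; apply force_proper; intros [|v]; apply meq_eq; intros i Hi; cbn [scons env_of fam E]; auto.
  symmetry. auto. }
 assert (E0 : exR q3 m R (fun _ => 0)).
 { apply (HE (fun _ => 0) mnil); [|exact H0]. intros i _. rewrite Nat.sub_0_r, skipn_all. refl. }
 destruct (select (fun i (_ : unit) => q3 i) (fun i _ z => R i 0 z) m Hm) as (Z0 & HZl0 & HZ0).
 assert (P0 : prv q3 (fun i => R i 0 (Z0 i tt))).
 { apply (HZ0 (fun _ => tt)); [|exact E0].
  intros z z' q' Ez. exact (congr1 D E H R (fun _ => 0) HR (HDt _) z z' q' Ez). }
 (* The parameter now contains the previous witness as well, and the axioms state that it is one.
    The second alternative restricts attention to indices with [j] below the length of [x]. *)
 destruct (select (fun i (ju : nat * bits) B => B = R i (fst ju) (snd ju) \/ (q3 i B \/ (~ fst ju < length (x i) /\ B = pbot)))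
  (fun i ju z => R i (S (fst ju)) z) m Hm) as (Z & HZl & HZ).
 (* Iterating the selection is harmless: the formulas in [U] may become huge, but the length of the
    list stays below [m i], and only the lines of derivations are counted. *)
 set (U := fun i => fix U (j : nat) : bits := match j with 0 => Z0 i tt | S j => Z i (j, U j) end).
 assert (HU : forall i j, length (U i j) <= m i) by (intros i [|j]; simpl; auto).
 assert (Step : forall jf : nat -> nat, prv (addc (restrict q3 (fun i => jf i < length (x i))) (fun i => R i (jf i) (U i (jf i))))
  (fun i => R i (S (jf i)) (U i (S (jf i))))).
 { intros jf. apply (HZ (fun i => (jf i, U i (jf i)))).
  - intros z z' q' Ez. exact (congr1 D E H R (fun i => S (jf i)) HR (HDt _) z z' q' Ez).
  - set (q4 := addc (restrict q3 (fun i => jf i < length (x i))) (fun i => R i (jf i) (U i (jf i)))).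
   change (exR q4 m R (fun i => S (jf i))).
   assert (S4 : sub q3 q4) by (eapply sub_trans; [apply sub_restrict|apply sub_addc]).
   assert (L4 : forall i, live q4 i -> jf i < length (x i)).
   { intros i Hi. apply (live_restrict q3 (fun i => jf i < length (x i)) i).
    eapply live_sub; [|exact Hi]. apply sub_addc. }
   apply (HE (fun i => S (jf i)) (mskip (fun i => length (x i) - S (jf i)) x)); [refl|].
   apply HS'; [exact (sub_trans S3 S4)|].
   apply (HE jf).
   + intros i Hi. cbn [fam mtl mskip]. rewrite tl_skipn. f_equal. specialize (L4 i Hi). lia.
   + apply (exR_intro q4 m R jf (mkelt (fun i => U i (jf i)) m Hm (fun i => HU i (jf i)))); [intros i; apply HU|].
    apply prv_hyp. }
 assert (Fin : prv q3 (fun i => R i (length (x i)) (U i (length (x i))))).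
 { apply (prv_ind q3 (fun i j => R i j (U i j)) (fun i => length (x i)) (fam_pb x)); auto.
  intros k q4 S4 Hk IH. assert (P := prv_imp _ _ _ (Step k)).
  apply (prv_live q3 q4 (fun i => k i < length (x i))) in P; auto. exact (prv_mp _ _ _ IH P). }
 apply (N q3 (sub_refl _)). apply (HE (fun i => length (x i))).
 - intros i _. now rewrite Nat.sub_diag.
 - apply (exR_intro q3 m R _ (mkelt (fun i => U i (length (x i))) m Hm (fun i => HU i (length (x i))))); auto.
  intros i; apply HU.
Qed.

Theorem force_S12 A : S12 A -> forall q r, force q r A.
Proof.
 intros [B HB|B HB|B HB]; intros q r; [now apply force_basic|now apply force_PV|now apply force_PIND].
Qed.
End Sigma.

(** * The programs for circuit evaluation *)

Notation len := N.size_nat.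

Lemma len_div2 z : len (N.div2 z) = len z - 1.
Proof. destruct z as [|[p|p|]]; simpl; lia. Qed.

Lemma len_pos z : z <> 0%N -> 0 < len z.
Proof. destruct z as [|[p|p|]]; simpl; try lia; tauto. Qed.

Lemma len_zero z : len z = 0 -> z = 0%N.
Proof. destruct z as [|[p|p|]]; simpl; try lia; auto. Qed.

Lemma rec_len_ind g h b e (P : N -> N -> Prop) :
 (forall z, len z = 0 -> P z (run g e)) ->
 (forall z v, z <> 0%N -> P (N.div2 z) v -> P z (N.min (run h (v :: z :: e)) (run b (z :: e)))) ->
 forall z, P z (run (Rec g h b) (z :: e)).
Proof.
 intros H0 HS z. remember (len z) as k eqn:Hk. revert z Hk. induction k as [|k IH]; intros z Hk; rewrite run_rec.
 - assert (z = 0%N) by (apply len_zero; auto). subst. simpl. now apply H0.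
 - destruct (N.eqb_spec z 0) as [->|Hz]; [discriminate|]. apply HS; auto. apply IH.
  rewrite len_div2. lia.
Qed.

Lemma run_half p e : run (half p) e = N.div2 (run p e).
Proof. refl. Qed.
Lemma run_odd p e : run (odd p) e = N.b2n (N.odd (run p e)).
Proof. refl. Qed.
Lemma run_s1 p e : run (s1 p) e = (2 * run p e + 1)%N.
Proof. refl. Qed.
Lemma run_smash p q e : run (smash p q) e = (2 ^ #(len (run p e) * len (run q e)))%N.
Proof. cbn. now rewrite !size_size_nat, Nat2N.inj_mul. Qed.
Lemma run_cond c p q e : run (Defs.cond c p q) e = if (run c e =? 0)%N then run q e else run p e.
Proof. refl. Qed.
Lemma run_comp f gs e : run (Comp f gs) e = run f (map (fun g => run g e) gs).
Proof. refl. Qed.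
Lemma run_push v b e c : run b e = N.b2n c -> run (push v b) e = (2 * run v e + N.b2n c)%N.
Proof. intros H. unfold push. rewrite run_cond, H. destruct c; cbn [N.b2n]; cbn; lia. Qed.

Lemma len_s1 z : len (2 * z + 1)%N = S (len z).
Proof. destruct z as [|p]; refl. Qed.

Lemma run_shr_aux u x : run (Rec (Proj 0) (half (Proj 0)) (Proj 1)) [u; x] = N.shiftr x #(len u).
Proof.
 apply (rec_len_ind (Proj 0) (half (Proj 0)) (Proj 1) [x] (fun u v => v = N.shiftr x #(len u))).
 - intros z Hz. now rewrite Hz.
 - intros z v Hz ->. cbn [run half map nth]. rewrite len_div2. assert (Hp := len_pos z Hz).
  rewrite N.div2_spec, N.shiftr_shiftr. replace (#(len z - 1) + 1)%N with #(len z) by lia.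
  apply N.min_l. rewrite N.shiftr_div_pow2. apply N.Div0.div_le_upper_bound.
  assert (E := N.pow_nonzero 2 #(len z)). nia.
Qed.

Lemma run_shr u x e : run (shr u x) e = N.shiftr (run x e) (#(len (run u e))).
Proof. unfold shr. rewrite run_comp. apply run_shr_aux. Qed.

Lemma run_bit u x e : run (bit u x) e = N.b2n (N.testbit (run x e) (#(len (run u e)))).
Proof.
 unfold bit. rewrite run_odd, run_shr, <- N.bit0_odd, N.shiftr_spec'. refl.
Qed.

Lemma len_times p q e : len (run (times p q) e) = len (run p e) * len (run q e).
Proof. unfold times. rewrite run_half, len_div2, run_smash, size_nat_pow2. lia. Qed.

Lemma size_nat_min a b : len (N.min a b) = Nat.min (len a) (len b).
Proof.
 destruct (N.le_ge_cases a b) as [H|H]; assert (H' := size_nat_mono _ _ H);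
  [rewrite N.min_l, Nat.min_l|rewrite N.min_r, Nat.min_r]; auto.
Qed.

Lemma len_unary i u e : len (run (unary i u) e) = Nat.min (N.to_nat (run i e)) (len (run u e)).
Proof.
 unfold unary. rewrite run_comp. cbn [map]. set (y := run u e).
 set (d := times (Proj 0) (s1 one)).
 apply (rec_len_ind Zero (Defs.cond (odd (Proj 1)) (s1 d) d) (Proj 1) [y]
  (fun z v => len v = Nat.min (N.to_nat z) (len y))).
 - intros z Hz. apply len_zero in Hz as ->. refl.
 - intros z v Hz IH. rewrite size_nat_min. cbn [run nth]. fold (run d [v; z; y]).
  assert (Ed : len (run d [v; z; y]) = 2 * len v).
  { unfold d. rewrite len_times, run_s1. cbn [run nth]. change (len (2 * run one [v; z; y] + 1)%N) with 2. lia. }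
  rewrite run_cond, run_odd, run_s1. cbn [run nth].
  assert (Ez := N.div2_odd z). rewrite IH in Ed.
  destruct (N.odd z); cbn [N.b2n] in *; simpl N.eqb; cbv iota; rewrite ?len_s1, Ed; lia.
Qed.

(** Horner's scheme: [f 0] becomes the most significant of the [n] bits appended below [a]. *)
Fixpoint rd (a : N) (n : nat) (f : nat -> bool) : N :=
 match n with
 | O => a
 | S n => (2 * rd a n f + N.b2n (f n))%N
 end.

Notation rb a n x := (rd a n (fun j => N.testbit x #j)).

Lemma rd_bound a n f : (rd a n f < (a + 1) * 2 ^ #n)%N.
Proof.
 induction n as [|n IH]; cbn [rd]; [simpl; lia|]. rewrite Nat2N.inj_succ, N.pow_succ_r'.
 set (P := (2 ^ #n)%N) in *. clearbody P. set (r := rd a n f) in *. clearbody r.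
 replace ((a + 1) * (2 * P))%N with (2 * ((a + 1) * P))%N by ring. set (Q := ((a + 1) * P)%N) in *. clearbody Q.
 destruct (f n); cbn [N.b2n]; lia.
Qed.

Lemma run_read_bits v u x e a : (forall e, run v e = a) -> (a <= 1)%N ->
 run (read_bits v u x) e = rb a (len (run u e)) (run x e).
Proof.
 intros Hv Ha. unfold read_bits. rewrite run_comp. cbn [map]. set (y := run x e).
 apply (rec_len_ind v (push (Proj 0) (bit (half (Proj 1)) (Proj 2))) (smash one (s1 (Proj 0))) [y]
  (fun z w => w = rb a (len z) y)).
 - intros z ->. apply Hv.
 - intros z w Hz ->. rewrite (run_push _ _ _ _ (run_bit _ _ _)), run_smash, run_half, run_s1.
  cbn [run nth]. rewrite len_s1, len_div2. assert (Hp := len_pos z Hz).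
  remember (len z - 1) as m eqn:Hm. replace (len z) with (S m) by lia. cbn [rd].
  apply N.min_l. assert (B := rd_bound a (S m) (fun j => N.testbit y #j)). cbn [rd] in B.
  change (len (run one [z; y])) with 1. rewrite Nat.mul_1_l, (Nat2N.inj_succ (S m)), N.pow_succ_r'.
  set (Q := (2 ^ #(S m))%N) in *. clearbody Q. nia.
Qed.

Lemma rd_testbit n f j : N.testbit (rd 0 n f) #j =
 if j <? n then f (n - 1 - j) else false.
Proof.
 revert j; induction n as [|n IH]; intros j; [cbn [rd]; now rewrite N.bits_0|].
 cbn [rd]. rewrite testbit_double. destruct j as [|j].
 - simpl. f_equal. lia.
 - rewrite IH. change (S j <? S n) with (j <? n). destruct (j <? n); auto. f_equal. lia.
Qed.

Lemma rd_ext a n f g : (forall j, j < n -> f j = g j) -> rd a n f = rd a n g.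
Proof.
 induction n as [|n IH]; intros H; cbn [rd]; auto. rewrite IH, H; auto.
Qed.

(** ** Stacks of bits *)

Definition stk (l : list bool) : N := fold_left (fun a b => 2 * a + N.b2n b)%N l 1%N.

Lemma stk_snoc l b : stk (l ++ [b]) = (2 * stk l + N.b2n b)%N.
Proof. unfold stk. now rewrite fold_left_app. Qed.

Lemma len_double z b : z <> 0%N -> len (2 * z + N.b2n b)%N = S (len z).
Proof. destruct z as [|p]; [tauto|]. destruct b; refl. Qed.

Lemma stk_nz l : stk l <> 0%N.
Proof.
 induction l as [|b l IH] using rev_ind; [discriminate|]. rewrite stk_snoc. lia.
Qed.

Lemma len_stk l : len (stk l) = S (length l).
Proof.
 induction l as [|b l IH] using rev_ind; [refl|].
 rewrite stk_snoc, len_double, IH, length_app by apply stk_nz. simpl. lia.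
Qed.

Lemma stk_testbit l i : i < length l -> N.testbit (stk l) #(length l - 1 - i) = nth i l false.
Proof.
 induction l as [|b l IH] using rev_ind; [simpl; lia|].
 rewrite length_app, stk_snoc, testbit_double. simpl. intros Hi.
 destruct (Nat.eq_dec i (length l)) as [->|Hne].
 - rewrite app_nth2, !Nat.sub_diag by lia. replace (length l + 1 - 1 - length l) with 0 by lia. refl.
 - rewrite app_nth1 by lia. replace (length l + 1 - 1 - i) with (S (length l - 1 - i)) by lia. apply IH. lia.
Qed.

Lemma rd_one_stk n f : rd 1 n f = stk (map f (seq 0 n)).
Proof.
 induction n as [|n IH]; [refl|]. cbn [rd]. rewrite seq_S, map_app, IH. simpl map.
 now rewrite stk_snoc.
Qed.

Lemma len_shiftr x k : len (N.shiftr x #k) = len x - k.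
Proof.
 induction k as [|k IH]; [change (N.of_nat 0) with 0%N; rewrite N.shiftr_0_r; lia|].
 rewrite Nat2N.inj_succ, N.shiftr_succ_r, len_div2, IH. lia.
Qed.

Lemma run_wire v i e l : run v e = stk l ->
 run (wire v i) e = N.b2n (nth (N.to_nat (run i e)) l false).
Proof.
 intros Hv. unfold wire. rewrite run_comp. cbn [map]. rewrite Hv. set (j := run i e).
 rewrite run_cond. set (r := shr _ _).
 (* The length of [r] counts the wires from the one addressed up to the top of the stack. It is 0
    exactly when the pointer is out of range, which then reads 0. *)
 assert (Lr : len (run r [stk l; j]) = length l - N.to_nat j).
 { unfold r. rewrite run_shr, len_unary, run_half. cbn [run nth]. rewrite len_stk.
  rewrite len_shiftr, len_div2, len_stk. lia. }
 destruct (N.eqb_spec (run r [stk l; j]) 0) as [E|E].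
 - rewrite E in Lr. simpl in Lr. rewrite nth_overflow by lia. refl.
 - apply len_pos in E. rewrite run_bit, run_half, len_div2, Lr. cbn [run nth].
  rewrite <- (stk_testbit l (N.to_nat j)) by lia. do 3 f_equal. lia.
Qed.

Definition gate_val (t : N) (p : nat) (l : list bool) : bool :=
 let a := nth (N.to_nat (rb 0 p (N.shiftr t 4))) l false in
 let b := nth (N.to_nat (rb 0 p (N.shiftr t #(4 + p)))) l false in
 N.testbit t (2 * N.b2n a + N.b2n b).

Lemma run_gate l t p : run gate_prog [stk l; t; p] = stk (l ++ [gate_val t (len p) l]).
Proof.
 unfold gate_prog. cbv zeta. set (t4 := half (half (half (half (Proj 1))))).
 set (e := [stk l; t; p]).
 assert (E4 : run t4 e = N.shiftr t 4).
 { unfold t4. rewrite !run_half. cbn [run nth e]. rewrite !N.div2_spec, !N.shiftr_shiftr. refl. }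
 assert (Hi : run (wire (Proj 0) (read_bits Zero (Proj 2) t4)) e =
  N.b2n (nth (N.to_nat (rb 0 (len p) (N.shiftr t 4))) l false)).
 { rewrite (run_wire _ _ _ l) by refl. rewrite (run_read_bits _ _ _ _ 0) by (auto; lia).
  now rewrite E4. }
 assert (Hj : run (wire (Proj 0) (read_bits Zero (Proj 2) (shr (Proj 2) t4))) e =
  N.b2n (nth (N.to_nat (rb 0 (len p) (N.shiftr t #(4 + len p)))) l false)).
 { rewrite (run_wire _ _ _ l) by refl. rewrite (run_read_bits _ _ _ _ 0) by (auto; lia).
  rewrite run_shr, E4, N.shiftr_shiftr, Nat2N.inj_add. refl. }
 rewrite (run_push _ _ _ (gate_val t (len p) l)); [now rewrite stk_snoc|].
 rewrite !run_cond, Hi, Hj, !run_odd, !run_half. unfold gate_val. cbn [run nth e].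
 set (a := nth _ l false). set (b := nth _ l false).
 rewrite <- !N.bit0_odd, !N.div2_spec, !N.shiftr_shiftr, !N.shiftr_spec'.
 destruct a, b; refl.
Qed.

Fixpoint gate_stack (C : N) (p L : nat) (l : list bool) (j : nat) : list bool :=
 match j with
 | 0 => l
 | S j => let l' := gate_stack C p L l j in
      l' ++ [gate_val (N.shiftr C #(j * L)) p l']
 end.

Lemma gate_stack_length C p L l j : length (gate_stack C p L l j) = length l + j.
Proof. induction j as [|j IH]; simpl; [lia|]. rewrite length_app, IH. simpl. lia. Qed.

Lemma len_n_power k e : len (run (n_power k) e) = len (nth 0 e 0%N) ^ k.
Proof.
 induction k as [|k IH]; [refl|]. cbn [n_power]. rewrite len_times, IH. simpl. lia.
Qed.

Definition out_bits (k n : nat) (C z : N) : list bool :=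
 let p := blen (n ^ k) + 1 in let L := 4 + 2 * p in
 let l := gate_stack C p L (map (fun j => N.testbit z #j) (seq 0 n)) (n ^ k) in
 map (fun j => nth (N.to_nat (rb 0 p (N.shiftr C #(n ^ k * L + j * p)))) l false) (seq 0 n).

Lemma run_gates v0 C p L K :
 forall l, v0 = stk l ->
 run (Rec (Proj 0) (Comp gate_prog [Proj 0; shr (times (half (Proj 1)) (Proj 5)) (Proj 3); Proj 4])
    (smash (s1 (Proj 0)) (s1 (Proj 1)))) [K; v0; C; p; L] =
 stk (gate_stack C (len p) (len L) l (len K)).
Proof.
 intros l ->.
 apply (rec_len_ind _ _ _ [stk l; C; p; L] (fun K v => v = stk (gate_stack C (len p) (len L) l (len K)))).
 - intros z ->. refl.
 - intros z v Hz ->. assert (Hp := len_pos z Hz). rewrite run_comp. cbn [map].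
  rewrite run_shr, len_times, run_half. cbn [run nth]. rewrite len_div2.
  remember (len z - 1) as m eqn:Hm. replace (len z) with (S m) by lia. cbn [gate_stack].
  fold (run gate_prog [stk (gate_stack C (len p) (len L) l m); N.shiftr C #(m * len L); p]).
  rewrite run_gate.
  apply N.min_l, N.lt_le_incl. rewrite run_smash. apply size_nat_le.
  rewrite len_stk, length_app, gate_stack_length, !run_s1, !len_s1. cbn [run nth length].
  rewrite len_stk. lia.
Qed.

Lemma nth_map_seq A (f : nat -> A) d n j : j < n -> nth j (map f (seq 0 n)) d = f j.
Proof.
 intros H. rewrite (nth_indep _ d (f 0)) by (rewrite length_map_seq; lia).
 now rewrite map_nth, seq_nth.
Qed.

Lemma run_outs N v l C p : v = stk l ->
 run (Rec Zero (push (Proj 0) (wire (Proj 2) (read_bits Zero (Proj 4)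
     (shr (times (half (Proj 1)) (Proj 4)) (Proj 3))))) (smash one (s1 (Proj 0)))) [N; v; C; p] =
 rd 0 (len N) (fun j => nth (N.to_nat (rb 0 (len p) (N.shiftr C #(j * len p)))) l false).
Proof.
 intros ->.
 apply (rec_len_ind _ _ _ [stk l; C; p] (fun K v => v = rd 0 (len K) _)).
 - intros z Hz. now rewrite Hz.
 - intros z v Hz ->. assert (Hp := len_pos z Hz).
  remember (len z - 1) as m eqn:Hm. assert (Ed := len_div2 z). rewrite <- Hm in Ed. rewrite Ed.
  set (f := fun j : nat => _).
  rewrite (run_push _ _ _ (f m)).
  + cbn [run nth]. replace (len z) with (S m) by lia. cbn [rd]. apply N.min_l.
   fold (run (smash one (s1 (Proj 0))) [z; stk l; C; p]). rewrite run_smash, run_s1. cbn [run nth]. rewrite len_s1.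
   change (len (run one _)) with 1. assert (B := rd_bound 0 (S m) f). cbn [rd] in B.
   rewrite Nat.mul_1_l. replace (len z) with (S m) by lia. rewrite (Nat2N.inj_succ (S m)), N.pow_succ_r'. lia.
  + rewrite (run_wire _ _ _ l) by refl. rewrite (run_read_bits _ _ _ _ 0) by (auto; lia).
   rewrite run_shr, len_times, run_half. cbn [run nth]. now rewrite Ed.
Qed.

Lemma run_eval k N C z j : N.testbit (run (eval_prog k) [N; C; z]) #j =
 nth j (out_bits k (len N) C z) false.
Proof.
 unfold eval_prog. cbv zeta. rewrite run_comp. cbn [map].
 set (K := run (n_power k) [N; C; z]).
 assert (LK : len K = len N ^ k) by apply len_n_power.
 set (p := run (s1 (Comp Len [n_power k])) [N; C; z]).
 assert (Lp : len p = blen (len N ^ k) + 1).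
 { unfold p. rewrite run_s1, len_s1, run_comp. cbn [map run nth]. fold K.
  unfold blen. rewrite size_size_nat, LK. lia. }
 set (L := run (s1 (s1 (s1 (s1 _)))) _).
 assert (LL : len L = 4 + 2 * len p).
 { unfold L. rewrite !run_s1, !len_s1, len_times. fold p. change (len (run (s1 one) _)) with 2. lia. }
 change (run (Proj 0) [N; C; z]) with N. change (run (Proj 1) [N; C; z]) with C.
 change (run (Proj 2) [N; C; z]) with z. clearbody K p L. set (e := [N; C; z; K; p; L]).
 rewrite (run_read_bits _ _ _ _ 0) by (auto; lia). change (run (Proj 0) e) with N.
 rewrite rd_testbit, run_comp. cbn [map].
 set (v := run (Comp (Rec (Proj 0) _ _) _) _).
 assert (Ev : v = stk (gate_stack C (len p) (len L) (map (fun j => N.testbit z #j) (seq 0 (len N))) (len K))).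
 { unfold v. rewrite run_comp. cbn [map]. apply run_gates.
  rewrite (run_read_bits _ _ _ _ 1) by (auto; lia). apply rd_one_stk. }
 rewrite (run_outs _ _ _ _ _ Ev). rewrite run_shr, len_times.
 change (run (Proj 0) e) with N. change (run (Proj 1) e) with C. change (run (Proj 3) e) with K.
 change (run (Proj 4) e) with p. change (run (Proj 5) e) with L.
 unfold out_bits. rewrite Lp, LK, LL, Lp.
 destruct (Nat.ltb_spec j (len N)) as [Hj|Hj].
 (* The outputs are accumulated most significant bit first, and the outer [read_bits] reverses them;
    the two reflections of the index cancel. *)
 - rewrite rd_testbit. replace (len N - 1 - j <? len N) with true by (symmetry; apply Nat.ltb_lt; lia).
  rewrite nth_map_seq by lia. rewrite N.shiftr_shiftr, <- Nat2N.inj_add. replace (len N - 1 - (len N - 1 - j)) with j by lia.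
  refl.
 - rewrite nth_overflow; auto. rewrite length_map_seq. lia.
Qed.

(** * Symbolic evaluation of [sat_prog] *)

Lemma be_val_rd f n s : be_val (map f (seq s n)) = N.to_nat (rd 0 n (fun k => f (s + k))).
Proof.
 unfold be_val. induction n as [|n IH]; [refl|].
 rewrite seq_S, map_app, fold_left_app, IH. cbn [rd map fold_left].
 destruct (f (s + n)); cbn [N.b2n Nat.b2n]; lia.
Qed.

Definition token_step (n : nat) (o0 o1 o2 : bool) (v : nat) (st : option (list pform)) :=
 if o2 then if o1 then None else
  match st with Some (B :: A :: l) => Some ((if o0 then por A B else pand A B) :: l) | _ => None end
 else if o1 then
  if o0 then match st with Some (B :: A :: l) => Some (pimp A B :: l) | _ => None end
  else match st with Some l => if v <? n then Some (pvar v :: l) else None | None => None end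
 else if o0 then match st with Some l => Some (pbot :: l) | None => None end
 else st.

Lemma read_token_step n st f m : read_token n st (map f (seq 0 (3 + m))) =
 token_step n (f 0) (f 1) (f 2) (N.to_nat (rd 0 m (fun k => f (3 + k)))) st.
Proof.
 rewrite <- be_val_rd. cbn [Nat.add seq map]. unfold read_token, token_step.
 destruct (f 2), (f 1), (f 0), st as [[|B [|A l]]|]; refl.
Qed.

Lemma len_ones k : len (N.ones #k) = k.
Proof.
 destruct k as [|k]; [refl|]. apply Nat.le_antisymm.
 - apply size_nat_le. rewrite N.ones_equiv. apply N.lt_pred_l, N.pow_nonzero. discriminate.
 - apply Nat.nlt_ge. intros H. assert (E := testbit_over (N.ones #(S k)) k ltac:(lia)).
  rewrite N.ones_spec_low in E by lia. discriminate.
Qed.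

Section Sym.
Context {SC : Scale}.

Lemma papp_cond_split q (P : nat -> Prop) c a b es (R : elt) :
 (forall q', sub q q' -> (forall i, live q' i -> P i) ->
   prv q' (nz (papp c es)) /\ meq q' (papp a es) R) ->
 (forall q', sub q q' -> (forall i, live q' i -> ~ P i) ->
   meq q' (papp c es) mnil /\ meq q' (papp b es) R) ->
 meq q (papp (Defs.cond c a b) es) R.
Proof.
 intros H1 H2.
 assert (E : forall q', meq q' (papp (Defs.cond c a b) es) (mmux (nz (papp c es)) (papp a es) (papp b es))).
 { intros q'. apply meq_eq. refl. }
 apply prv_split with P.
 - destruct (H1 (restrict q P)) as [A B]; [apply sub_restrict|intros i; apply live_restrict|].
  change (meq (restrict q P) (papp (Defs.cond c a b) es) R).
  etrans; [apply E|]. etrans; [apply mmux_true, A|exact B].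
 - destruct (H2 (restrict q (fun i => ~ P i))) as [A B];
   [apply sub_restrict|intros i; apply (live_restrict q (fun i => ~ P i))|].
  change (meq (restrict q (fun i => ~ P i)) (papp (Defs.cond c a b) es) R).
  etrans; [apply E|]. etrans; [apply mmux_false, nz_false, A|exact B].
Qed.

Lemma papp_cond_isc {q c a b es} {R : elt} {m} : isc q (papp c es) m ->
 (forall q', sub q q' -> (forall i, live q' i -> m i <> 0%N) -> meq q' (papp a es) R) ->
 (forall q', sub q q' -> (forall i, live q' i -> m i = 0%N) -> meq q' (papp b es) R) ->
 meq q (papp (Defs.cond c a b) es) R.
Proof.
 intros Hm H1 H2. apply papp_cond_split with (fun i => m i <> 0%N); intros q' Hq HP.
 - split; auto. apply nz_isc with m; auto. now apply (isc_sub (q := q)).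
 - assert (G : forall i, live q' i -> m i = 0%N) by (intros i Hi; apply NNPP; auto).
  split; auto. apply (isc_unique _ _ _ (fun _ => 0%N)); [|apply isc_nil].
  apply isc_ext with m; auto; [apply (pb_const 0)|now apply (isc_sub (q := q))].
Qed.

Lemma meq_bool q (f : nat -> bool) (x y : elt) :
 (forall b q', sub q q' -> (forall i, live q' i -> f i = b) -> meq q' x y) -> meq q x y.
Proof.
 intros H. apply prv_split with (fun i => f i = true).
 - apply (H true); [apply sub_restrict|intros i; apply live_restrict].
 - apply (H false); [apply sub_restrict|]. intros i Hi. now apply live_restrict, not_true_iff_false in Hi.
Qed.

Lemma papp_cond_bool q c a d es m (b : bool) : isc q (papp c es) m -> (forall i, live q i -> (m i =? 0)%N = negb b) ->
 meq q (papp (Defs.cond c a d) es) (papp (if b then a else d) es).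
Proof.
 intros H E. apply (papp_cond_isc H); intros q' Sq Hm; apply meq_eq; intros i Hi; specialize (E i (live_sub Sq Hi));
  destruct b; auto; exfalso; [apply N.eqb_eq in E; now apply (Hm i)|apply N.eqb_neq in E; auto].
Qed.

Lemma papp_push q v b es : meq q (papp (push v b) es) (mcons (nz (papp b es)) (papp v es)).
Proof.
 apply meq_intro. intros k q' _ _.
 assert (B := mux_bit q' (nz (papp b es)) (mcons ftop_ (papp v es)) (mcons fbot_ (papp v es)) k).
 puse B.
 ptaut_fin_by (change (papp (push v b) es i) with (muxp (nz (papp b es) i) (mcons ftop_ (papp v es) i) (mcons fbot_ (papp v es) i)); cbn [fam mcons]; unfold ftop_, fbot_; destruct (k i); nth_cons).
Qed.

Lemma madd_self q b (x : elt) : meq q (madd b x x) (mcons b x).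
Proof.
 apply meq_intro. intros k q' _ _. assert (B := add_bit q' b x x k). cbn [fam madd mcons].
 puse B. ptaut_fin_by (destruct (k i); cbn [carry]; nth_cons).
Qed.

Lemma le_tl q (x : elt) : le_ q (mtl x) x.
Proof.
 set (b := fun i => nth_bit (x i) 0).
 assert (E : meq q x (madd fbot_ (mtl x) (madd b (mtl x) mnil))).
 { etrans; [apply mcons_tl|]. fold b. etrans; [symmetry; apply madd_self|].
  etrans; [|apply madd_assoc with (c1 := fbot_) (c2 := b)].
  - etrans; [apply madd_proper; [refl|refl|symmetry; apply madd_0]|].
   etrans; [|symmetry; apply madd_assoc with (d1 := fbot_) (d2 := b)]; [refl|].
   unfold fbot_. ptaut0.
  - unfold fbot_. ptaut0. }
 apply (proj2 (le_proper q _ _ (reflexivity _) _ _ E)), le_add_r.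
Qed.

Lemma le_skip q k (x : elt) : pb k -> le_ q (mskip k x) x.
Proof.
 intros Hk. refine (prv_ind q (fun i k => pneg (lessp (x i) (skipn k (x i)))) k Hk _ _ k (fun i _ => le_n _)).
 - apply le_refl.
 - intros k' q' _ _ IH. apply (le_trans q' (mskip (fun i => S (k' i)) x) (mskip k' x) x); [|exact IH].
  eapply le_proper; [|refl|apply (le_tl q' (mskip k' x))].
  apply meq_eq. intros i _. cbn [fam mskip mtl]. now rewrite tl_skipn.
Qed.

(** Only the amount of the shift is constant, so [closed_run] does not apply. The shifted argument
    may be symbolic, as it is when a variable of the formula is looked up in [y]. *)
Lemma papp_shr q u x es m : isc q (papp u es) m ->
 meq q (papp (shr u x) es) (mskip (fun i => N.size_nat (m i)) (papp x es)).
Proof.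
 intros Hm. destruct Hm as (Hp & Hm).
 set (X := papp x es) in *. set (U := cst m Hp) in *.
 set (F := fun k => papp (Rec (Proj 0) (half (Proj 0)) (Proj 1)) [mskip k U; X]).
 set (G := fun k => mskip (fun i => N.size_nat (m i) - k i) X).
 assert (E : meq q (F (fun _ => 0)) (G (fun _ => 0))).
 { apply (meq_ind_down (fun i k => F (fun _ => k) i) (fun i k => G (fun _ => k) i) F G q (fun i => N.size_nat (m i)));
   [refl|refl|exact Hp| |].
  - etrans; [apply rec_zero; apply mskip_over; intros i _; cbn [fam U cst]; rewrite bitsN_length; lia|].
   etrans; [apply papp_proj|]. cbn [nth]. apply meq_eq. intros i _.
   cbn [fam G mskip]. now rewrite Nat.sub_diag.
  - intros k q' Hq Hk IH.
   assert (IZ : isc q' (mskip k U) (fun i => N.shiftr (m i) #(k i))) by apply isc_skip, isc_cst.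
   etrans; [apply rec_step; apply (nz_isc _ _ _ IZ)|].
   + intros i Hi E. specialize (Hk i Hi). assert (L := len_shiftr (m i) (k i)). rewrite E in L. simpl in L. lia.
   + assert (IH' : meq q' (papp (Rec (Proj 0) (half (Proj 0)) (Proj 1)) [mtl (mskip k U); X]) (G (fun i => 1 + k i))).
    { etrans; [|exact IH]. apply meq_eq. intros i _. unfold F. cbn [fam papp args map mtl mskip].
     now rewrite tl_skipn. }
    set (PV := papp (Rec _ _ _) _) in *.
    assert (E1 : meq q' (papp (half (Proj 0)) [PV; mskip k U; X]) (G k)).
    { etrans; [apply meq_eq with (y := mtl PV); refl|]. rewrite IH'. apply meq_eq. intros i Hi.
     specialize (Hk i Hi). cbn [fam mtl G mskip]. rewrite tl_skipn. f_equal. lia. }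
    etrans; [apply mmin_proper; [exact E1|apply meq_eq with (y := X); refl]|].
    apply mmin_le, le_skip. eapply pb_le; [|exact Hp]. intros i. cbv beta. lia. }
 transitivity (F (fun _ => 0)).
 - change (meq q (papp (Rec (Proj 0) (half (Proj 0)) (Proj 1)) [papp u es; X]) (F (fun _ => 0))).
  apply papp_proper. constructor; [|constructor; [refl|constructor]].
  etrans; [exact Hm|symmetry; apply mskip_0].
 - etrans; [exact E|]. apply meq_eq. intros i _. cbn [fam G mskip]. now rewrite Nat.sub_0_r.
Qed.

Lemma lt_pow2 q (x y : elt) l : pb l -> (forall i, live q i -> length (x i) <= l i) ->
 isc q y (fun i => 2 ^ #(l i))%N -> lt_ q x y.
Proof.
 intros Hl Hx (Hp & Hy).
 apply (proj2 (lt_proper q _ _ (reflexivity x) _ _ Hy)). unfold lt_.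
 assert (E := lessp_at q x (cst _ Hp) (fun i => S (l i)) (pb_S _ Hl)).
 assert (E' := E ltac:(intros i Hi; specialize (Hx i Hi); cbn [fam cst];
   rewrite bitsN_length, size_nat_pow2; lia)).
 puse E'. ptaut_by (cbn [fam cst]; unfold lessn; fold lessn; cbv zeta; rewrite bitsN_bit, (nth_bit_over (x i)) by (now apply Hx); rewrite N.pow2_bits_true).
Qed.

(** The top formula is the least significant bit, the final [ptop] is the sentinel, and an error is
    the number 0. *)
Definition enc (F : pform -> pform) (st : option (list pform)) : bits :=
 match st with Some l => map F l ++ [ptop] | None => [] end.

Definition stack_nth (j : nat) (st : option (list pform)) : pform :=
 match st with Some l => nth j l pbot | None => pbot end.

(** [F i A] is the value of [A] at the assignment [y i]: the formula obtained by
  substitution, or the truth value if [y] is a constant. *)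
Record valuation (q : cond) (F : nat -> pform -> pform) (y : nat -> bits) (n : nat -> nat) : Prop := {
 val_bot : prv q (fun i => pneg (F i pbot));
 val_var : forall k q', sub q q' -> (forall i, live q' i -> k i < n i) ->
  prv q' (fun i => piff (F i (pvar (k i))) (nth_bit (y i) (k i)));
 val_imp : forall A B, prv q (fun i => piff (F i (pimp (A i) (B i))) (pimp (F i (A i)) (F i (B i))));
 val_and : forall A B, prv q (fun i => piff (F i (pand (A i) (B i))) (pand (F i (A i)) (F i (B i))));
 val_or : forall A B, prv q (fun i => piff (F i (por (A i) (B i))) (por (F i (A i)) (F i (B i)))) }.

Lemma valuation_sub {q q' F y n} : sub q q' -> valuation q F y n -> valuation q' F y n.
Proof.
 intros H []. constructor; intros; try (eapply prv_sub; [exact H|auto]).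
 apply val_var0; auto. now apply (sub_trans (q' := q')).
Qed.

Section Step.
Variables (n : nat -> nat) (F : nat -> pform -> pform) (v t Ne y v' : elt) (tn : nat -> N).
Variable st : nat -> option (list pform).
Let es := [v; t; Ne; y].
Hypothesis Hv : forall i, v i = enc (F i) (st i).

Lemma nz_top q (x : elt) : (forall i, live q i -> In ptop (x i)) -> prv q (nz x).
Proof.
 intros H. apply (pdisj_intro q x (fun _ => ptop)); [apply fam_pb|exact H|apply prv_top].
Qed.

(** [P] says that the operands are present. The program detects this by the sentinel that is left in
    [r] after popping them. *)
Lemma guarded_step q r b (R : elt) (P : nat -> Prop) :
 (forall i, live q i -> P i -> In ptop (papp r es i)) ->
 (forall i, live q i -> ~ P i -> papp r es i = [] /\ R i = []) ->
 (forall q', sub q q' -> (forall i, live q' i -> P i) ->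
   exists c : nat -> pform, prv q' (fun i => piff (nz (papp b es) i) (c i)) /\
    forall i, live q' i -> R i = c i :: papp r es i) ->
 meq q (papp (Defs.cond r (push r b) Zero) es) R.
Proof.
 intros H1 H2 H3. apply papp_cond_split with P; intros q' Hq HP.
 - split; [apply nz_top; intros i Hi; apply H1; auto; now apply (live_sub Hq)|].
  destruct (H3 q' Hq HP) as (c & Hc & HR). etrans; [apply papp_push|].
  transitivity (mcons c (papp r es)).
  + apply meq_cons; [exact Hc|refl].
  + apply meq_eq. intros i Hi. cbn [fam mcons]. symmetry. auto.
 - assert (G := fun i Hi => H2 i (live_sub Hq Hi) (HP i Hi)).
  split; apply meq_eq; intros i Hi; destruct (G i Hi) as [G1 G2]; [exact G1|now rewrite G2].
Qed.

Lemma enc_ptop (l : list pform) (f : pform -> pform) : In ptop (map f l ++ [ptop]).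
Proof. apply in_or_app. right. now left. Qed.

Lemma binary_step q b (c : pform -> pform -> pform) (T : nat -> option (list pform)) :
 (forall A B, prv q (fun i => piff (F i (c (A i) (B i))) (c (F i (A i)) (F i (B i))))) ->
 (forall i, live q i -> v' i = enc (F i) (T i)) ->
 (forall i, live q i -> T i = match st i with Some (B :: A :: l) => Some (c A B :: l) | _ => None end) ->
 (forall q2 (a0 a1 : nat -> pform), sub q q2 -> (forall i, live q2 i -> exists l, v i = a0 i :: a1 i :: l) ->
   prv q2 (fun i => piff (nz (papp b es) i) (c (a1 i) (a0 i)))) ->
 meq q (papp (Defs.cond (half (half (Proj 0))) (push (half (half (Proj 0))) b) Zero) es) v'.
Proof.
 intros Hc Hv' HT Hb. assert (Hr : forall i, papp (half (half (Proj 0))) es i = tl (tl (v i))) by refl.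
 apply guarded_step with (fun i => exists B A l, st i = Some (B :: A :: l)).
 - intros i _ (B & A & l & E). rewrite Hr, Hv, E. apply enc_ptop.
 - intros i Hi HP. rewrite Hr, Hv, Hv', HT by auto. destruct (st i) as [[|B [|A l]]|]; auto. exfalso. eauto.
 - intros q2 S2 HP. exists (fun i => F i (c (stack_nth 1 (st i)) (stack_nth 0 (st i)))). split.
  + assert (E := Hb q2 (fun i => F i (stack_nth 0 (st i))) (fun i => F i (stack_nth 1 (st i))) S2).
   assert (E2 := prv_sub S2 (Hc (fun i => stack_nth 1 (st i)) (fun i => stack_nth 0 (st i)))).
   puses (E2, E ltac:(intros i Hi; destruct (HP i Hi) as (B & A & l & Ei); rewrite Hv, Ei; cbn; eauto)). ptaut.
  + intros i Hi. destruct (HP i Hi) as (B & A & l & Ei). apply (live_sub S2) in Hi. now rewrite Hv', HT, Hr, Hv, Ei.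
Qed.

Lemma unary_step q b (c : nat -> pform) (T : nat -> option (list pform)) :
 (forall i, live q i -> v' i = enc (F i) (T i)) ->
 (forall i, live q i -> T i = match st i with Some l => Some (c i :: l) | None => None end) ->
 prv q (fun i => piff (nz (papp b es) i) (F i (c i))) ->
 meq q (papp (Defs.cond (Proj 0) (push (Proj 0) b) Zero) es) v'.
Proof.
 intros Hv' HT Hb. assert (Hr : forall i, papp (Proj 0) es i = v i) by refl.
 apply guarded_step with (fun i => st i <> None).
 - intros i _ E. rewrite Hr, Hv. destruct (st i); [apply enc_ptop|tauto].
 - intros i Hi E. rewrite Hr, Hv, Hv', HT by auto. destruct (st i); auto. destruct E. discriminate.
 - intros q2 S2 HP. exists (fun i => F i (c i)). split; [exact (prv_sub S2 Hb)|].
  intros i Hi. specialize (HP i Hi). apply (live_sub S2) in Hi. rewrite Hr, Hv, Hv', HT by auto. now destruct (st i).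
Qed.

(** The token is a constant, so its operation and its variable are settled by a case distinction on
    the index. Only the stack and the assignment remain symbolic. *)
Lemma sat_step q : isc q Ne (fun i => N.ones #(n i)) -> isc q t tn -> valuation q F y n ->
 (forall i, live q i -> v' i = enc (F i)
   (token_step (n i) (N.testbit (tn i) 0) (N.testbit (tn i) 1) (N.testbit (tn i) 2)
    (N.to_nat (rb 0 (blen (n i)) (N.shiftr (tn i) 3))) (st i))) ->
 meq q (papp step_prog es) v'.
Proof.
 intros HN Ht HF Hv'. set (V := fun i => N.to_nat (rb 0 (blen (n i)) (N.shiftr (tn i) 3))).
 change (forall i, live q i -> v' i = enc (F i)
  (token_step (n i) (N.testbit (tn i) 0) (N.testbit (tn i) 1) (N.testbit (tn i) 2) (V i) (st i))) in Hv'.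
 apply (meq_bool q (fun i => N.testbit (tn i) 2)); intros b2 q2 S2 E2.
 apply (meq_bool q2 (fun i => N.testbit (tn i) 1)); intros b1 q1 S1 E1.
 apply (meq_bool q1 (fun i => N.testbit (tn i) 0)); intros b0 q0 S0 E0.
 assert (S10 := sub_trans S1 S0). assert (Sq := sub_trans S2 S10).
 assert (HT : forall i, live q0 i -> v' i = enc (F i) (token_step (n i) b0 b1 b2 (V i) (st i))).
 { intros i Hi. rewrite Hv' by exact (live_sub Sq Hi). now rewrite E0, E1, E2 by eauto using live_sub. }
 apply (isc_sub Sq) in HN, Ht. apply (valuation_sub Sq) in HF.
 (* A subprogram that looks neither at the stack nor at the assignment may be run with 0 in their
    place, that is on constants. *)
 assert (C : forall p, (forall i, papp p es i = papp p [mnil; t; Ne; mnil] i) ->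
   isc q0 (papp p es) (fun i => run p [0%N; tn i; N.ones #(n i); 0%N])).
 { intros p E. eapply isc_meq; [apply meq_eq; intros i _; apply E|].
  apply (closed_run p q0 _ [fun _ => 0%N; tn; fun i => N.ones #(n i); fun _ => 0%N]).
  repeat constructor; try apply isc_nil; auto. }
 assert (HB : forall b b' : bool, b = b' -> (N.b2n b =? 0)%N = negb b') by (intros [] b' <-; refl).
 assert (O0 := C (odd (Proj 1)) (fun i => eq_refl)). assert (O1 := C (odd (half (Proj 1))) (fun i => eq_refl)).
 assert (O2 := C (odd (half (half (Proj 1)))) (fun i => eq_refl)).
 assert (R0 : forall a d, meq q0 (papp (Defs.cond (odd (Proj 1)) a d) es) (papp (if b0 then a else d) es)).
 { intros a d. apply (papp_cond_bool _ _ _ _ _ _ _ O0). intros i Hi.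
  rewrite run_odd, <- N.bit0_odd. apply HB, (E0 i Hi). }
 clear O0. unfold step_prog. cbv zeta.
 etrans; [apply (papp_cond_bool _ _ _ _ _ _ b2 O2)|].
 { intros i Hi. rewrite run_odd, !run_half, <- N.bit0_odd, !N.div2_spec, !N.shiftr_shiftr, N.shiftr_spec'.
  apply HB, (E2 i (live_sub S10 Hi)). }
 assert (Q1 : forall a d, meq q0 (papp (Defs.cond (odd (half (Proj 1))) a d) es) (papp (if b1 then a else d) es)).
 { intros a d. apply (papp_cond_bool _ _ _ _ _ _ _ O1). intros i Hi.
  rewrite run_odd, run_half, <- N.bit0_odd, N.div2_spec, N.shiftr_spec'. apply HB, (E1 i (live_sub S0 Hi)). }
 clear O1 O2 E0 E1 E2 Hv'. destruct b2; (etrans; [apply Q1|]); destruct b1.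
 - apply meq_eq. intros i Hi. now rewrite HT.
 - apply (binary_step q0 _ (if b0 then por else pand) _) with (2 := HT); [destruct HF, b0; auto|intros i _; destruct b0; refl|].
  intros q3 a0 a1 S3 E. destruct b0; set (X := Defs.cond _ one _); set (Y := Defs.cond _ _ Zero);
   assert (Z := meq_sub S3 (R0 X Y)); apply nz_proper in Z; unfold peq in Z; puse Z;
   ptaut_by (destruct (E i Hi) as (l & Ei);
    change (nz (papp X es) i) with (pdisj (muxp (pdisj (firstn 1 (tl (v i)))) [ptop] (firstn 1 (v i))));
    change (nz (papp Y es) i) with (pdisj (muxp (pdisj (firstn 1 (tl (v i)))) (firstn 1 (v i)) []));
    rewrite Ei; unfold muxp, nth_bit; cbn [pdisj fold_right firstn tl map length seq Nat.max nth]).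
 - etrans; [apply R0|]. destruct b0.
  + apply (binary_step q0 _ pimp _) with (2 := HT); [apply HF|refl|]. intros q3 a0 a1 S3 E. set (X := Defs.cond _ _ one).
   ptaut_by (destruct (E i Hi) as (l & Ei);
    change (nz (papp X es) i) with (pdisj (muxp (pdisj (firstn 1 (tl (v i)))) (firstn 1 (v i)) [ptop]));
    rewrite Ei; unfold muxp, nth_bit; cbn [pdisj fold_right firstn tl map length seq Nat.max nth]).
  + set (ip := unary _ _). set (e0 := fun i => [0%N; tn i; N.ones #(n i); 0%N]).
   assert (HI : isc q0 (papp ip es) (fun i => run ip (e0 i))) by exact (C ip (fun i => eq_refl)).
   assert (HS : isc q0 (papp (shr ip (Proj 2)) es) (fun i => run (shr ip (Proj 2)) (e0 i))) by exact (C (shr ip (Proj 2)) (fun i => eq_refl)).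
   assert (LI : forall i, len (run ip (e0 i)) = Nat.min (V i) (n i)).
   { intros i. unfold ip. rewrite len_unary, (run_read_bits _ _ _ _ 0), !run_half, run_comp by (auto; lia).
    cbn [map run nth e0]. unfold V, blen. now rewrite size_size_nat, len_ones, !N.div2_spec, !N.shiftr_shiftr. }
   apply (meq_bool q0 (fun i => V i <? n i)); intros bv q4 S4 E4.
   assert (HT4 : forall i, live q4 i -> v' i = enc (F i) match st i with Some l => if bv then Some (pvar (V i) :: l) else None | None => None end).
   { intros i Hi. rewrite (HT i (live_sub S4 Hi)). cbn [token_step]. now rewrite (E4 i Hi). }
   etrans; [apply (papp_cond_bool _ _ _ _ _ _ bv (isc_sub S4 HS))|].
   { intros i Hi. rewrite <- (E4 i Hi). assert (LS : len (run (shr ip (Proj 2)) (e0 i)) = n i - Nat.min (V i) (n i)).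
    { rewrite run_shr, len_shiftr, LI. cbn [run nth e0]. now rewrite len_ones. }
    destruct (Nat.ltb_spec (V i) (n i)), (N.eqb_spec (run (shr ip (Proj 2)) (e0 i)) 0) as [E|E]; auto.
    - rewrite E in LS. cbn [N.size_nat] in LS. lia.
    - apply len_pos in E. rewrite LS in E. lia. }
   destruct bv; [|apply meq_eq; intros i Hi; rewrite HT4 by auto; now destruct (st i)].
   apply (unary_step q4 _ (fun i => pvar (V i)) _ HT4); [refl|].
   assert (HL : forall i, live q4 i -> V i < n i) by (intros i Hi; now apply Nat.ltb_lt, E4).
   assert (Z1 := val_var _ _ _ _ HF V q4 S4 HL).
   assert (Z2 : meq q4 (papp (bit ip (Proj 3)) es) (mcons (fun i => nth_bit (y i) (V i)) mnil)).
   { etrans; [apply (papp_odd q4 [papp (shr ip (Proj 3)) es])|]. apply meq_cons; [|refl].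
    assert (Z3 := papp_shr q4 ip (Proj 3) es _ (isc_sub S4 HI)).
    apply meq_bit with (k := fun _ => 0) in Z3. puse Z3.
    ptaut_by (cbn [fam mskip nth]; rewrite nth_bit_skipn, Nat.add_0_r, LI, Nat.min_l by (apply Nat.lt_le_incl, HL, Hi);
     change (papp (Proj 3) es i) with (y i)). }
   apply nz_proper in Z2. puses (Z1, Z2). ptaut_by (unfold nz at 2; cbn [fam mcons mnil pdisj fold_right]).
 - etrans; [apply R0|]. destruct b0.
  + apply (unary_step q0 _ (fun _ => pbot) _ HT); [refl|]. assert (Z := val_bot _ _ _ _ HF). puse Z.
   ptaut_by (change (nz (papp Zero es) i) with pbot).
  + apply meq_eq. intros i Hi. rewrite HT by auto. exact (Hv i).
Qed.
End Step.

Definition bits_of (n : nat) (x : N) : list bool := map (fun j => N.testbit x #j) (seq 0 n).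

Definition tokens (n : nat) (x : list bool) (j : nat) : option (list pform) :=
 fold_left (read_token n) (map (fun j => slice x (j * (3 + blen n)) (3 + blen n)) (seq 0 j)) (Some []).

Lemma tokens_S n x j : tokens n x (S j) =
 read_token n (tokens n x j) (slice x (j * (3 + blen n)) (3 + blen n)).
Proof. unfold tokens. now rewrite seq_S, map_app, fold_left_app. Qed.

Lemma token_step_length F n o0 o1 o2 v st m : length (enc F st) <= m ->
 length (enc F (token_step n o0 o1 o2 v st)) <= S m.
Proof.
 unfold token_step. destruct o2, o1, o0, st as [[|B [|A l]]|]; cbn [enc length map app]; try lia;
  destruct (v <? n); cbn [enc length map app]; lia.
Qed.

Lemma enc_length F n x j : length (enc F (tokens n x j)) <= S j.
Proof.
 induction j as [|j IH]; [refl|]. rewrite tokens_S. unfold slice. rewrite read_token_step.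
 now apply token_step_length.
Qed.

Lemma bits_of_nth n x k : (x < 2 ^ #n)%N -> nth k (bits_of n x) false = N.testbit x #k.
Proof.
 intros H. apply size_nat_le in H. unfold bits_of. destruct (Nat.lt_ge_cases k n) as [Hk|Hk].
 - now rewrite nth_map_seq.
 - rewrite nth_overflow by (rewrite length_map_seq; lia). symmetry. apply testbit_over. lia.
Qed.

Section Sat.
Variables (n : nat -> nat) (F : nat -> pform -> pform) (Ne X Y : elt) (x : nat -> N) (q : cond).
Hypothesis HN : isc q Ne (fun i => N.ones #(n i)).
Hypothesis HX : isc q X x.

Lemma pb_ones : pb n.
Proof. apply isc_pb in HN. eapply pb_le; [|exact HN]. intros i. cbv beta. now rewrite len_ones. Qed.

Lemma stack_pb (k : nat -> nat) : pb (fun i => length (enc (F i) (tokens (n i) (bits_of (n i) (x i)) (n i - k i)))).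
Proof. eapply pb_le; [|apply (pb_S _ pb_ones)]. intros i. cbv beta. etrans; [apply enc_length|lia]. Qed.

Definition stack (k : nat -> nat) : elt := Elt _ (stack_pb k).

Let w := s1 (s1 (s1 (Comp Len [Proj 2]))).
Let h := Comp step_prog [Proj 0; shr (times (half (Proj 1)) w) (Proj 3); Proj 2; Proj 4].

Lemma sat_stack : valuation q F Y n -> (forall i, live q i -> (x i < 2 ^ #(n i))%N) ->
 meq q (papp (Rec one h (smash one (s1 (Proj 0)))) [Ne; Ne; X; Y]) (stack (fun _ => 0)).
Proof.
 intros HF Hx. destruct HN as (HNp & HNe).
 set (U := cst _ HNp) in *.
 set (G := fun k => papp (Rec one h (smash one (s1 (Proj 0)))) [mskip k U; Ne; X; Y]).
 transitivity (G (fun _ => 0)).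
 { apply papp_proper. constructor; [|repeat (constructor; [refl|]); constructor].
  etrans; [exact HNe|symmetry; apply mskip_0]. }
 apply (meq_ind_down (fun i k => G (fun _ => k) i) (fun i k => stack (fun _ => k) i) G stack q n);
  [refl|refl|apply pb_ones| |].
 - etrans; [apply rec_zero; apply mskip_over; intros i _; cbn [fam U cst]; rewrite bitsN_length, len_ones; lia|].
  apply meq_eq. intros i _. cbn [fam stack]. rewrite Nat.sub_diag. refl.
 - intros k q' Hq Hk IH. set (z := fun i => N.shiftr (N.ones #(n i)) #(k i)).
  assert (IZ : isc q' (mskip k U) z) by apply isc_skip, isc_cst.
  assert (LZ : forall i, len (z i) = n i - k i) by (intros i; unfold z; now rewrite len_shiftr, len_ones).
  etrans; [apply rec_step; apply (nz_isc _ _ _ IZ)|].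
  { intros i Hi E. specialize (Hk i Hi). assert (L := LZ i). rewrite E in L. simpl in L. lia. }
  assert (IH' : meq q' (papp (Rec one h (smash one (s1 (Proj 0)))) [mtl (mskip k U); Ne; X; Y]) (stack (fun i => S (k i)))).
  { etrans; [|exact IH]. apply meq_eq. intros i _. unfold G. cbn [fam papp args map mtl mskip].
   now rewrite tl_skipn. }
  set (PV := papp (Rec _ _ _) _) in *.
  assert (C : forall p (es : list elt), (forall i, papp p es i = papp p [mnil; mskip k U; Ne; X; mnil] i) ->
    isc q' (papp p es) (fun i => run p [0%N; z i; N.ones #(n i); x i; 0%N])).
  { intros p es E. eapply isc_meq; [apply meq_eq; intros i _; apply E|].
   apply (closed_run p q' _ [fun _ => 0%N; z; fun i => N.ones #(n i); x; fun _ => 0%N]).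
   repeat constructor; try apply isc_nil; auto; now apply (isc_sub (q := q)). }
  set (tp := shr (times (half (Proj 1)) w) (Proj 3)) in *.
  assert (IT := C tp [PV; mskip k U; Ne; X; Y] (fun i => eq_refl)).
  assert (ET : forall i, run tp [0%N; z i; N.ones #(n i); x i; 0%N] =
   N.shiftr (x i) (#((n i - S (k i)) * (3 + blen (n i))))).
  { intros i. unfold tp. rewrite run_shr, len_times, run_half, len_div2. cbn [run nth]. rewrite LZ.
   unfold w. rewrite !run_s1, !len_s1, run_comp. cbn [map run nth]. rewrite size_size_nat, len_ones.
   unfold blen. do 3 f_equal; lia. }
  set (SS := stack (fun i => S (k i))) in *.
  assert (EH : meq q' (papp h [PV; mskip k U; Ne; X; Y]) (stack k)).
  { transitivity (papp step_prog [SS; papp tp [PV; mskip k U; Ne; X; Y]; Ne; Y]).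
   - etrans; [apply papp_comp|]. cbn [map]. apply papp_proper.
    constructor; [etrans; [apply papp_proj|exact IH']|].
    constructor; [refl|]. constructor; [exact (papp_proj q' 2 _)|].
    constructor; [exact (papp_proj q' 4 _)|constructor].
   - apply (sat_step n F SS _ Ne Y (stack k) _ (fun i => tokens (n i) (bits_of (n i) (x i)) (n i - S (k i)))
     (fun i => eq_refl) q' (isc_sub Hq HN) IT (valuation_sub Hq HF)).
    intros i Hi. cbn [fam stack]. specialize (Hk i Hi). apply (live_sub Hq) in Hi.
    replace (n i - k i) with (S (n i - S (k i))) by lia. rewrite tokens_S. f_equal.
    unfold slice. rewrite read_token_step, ET. rewrite !bits_of_nth, !N.shiftr_spec' by auto.
    f_equal; try (f_equal; lia). f_equal. apply rd_ext. intros j _.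
    rewrite bits_of_nth, !N.shiftr_spec' by auto. f_equal. lia. }
  etrans; [apply mmin_proper; [exact EH|refl]|].
  (* The limit of the recursion is the power of 2 with exponent [S (n i - k i)]. It is never
     reached: after [n i - k i] tokens the stack with its sentinel has at most [S (n i - k i)]
     bits. *)
  apply mmin_lt, lt_pow2 with (l := fun i => S (n i - k i)).
  + apply pb_S. eapply pb_le; [|apply pb_ones]. intros i. cbv beta. lia.
  + intros i _. apply enc_length.
  + assert (IB : isc q' (papp (smash one (s1 (Proj 0))) [mskip k U; Ne; X; Y])
     (fun i => run (smash one (s1 (Proj 1))) [0%N; z i; N.ones #(n i); x i; 0%N])).
   { eapply isc_meq; [|apply (C (smash one (s1 (Proj 1))) [mnil; mskip k U; Ne; X; mnil] (fun i => eq_refl))].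
    apply meq_eq. refl. }
   eapply isc_ext; [| |exact IB].
   * intros i _. cbv beta. rewrite run_smash, run_s1, len_s1. cbn [run nth]. rewrite LZ.
    change (len (run one _)) with 1. now rewrite Nat.mul_1_l.
   * eapply pb_le; [|apply (pb_S _ (pb_S _ pb_ones))]. intros i. cbv beta. rewrite size_nat_pow2. lia.
Qed.

Lemma decode_tokens m l : decode m l = match tokens m l m with Some [A] => Some A | _ => None end.
Proof. refl. Qed.

Lemma sat_value_pb : pb (fun i => length match decode (n i) (bits_of (n i) (x i)) with Some A => [F i A] | None => [] end).
Proof. apply (pb_le _ (fun _ => 1)); [|apply pb_const]. intros i. destruct (decode _ _); simpl; lia. Qed.

Definition sat_value : elt := Elt _ sat_value_pb.

Let final := Defs.cond (half (half (Proj 0))) Zero (Defs.cond (odd (half (Proj 0))) (odd (Proj 0)) Zero).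

Lemma sat_core : valuation q F Y n -> (forall i, live q i -> (x i < 2 ^ #(n i))%N) ->
 meq q (papp final [papp (Rec one h (smash one (s1 (Proj 0)))) [Ne; Ne; X; Y]]) sat_value.
Proof.
 intros HF Hx. etrans; [apply papp_proper; constructor; [apply sat_stack; auto|constructor]|].
 set (SS := stack (fun _ => 0)). set (st := fun i => tokens (n i) (bits_of (n i) (x i)) (n i)).
 assert (ES : forall i, SS i = enc (F i) (st i)).
 { intros i. cbn [fam SS stack]. now rewrite Nat.sub_0_r. }
 assert (EV : forall i, sat_value i = match st i with Some [A] => [F i A] | _ => [] end).
 { intros i. cbn [fam sat_value]. rewrite decode_tokens. fold (st i). destruct (st i) as [[|A [|B l]]|]; auto. }
 unfold final. apply papp_cond_split with (fun i => exists B A l, st i = Some (B :: A :: l)); intros q' Hq HP.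
 - split.
  + apply nz_top. intros i Hi. change (In ptop (tl (tl (SS i)))). destruct (HP i Hi) as (B & A & l & E).
   rewrite ES, E. apply enc_ptop.
  + apply meq_eq. intros i Hi. rewrite EV. destruct (HP i Hi) as (B & A & l & ->). refl.
 - split.
  + apply meq_eq. intros i Hi. change (tl (tl (SS i)) = []). rewrite ES. specialize (HP i Hi).
   destruct (st i) as [[|B [|A l]]|]; auto. exfalso. eauto.
  + apply papp_cond_split with (fun i => exists A, st i = Some [A]); intros q2 S2 HP2.
   * split.
    -- apply nz_top. intros i Hi. change (In ptop (firstn 1 (tl (SS i)))). destruct (HP2 i Hi) as (A & E).
      rewrite ES, E. now left.
    -- apply meq_eq. intros i Hi. change (firstn 1 (SS i) = sat_value i). destruct (HP2 i Hi) as (A & E).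
      now rewrite EV, ES, E.
   * split; apply meq_eq; intros i Hi.
    -- change (firstn 1 (tl (SS i)) = []). rewrite ES. specialize (HP i (live_sub S2 Hi)). specialize (HP2 i Hi).
      destruct (st i) as [[|B [|A l]]|]; auto; exfalso; eauto.
    -- rewrite EV. specialize (HP i (live_sub S2 Hi)). specialize (HP2 i Hi).
      destruct (st i) as [[|B [|A l]]|]; auto; exfalso; eauto.
Qed.

Lemma guard_x q' : sub q q' -> isc q' (papp (shr (Proj 0) (Proj 1)) [Ne; X; Y]) (fun i => N.shiftr (x i) #(n i)).
Proof.
 intros Hq. assert (I : isc q' (papp (shr (Proj 0) (Proj 1)) [Ne; X])
  (fun i => run (shr (Proj 0) (Proj 1)) [N.ones #(n i); x i])).
 { apply (closed_run _ q' _ [fun i => N.ones #(n i); x]). repeat constructor; now apply (isc_sub (q := q)). }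
 apply (isc_ext _ _ (fun i => run (shr (Proj 0) (Proj 1)) [N.ones #(n i); x i])).
 - intros i _. rewrite run_shr. cbn [run nth]. now rewrite len_ones.
 - eapply pb_le; [|apply (isc_pb HX)]. intros i. cbv beta. rewrite len_shiftr. lia.
 - eapply isc_meq; [|exact I]. apply meq_eq. refl.
Qed.

End Sat.

Lemma shiftr_small x n : (x < 2 ^ #n)%N <-> N.shiftr x #n = 0%N.
Proof.
 rewrite <- size_nat_le. split; intros H.
 - apply len_zero. rewrite len_shiftr. lia.
 - apply (f_equal N.size_nat) in H. rewrite len_shiftr in H. simpl in H. lia.
Qed.

(** The formula is a constant and the assignment consists of arbitrary formulas: the truth value is
    then the decoded formula with these formulas substituted for its variables. Thus a formula of
    the object level reappears as a line of a derivation. *)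
Theorem sat_symbolic q n Ne X (Y : elt) x : isc q Ne (fun i => N.ones #(n i)) -> isc q X x ->
 (forall i, live q i -> (x i < 2 ^ #(n i))%N) -> (forall i, live q i -> length (Y i) <= n i) ->
 meq q (papp sat_prog [Ne; X; Y]) (sat_value n (fun i => psubst (nth_bit (Y i))) x).
Proof.
 intros HN HX Hx HY. set (R := sat_value _ _ _).
 apply (papp_cond_isc (guard_x n Ne X Y x q HN HX q (sub_refl q))); intros q1 S1 H1.
 { apply meq_eq. intros i Hi. exfalso. apply (H1 i Hi), shiftr_small, Hx. now apply (live_sub S1). }
 (* The test of the length of [y] is not a constant, but [Y] has at most [n i] entries, so that the
    shift by [n i] leaves the empty list. *)
 apply papp_cond_split with (fun _ => False); intros q2 S2 H2.
 { split; [|apply meq_eq]; [eapply prv_bot, prv_eq; [|apply prv_top]|]; intros i Hi; destruct (H2 i Hi). }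
 assert (Q2 := sub_trans S1 S2). split.
 - etrans; [apply (papp_shr q2 _ _ _ (fun i => N.ones #(n i)));
   eapply isc_meq; [apply papp_proj|apply (isc_sub (q := q)); auto]|].
  apply mskip_over. intros i Hi. rewrite len_ones. apply HY. now apply (live_sub Q2).
 - apply (sat_core n _ Ne X Y x q2 (isc_sub Q2 HN) (isc_sub Q2 HX)).
  + constructor; intros; cbn [psubst]; ptaut0.
  + intros i Hi. apply Hx. now apply (live_sub Q2).
Qed.

Definition satb (n : nat) (x y : N) : bool :=
 (x <? 2 ^ #n)%N && (y <? 2 ^ #n)%N && SAT2 n (bits_of n x) (bits_of n y).

(** The same evaluation with truth values in place of substituted formulas. It shows at once that
    the program computes [SAT2] and that this has short proofs. *)
Theorem sat_const q n Ne X Y x y : isc q Ne (fun i => N.ones #(n i)) -> isc q X x -> isc q Y y ->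
 isc q (papp sat_prog [Ne; X; Y]) (fun i => N.b2n (satb (n i) (x i) (y i))).
Proof.
 intros HN HX HY.
 assert (PB : pbN (fun i => N.b2n (satb (n i) (x i) (y i)))).
 { apply (pb_le _ (fun _ => 1)); [|apply pb_const]. intros i. cbv beta. destruct (satb _ _ _); simpl; lia. }
 exists PB. set (R := cst _ PB).
 assert (GY : forall q', sub q q' -> isc q' (papp (shr (Proj 0) (Proj 2)) [Ne; X; Y]) (fun i => N.shiftr (y i) #(n i))).
 { intros q' Hq. eapply isc_meq; [|exact (guard_x n Ne Y X y q HN HY q' Hq)]. apply meq_eq. refl. }
 assert (R0 : forall q', (forall i, live q' i -> satb (n i) (x i) (y i) = false) -> meq q' (papp Zero [Ne; X; Y]) R).
 { intros q' H. apply meq_eq. intros i Hi. cbn [fam R cst]. now rewrite H. }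
 apply (papp_cond_isc (guard_x n Ne X Y x q HN HX q (sub_refl q))); intros q1 S1 H1.
 { apply R0. intros i Hi. unfold satb. destruct (N.ltb_spec (x i) (2 ^ #(n i))) as [E|E]; auto.
  exfalso. now apply (H1 i Hi), shiftr_small. }
 apply (papp_cond_isc (GY q1 S1)); intros q2 S2 H2.
 { apply R0. intros i Hi. unfold satb. destruct (N.ltb_spec (y i) (2 ^ #(n i))) as [E|E]; [|now rewrite andb_false_r].
  exfalso. now apply (H2 i Hi), shiftr_small. }
 assert (Q2 := sub_trans S1 S2).
 assert (Hx : forall i, live q2 i -> (x i < 2 ^ #(n i))%N).
 { intros i Hi. apply shiftr_small, H1. now apply (live_sub S2). }
 assert (Hy : forall i, live q2 i -> (y i < 2 ^ #(n i))%N) by (intros i Hi; now apply shiftr_small, H2).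
 set (F := fun i A => pconst (peval (fun k => N.testbit (y i) #k) A)).
 transitivity (sat_value n F x).
 - apply (sat_core n F Ne X Y x q2 (isc_sub Q2 HN) (isc_sub Q2 HX)); auto.
  constructor; unfold F; cbn [peval pconst].
  + ptaut0.
  + intros k q3 S3 Hk. assert (B := isc_bit q3 Y y k (isc_sub (sub_trans Q2 S3) HY)).
   puse B.
   ptaut_by (idtac).
  + intros A B. ptaut_fin_by (destruct (peval _ (A i)), (peval _ (B i)); cbn [implb andb orb]).
  + intros A B. ptaut_fin_by (destruct (peval _ (A i)), (peval _ (B i)); cbn [implb andb orb]).
  + intros A B. ptaut_fin_by (destruct (peval _ (A i)), (peval _ (B i)); cbn [implb andb orb]).
 - apply meq_bits. intros i k Hi. cbn [fam sat_value R cst]. unfold satb, SAT2.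
  rewrite (proj2 (N.ltb_lt _ _) (Hx i Hi)), (proj2 (N.ltb_lt _ _) (Hy i Hi)).
  destruct (decode (n i) (bits_of (n i) (x i))) as [A|]; [|refl].
  unfold F. rewrite (peval_ext (fun k => nth k (bits_of (n i) (y i)) false) (fun k => N.testbit (y i) #k) A).
  + unfold bits_of at 1 2. rewrite !length_map_seq, Nat.eqb_refl. cbn [andb].
   destruct (peval _ A); [refl|]. destruct k as [|[|k]]; refl.
  + intros j _. apply bits_of_nth, Hy, Hi.
Qed.

End Sym.

(** * Encoding of formulas *)

Definition token : Type := (bool * bool * bool * nat)%type.

Definition token_run (n : nat) (ts : list token) (st : option (list pform)) :=
 fold_left (fun st '(o0, o1, o2, v) => token_step n o0 o1 o2 v st) ts st.

Definition token_bit (m : nat) (t : token) (r : nat) : bool :=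
 let '(o0, o1, o2, v) := t in
 match r with 0 => o0 | 1 => o1 | 2 => o2 | S (S (S r)) => Nat.testbit v (m - 1 - r) end.

Definition blank : token := (false, false, false, 0).

Definition encode (n : nat) (ts : list token) : list bool :=
 map (fun q => token_bit (blen n) (nth (q / (3 + blen n)) ts blank) (q mod (3 + blen n))) (seq 0 n).

Lemma encode_length n ts : length (encode n ts) = n.
Proof. unfold encode. now rewrite length_map_seq. Qed.

Lemma blank_bit m r : token_bit m blank r = false.
Proof. destruct r as [|[|[|r]]]; auto. apply Nat.bits_0. Qed.

Lemma encode_nth n ts T r : length ts * (3 + blen n) <= n -> r < 3 + blen n ->
 nth (T * (3 + blen n) + r) (encode n ts) false = token_bit (blen n) (nth T ts blank) r.
Proof.
 intros Hl Hr. set (w := 3 + blen n) in *. destruct (Nat.lt_ge_cases (T * w + r) n) as [H|H].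
 - unfold encode. rewrite nth_map_seq by auto. fold w.
  rewrite <- (Nat.div_unique (T * w + r) w T r), <- (Nat.mod_unique (T * w + r) w T r) by lia. refl.
 - rewrite nth_overflow by now rewrite encode_length. rewrite nth_overflow; [now rewrite blank_bit|].
  destruct (Nat.lt_ge_cases T (length ts)) as [L|L]; auto.
  assert (E := Nat.mul_le_mono_r _ _ w L). lia.
Qed.

Lemma rd_value m v : (v < 2 ^ #m)%N -> rd 0 m (fun j => N.testbit v #(m - 1 - j)) = v.
Proof.
 intros H. apply N.bits_inj. intros j. rewrite <- (N2Nat.id j), rd_testbit.
 destruct (Nat.ltb_spec (N.to_nat j) m) as [L|L].
 - do 2 f_equal. lia.
 - symmetry. apply testbit_over. apply size_nat_le in H. lia.
Qed.

Lemma blen_lt m : (#m < 2 ^ #(blen m))%N.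
Proof. apply size_nat_gt. Qed.

Lemma tokens_encode n ts : length ts * (3 + blen n) <= n ->
 Forall (fun t : token => (#(snd t) < 2 ^ #(blen n))%N) ts ->
 forall j, tokens n (encode n ts) j = token_run n (firstn j ts) (Some []).
Proof.
 intros Hl Hv j. induction j as [|j IH]; [refl|]. rewrite tokens_S, IH. unfold slice.
 rewrite read_token_step.
 assert (HB : (#(snd (nth j ts blank)) < 2 ^ #(blen n))%N).
 { destruct (Nat.lt_ge_cases j (length ts)) as [L|L].
  - now apply (proj1 (Forall_forall _ _) Hv), nth_In.
  - rewrite nth_overflow by auto. simpl. apply N.neq_0_lt_0, N.pow_nonzero. discriminate. }
 destruct (nth j ts blank) as [[[o0 o1] o2] v] eqn:E.
 replace (rd 0 _ _) with #v.
 2: { rewrite <- (rd_value (blen n) #v) at 1 by exact HB. apply rd_ext. intros i Hi.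
    rewrite encode_nth, E by (auto; lia). cbn [token_bit Nat.add]. apply of_nat_testbit. }
 rewrite !encode_nth, E, Nat2N.id by (auto; lia). cbn [token_bit].
 destruct (Nat.lt_ge_cases j (length ts)) as [L|L].
 - assert (F : firstn (S j) ts = firstn j ts ++ [nth j ts blank]).
  { clear -L. revert ts L. induction j as [|j IH]; intros [|t ts] L; simpl in *; try lia; auto. f_equal. apply IH. lia. }
  rewrite F, E. unfold token_run. now rewrite fold_left_app.
 - rewrite nth_overflow in E by auto. injection E as <- <- <- <-. cbn [token_step].
  rewrite !firstn_all2 by lia. refl.
Qed.

Lemma decode_encode n ts : length ts * (3 + blen n) <= n ->
 Forall (fun t : token => (#(snd t) < 2 ^ #(blen n))%N) ts ->
 decode n (encode n ts) = match token_run n ts (Some []) with Some [A] => Some A | _ => None end.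
Proof.
 intros Hl Hv. rewrite decode_tokens, tokens_encode, firstn_all2 by (auto; nia). refl.
Qed.

Lemma token_run_app n ts ts' st : token_run n (ts ++ ts') st = token_run n ts' (token_run n ts st).
Proof. unfold token_run. apply fold_left_app. Qed.

Fixpoint rpn (A : pform) : list token :=
 match A with
 | pvar i => [(false, true, false, i)]
 | pbot => [(true, false, false, 0)]
 | pimp A B => rpn A ++ rpn B ++ [(true, true, false, 0)]
 | pand A B => rpn A ++ rpn B ++ [(false, false, true, 0)]
 | por A B => rpn A ++ rpn B ++ [(true, false, true, 0)]
 end.

Lemma rpn_run n A l : maxvar A <= n -> token_run n (rpn A) (Some l) = Some (A :: l).
Proof.
 revert l. induction A as [i| |A IHA B IHB|A IHA B IHB|A IHA B IHB]; intros l H; cbn [rpn maxvar] in *.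
 2: refl.
 2-4: rewrite !token_run_app, IHA, IHB by lia; refl.
 change (token_run n _ (Some l)) with (if i <? n then Some (pvar i :: l) else None).
 destruct (Nat.ltb_spec i n); [refl|lia].
Qed.

Lemma rpn_length A : length (rpn A) = psize A.
Proof. induction A; cbn [rpn psize]; rewrite ?length_app; simpl; lia. Qed.

Lemma rpn_var A t : In t (rpn A) -> snd t <= maxvar A.
Proof.
 induction A as [i| |A IHA B IHB|A IHA B IHB|A IHA B IHB]; cbn [rpn maxvar].
 3-5: rewrite !in_app_iff; intros [H|[H|[<-|[]]]]; [apply IHA in H|apply IHB in H|]; cbn; lia.
 all: intros [<-|[]]; cbn; lia.
Qed.

(** * Circuits of sublinear size do not compute SAT *)

Definition reads {n} (C : circuit n) : list nat :=
 output n C :: flat_map (fun '(_, i, j) => [i; j]) (gates n C).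

Lemma nth_snoc {A} (x : list A) b d q : nth q (x ++ [b]) d = if q =? length x then b else nth q x d.
Proof.
 destruct (Nat.eqb_spec q (length x)) as [->|H]; [rewrite app_nth2, Nat.sub_diag by lia; refl|].
 destruct (Nat.lt_ge_cases q (length x)) as [L|L]; [now apply app_nth1|].
 rewrite (nth_overflow x) by auto. apply nth_overflow. rewrite length_app. simpl. lia.
Qed.

Lemma wires_unread p gs : forall x x', length x = length x' ->
 (forall q, q <> p -> nth q x false = nth q x' false) ->
 ~ In p (flat_map (fun '(_, i, j) => [i; j]) (gs : list gate)) ->
 forall q, q <> p -> nth q (wires gs x) false = nth q (wires gs x') false.
Proof.
 induction gs as [|[[op i] j] gs IH]; intros x x' Hl Hx Hp; [exact Hx|].
 cbn in Hp. apply IH; [rewrite !length_app; simpl; lia| |tauto].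
 intros q Hq. rewrite !nth_snoc, Hl, (Hx i), (Hx j), (Hx q) by (auto; intros ->; apply Hp; auto). refl.
Qed.

(** The formula consisting of one variable, followed by blank tokens, is satisfiable; changing a
    single bit of any blank token puts a second formula on the stack, which makes the string
    ill-formed. The circuit has to read that bit in each of the [m] blank tokens, while it has only
    two reads per gate and its output. *)
Lemma sensitivity n (C : circuit n) m : (forall x, length x = n -> (circuit_eval C x = true <-> SAT n x)) ->
 0 < n -> (m + 1) * (3 + blen n) <= n -> m <= 2 * circuit_size C + 1.
Proof.
 intros HC Hn Hm. set (w := 3 + blen n) in *. set (v0 := (false, true, false, 0) : token).
 set (x := fun ts => encode n (v0 :: ts)).
 assert (HF : forall j, Forall (fun t : token => (#(snd t) < 2 ^ #(blen n))%N) (v0 :: repeat blank j ++ [v0])).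
 { intros j. apply Forall_forall. intros t Ht. replace (snd t) with 0.
  - apply N.neq_0_lt_0, N.pow_nonzero. discriminate.
  - destruct Ht as [<-|Ht]; auto. apply in_app_or in Ht as [Ht|[<-|[]]]; auto. now apply repeat_spec in Ht as ->. }
 assert (RB : forall j st, token_run n (repeat blank j) st = st) by (intros j st; induction j; auto).
 assert (RV : forall l, token_run n [v0] (Some l) = Some (pvar 0 :: l)).
 { intros l. change (token_run n _ (Some l)) with (if 0 <? n then Some (pvar 0 :: l) else None).
  now rewrite (proj2 (Nat.ltb_lt 0 n)). }
 assert (H1 : circuit_eval C (x []) = true).
 { apply HC; [apply encode_length|]. exists (repeat true n). split; [apply repeat_length|].
  unfold SAT2, x. rewrite decode_encode; [| |].
  - rewrite RV, encode_length, repeat_length, Nat.eqb_refl. cbn. destruct n; [lia|refl].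
  - cbn [length]. fold w. lia.
  - constructor; auto. cbn. apply N.neq_0_lt_0, N.pow_nonzero. discriminate. }
 assert (H2 : forall j, j < m -> circuit_eval C (x (repeat blank j ++ [v0])) = false).
 { intros j Hj. apply not_true_iff_false. intros E. apply HC in E as (y & _ & E); [|apply encode_length].
  unfold SAT2, x in E. rewrite decode_encode in E; [|fold w; cbn [length]; rewrite length_app, repeat_length; simpl; nia|apply HF].
  change (v0 :: repeat blank j ++ [v0]) with ([v0] ++ repeat blank j ++ [v0]) in E.
  rewrite !token_run_app, RV, RB, RV in E. discriminate. }
 assert (HR : forall j, j < m -> In ((j + 1) * w + 1) (reads C)).
 { intros j Hj. apply NNPP. intros HR. cbn [reads In] in HR.
  assert (E : circuit_eval C (x []) = circuit_eval C (x (repeat blank j ++ [v0]))); [|rewrite H1, H2 in E by auto; discriminate].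
  apply wires_unread with ((j + 1) * w + 1); [unfold x; now rewrite !encode_length| |tauto|intros E; apply HR; auto].
  intros q Hq. destruct (Nat.lt_ge_cases q n) as [L|L]; [|rewrite !nth_overflow; auto; unfold x; now rewrite encode_length].
  unfold x, encode. rewrite !nth_map_seq by auto. fold w. set (T := q / w). set (r := q mod w).
  assert (Eq : q = w * T + r) by apply Nat.div_mod_eq. clearbody T r w.
  destruct T as [|T]; [refl|]. cbn [nth].
  destruct (Nat.lt_trichotomy T j) as [LT|[->|LT]].
  - rewrite app_nth1 by (rewrite repeat_length; auto). rewrite nth_repeat. now destruct T.
  - rewrite app_nth2, repeat_length, Nat.sub_diag by (rewrite repeat_length; auto). cbn [nth].
   match goal with |- ?l = _ => assert (E : l = token_bit (blen n) blank r) by (destruct j; refl) end.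
   rewrite E, blank_bit. destruct r as [|[|[|r]]]; try refl; [exfalso; apply Hq; lia|]. symmetry. apply Nat.bits_0.
  - rewrite nth_overflow by (rewrite length_app, repeat_length; simpl; lia). now destruct T. }
 assert (NI := NoDup_incl_length (l := map (fun j => (j + 1) * w + 1) (seq 0 m)) (l' := reads C)).
 rewrite length_map_seq in NI. etrans; [apply NI|].
 - apply FinFun.Injective_map_NoDup; [|apply seq_NoDup].
  intros a b E. assert (0 < w) by (unfold w; lia). nia.
 - intros p Hp. apply in_map_iff in Hp as (j & <- & Hj). apply in_seq in Hj. apply HR. lia.
 - unfold reads, circuit_size. cbn [length].
  assert (G : forall gs : list gate, length (flat_map (fun '(_, i, j) => [i; j]) gs) = 2 * length gs).
  { induction gs as [|[[op i] j] gs IH]; auto. cbn in *. lia. }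
  rewrite G. lia.
Qed.

(** * Descriptions of circuits *)

Definition gate_bit (p : nat) (g : gate) (r : nat) : bool :=
 let '(op, i, j) := g in
 if r <? 4 then op (2 <=? r) (Nat.odd r)
 else if r <? 4 + p then Nat.testbit i (p - 1 - (r - 4))
 else Nat.testbit j (p - 1 - (r - (4 + p))).

Definition const_gate (b : bool) : gate := (fun _ _ => b, 0, 0).

Definition descr_bit (n k : nat) (gs : list gate) (os : list nat) (m : nat) : bool :=
 let p := blen (n ^ k) + 1 in let L := 4 + 2 * p in
 if m <? n ^ k * L then gate_bit p (nth (m / L) gs (const_gate false)) (m mod L)
 else let m' := m - n ^ k * L in Nat.testbit (nth (m' / p) os 0) (p - 1 - m' mod p).

Definition descr (n k : nat) gs os : N :=
 let s := descr_len n k in rd 0 s (fun j => descr_bit n k gs os (s - 1 - j)).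

Lemma descr_size n k gs os : len (descr n k gs os) <= descr_len n k.
Proof.
 apply size_nat_le. unfold descr. eapply N.lt_le_trans; [apply rd_bound|]. lia.
Qed.

Lemma descr_testbit n k gs os m : m < descr_len n k ->
 N.testbit (descr n k gs os) #m = descr_bit n k gs os m.
Proof.
 intros H. unfold descr. cbv zeta. rewrite rd_testbit, (proj2 (Nat.ltb_lt _ _) H). f_equal. lia.
Qed.

Lemma div_mod_block w T r : r < w -> (T * w + r) / w = T /\ (T * w + r) mod w = r.
Proof.
 intros H. split; symmetry; [apply Nat.div_unique with r|apply Nat.mod_unique with T]; lia.
Qed.

Lemma pointer_value p v x : (#v < 2 ^ #p)%N ->
 (forall j, j < p -> N.testbit x #j = Nat.testbit v (p - 1 - j)) -> N.to_nat (rb 0 p x) = v.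
Proof.
 intros H E. rewrite <- (Nat2N.id v), <- (rd_value p #v H). f_equal. apply rd_ext. intros j Hj.
 rewrite E by auto. symmetry. apply of_nat_testbit.
Qed.

Lemma descr_eval n k gs os z : length gs = n ^ k -> length os = n ->
 Forall (fun '(_, i, j) => i < n + n ^ k /\ j < n + n ^ k) (gs : list gate) -> Forall (fun o => o < n + n ^ k) os -> 1 <= k ->
 out_bits k n (descr n k gs os) z = map (fun o => nth o (wires gs (bits_of n z)) false) os.
Proof.
 intros Hg Ho Fg Fo Hk. set (C := descr n k gs os). unfold out_bits. cbv zeta.
 set (p := blen (n ^ k) + 1). set (L := 4 + 2 * p).
 assert (HD : descr_len n k = n ^ k * L + n * p) by refl.
 (* The additional bit of a pointer makes room for the inputs, because [n <= n ^ k]. *)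
 assert (HB : forall v, v < n + n ^ k -> (#v < 2 ^ #p)%N).
 { intros v Hv. assert (H1 := blen_lt (n ^ k)). unfold p. rewrite Nat.add_1_r, Nat2N.inj_succ, N.pow_succ_r'.
  assert (n <= n ^ k). { destruct n as [|n]; [lia|]. rewrite <- (Nat.pow_1_r (S n)) at 1. apply Nat.pow_le_mono_r; lia. }
  lia. }
 assert (HG : forall l j, j < n ^ k -> gate_val (N.shiftr C #(j * L)) p l =
   let '(op, a, b) := nth j gs (const_gate false) in op (nth a l false) (nth b l false)).
 { intros l j Hj.
  assert (B : forall r, r < L -> N.testbit (N.shiftr C #(j * L)) #r = gate_bit p (nth j gs (const_gate false)) r).
  { intros r Hr. assert (E := Nat.mul_le_mono_r _ _ L Hj).
   rewrite N.shiftr_spec', <- Nat2N.inj_add, Nat.add_comm. unfold C. rewrite descr_testbit by lia.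
   unfold descr_bit. fold p. fold L. destruct (div_mod_block L j r Hr) as [-> ->].
   now rewrite (proj2 (Nat.ltb_lt _ _)) by lia. }
  assert (Hin : In (nth j gs (const_gate false)) gs) by (apply nth_In; lia).
  apply (proj1 (Forall_forall _ _) Fg) in Hin. destruct (nth j gs (const_gate false)) as [[op a] b].
  unfold gate_val. rewrite (pointer_value p a), (pointer_value p b); try (apply HB; apply Hin).
  - set (A := nth a l false). set (A' := nth b l false).
   replace (2 * N.b2n A + N.b2n A')%N with #(2 * Nat.b2n A + Nat.b2n A') by (destruct A, A'; refl).
   rewrite B by (destruct A, A'; simpl; lia). destruct A, A'; refl.
  - intros i Hi. rewrite N.shiftr_spec', <- Nat2N.inj_add, B by lia. unfold gate_bit.
   rewrite (proj2 (Nat.ltb_ge (i + (4 + p)) 4)), (proj2 (Nat.ltb_ge (i + (4 + p)) (4 + p))) by lia.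
   now replace (i + (4 + p) - (4 + p)) with i by lia.
  - intros i Hi. rewrite N.shiftr_spec'. change (#i + 4)%N with (#i + N.of_nat 4)%N. rewrite <- Nat2N.inj_add, B by lia. unfold gate_bit.
   rewrite (proj2 (Nat.ltb_ge (i + 4) 4)), (proj2 (Nat.ltb_lt (i + 4) (4 + p))) by lia.
   now replace (i + 4 - 4) with i by lia. }
 assert (HS : forall j, j <= n ^ k -> gate_stack C p L (bits_of n z) j = wires (firstn j gs) (bits_of n z)).
 { induction j as [|j IH]; intros Hj; [refl|]. cbn [gate_stack]. rewrite IH, HG by lia.
  assert (E : firstn (S j) gs = firstn j gs ++ [nth j gs (const_gate false)]).
  { rewrite <- Hg in Hj. clear -Hj. revert gs Hj. induction j as [|j IH]; intros [|g gs] Hj; simpl in *; try lia; auto. f_equal. apply IH. lia. }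
  rewrite E. unfold wires. rewrite fold_left_app. cbn [fold_left].
  destruct (nth j gs (const_gate false)) as [[op a] b]. refl. }
 fold (bits_of n z). rewrite HS, <- Hg, firstn_all by lia. rewrite Hg.
 replace (seq 0 n) with (seq 0 (length os)) by now rewrite Ho.
 assert (X : forall A B (f : nat -> B) (g : A -> B) (d : A) l, (forall j, j < length l -> f j = g (nth j l d)) ->
   map f (seq 0 (length l)) = map g l).
 { intros A B f g d l. revert f. induction l as [|a l IH]; intros f H; [refl|]. cbn [length seq map].
  f_equal; [apply (H 0); simpl; lia|]. rewrite <- seq_shift, map_map. apply IH. intros j Hj. apply (H (S j)). simpl. lia. }
 apply X with (d := 0). intros j Hj. f_equal.
 assert (Hin : In (nth j os 0) os) by now apply nth_In.
 apply (proj1 (Forall_forall _ _) Fo) in Hin. apply pointer_value; [now apply HB|].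
 intros i Hi. rewrite Ho in Hj. assert (E := Nat.mul_le_mono_r _ _ p Hj). rewrite N.shiftr_spec', <- Nat2N.inj_add.
 unfold C. rewrite descr_testbit by lia. unfold descr_bit. fold p. fold L.
 rewrite (proj2 (Nat.ltb_ge _ _)) by lia.
 replace (i + (n ^ k * L + j * p) - n ^ k * L) with (j * p + i) by lia.
 destruct (div_mod_block p j i Hi) as [-> ->]. f_equal.
Qed.

(** * From deciding SAT to finding satisfying assignments *)

Lemma token_run_mono n n' ts : n <= n' -> forall st r, token_run n ts st = Some r -> token_run n' ts st = Some r.
Proof.
 intros Hn. induction ts as [|[[[o0 o1] o2] v] ts IH]; intros st r H; auto.
 cbn in *. apply IH.
 destruct (token_step n o0 o1 o2 v st) as [l|] eqn:E.
 - replace (token_step n' o0 o1 o2 v st) with (Some l); auto. rewrite <- E. unfold token_step.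
  destruct o2, o1, o0, st as [[|B [|A l']]|]; auto; unfold token_step in E;
   destruct (Nat.ltb_spec v n); try discriminate; now rewrite (proj2 (Nat.ltb_lt v n')) by lia.
 - exfalso. clear -H. induction ts as [|[[[o0 o1] o2] v] ts IH]; [discriminate|]. cbn in H. apply IH.
  rewrite <- H. f_equal. destruct o0, o1, o2; refl.
Qed.

Lemma token_run_vars n ts : forall st l, token_run n ts st = Some l ->
 (forall l0, st = Some l0 -> Forall (fun A => maxvar A <= n) l0) -> Forall (fun A => maxvar A <= n) l.
Proof.
 induction ts as [|[[[o0 o1] o2] v] ts IH]; intros st l H Hst; [now apply Hst|].
 apply (IH _ _ H). intros l0. unfold token_step.
 destruct st as [l1|]; [specialize (Hst l1 eq_refl)|destruct o2, o1, o0; discriminate].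
 destruct o2, o1, o0, l1 as [|B [|A l2]]; try discriminate; try (destruct (Nat.ltb_spec v n));
  intros [= <-]; repeat match goal with H : Forall _ (_ :: _) |- _ => inversion_clear H end;
  repeat constructor; cbn [maxvar]; auto; lia.
Qed.

Definition xtok (n : nat) (x : list bool) (T : nat) : token :=
 let b := fun r => nth (T * (3 + blen n) + r) x false in
 (b 0, b 1, b 2, N.to_nat (rd 0 (blen n) (fun j => b (3 + j)))).

Lemma token_run_xtok n x j : token_run n (map (xtok n x) (seq 0 j)) (Some []) = tokens n x j.
Proof.
 induction j as [|j IH]; [refl|]. rewrite seq_S, map_app, token_run_app, IH, tokens_S.
 unfold slice. rewrite read_token_step. refl.
Qed.

(** The tokens adding the conjunct [var l], or [var l -> bot], to the formula on the stack. *)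
Definition ctok (l : nat) (c : option bool) (s : nat) : token :=
 match c, s with
 | None, _ => blank
 | Some b, 0 => (false, true, false, l)
 | Some b, 1 => (negb b, false, false, 0)
 | Some b, 2 => (negb b, negb b, false, 0)
 | Some b, _ => (false, false, true, 0)
 end.

(** Each variable occupies four tokens whatever is required of it. The positions in the string are
    then independent of the values found so far, as a circuit demands. *)
Definition ctoks (c : nat -> option bool) (n : nat) : list token :=
 map (fun m => ctok (m / 4) (c (m / 4)) (m mod 4)) (seq 0 (4 * n)).

Lemma ctoks_S c n : ctoks c (S n) = ctoks c n ++ map (ctok n (c n)) [0; 1; 2; 3].
Proof.
 unfold ctoks. replace (4 * S n) with (4 * n + 4) by lia. rewrite seq_app, map_app. f_equal.
 replace (seq (0 + 4 * n) 4) with (map (fun s => n * 4 + s) [0; 1; 2; 3]).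
 - rewrite map_map. apply map_ext_in. intros s Hs.
  destruct (div_mod_block 4 n s) as [-> ->]; auto. destruct Hs as [<-|[<-|[<-|[<-|[]]]]]; lia.
 - cbn [map seq]. repeat (f_equal; try lia).
Qed.

Fixpoint constrain (c : nat -> option bool) (A : pform) (n : nat) : pform :=
 match n with
 | 0 => A
 | S l => match c l with
      | None => constrain c A l
      | Some b => pand (constrain c A l) (if b then pvar l else pneg (pvar l))
      end
 end.

Lemma ctoks_run c A n m l : m <= n ->
 token_run n (ctoks c m) (Some (A :: l)) = Some (constrain c A m :: l).
Proof.
 induction m as [|m IH]; intros H; [refl|]. rewrite ctoks_S, token_run_app, IH by lia. cbn [constrain].
 destruct (c m) as [b|]; [|refl].
 assert (E : m <? n = true) by (apply Nat.ltb_lt; lia).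
 destruct b; cbn [map ctok negb token_run fold_left]; cbn -[Nat.ltb]; rewrite E; refl.
Qed.

Lemma constrain_eval c A v n : peval v (constrain c A n) = true <->
 peval v A = true /\ forall l b, l < n -> c l = Some b -> v l = b.
Proof.
 induction n as [|n IH]; cbn [constrain].
 - split; [intros H; split; auto; intros; lia|tauto].
 - assert (G : forall b : bool, peval v (if b then pvar n else pneg (pvar n)) = true <-> v n = b).
  { intros []; cbn; destruct (v n); cbn; split; congruence. }
  destruct (c n) as [b|] eqn:E; cbn [peval]; rewrite ?andb_true_iff, ?G, IH; split.
  + intros ((H1 & H2) & H3). split; auto. intros l b' Hl Hb. destruct (Nat.eq_dec l n) as [->|]; [congruence|apply H2; auto; lia].
  + intros (H1 & H2). repeat split; auto.
  + intros (H1 & H2). split; auto. intros l b' Hl Hb. destruct (Nat.eq_dec l n) as [->|]; [congruence|apply H2; auto; lia].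
  + intros (H1 & H2). split; auto.
Qed.

Lemma constrain_vars c A n m : maxvar A <= n -> m <= n -> maxvar (constrain c A m) <= n.
Proof.
 intros HA. induction m as [|m IH]; intros H; [exact HA|]. cbn [constrain].
 destruct (c m) as [[]|]; cbn [maxvar pneg]; specialize (IH ltac:(lia)); lia.
Qed.

Lemma map_seq_nth A (l : list A) d : map (fun i => nth i l d) (seq 0 (length l)) = l.
Proof.
 induction l as [|a l IH]; [refl|]. cbn [length seq map]. f_equal.
 rewrite <- seq_shift, map_map. exact IH.
Qed.

Section Search.
Variables (n n' : nat).
Let w := 3 + blen n.
Let w' := 3 + blen n'.
Hypothesis Hn : 0 < n.
Hypothesis Hnn : n <= n'.
Hypothesis Hb : blen n <= blen n'.
Hypothesis Hw : 5 * n * w' <= n'.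

(** The instance consists of the [n] tokens of [x], rewritten with wider indices, and [4 * n] tokens
    of constraints; this explains [5 * n * w' <= n']. *)
Definition fixed (x : list bool) (c : nat -> option bool) : list bool :=
 encode n' (map (xtok n x) (seq 0 n) ++ ctoks c n).

Lemma lt_blen v : v < n' -> (#v < 2 ^ #(blen n'))%N.
Proof. intros H. assert (E := blen_lt n'). lia. Qed.

Lemma toks_length x c : length (map (xtok n x) (seq 0 n) ++ ctoks c n) = 5 * n.
Proof. unfold ctoks. rewrite length_app, !length_map_seq. lia. Qed.

Lemma fixed_decode x c A : decode n x = Some A -> decode n' (fixed x c) = Some (constrain c A n).
Proof.
 intros H. unfold fixed. rewrite decode_encode.
 - rewrite token_run_app. rewrite decode_tokens, <- token_run_xtok in H.
  destruct (token_run n _ _) as [[|B [|]]|] eqn:E; try discriminate. injection H as ->.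
  rewrite (token_run_mono n n' _ Hnn _ _ E).
  rewrite (token_run_mono n n' (ctoks c n) Hnn _ [constrain c A n]); auto.
  rewrite <- (ctoks_run c A n n []) by lia. refl.
 - rewrite toks_length. exact Hw.
 - apply Forall_forall. intros t Ht. apply in_app_iff in Ht as [Ht|Ht]; apply in_map_iff in Ht as (m & <- & Hm).
  + cbn [xtok snd]. rewrite N2Nat.id. eapply N.lt_le_trans; [apply rd_bound|].
   rewrite N.mul_1_l. apply N.pow_le_mono_r; lia.
  + apply lt_blen. apply in_seq in Hm. unfold ctok.
   assert (m / 4 < n) by (apply Nat.Div0.div_lt_upper_bound; lia).
   destruct (c (m / 4)) as [b|]; [|cbn [snd blank]; lia]. destruct (m mod 4) as [|[|[|]]]; cbn [snd blank]; lia.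
Qed.

Lemma decode_vars x A : decode n x = Some A -> maxvar A <= n.
Proof.
 intros H. rewrite decode_tokens, <- token_run_xtok in H.
 destruct (token_run n _ _) as [[|B [|]]|] eqn:E; try discriminate. injection H as ->.
 apply token_run_vars in E; [now inversion_clear E|]. intros l0 [= <-]. constructor.
Qed.

Lemma fixed_sat x c A : decode n x = Some A ->
 (SAT n' (fixed x c) <-> exists v, peval v A = true /\ forall l b, l < n -> c l = Some b -> v l = b).
Proof.
 intros H. unfold SAT, SAT2. rewrite (fixed_decode x c A H). split.
 - intros (y & _ & E). apply andb_prop in E as (_ & E). apply constrain_eval in E. now exists (fun i => nth i y false).
 - intros (v & Hv). exists (map v (seq 0 n')). rewrite length_map_seq. split; auto.
  unfold fixed. rewrite encode_length, Nat.eqb_refl. cbn [andb].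
  rewrite (peval_ext _ v); [now apply constrain_eval|]. intros i Hi.
  assert (V := constrain_vars c A n n (decode_vars _ _ H) (le_n _)). apply nth_map_seq. lia.
Qed.

Variable D : circuit n'.
Hypothesis HD : forall x, length x = n' -> (circuit_eval D x = true <-> SAT n' x).

Definition guess (ys : list bool) (l : nat) : option bool :=
 if l <? length ys then Some (nth l ys false) else if l =? length ys then Some true else None.

Fixpoint found (x : list bool) (j : nat) : list bool :=
 match j with
 | 0 => []
 | S j => let ys := found x j in ys ++ [circuit_eval D (fixed x (guess ys))]
 end.

Lemma found_length x j : length (found x j) = j.
Proof. induction j as [|j IH]; auto. cbn. rewrite length_app, IH. simpl. lia. Qed.

(** The values found so far always extend to a satisfying assignment: each query asks whether the
    next variable may be true, and a negative answer leaves the previous assignment valid. *)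
Lemma found_correct x A j : decode n x = Some A -> SAT n x -> j <= n ->
 exists v, peval v A = true /\ forall l, l < j -> v l = nth l (found x j) false.
Proof.
 intros HA (y & Hy & HS). unfold SAT2 in HS. rewrite HA in HS. apply andb_prop in HS as (_ & HS).
 induction j as [|j IH]; intros Hj; [exists (fun i => nth i y false); split; auto; lia|].
 destruct IH as (v & Hv & Hl); [lia|]. cbn [found].
 set (ys := found x j) in *. assert (Ly : length ys = j) by apply found_length.
 assert (E := fixed_sat x (guess ys) A HA). rewrite <- HD in E by apply encode_length.
 assert (G : forall u, (forall l, l < j -> u l = nth l ys false) -> u j = circuit_eval D (fixed x (guess ys)) ->
  forall l, l < S j -> u l = nth l (ys ++ [circuit_eval D (fixed x (guess ys))]) false).
 { intros u H1 H2 l H. rewrite nth_snoc, Ly. destruct (Nat.eqb_spec l j) as [->|]; auto. apply H1. lia. }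
 assert (GG : forall u, u j = true -> (forall l, l < j -> u l = nth l ys false) ->
   forall l b, l < n -> guess ys l = Some b -> u l = b).
 { intros u H1 H2 l b _. unfold guess. rewrite Ly. destruct (Nat.ltb_spec l j); [rewrite H2 by auto; congruence|].
  destruct (Nat.eqb_spec l j) as [->|]; congruence. }
 destruct (circuit_eval D (fixed x (guess ys))) eqn:Ec.
 - destruct (proj1 E eq_refl) as (u & Hu & Hg). exists u. split; auto. apply G.
  + intros l H. apply Hg; [lia|]. unfold guess. now rewrite Ly, (proj2 (Nat.ltb_lt _ _) H).
  + apply Hg; [lia|]. unfold guess. now rewrite Ly, Nat.ltb_irrefl, Nat.eqb_refl.
 - exists v. split; auto. apply G; auto. apply not_true_iff_false. intros Ev.
  enough (false = true) by discriminate. apply E. exists v. split; auto.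
Qed.

Lemma found_SAT x : length x = n -> SAT n x -> SAT2 n x (found x n) = true.
Proof.
 intros Hx H. assert (H' := H). destruct H' as (y & _ & E). unfold SAT2 in *.
 destruct (decode n x) as [A|] eqn:HA; [|discriminate].
 rewrite Hx, found_length, Nat.eqb_refl. cbn [andb].
 destruct (found_correct x A n HA H (le_n _)) as (v & Hv & Hl).
 rewrite (peval_ext _ v); auto. intros i Hi. apply decode_vars in HA. symmetry. apply Hl. lia.
Qed.
End Search.

(** * The self-reduction as a circuit *)

Section SearchCircuit.
Variables (n n' : nat) (D : circuit n').
Let u := blen n.
Let u' := blen n'.
Hypothesis Hn : 0 < n.
Hypothesis Hnn : n <= n'.
Hypothesis Hb : u <= u'.
Hypothesis Hw : 5 * n * (3 + u') <= n'.

(** Wires: the inputs, the constants [false] and [true], and for every variable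
  a copy of [D] followed by its value and the negation of this value. *)
Let g := length (gates n' D).
Definition base (j : nat) : nat := n + 2 + j * (g + 2).
Let cw (b : bool) : nat := if b then n + 1 else n.
Let inp (q : nat) : nat := if q <? n then q else n.

(** The wire that carries bit [q] of the query for variable [j]. Indices in [x] are widened by
    leading zeros. In a constraint, the value of an earlier variable influences only the bits that
    choose between [var] and [var -> bot]; these are connected to its negation, and all other bits
    are constants. *)
Definition sel (j q : nat) : nat :=
 let T := q / (3 + u') in let r := q mod (3 + u') in
 if T <? n then
  if r <? 3 then inp (T * (3 + u) + r)
  else if r - 3 <? u' - u then n
  else inp (T * (3 + u) + (3 + (r - 3 - (u' - u))))
 else if T <? 5 * n then
  let l := (T - n) / 4 in let s := (T - n) mod 4 in
  if l <=? j then
   if (s =? 1) && (r =? 0) || (s =? 2) && (r <? 2)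
   then if l <? j then base l + g + 1 else n
   else cw (token_bit u' (ctok l (Some true) s) r)
  else n
 else n.

Definition reloc (j i : nat) : nat := if i <? n' then sel j i else base j + (i - n').

Definition stage (j : nat) : list gate :=
 let o := reloc j (output n' D) in
 map (fun '(op, i, i') => (op, reloc j i, reloc j i')) (gates n' D)
  ++ [(fun a _ => a, o, o); (fun a _ => negb a, o, o)].

Fixpoint search_gates (j : nat) : list gate :=
 match j with
 | 0 => [const_gate false; const_gate true]
 | S j => search_gates j ++ stage j
 end.

Lemma search_gates_length j : length (search_gates j) = 2 + j * (g + 2).
Proof.
 induction j as [|j IH]; [refl|]. cbn [search_gates]. unfold stage.
 rewrite !length_app, IH, length_map. change (length (gates n' D)) with g. cbn [length]. lia.
Qed.

Lemma inp_bound q : inp q < n + 2.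
Proof. unfold inp. destruct (Nat.ltb_spec q n); lia. Qed.

Lemma base_ge j : n + 2 <= base j.
Proof. apply Nat.le_add_r. Qed.

Lemma base_S j : base (S j) = base j + (g + 2).
Proof. unfold base. lia. Qed.

Lemma base_mono l j : l < j -> base l + g + 2 <= base j.
Proof. intros H. assert (E := Nat.mul_le_mono_r (S l) j (g + 2) H). unfold base. lia. Qed.

Lemma sel_bound j q : sel j q < base j.
Proof.
 assert (B := inp_bound). assert (B0 := base_ge j). unfold sel. cbv zeta.
 repeat match goal with
 | |- inp ?q < _ => specialize (B q); lia
 | |- (if ?b then _ else _) < _ => destruct b eqn:?
 end; try lia.
 - match goal with H : (_ <? j) = true |- _ => apply Nat.ltb_lt, base_mono in H end. lia.
 - unfold cw. destruct (token_bit _ _ _); lia.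
Qed.

Lemma sel_correct x c j v : length x = n ->
 (forall l, c l = if l <? j then Some (match c l with Some b => b | None => false end)
       else if l =? j then Some true else None) ->
 (forall q, q < n -> nth q v false = nth q x false) -> nth n v false = false -> nth (n + 1) v false = true ->
 (forall l b, l < j -> c l = Some b -> nth (base l + g + 1) v false = negb b) ->
 forall q, q < n' -> nth (sel j q) v false = nth q (fixed n n' x c) false.
Proof.
 intros Hx Hc Hv H0 H1 Hnb q Hq. unfold fixed, encode. rewrite nth_map_seq by auto. fold u'.
 assert (HI : forall q, nth (inp q) v false = nth q x false).
 { intros i. unfold inp. destruct (Nat.ltb_spec i n); [auto|]. rewrite H0. symmetry. apply nth_overflow. lia. }
 assert (HC : forall b, nth (cw b) v false = b) by (intros []; auto).
 unfold sel. cbv zeta. set (T := q / (3 + u')). set (r := q mod (3 + u')).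
 assert (Hr : r < 3 + u') by (apply Nat.mod_upper_bound; lia). clearbody T r.
 destruct (Nat.ltb_spec T n) as [HT|HT].
 - rewrite app_nth1 by now rewrite length_map_seq. rewrite nth_map_seq by auto. unfold xtok. fold u.
  destruct r as [|[|[|r]]]; [apply HI|apply HI|apply HI|].
  cbn [token_bit]. change (S (S (S r)) <? 3) with false. cbv iota. rewrite <- of_nat_testbit, N2Nat.id.
  rewrite rd_testbit. replace (S (S (S r)) - 3) with r by lia. rewrite ?Nat.sub_0_r.
  destruct (Nat.ltb_spec r (u' - u)) as [L|L].
  + rewrite H0. destruct (Nat.ltb_spec (u' - 1 - r) u); [lia|refl].
  + rewrite HI. destruct (Nat.ltb_spec (u' - 1 - r) u); [|lia]. do 2 f_equal. lia.
 - rewrite app_nth2, length_map_seq by now rewrite length_map_seq.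
  destruct (Nat.ltb_spec T (5 * n)) as [HT5|HT5].
  + unfold ctoks. rewrite nth_map_seq by lia. set (l := (T - n) / 4). set (s := (T - n) mod 4).
   assert (Hs : s < 4) by (apply Nat.mod_upper_bound; lia).
   clearbody l s. specialize (Hnb l). specialize (Hc l).
   destruct (Nat.leb_spec l j) as [Hl|Hl].
   * assert (E : exists b, c l = Some b /\ nth (if l <? j then base l + g + 1 else n) v false = negb b).
    { destruct (Nat.ltb_spec l j).
     - destruct (c l) as [b|]; [|discriminate]. exists b. auto.
     - replace l with j in * by lia. rewrite Nat.eqb_refl in Hc. exists true. auto. }
    destruct E as (b & -> & Eb).
    destruct ((s =? 1) && (r =? 0) || (s =? 2) && (r <? 2)) eqn:Es.
    -- rewrite Eb. destruct s as [|[|[|s]]]; cbn in Es; try discriminate.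
      ++ destruct r; [refl|discriminate].
      ++ destruct r as [|[|]]; try refl. discriminate.
    -- rewrite HC. destruct s as [|[|[|s]]]; cbn in Es; try refl.
      ++ destruct r as [|[|[|r]]]; try discriminate; refl.
      ++ destruct r as [|[|[|r]]]; try discriminate; refl.
   * replace (c l) with (@None bool); [now rewrite H0, blank_bit|]. rewrite Hc.
    destruct (Nat.ltb_spec l j); [lia|]. destruct (Nat.eqb_spec l j); [lia|refl].
  + rewrite H0, nth_overflow, blank_bit; auto. unfold ctoks. rewrite length_map_seq. lia.
Qed.

Lemma wires_app gs gs' x : wires (gs ++ gs') x = wires gs' (wires gs x).
Proof. apply fold_left_app. Qed.

Lemma wires_reloc j gs : forall m v z, wf_gates m gs -> n' <= m -> length z = m -> length v = base j + (m - n') ->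
 (forall i, i < m -> nth (reloc j i) v false = nth i z false) ->
 let v' := wires (map (fun '(op, i, i') => (op, reloc j i, reloc j i')) gs) v in
 length v' = length v + length gs /\ (forall q, q < length v -> nth q v' false = nth q v false) /\
 forall i, i < m + length gs -> nth (reloc j i) v' false = nth i (wires gs z) false.
Proof.
 induction gs as [|[[op a] b] gs IH]; intros m v z Hwf Hm Hz Hv H.
 - cbn. rewrite !Nat.add_0_r. auto.
 - destruct Hwf as (Ha & Hb' & Hwf). cbn [map].
  destruct (IH (S m) (v ++ [op (nth (reloc j a) v false) (nth (reloc j b) v false)])
    (z ++ [op (nth a z false) (nth b z false)])) as (L & P & R); auto; try lia.
  + rewrite length_app. cbn [length]. lia.
  + rewrite length_app. cbn [length]. lia.
  + intros i Hi. rewrite !nth_snoc, !H, Hz by auto. unfold reloc at 1 2.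
   destruct (Nat.ltb_spec i n') as [Hi'|Hi'].
   * rewrite (proj2 (Nat.eqb_neq i m)) by lia. assert (B := sel_bound j i).
    rewrite (proj2 (Nat.eqb_neq _ _)) by lia. rewrite <- H by lia. unfold reloc.
    now rewrite (proj2 (Nat.ltb_lt _ _) Hi').
   * rewrite Hv. destruct (Nat.eqb_spec i m) as [->|Hne]; [now rewrite Nat.eqb_refl|].
    rewrite (proj2 (Nat.eqb_neq _ _)) by lia. rewrite <- H by lia. unfold reloc.
    now rewrite (proj2 (Nat.ltb_ge _ _) Hi').
  + rewrite length_app in L. cbn [length] in *. cbv zeta. repeat split.
   * cbn. unfold wires in L. rewrite L. lia.
   * intros q Hq. etrans; [apply P; rewrite length_app; simpl; lia|]. apply app_nth1. lia.
   * intros i Hi. apply R. lia.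
Qed.

Lemma search_wires x j : length x = n -> j <= n ->
 let v := wires (search_gates j) x in
 length v = base j /\ (forall q, q < n -> nth q v false = nth q x false) /\
 nth n v false = false /\ nth (n + 1) v false = true /\
 forall l, l < j -> nth (base l + g) v false = nth l (found n n' D x j) false /\
   nth (base l + g + 1) v false = negb (nth l (found n n' D x j) false).
Proof.
 intros Hx. induction j as [|j IH]; intros Hj.
 - cbn. rewrite <- Hx, !length_app. unfold base. repeat split; try (intros; lia); try (cbn; lia).
  + intros q Hq. now rewrite !app_nth1 by (rewrite ?length_app; simpl; lia).
  + now rewrite app_nth1, app_nth2, Nat.sub_diag by (rewrite ?length_app; simpl; lia).
  + now rewrite app_nth2, length_app, Nat.sub_diag by (rewrite ?length_app; simpl; lia).
 - destruct IH as (Lv & Px & P0 & P1 & Py); [lia|].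
  set (v := wires (search_gates j) x) in *. cbv zeta. cbn [search_gates].
  set (c := guess (found n n' D x j)). set (z := fixed n n' x c).
  assert (Lf : length (found n n' D x j) = j) by (eapply found_length; eassumption).
  assert (Hsel : forall i, i < n' -> nth (reloc j i) v false = nth i z false).
  { intros i Hi. unfold reloc. rewrite (proj2 (Nat.ltb_lt _ _) Hi). apply sel_correct; auto.
   - intros l. unfold c, guess. rewrite Lf. destruct (Nat.ltb_spec l j); auto.
   - intros l b Hl. unfold c, guess. rewrite Lf, (proj2 (Nat.ltb_lt _ _) Hl). intros [= <-]. apply Py. auto. }
  assert (Lz : length z = n') by apply encode_length.
  destruct (wires_reloc j (gates n' D) n' v z (gates_wf n' D) (le_n _) Lz ltac:(lia) Hsel) as (L1 & R1 & R2).
  set (v1 := wires (map (fun '(op, i, i') => (op, reloc j i, reloc j i')) (gates n' D)) v) in *. change (length (gates n' D)) with g in L1.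
  assert (Ho := output_wf n' D). change (length (gates n' D)) with g in Ho, R2.
  set (o := reloc j (output n' D)) in *.
  assert (Ey : nth o v1 false = circuit_eval D z) by (apply R2; auto).
  assert (Bo : o < length v1).
  { unfold o, reloc. assert (B := sel_bound j (output n' D)). destruct (Nat.ltb_spec (output n' D) n'); lia. }
  set (y := circuit_eval D z) in *.
  assert (E : wires (search_gates j ++ stage j) x = (v1 ++ [y]) ++ [negb y]).
  { rewrite wires_app. fold v. unfold stage. rewrite wires_app.
   change (wires (map _ (gates n' D)) v) with v1. change (reloc j (output n' D)) with o.
   unfold wires. cbn [fold_left]. rewrite Ey, app_nth1, Ey by auto. refl. }
  rewrite E. cbn [found]. fold c. fold z. fold y.
  assert (G : forall q, q < base j -> nth q ((v1 ++ [y]) ++ [negb y]) false = nth q v false).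
  { intros q Hq. rewrite !app_nth1 by (rewrite ?length_app; lia). apply R1. lia. }
  assert (B0 := base_ge j).
  repeat split.
  + rewrite !length_app, base_S. cbn [length]. lia.
  + intros q Hq. rewrite G by lia. auto.
  + rewrite G by lia. auto.
  + rewrite G by lia. auto.
  + rewrite !nth_snoc, length_app, Lf, L1, Lv. cbn [length].
   destruct (Nat.eqb_spec l j) as [->|Hne].
   * rewrite (proj2 (Nat.eqb_neq _ _)) by lia. now rewrite Nat.eqb_refl.
   * assert (B : base l + g + 2 <= base j) by (apply base_mono; lia).
    rewrite !(proj2 (Nat.eqb_neq _ _)) by lia. rewrite R1 by lia. apply Py. lia.
  + rewrite !nth_snoc, length_app, Lf, L1, Lv. cbn [length].
   destruct (Nat.eqb_spec l j) as [->|Hne].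
   * now rewrite Nat.eqb_refl.
   * assert (B : base l + g + 2 <= base j) by (apply base_mono; lia).
    rewrite !(proj2 (Nat.eqb_neq _ _)) by lia. rewrite R1 by lia. apply Py. lia.
Qed.

Lemma search_pointers j : Forall (fun '(_, i, i') => i < base j /\ i' < base j) (search_gates j).
Proof.
 assert (BM : forall j i, i <= n' + g -> i < n' + g -> reloc j i < base j + g).
 { intros l i _ Hi. unfold reloc. assert (B := sel_bound l i). destruct (Nat.ltb_spec i n'); lia. }
 assert (BS := base_S).
 induction j as [|j IH]; cbn [search_gates].
 - repeat constructor; unfold base; lia.
 - apply Forall_app. split; [|apply Forall_app; split].
  + eapply Forall_impl; [|exact IH]. intros [[op a] b]. rewrite BS. lia.
  + assert (W : forall gs m, wf_gates m gs -> m + length gs <= n' + g ->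
    Forall (fun '(_, i, i') => i < base (S j) /\ i' < base (S j)) (map (fun '(op, i, i') => (op, reloc j i, reloc j i')) gs : list gate)).
   { induction gs as [|[[op a] b] gs IHg]; intros m Hwf Hm; cbn [map]; constructor.
    - destruct Hwf as (H1 & H2 & _). cbn [length] in Hm. rewrite BS.
     assert (E1 := BM j a ltac:(lia) ltac:(lia)). assert (E2 := BM j b ltac:(lia) ltac:(lia)). lia.
    - destruct Hwf as (H1 & H2 & H3). apply (IHg (S m)); auto. cbn [length] in Hm. lia. }
   apply (W _ n'); [apply gates_wf|unfold g; lia].
  + assert (Ho := output_wf n' D). change (length (gates n' D)) with g in Ho.
   assert (E1 := BM j (output n' D) ltac:(lia) Ho). rewrite BS. repeat constructor; lia.
Qed.

End SearchCircuit.

Lemma size_of_bits n x : (forall j, n <= j -> N.testbit x #j = false) -> (x < 2 ^ #n)%N.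
Proof.
 intros H. replace x with (x mod 2 ^ #n)%N; [apply N.mod_lt, N.pow_nonzero; discriminate|].
 apply N.bits_inj. intros j. destruct (N.lt_ge_cases j #n) as [L|L].
 - now apply N.mod_pow2_bits_low.
 - rewrite N.mod_pow2_bits_high by auto. rewrite <- (N2Nat.id j), H; auto. lia.
Qed.

Lemma run_eval_bits k n C z : (run (eval_prog k) [N.ones #n; C; z] < 2 ^ #n)%N /\
 bits_of n (run (eval_prog k) [N.ones #n; C; z]) = out_bits k n C z.
Proof.
 set (v := run _ _).
 assert (E : forall j, N.testbit v #j = nth j (out_bits k n C z) false).
 { intros j. unfold v. now rewrite run_eval, len_ones. }
 assert (L : length (out_bits k n C z) = n) by (unfold out_bits; now rewrite length_map_seq).
 split.
 - apply size_of_bits. intros j Hj. rewrite E. apply nth_overflow. lia.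
 - unfold bits_of. rewrite (map_ext _ _ E), <- L at 1. apply map_seq_nth.
Qed.

Lemma search_description k n n' (D : circuit n') : 1 <= k -> 0 < n -> n <= n' -> blen n <= blen n' ->
 5 * n * (3 + blen n') <= n' -> 2 + n * (circuit_size D + 2) <= n ^ k ->
 (forall x, length x = n' -> (circuit_eval D x = true <-> SAT n' x)) ->
 exists C, len C <= descr_len n k /\ forall x y, satb n x y = true ->
  satb n x (run (eval_prog k) [N.ones #n; C; x]) = true.
Proof.
 intros Hk Hn Hnn Hb Hw Hs HD. unfold circuit_size in Hs.
 set (g := length (gates n' D)) in *. set (B := base n n' D n).
 (* A description has exactly [n ^ k] gates, so constant gates are appended; they do not disturb the
    wires already defined. *)
 set (gs := search_gates n n' D n ++ repeat (const_gate false) (n ^ k - (2 + n * (g + 2)))).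
 set (os := map (fun l => base n n' D l + g) (seq 0 n)).
 assert (HB : B = n + (2 + n * (g + 2))) by (unfold B, base; fold g; lia).
 exists (descr n k gs os). split; [apply descr_size|]. intros x y Hxy.
 destruct (run_eval_bits k n (descr n k gs os) x) as [R1 R2].
 set (v := run _ _) in *. rewrite descr_eval in R2; auto.
 - unfold satb in *. apply andb_prop in Hxy as (Hxy & HS). apply andb_prop in Hxy as (Hx & Hy).
  rewrite Hx, (proj2 (N.ltb_lt _ _) R1), R2. cbn [andb].
  destruct (search_wires n n' D Hn Hnn Hb Hw (bits_of n x) n) as (L & _ & _ & _ & HW); auto.
  { unfold bits_of. now rewrite length_map_seq. }
  replace (map _ os) with (found n n' D (bits_of n x) n).
  + apply found_SAT; auto. { unfold bits_of. now rewrite length_map_seq. }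
   exists (bits_of n y). split; auto. unfold bits_of. now rewrite length_map_seq.
  + rewrite <- (map_seq_nth _ (found n n' D (bits_of n x) n) false) at 1.
   replace (length (found n n' D (bits_of n x) n)) with n by (symmetry; eapply found_length; eassumption).
   unfold os. rewrite map_map. apply map_ext_in. intros l Hl. apply in_seq in Hl.
   destruct (HW l ltac:(lia)) as (<- & _). unfold gs. rewrite wires_app.
   set (w := wires (search_gates n n' D n) (bits_of n x)) in *.
   assert (HP : forall m q, q < length w -> nth q (wires (repeat (const_gate false) m) w) false = nth q w false).
   { clearbody w. clear. intros m. revert w. induction m as [|m IH]; intros w q Hq; [refl|].
    cbn [repeat]. change (wires (const_gate false :: repeat (const_gate false) m) w) with
     (wires (repeat (const_gate false) m) (w ++ [false])).
    rewrite IH by (rewrite length_app; simpl; lia). now apply app_nth1. }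
   symmetry. apply HP. rewrite L. assert (M : base n n' D l + g + 2 <= base n n' D n) by (apply base_mono; auto; lia). fold B in M. unfold B in *. lia.
 - unfold gs. rewrite length_app, repeat_length, search_gates_length by auto. fold g. lia.
 - unfold os. now rewrite length_map_seq.
 - apply Forall_app. split.
  + eapply Forall_impl; [|apply search_pointers; eassumption]. fold B. intros [[op i] j]. lia.
  + apply Forall_forall. intros t Ht. apply repeat_spec in Ht as ->. cbn. lia.
 - apply Forall_forall. intros o Ho. apply in_map_iff in Ho as (l & <- & Hl). apply in_seq in Hl.
  assert (M : base n n' D l + g + 2 <= base n n' D n) by (apply base_mono; auto; lia). fold B in M. lia.
Qed.

(** Eighth powers remove the real exponent, and all further estimates are in natural numbers. *)
Lemma Rpower_root g n k : 0 < n -> (INR g <= Rpower (INR n) (1 / 8 * INR k))%R -> g ^ 8 <= n ^ k.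
Proof.
 intros Hn H. apply INR_le. rewrite !pow_INR.
 assert (Hp : (0 < INR n)%R) by now apply lt_0_INR.
 replace (INR n ^ k)%R with (Rpower (INR n) (1 / 8 * INR k) ^ 8)%R.
 - apply pow_incr. split; [apply pos_INR|exact H].
 - rewrite <- (Rpower_pow 8) by apply exp_pos. rewrite Rpower_mult, <- (Rpower_pow k) by auto. f_equal.
  simpl. lra.
Qed.

Lemma blen_pow2 a : blen (2 ^ a) = S a.
Proof. unfold blen. rewrite Nat2N.inj_pow. apply size_nat_pow2. Qed.

Lemma pow_gt a : a < 2 ^ a.
Proof. apply Nat.pow_gt_lin_r. lia. Qed.

Theorem search_circuits k : 1 <= k ->
 (exists m, forall n, m < n -> SAT_in_Circuit n (Rpower (INR n) (1 / 8 * INR k))) ->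
 exists a0, forall a, a0 <= a -> exists C, len C <= descr_len (2 ^ a) k /\
  forall x y, satb (2 ^ a) x y = true ->
   satb (2 ^ a) x (run (eval_prog k) [N.ones #(2 ^ a); C; x]) = true.
Proof.
 intros Hk (m & Hm). destruct (Nat.le_gt_cases 3 k) as [H3|H3].
 (* With instances of [n * n] bits the circuit size is at most [n ^ (k/4)], hence at most
    [n ^ (k - 2)] as [3 <= k]. The bound 7 is where [5 * (4 + 2 * a) <= 2 ^ a] begins, which makes
    the tokens of a query fit. *)
 - exists (m + 7). intros a Ha. set (n := 2 ^ a).
  assert (G : 5 * (4 + 2 * a) <= n).
  { unfold n. clear -Ha. assert (H : 7 <= a) by lia. clear Ha. induction H as [|a H IH]; [simpl; lia|].
   rewrite Nat.pow_succ_r'. lia. }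
  assert (Ga : a < n) by apply pow_gt.
  assert (En : n * n = 2 ^ (a + a)) by (unfold n; now rewrite Nat.pow_add_r).
  destruct (Hm (n * n) ltac:(nia)) as (D & HDs & HD).
  apply Rpower_root in HDs; [|nia].
  assert (Hg : circuit_size D <= n ^ (k - 2)).
  { apply Nat.nlt_ge. intros L. assert (L8 := Nat.pow_lt_mono_l _ _ 8 ltac:(discriminate) L).
   rewrite <- Nat.pow_mul_r in L8.
   assert (HQ : (n * n) ^ k = n ^ (2 * k)) by (rewrite Nat.pow_mul_r; f_equal; simpl; lia). rewrite HQ in HDs.
   assert (n ^ (2 * k) <= n ^ ((k - 2) * 8)) by (apply Nat.pow_le_mono_r; lia). lia. }
  apply (search_description k n (n * n) D); auto; try lia; try nia.
  + unfold n at 1. rewrite En, !blen_pow2. lia.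
  + rewrite En at 1. rewrite blen_pow2. nia.
  + replace k with (2 + (k - 2)) by lia. rewrite Nat.pow_add_r.
   assert (n <= n ^ (k - 2)). { rewrite <- (Nat.pow_1_r n) at 1. apply Nat.pow_le_mono_r; lia. }
   set (M := n ^ (k - 2)) in *. clearbody M. replace (n ^ 2) with (n * n) by (simpl; lia). nia.
 (* Here [n = A ^ 4] and [k <= 2], so the circuit has at most [A] gates. Since [n] has room for more
    than [2 * A + 2] tokens, this contradicts [sensitivity]. *)
 - exfalso. set (a := m + 3). set (n := 2 ^ (4 * a)). set (A := 2 ^ a).
  assert (Ga : a < A) by apply pow_gt.
  assert (GA : 8 <= A) by (change 8 with (2 ^ 3); apply Nat.pow_le_mono_r; unfold a; lia).
  assert (En : n = A ^ 4) by (unfold n, A; rewrite <- Nat.pow_mul_r; f_equal; lia).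
  assert (En2 : n = A * A * (A * A)) by (rewrite En; simpl; lia).
  assert (Gm : m < A) by (unfold a in Ga; lia).
  assert (Q1 : 8 * A <= A * A) by nia.
  assert (Q2 : 64 * (A * A) <= n) by (rewrite En2; nia).
  destruct (Hm n ltac:(lia)) as (D & HDs & HD).
  apply Rpower_root in HDs; [|lia].
  assert (Hg : circuit_size D <= A).
  { apply Nat.nlt_ge. intros L. assert (L8 := Nat.pow_lt_mono_l _ _ 8 ltac:(discriminate) L).
   assert (n ^ k <= n ^ 2) by (apply Nat.pow_le_mono_r; lia).
   assert (EQ : n ^ 2 = A ^ 8) by (rewrite En, <- Nat.pow_mul_r; refl). lia. }
  assert (S1 := sensitivity n D (2 * A + 2) HD ltac:(lia)).
  enough (2 * A + 2 <= 2 * circuit_size D + 1) by lia. apply S1.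
  assert (Eb : blen n = S (4 * a)) by apply blen_pow2. rewrite Eb. clearbody a.
  assert (Q3 : (2 * A + 2 + 1) * (3 + S (4 * a)) <= 3 * A * (4 * A)) by (apply Nat.mul_le_mono; lia). lia.
Qed.

(** * Eliminating the definitions of the propositional translation *)

Definition agree (q : nat) (s s' : nat -> pform) : Prop := forall i, i < q -> s' i = s i.

Definition cost (ds : list pform) : nat := list_sum (map psize ds).

(** When every extension variable is replaced by what it abbreviates, its definition becomes an
    equivalence of a formula with itself, which is cheap to derive. *)
Definition trivial_defs (q : nat) (ds : list pform) (s : nat -> pform) : Prop :=
 forall d, In d ds -> maxvar d <= q /\ exists X, psubst s d = piff X X.

Definition inst_of (s : nat -> pform) (q : nat) (A B : pform) : Prop := maxvar A <= q /\ psubst s A = B.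

(** The bits produced by the translation are variables or constants, and [ptop] has size 3. The size
    bound keeps the definitions small, while the expanded formula [B] may be large. *)
Definition bit_of (s : nat -> pform) (q : nat) (A B : pform) : Prop := inst_of s q A B /\ psize A <= 3.

Definition bits_inst (s : nat -> pform) (q : nat) : bits -> bits -> Prop := Forall2 (bit_of s q).

(** The substitution [s] is extended to the new variables as they are created. The result of [m]
    then becomes the unabbreviated value [x], and [K] bounds the total size of the definitions
    added. *)
Definition sim {A X} (R : (nat -> pform) -> nat -> A -> X -> Prop) q ds s K (m : trans A) (x : X) : Prop :=
 exists s' a q' ds', m (q, ds) = (a, (q', ds')) /\ q <= q' /\ agree q s s' /\ trivial_defs q' ds' s' /\
  R s' q' a x /\ cost ds' <= cost ds + K.

Lemma psubst_ext s s' A : (forall i, i < maxvar A -> s' i = s i) -> psubst s' A = psubst s A.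
Proof. induction A; simpl; intros H; auto; rewrite ?IHA1, ?IHA2; auto; intros; apply H; lia. Qed.

Lemma ext_trans q q' s s' s'' : q <= q' -> agree q s s' -> agree q' s' s'' -> agree q s s''.
Proof. intros Hq H1 H2 i Hi. rewrite H2 by lia. auto. Qed.

Lemma inst_of_ext s s' q q' A B : q <= q' -> agree q s s' -> inst_of s q A B -> inst_of s' q' A B.
Proof.
 intros Hq H [H1 H2]. split; [lia|]. rewrite <- H2. apply psubst_ext. intros i Hi. apply H. lia.
Qed.

Lemma bit_of_ext s s' q q' A B : q <= q' -> agree q s s' -> bit_of s q A B -> bit_of s' q' A B.
Proof. intros Hq H [H1 H2]. split; auto. eapply inst_of_ext; eauto. Qed.

Lemma bits_inst_ext {s s' q q' x X} : q <= q' -> agree q s s' -> bits_inst s q x X -> bits_inst s' q' x X.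
Proof. intros Hq H. apply Forall2_impl. intros. eapply bit_of_ext; eauto. Qed.

Lemma sim_ret {A X} (R : (nat -> pform) -> nat -> A -> X -> Prop) q ds s K a x :
 trivial_defs q ds s -> R s q a x -> sim R q ds s K (ret a) x.
Proof. intros H1 H2. exists s, a, q, ds. repeat split; auto; try lia; now apply H1. Qed.

Lemma sim_bind {A B X Y} (RA : (nat -> pform) -> nat -> A -> X -> Prop) (RB : (nat -> pform) -> nat -> B -> Y -> Prop)
  q ds s K1 K2 K (m : trans A) (f : A -> trans B) x y :
 sim RA q ds s K1 m x ->
 (forall q1 ds1 s1 a, q <= q1 -> agree q s s1 -> trivial_defs q1 ds1 s1 -> RA s1 q1 a x -> sim RB q1 ds1 s1 K2 (f a) y) ->
 K1 + K2 <= K -> sim RB q ds s K (bind m f) y.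
Proof.
 intros (s1 & a & q1 & ds1 & E1 & Hq & He & Ht & HR & Hc) H HK.
 destruct (H q1 ds1 s1 a Hq He Ht HR) as (s2 & b & q2 & ds2 & E2 & Hq2 & He2 & Ht2 & HR2 & Hc2).
 exists s2, b, q2, ds2. unfold bind. rewrite E1. repeat split; auto; try lia; try now apply Ht2.
 eapply ext_trans; eauto.
Qed.

Lemma sim_define q ds s A X K : trivial_defs q ds s -> inst_of s q A X -> psize A * 2 + 5 <= K ->
 sim bit_of q ds s K (define A) X.
Proof.
 intros Ht [H1 H2] HK. set (s' := fun i => if i =? q then X else s i).
 assert (E : agree q s s').
 { intros i Hi. unfold s'. now rewrite (proj2 (Nat.eqb_neq i q)) by lia. }
 assert (EA : psubst s' A = X) by (rewrite <- H2; apply psubst_ext; intros i Hi; apply E; lia).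
 assert (Eq : s' q = X) by (unfold s'; now rewrite Nat.eqb_refl).
 exists s', (pvar q), (S q), (piff (pvar q) A :: ds). cbn [define]. repeat split; auto.
 - destruct H as [<-|H]; [cbn [piff maxvar]; lia|]. apply Ht in H as [H _]. lia.
 - destruct H as [<-|H].
  + exists X. cbn. now rewrite EA, Eq.
  + apply Ht in H as (Hd & Y & HY). exists Y. rewrite <- HY. apply psubst_ext. intros i Hi. apply E. lia.
 - change (psize (piff (pvar q) A) + cost ds <= cost ds + K). cbn [piff psize]. lia.
Qed.

Lemma sim_mapM {A Y} (R : (nat -> pform) -> nat -> Y -> Y -> Prop) (f : A -> trans Y) (F : A -> Y) K l :
 (forall s s' q q' y Z, q <= q' -> agree q s s' -> R s q y Z -> R s' q' y Z) ->
 forall q ds s, trivial_defs q ds s ->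
 (forall a q1 ds1 s1, In a l -> q <= q1 -> agree q s s1 -> trivial_defs q1 ds1 s1 -> sim R q1 ds1 s1 (K a) (f a) (F a)) ->
 sim (fun s q => Forall2 (R s q)) q ds s (list_sum (map K l)) (mapM f l) (map F l).
Proof.
 intros HR. induction l as [|a l IH]; intros q ds s Ht H; [apply sim_ret; auto|].
 change (mapM f (a :: l)) with (b <- f a;; bs <- mapM f l;; ret (b :: bs)).
 apply sim_bind with (RA := R) (x := F a) (K1 := K a) (K2 := list_sum (map K l)); [apply H; auto; [now left|intros i; auto]| |simpl; lia].
 intros q1 ds1 s1 b Hq He Ht1 Hb.
 apply sim_bind with (RA := fun s q => Forall2 (R s q)) (x := map F l) (K1 := list_sum (map K l)) (K2 := 0); [| |lia].
 - apply IH; auto. intros a' q2 ds2 s2 Ha Hq2 He2 Ht2. apply H; auto; [now right|lia|]. eapply ext_trans; eauto.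
 - intros q2 ds2 s2 bs Hq2 He2 Ht2 Hbs. apply sim_ret; auto. constructor; auto. eapply HR; eauto.
Qed.

Lemma sim_foldM {A B X} (R : (nat -> pform) -> nat -> A -> X -> Prop) (I : X -> Prop) (f : A -> B -> trans A) (F : X -> B -> X) K l :
 (forall s s' q q' y Z, q <= q' -> agree q s s' -> R s q y Z -> R s' q' y Z) ->
 (forall x b, I x -> In b l -> I (F x b)) ->
 forall q ds s a x, trivial_defs q ds s -> R s q a x -> I x ->
 (forall a x b q1 ds1 s1, In b l -> q <= q1 -> agree q s s1 -> trivial_defs q1 ds1 s1 -> R s1 q1 a x -> I x -> sim R q1 ds1 s1 K (f a b) (F x b)) ->
 sim R q ds s (length l * K) (foldM f a l) (fold_left F l x).
Proof.
 intros HR. induction l as [|b l IH]; intros HI q ds s a x Ht Ha Hx H; [now apply sim_ret|].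
 change (foldM f a (b :: l)) with (a' <- f a b;; foldM f a' l).
 apply sim_bind with (RA := R) (x := F x b) (K1 := K) (K2 := length l * K);
  [apply H; auto; [now left|intros i; auto]| |simpl; lia].
 intros q1 ds1 s1 a1 Hq He Ht1 Ha1. cbn [fold_left]. apply IH; auto.
 - intros; apply HI; auto. now right.
 - apply HI; auto. now left.
 - intros a2 x2 b2 q2 ds2 s2 Hb Hq2 He2 Ht2 Ha2 Hx2. apply H; auto; [now right|lia|]. eapply ext_trans; eauto.
Qed.

Section Formulas.
Variables (s : nat -> pform) (q : nat).

Lemma inst_const A : maxvar A = 0 -> inst_of s q A A.
Proof.
 intros H. split; [lia|]. induction A; cbn [psubst maxvar] in *; try lia; auto; rewrite IHA1, IHA2 by lia; refl.
Qed.

Lemma inst_and A B X Y : inst_of s q A X -> inst_of s q B Y -> inst_of s q (pand A B) (pand X Y).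
Proof. intros [H1 H2] [H3 H4]. split; cbn; [lia|congruence]. Qed.

Lemma inst_or A B X Y : inst_of s q A X -> inst_of s q B Y -> inst_of s q (por A B) (por X Y).
Proof. intros [H1 H2] [H3 H4]. split; cbn; [lia|congruence]. Qed.

Lemma inst_imp A B X Y : inst_of s q A X -> inst_of s q B Y -> inst_of s q (pimp A B) (pimp X Y).
Proof. intros [H1 H2] [H3 H4]. split; cbn; [lia|congruence]. Qed.

Lemma inst_neg A X : inst_of s q A X -> inst_of s q (pneg A) (pneg X).
Proof. intros H. apply inst_imp; auto. now apply inst_const. Qed.

Lemma inst_iff A B X Y : inst_of s q A X -> inst_of s q B Y -> inst_of s q (piff A B) (piff X Y).
Proof. intros. apply inst_and; apply inst_imp; auto. Qed.

Lemma inst_disj l L : Forall2 (inst_of s q) l L -> inst_of s q (pdisj l) (pdisj L).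
Proof. induction 1; [now apply inst_const|now apply inst_or]. Qed.

Lemma inst_conj l L : Forall2 (inst_of s q) l L -> inst_of s q (pconj l) (pconj L).
Proof. induction 1; [now apply inst_const|now apply inst_and]. Qed.

Lemma inst_bits x X : bits_inst s q x X -> Forall2 (inst_of s q) x X.
Proof. apply Forall2_impl. now intros A B [H _]. Qed.

Lemma bits_length x X : bits_inst s q x X -> length x = length X.
Proof. apply Forall2_length. Qed.

Lemma bit_const A : maxvar A = 0 -> psize A <= 3 -> bit_of s q A A.
Proof. intros H1 H2. split; auto. now apply inst_const. Qed.

Lemma bits_nth x X i : bits_inst s q x X -> bit_of s q (nth_bit x i) (nth_bit X i).
Proof.
 intros H. revert i. induction H as [|A B x X HA H IH]; intros i.
 - unfold nth_bit. destruct i; apply bit_const; auto; cbn; lia.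
 - destruct i as [|i]; [exact HA|apply IH].
Qed.

Lemma bits_skipn x X i : bits_inst s q x X -> bits_inst s q (skipn i x) (skipn i X).
Proof. intros H. revert i. induction H; intros [|i]; cbn; auto; try constructor; auto. Qed.

Lemma bits_firstn x X i : bits_inst s q x X -> bits_inst s q (firstn i x) (firstn i X).
Proof. intros H. revert i. induction H as [|A B x X HA H IH]; intros [|i]; cbn; constructor; [exact HA|apply IH]. Qed.

Lemma Forall2_map_same {A} (l : list A) (f g : A -> pform) (P : pform -> pform -> Prop) :
 (forall a, In a l -> P (f a) (g a)) -> Forall2 P (map f l) (map g l).
Proof. induction l as [|a l IH]; intros H; constructor; [apply H; now left|apply IH; intros; apply H; now right]. Qed.

Lemma inst_len_is x X a : bits_inst s q x X -> inst_of s q (len_is x a) (len_is X a).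
Proof.
 intros H. apply inst_and.
 - destruct (a =? 0); [now apply inst_const|apply bits_nth; auto].
 - apply inst_conj. apply (bits_skipn _ _ a), inst_bits in H.
  induction H; constructor; auto. now apply inst_neg.
Qed.

Lemma size_disj l m : (forall A, In A l -> psize A <= m) -> psize (pdisj l) <= 1 + length l * (m + 1).
Proof. induction l as [|A l IH]; intros H; [cbn; lia|]. change (S (psize A + psize (pdisj l)) <= 1 + S (length l) * (m + 1)). assert (H1 := H A (or_introl eq_refl)). specialize (IH (fun B HB => H B (or_intror HB))). lia. Qed.

Lemma bits_small x X A : bits_inst s q x X -> In A x -> psize A <= 3.
Proof. induction 1 as [|B C x X [_ HB] H IH]; intros []; subst; auto. Qed.

Lemma nth_small x X i : bits_inst s q x X -> psize (nth_bit x i) <= 3.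
Proof. intros H. now apply (bits_nth _ _ i) in H as [_ H]. Qed.

Lemma size_len_is x X a : bits_inst s q x X -> psize (len_is x a) <= 7 + length x * 6.
Proof.
 intros H. unfold len_is. cbn [psize].
 assert (H1 : psize (if a =? 0 then ptop else nth_bit x (a - 1)) <= 3).
 { destruct (a =? 0); [cbn; lia|eapply nth_small; eauto]. }
 assert (H2 : psize (pconj (map pneg (skipn a x))) <= 3 + length (skipn a x) * 6).
 { apply (bits_skipn _ _ a) in H. induction H as [|B C y Y [_ HB] H IH]; [cbn; lia|].
  change (S (S (psize B + 1) + psize (pconj (map pneg y))) <= 3 + S (length y) * 6). lia. }
 rewrite length_skipn in H2. lia.
Qed.
End Formulas.

Lemma sim_le {A X} (R : (nat -> pform) -> nat -> A -> X -> Prop) q ds s K K' (m : trans A) x :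
 sim R q ds s K m x -> K <= K' -> sim R q ds s K' m x.
Proof.
 intros (s' & a & q' & ds' & H1 & H2 & H3 & H4 & H5 & H6) HK. exists s', a, q', ds'. repeat split; auto; try lia; now apply H4.
Qed.

Lemma sum_const {A} (K : A -> nat) (c : nat) l : (forall a, In a l -> K a <= c) -> list_sum (map K l) <= length l * c.
Proof.
 induction l as [|a l IH]; intros H; cbn; [lia|]. assert (H1 := H a (or_introl eq_refl)).
 specialize (IH (fun b Hb => H b (or_intror Hb))). unfold list_sum in IH. lia.
Qed.

Lemma sim_defines q ds s l (f F : nat -> pform) c : trivial_defs q ds s ->
 (forall i, In i l -> inst_of s q (f i) (F i) /\ psize (f i) <= c) ->
 sim bits_inst q ds s (length l * (c * 2 + 5)) (mapM (fun i => define (f i)) l) (map F l).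
Proof.
 intros Ht H. eapply sim_le.
 - apply (sim_mapM bit_of _ _ (fun i => psize (f i) * 2 + 5)); [apply bit_of_ext|auto|].
  intros i q1 ds1 s1 Hi Hq He Ht1. apply sim_define; auto. eapply inst_of_ext; eauto. now apply H.
 - apply sum_const. intros i Hi. destruct (H i Hi) as [_ H1]. lia.
Qed.

Lemma sim_mux q ds s c C x X y Y : trivial_defs q ds s -> bit_of s q c C -> bits_inst s q x X -> bits_inst s q y Y ->
 sim bits_inst q ds s (39 * (length X + length Y)) (mux c x y) (muxp C X Y).
Proof.
 intros Ht Hc Hx Hy. unfold mux, muxp. rewrite (bits_length _ _ _ _ Hx), (bits_length _ _ _ _ Hy).
 eapply sim_le; [apply sim_defines with (c := 17); auto|rewrite length_seq; lia].
 intros i _. assert (Hx' := bits_nth _ _ _ _ i Hx). assert (Hy' := bits_nth _ _ _ _ i Hy).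
 destruct Hc as [Hc Sc], Hx' as [Hx' Sx], Hy' as [Hy' Sy]. split.
 - repeat first [apply inst_or | apply inst_and | apply inst_neg | assumption].
 - cbn [psize pneg]. lia.
Qed.

Lemma lessn_fold x y m : fold_left (fun c i => por (pand (pneg (nth_bit x i)) (nth_bit y i))
  (pand (piff (nth_bit x i) (nth_bit y i)) c)) (seq 0 m) pbot = lessn x y m.
Proof. induction m as [|m IH]; [refl|]. now rewrite seq_S, fold_left_app, IH. Qed.

Lemma sim_less q ds s x X y Y : trivial_defs q ds s -> bits_inst s q x X -> bits_inst s q y Y ->
 sim bit_of q ds s (65 * (length X + length Y)) (less x y) (lessp X Y).
Proof.
 intros Ht Hx Hy. unfold less, lessp. rewrite (bits_length _ _ _ _ Hx), (bits_length _ _ _ _ Hy), <- lessn_fold.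
 eapply sim_le; [apply (sim_foldM bit_of (fun _ => True)) with (K := 65)|rewrite length_seq; lia]; auto.
 - apply bit_of_ext.
 - apply bit_const; cbn; lia.
 - intros c C i q1 ds1 s1 _ Hq He Ht1 Hc _.
  apply (bits_nth _ _ _ _ i) in Hx as Hx'. apply (bits_nth _ _ _ _ i) in Hy as Hy'.
  apply (bit_of_ext _ _ _ _ _ _ Hq He) in Hx' as [Ha Sa]. apply (bit_of_ext _ _ _ _ _ _ Hq He) in Hy' as [Hb Sb].
  destruct Hc as [Hc Sc]. apply sim_define; auto.
  + repeat first [apply inst_or | apply inst_iff | apply inst_and | apply inst_neg | assumption].
  + cbn [psize pneg piff]. lia.
Qed.

Lemma sim_minimum q ds s x X y Y : trivial_defs q ds s -> bits_inst s q x X -> bits_inst s q y Y ->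
 sim bits_inst q ds s (104 * (length X + length Y)) (minimum x y) (minp X Y).
Proof.
 intros Ht Hx Hy. unfold minimum. eapply sim_bind; [apply (sim_less _ _ _ x X y Y); auto| |].
 2: assert (65 * (length X + length Y) + (39 * (length X + length Y) + 0) <= 104 * (length X + length Y)) by lia; eassumption.
 intros q1 ds1 s1 c Hq He Ht1 Hc. eapply sim_bind; [apply (sim_mux _ _ _ c (lessp X Y) x X y Y); auto; eapply bits_inst_ext; eauto| |apply le_n].
 intros q2 ds2 s2 r Hq2 He2 Ht2 Hr. apply sim_ret; auto. unfold minp. rewrite (bits_length _ _ _ _ Hy).
 now apply bits_firstn.
Qed.

Lemma bits_nth_list s q e E i : Forall2 (bits_inst s q) e E -> bits_inst s q (nth i e []) (nth i E []).
Proof. intros H. revert i. induction H; intros [|i]; cbn; auto; constructor. Qed.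

Lemma list_ext s s' q q' e E : q <= q' -> agree q s s' -> Forall2 (bits_inst s q) e E -> Forall2 (bits_inst s' q') e E.
Proof. intros Hq H. apply Forall2_impl. intros. eapply bits_inst_ext; eauto. Qed.

Lemma bits_tl_list s q e E : Forall2 (bits_inst s q) e E -> Forall2 (bits_inst s q) (tl e) (tl E).
Proof. intros []; cbn; auto; constructor. Qed.

Lemma sim_len q ds s x X : trivial_defs q ds s -> bits_inst s q x X ->
 sim bits_inst q ds s (blen (length X) * ((1 + S (length X) * (8 + length X * 6)) * 2 + 5)) (translate Len [x]) (lenp X).
Proof.
 intros Ht Hx. unfold lenp. cbn [translate nth]. rewrite (bits_length _ _ _ _ Hx).
 eapply sim_le; [apply sim_defines with (c := 1 + S (length X) * (8 + length X * 6)); auto|now rewrite length_seq].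
 intros j _. split.
 - apply inst_disj, Forall2_map_same. intros a _. now apply inst_len_is.
 - etrans; [apply size_disj with (m := 7 + length X * 6)|].
  + intros A HA. apply in_map_iff in HA as (a & <- & _). rewrite <- (bits_length _ _ _ _ Hx). eapply size_len_is; eauto.
  + rewrite length_map. assert (L := filter_length_le (fun a => Nat.testbit a j) (seq 0 (S (length X)))).
   rewrite length_seq in L. apply (Nat.mul_le_mono_r _ _ (7 + length X * 6 + 1)) in L. lia.
Qed.

Lemma sim_smash q ds s x X y Y : trivial_defs q ds s -> bits_inst s q x X -> bits_inst s q y Y ->
 sim bits_inst q ds s (S (length X * length Y) * ((1 + (S (length X) * S (length Y)) * (16 + (length X + length Y) * 6)) * 2 + 5))
  (translate Smash [x; y]) (smashp X Y).
Proof.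
 intros Ht Hx Hy. unfold smashp. cbn [translate nth]. rewrite (bits_length _ _ _ _ Hx), (bits_length _ _ _ _ Hy).
 eapply sim_le; [eapply sim_defines; auto|rewrite length_seq; apply le_n].
 intros j _. cbv beta. split.
 - apply inst_disj, Forall2_map_same. intros [a b] _. apply inst_and; now apply inst_len_is.
 - etrans; [apply size_disj with (m := 15 + (length X + length Y) * 6)|].
  + intros A HA. apply in_map_iff in HA as ([a b] & <- & _). cbn [psize].
   assert (Sx := size_len_is _ _ _ _ a Hx). assert (Sy := size_len_is _ _ _ _ b Hy).
   rewrite (bits_length _ _ _ _ Hx) in Sx. rewrite (bits_length _ _ _ _ Hy) in Sy. lia.
  + rewrite length_map. assert (L := filter_length_le (fun '(a, b) => a * b =? j) (list_prod (seq 0 (S (length X))) (seq 0 (S (length Y))))).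
   rewrite length_prod, !length_seq in L. apply (Nat.mul_le_mono_r _ _ (15 + (length X + length Y) * 6 + 1)) in L. lia.
Qed.

Section Translate.
Context {SC : Scale}.

Definition simulated (p : prog) : Prop := forall L, pb L -> exists K, pb K /\
 forall i e E q ds s, trivial_defs q ds s -> Forall2 (bits_inst s q) e E -> (forall x, In x E -> length x <= L i) ->
 sim bits_inst q ds s (K i) (translate p e) (ttrans p E).

Lemma simulated_list gs : Forall simulated gs -> forall L, pb L -> exists K, pb K /\
 forall i e E q ds s, trivial_defs q ds s -> Forall2 (bits_inst s q) e E -> (forall x, In x E -> length x <= L i) ->
 sim (fun s q => Forall2 (bits_inst s q)) q ds s (K i) (mapM (fun g => translate g e) gs) (map (fun g => ttrans g E) gs).
Proof.
 intros H L HL. induction H as [|g gs Hg _ (K2 & HK2 & H2)].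
 - exists (fun _ => 0). split; [apply pb_const|]. intros. now apply sim_ret.
 - destruct (Hg L HL) as (K1 & HK1 & H1). exists (fun i => K1 i + K2 i). split; [now apply pb_add|].
  intros i e E q ds s Ht He HE. cbn [map].
  change (mapM (fun g => translate g e) (g :: gs)) with (b <- translate g e;; bs <- mapM (fun g => translate g e) gs;; ret (b :: bs)).
  eapply sim_bind; [apply (H1 i e E); auto| |apply le_n].
  intros q1 ds1 s1 b Hq Hs Ht1 Hb. eapply sim_bind with (K2 := 0); [apply (H2 i e E); auto; eapply list_ext; eauto| |lia].
  intros q2 ds2 s2 bs Hq2 Hs2 Ht2 Hbs. apply sim_ret; auto. constructor; auto. eapply bits_inst_ext; eauto.
Qed.

Ltac pbs := repeat first [apply pb_add | apply pb_mul | apply pb_S | apply outlen_pb | apply pb_const | assumption].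

(** For a fixed program, the size of the translation is polynomial in the lengths of the arguments.
    In the case of [Rec], [V] bounds the length of the accumulator throughout, thanks to the
    truncation in [minimum]. *)
Theorem sim_translate p : simulated p.
Proof.
 induction p as [j| |b| | | | | |f gs IHf IHgs|g h b IHg IHh IHb] using prog_nested_ind; intros L HL.
 - exists (fun _ => 0). split; [apply pb_const|]. intros. apply sim_ret; auto. now apply bits_nth_list.
 - exists (fun _ => 0). split; [apply pb_const|]. intros. apply sim_ret; auto. constructor.
 - exists (fun _ => 0). split; [apply pb_const|]. intros. apply sim_ret; auto. constructor; [|now apply bits_nth_list].
  destruct b; apply bit_const; cbn; lia.
 - exists (fun _ => 0). split; [apply pb_const|]. intros i e E q ds s Ht He _. apply sim_ret; auto.
  exact (bits_skipn _ _ _ _ 1 (bits_nth_list _ _ _ _ 0 He)).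
 - exists (fun _ => 0). split; [apply pb_const|]. intros i e E q ds s Ht He _. apply sim_ret; auto.
  now apply (bits_firstn _ _ _ _ 1), bits_nth_list.
 - exists (fun i => L i * ((1 + S (L i) * (8 + L i * 6)) * 2 + 5)). split; [pbs|].
  intros i e E q ds s Ht He HE. eapply sim_le; [apply (sim_len q ds s _ _ Ht (bits_nth_list _ _ _ _ 0 He))|].
  assert (H : length (nth 0 E []) <= L i) by (apply nth_bound; auto).
  assert (Hb := blen_le (length (nth 0 E []))).
  apply Nat.mul_le_mono; [lia|]. assert (S (length (nth 0 E [])) * (8 + length (nth 0 E []) * 6) <= S (L i) * (8 + L i * 6)) by (apply Nat.mul_le_mono; lia). lia.
 - exists (fun i => S (L i * L i) * ((1 + (S (L i) * S (L i)) * (16 + (L i + L i) * 6)) * 2 + 5)). split; [pbs|].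
  intros i e E q ds s Ht He HE. eapply sim_le; [apply (sim_smash q ds s _ _ _ _ Ht (bits_nth_list _ _ _ _ 0 He) (bits_nth_list _ _ _ _ 1 He))|].
  assert (H0 : length (nth 0 E []) <= L i) by (apply nth_bound; auto).
  assert (H1 : length (nth 1 E []) <= L i) by (apply nth_bound; auto).
  set (a := length (nth 0 E [])) in *. set (c := length (nth 1 E [])) in *.
  apply Nat.mul_le_mono; [apply le_n_S, Nat.mul_le_mono; auto|].
  assert (S a * S c * (16 + (a + c) * 6) <= S (L i) * S (L i) * (16 + (L i + L i) * 6)) by (repeat apply Nat.mul_le_mono; lia). lia.
 - exists (fun i => (1 + L i * 4) * 2 + 5 + 39 * (L i + L i)). split; [pbs|].
  intros i e E q ds s Ht He HE. cbn [translate ttrans].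
  assert (H : forall j, length (nth j E []) <= L i) by (intros j; apply nth_bound; auto).
  assert (H0 := bits_nth_list _ _ _ _ 0 He).
  eapply sim_bind with (RA := bit_of); [apply sim_define; [exact Ht|apply inst_disj, inst_bits; exact H0|apply le_n]| |].
  + intros q1 ds1 s1 c Hq Hs Ht1 Hc. apply sim_mux; auto; eapply bits_inst_ext; eauto; now apply bits_nth_list.
  + assert (Sz := size_disj (nth 0 e []) 3 (fun A => bits_small _ _ _ _ A H0)). rewrite (bits_length _ _ _ _ H0) in Sz.
   assert (A0 := H 0). assert (A1 := H 1). assert (A2 := H 2). lia.
 - destruct (simulated_list gs IHgs L HL) as (K1 & HK1 & H1).
  set (L' := fun i => outlen (Comp (Proj 0) gs) (L i)).
  destruct (IHf L' (outlen_pb (Comp (Proj 0) gs) L HL)) as (K2 & HK2 & H2).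
  exists (fun i => K1 i + K2 i). split; [pbs|]. intros i e E q ds s Ht He HE. cbn [translate ttrans].
  eapply sim_bind; [apply (H1 i e E); auto| |apply le_n].
  intros q1 ds1 s1 xs Hq Hs Ht1 Hxs. apply H2; auto.
  intros x Hx. apply in_map_iff in Hx as (g & <- & Hg). etrans; [apply ttrans_length; eauto|].
  unfold L'. cbn [outlen]. now apply (list_sum_le_in (fun g => outlen g (L i))).
 - set (V := fun i => outlen g (L i) + outlen b (L i)). set (M := fun i => V i + L i).
  assert (HV : pb V) by (unfold V; pbs). assert (HM : pb M) by (unfold M; pbs).
  destruct (IHg L HL) as (Kg & HKg & Hg). destruct (IHh M HM) as (Kh & HKh & Hh). destruct (IHb L HL) as (Kb & HKb & Hb).
  set (K := fun i => Kh i + (Kb i + (104 * (outlen h (M i) + V i) + ((1 + L i * 4) * 2 + 5 + 39 * (V i + V i))))).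
  exists (fun i => Kg i + L i * K i). split; [unfold K; pbs|].
  intros i e E q ds s Ht He HE. cbn [translate ttrans].
  assert (HT : forall x, In x (tl E) -> length x <= L i) by (intros x Hx; apply HE; now apply in_tl).
  assert (H0 : length (nth 0 E []) <= L i) by (apply nth_bound; auto).
  eapply sim_bind with (K1 := Kg i) (K2 := L i * K i); [apply (Hg i (tl e) (tl E)); auto; now apply bits_tl_list| |lia].
  intros q1 ds1 s1 v0 Hq Hs Ht1 Hv0.
  assert (He1 := list_ext _ _ _ _ _ _ Hq Hs He).
  assert (Hx := bits_nth_list _ _ _ _ 0 He1).
  rewrite (bits_length _ _ _ _ Hx).
  eapply sim_le; [apply (sim_foldM bits_inst (fun v => length v <= V i)) with (K := K i)|].
  + exact @bits_inst_ext.
  + intros v j Hv _. cbv zeta. rewrite muxp_length, minp_length.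
   assert (B := ttrans_length b (skipn j (nth 0 E []) :: tl E) (L i)). unfold V in *.
   enough (length (ttrans b (skipn j (nth 0 E []) :: tl E)) <= outlen b (L i)) by lia. apply B.
   intros x [<-|Hi]; [rewrite length_skipn; lia|auto].
  + exact Ht1.
  + exact Hv0.
  + unfold V. enough (length (ttrans g (tl E)) <= outlen g (L i)) by lia. apply ttrans_length. auto.
  + intros v w j q2 ds2 s2 _ Hq2 Hs2 Ht2 Hv HvV. cbv zeta.
   assert (He2 := list_ext _ _ _ _ _ _ Hq2 Hs2 He1).
   assert (Hz := bits_skipn _ _ _ _ j (bits_nth_list _ _ _ _ 0 He2)).
   set (z := skipn j (nth 0 e [])) in *. set (Z := skipn j (nth 0 E [])) in *.
   assert (LZ : length Z <= L i) by (unfold Z; rewrite length_skipn; lia).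
   assert (Het := bits_tl_list _ _ _ _ He2).
   assert (AH : forall x, In x (w :: Z :: tl E) -> length x <= M i).
   { intros x [<-|[<-|Hi]]; unfold M; [lia|lia|]. specialize (HT x Hi). lia. }
   assert (AB : forall x, In x (Z :: tl E) -> length x <= L i) by (intros x [<-|Hi]; auto).
   assert (LH := ttrans_length h _ _ AH). assert (LB := ttrans_length b _ _ AB).
   eapply sim_bind; [apply (Hh i (v :: z :: tl e) (w :: Z :: tl E)); auto| |unfold K; apply le_n].
   intros q3 ds3 s3 hv Hq3 Hs3 Ht3 Hhv.
   eapply sim_bind; [apply (Hb i (z :: tl e) (Z :: tl E)); auto; eapply list_ext; [| |constructor; eauto]; eauto| |apply le_n].
   intros q4 ds4 s4 bv Hq4 Hs4 Ht4 Hbv. apply (bits_inst_ext Hq4 Hs4) in Hhv.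
   eapply sim_bind; [eapply sim_le; [apply (sim_minimum _ _ _ hv _ bv _ Ht4 Hhv Hbv)|]| |apply le_n].
   { apply Nat.mul_le_mono_l. unfold V. lia. }
   intros q5 ds5 s5 m Hq5 Hs5 Ht5 Hm.
   assert (Hs35 := ext_trans _ _ _ _ _ Hq3 Hs3 (ext_trans _ _ _ _ _ Hq4 Hs4 Hs5)).
   assert (Hq35 : q2 <= q5) by lia.
   apply (bits_inst_ext Hq35 Hs35) in Hz. apply (bits_inst_ext Hq35 Hs35) in Hv.
   eapply sim_bind with (RA := bit_of); [eapply sim_le; [apply sim_define; [exact Ht5|apply inst_disj, inst_bits; exact Hz|apply le_n]|]| |apply le_n].
   { assert (Sz := size_disj z 3 (fun A => bits_small _ _ _ _ A Hz)). rewrite (bits_length _ _ _ _ Hz) in Sz. lia. }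
   intros q6 ds6 s6 c Hq6 Hs6 Ht6 Hc. eapply sim_le; [apply sim_mux; auto; eapply bits_inst_ext; eauto|].
   apply Nat.mul_le_mono_l. rewrite minp_length. unfold V in *. lia.
  + rewrite length_rev, length_seq. apply Nat.mul_le_mono_r. exact H0.
Qed.
End Translate.

Definition matrix (k n : nat) (f : poly_fun) (x y C : bits) : pform :=
 let N := repeat ptop n in
 let sat u v := pdisj (ttrans sat_prog [N; u; v]) in
 let f1 := ttrans (fst f) [N; C] in
 por (pimp (sat x y) (sat x (ttrans (eval_prog k) [N; C; x])))
   (pand (sat f1 (ttrans (snd f) [N; C])) (pneg (sat f1 (ttrans (eval_prog k) [N; C; f1])))).

Lemma bits_var_block s q off l X : length X = l -> off + l <= q -> (forall j, j < l -> s (off + j) = nth j X pbot) ->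
 bits_inst s q (var_block off l) X.
Proof.
 unfold var_block. revert off X. induction l as [|l IH]; intros off [|A X] HX Hq Hs; try discriminate; cbn; constructor.
 - split; [|cbn; lia]. split; [cbn; lia|]. cbn. rewrite <- (Nat.add_0_r off). apply (Hs 0). lia.
 - apply IH; [auto|lia|]. intros j Hj. change (nth j X pbot) with (nth (S j) (A :: X) pbot). rewrite <- Hs by lia. f_equal. lia.
Qed.

Section Instance.
Context {SC : Scale}.

Lemma descr_len_pb n k : pb n -> pb (fun i => descr_len (n i) k).
Proof.
 intros H. assert (Hk := pb_pow n k H).
 assert (Hp : pb (fun i => blen (n i ^ k) + 1)).
 { eapply pb_le; [|apply (pb_S _ Hk)]. intros i. cbv beta. assert (B := blen_le (n i ^ k)). lia. }
 unfold descr_len. cbv zeta.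
 apply (pb_add (fun i => n i ^ k * (4 + 2 * (blen (n i ^ k) + 1))) (fun i => n i * (blen (n i ^ k) + 1))).
 - apply (pb_mul (fun i => n i ^ k)); auto. apply (pb_add (fun _ => 4)); [apply pb_const|]. apply (pb_mul (fun _ => 2)); [apply pb_const|exact Hp].
 - now apply (pb_mul n).
Qed.

Lemma sim_sat L : pb L -> exists K, pb K /\
 forall i N x X y Y q ds s, trivial_defs q ds s -> bits_inst s q N N -> bits_inst s q x X -> bits_inst s q y Y ->
 length N <= L i -> length X <= L i -> length Y <= L i ->
 sim (fun s q A B => inst_of s q A B /\ psize A <= K i) q ds s (K i)
  (t <- translate sat_prog [N; x; y];; ret (pdisj t)) (pdisj (ttrans sat_prog [N; X; Y])).
Proof.
 intros HL. destruct (sim_translate sat_prog L HL) as (K & HK & H).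
 exists (fun i => K i + (1 + outlen sat_prog (L i) * 4)). split.
 { apply pb_add; auto. apply (pb_S (fun i => outlen sat_prog (L i) * 4)).
  apply (pb_mul (fun i => outlen sat_prog (L i)) (fun _ => 4)); [now apply outlen_pb|apply pb_const]. }
 intros i N x X y Y q ds s Ht HN Hx Hy LN LX LY.
 assert (HE : forall z, In z [N; X; Y] -> length z <= L i) by (intros z [<-|[<-|[<-|[]]]]; auto).
 eapply sim_bind with (K2 := 0); [apply (H i _ [N; X; Y]); auto| |lia].
 intros q1 ds1 s1 t _ _ Ht1 Hb. apply sim_ret; auto. split; [now apply inst_disj, inst_bits|].
 assert (Sz := size_disj t 3 (fun A => bits_small _ _ _ _ A Hb)). rewrite (bits_length _ _ _ _ Hb) in Sz.
 assert (LE := ttrans_length sat_prog _ _ HE). lia.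
Qed.

(** Any formulas may be put for the bits of [x], [y] and [C]: some instance of [w_formula] then has
    only equivalences [X <-> X] as hypotheses. The extended system therefore derives the expanded
    matrix in polynomially many lines. *)
Theorem w_instance k f n : pb n -> exists K, pb K /\ forall i x y C,
 length x = n i -> length y = n i -> length C = descr_len (n i) k ->
 psize (w_formula k (n i) f) <= K i /\
 exists s ds, psubst s (w_formula k (n i) f) = pimp (pconj ds) (matrix k (n i) f x y C) /\
  length ds <= K i /\ forall d, In d ds -> exists X, d = piff X X.
Proof.
 intros Hn. set (L0 := fun i => n i + descr_len (n i) k).
 assert (H0 : pb L0) by (apply pb_add; [auto|now apply descr_len_pb]).
 set (L1 := fun i => L0 i + outlen (fst f) (L0 i)).
 assert (H1 : pb L1) by (apply pb_add; auto; now apply outlen_pb).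
 set (L2 := fun i => L1 i + (outlen (snd f) (L1 i) + outlen (eval_prog k) (L1 i))).
 assert (H2 : pb L2) by (apply pb_add; [exact H1|apply pb_add; now apply outlen_pb]).
 destruct (sim_translate (eval_prog k) L1 H1) as (Ke & HKe & He).
 destruct (sim_translate (fst f) L1 H1) as (K1 & HK1 & Hf1).
 destruct (sim_translate (snd f) L1 H1) as (K2 & HK2 & Hf2).
 destruct (sim_sat L2 H2) as (Ks & HKs & Hs).
 set (T := fun i => Ke i + (K1 i + (K2 i + (Ke i + (Ks i + (Ks i + (Ks i + (Ks i + 0)))))))).
 set (K := fun i => 6 + (T i + T i) + (Ks i + Ks i + (Ks i + Ks i)) + 5).
 assert (HK : pb K).
 { unfold K, T. repeat first [apply pb_add | apply pb_const | assumption]. }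
 exists K. split; auto. intros i x y C Lx Ly LC.
 set (s0 := fun j => if j <? n i then nth j x pbot else if j <? 2 * n i then nth (j - n i) y pbot else nth (j - 2 * n i) C pbot).
 set (q0 := 2 * n i + descr_len (n i) k).
 set (N := repeat ptop (n i)).
 assert (LN : length N = n i) by apply repeat_length.
 assert (HN : forall s q, bits_inst s q N N).
 { intros s q. unfold N. clear. induction (n i); constructor; auto. apply bit_const; cbn; lia. }
 assert (Ht0 : trivial_defs q0 [] s0) by (intros d []).
 assert (Hx : bits_inst s0 q0 (var_block 0 (n i)) x).
 { apply bits_var_block; auto; [unfold q0; lia|]. intros j Hj. unfold s0. cbn [Nat.add].
  now rewrite (proj2 (Nat.ltb_lt _ _) Hj). }
 assert (Hy : bits_inst s0 q0 (var_block (n i) (n i)) y).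
 { apply bits_var_block; auto; [unfold q0; lia|]. intros j Hj. unfold s0.
  rewrite (proj2 (Nat.ltb_ge _ _)), (proj2 (Nat.ltb_lt _ _)) by lia. f_equal. lia. }
 assert (HC : bits_inst s0 q0 (var_block (2 * n i) (descr_len (n i) k)) C).
 { apply bits_var_block; auto. intros j Hj. unfold s0.
  rewrite !(proj2 (Nat.ltb_ge _ _)) by lia. f_equal. lia. }
 set (vx := var_block 0 (n i)) in *. set (vy := var_block (n i) (n i)) in *.
 set (vC := var_block (2 * n i) (descr_len (n i) k)) in *.
 set (F1 := ttrans (fst f) [N; C]).
 assert (B0 : forall z, In z [N; C] -> length z <= L0 i) by (intros z [<-|[<-|[]]]; unfold L0; lia).
 assert (B1 : forall z, In z [N; C] -> length z <= L1 i) by (intros z Hz; specialize (B0 z Hz); unfold L1; lia).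
 assert (LF1 : length F1 <= L1 i) by (assert (E := ttrans_length (fst f) _ _ B0); unfold L1, F1; lia).
 assert (Bx : forall z, In z [N; C; x] -> length z <= L1 i) by (intros z [<-|[<-|[<-|[]]]]; unfold L1, L0; lia).
 assert (Bf : forall z, In z [N; C; F1] -> length z <= L1 i) by (intros z [<-|[<-|[<-|[]]]]; auto; unfold L1, L0; lia).
 set (m := (Cx <- translate (eval_prog k) [N; vC; vx];;
   f1 <- translate (fst f) [N; vC];;
   f2 <- translate (snd f) [N; vC];;
   Cf1 <- translate (eval_prog k) [N; vC; f1];;
   a <- (t <- translate sat_prog [N; vx; vy];; ret (pdisj t));;
   b <- (t <- translate sat_prog [N; vx; Cx];; ret (pdisj t));;
   c <- (t <- translate sat_prog [N; f1; f2];; ret (pdisj t));;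
   d <- (t <- translate sat_prog [N; f1; Cf1];; ret (pdisj t));;
   ret (por (pimp a b) (pand c (pneg d)))) : trans pform).
 assert (G : sim (fun s q A B => inst_of s q A B /\ psize A <= 6 + (Ks i + Ks i + (Ks i + Ks i))) q0 [] s0 (T i) m (matrix k (n i) f x y C)).
 { unfold m, matrix. cbv zeta. fold N. fold F1.
  assert (LE : forall p z, (forall w, In w z -> length w <= L1 i) -> length (ttrans p z) <= outlen p (L1 i)) by (intros; now apply ttrans_length).
  assert (LEx := LE (eval_prog k) _ Bx). assert (LEf := LE (eval_prog k) _ Bf). assert (LF2 := LE (snd f) _ B1).
  assert (LL : L1 i <= L2 i) by (unfold L2; lia). assert (L01 : L0 i <= L1 i) by (unfold L1; lia).
  assert (Ln : n i <= L0 i) by (unfold L0; lia).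
  eapply sim_bind; [apply (He i _ [N; C; x]); auto; repeat constructor; auto| |unfold T; apply le_n].
  intros q1 ds1 s1 Cx Q1 E1 T1 R1.
  apply (bits_inst_ext Q1 E1) in Hx, Hy, HC.
  eapply sim_bind; [apply (Hf1 i _ [N; C]); auto; repeat constructor; auto| |apply le_n].
  intros q2 ds2 s2 f1 Q2 E2 T2 R2. apply (bits_inst_ext Q2 E2) in Hx, Hy, HC, R1. fold F1 in R2.
  eapply sim_bind; [apply (Hf2 i _ [N; C]); auto; repeat constructor; auto| |apply le_n].
  intros q3 ds3 s3 f2 Q3 E3 T3 R3. apply (bits_inst_ext Q3 E3) in Hx, Hy, HC, R1, R2.
  eapply sim_bind; [apply (He i _ [N; C; F1]); auto; repeat constructor; auto| |apply le_n].
  intros q4 ds4 s4 Cf1 Q4 E4 T4 R4. apply (bits_inst_ext Q4 E4) in Hx, Hy, HC, R1, R2, R3.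
  eapply sim_bind; [apply (Hs i N vx x vy y); auto; lia| |apply le_n].
  intros q5 ds5 s5 a Q5 E5 T5 [Ra Sa]. apply (bits_inst_ext Q5 E5) in Hx, Hy, HC, R1, R2, R3, R4.
  eapply sim_bind; [apply (Hs i N vx x Cx (ttrans (eval_prog k) [N; C; x])); auto; unfold L2; lia| |apply le_n].
  intros q6 ds6 s6 b Q6 E6 T6 [Rb Sb]. apply (bits_inst_ext Q6 E6) in Hx, Hy, HC, R1, R2, R3, R4. apply (inst_of_ext _ _ _ _ _ _ Q6 E6) in Ra.
  eapply sim_bind; [apply (Hs i N f1 F1 f2 (ttrans (snd f) [N; C])); auto; unfold L2; lia| |apply le_n].
  intros q7 ds7 s7 c Q7 E7 T7 [Rc Sc]. apply (bits_inst_ext Q7 E7) in R2, R4. apply (inst_of_ext _ _ _ _ _ _ Q7 E7) in Ra, Rb.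
  eapply sim_bind; [apply (Hs i N f1 F1 Cf1 (ttrans (eval_prog k) [N; C; F1])); auto; unfold L2; lia| |apply le_n].
  intros q8 ds8 s8 d Q8 E8 T8 [Rd Sd]. apply (inst_of_ext _ _ _ _ _ _ Q8 E8) in Ra, Rb, Rc.
  apply sim_ret; auto. split.
  - exact (inst_or _ _ _ _ _ _ (inst_imp _ _ _ _ _ _ Ra Rb) (inst_and _ _ _ _ _ _ Rc (inst_neg _ _ _ _ Rd))).
  - cbn [psize pneg]. lia. }
 destruct G as (s & A & q & ds & Em & _ & _ & Ht & [[_ RA] SA] & Hc).
 assert (EW : w_formula k (n i) f = pimp (pconj ds) A).
 { transitivity (let (M, st) := m (q0, []) in pimp (pconj (snd st)) M); [refl|]. rewrite Em. refl. }
 change (cost []) with 0 in Hc. cbn [Nat.add] in Hc.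
 assert (SD : psize (pconj ds) <= 3 + (cost ds + length ds) /\ length ds <= cost ds).
 { clear. induction ds as [|d ds [IH1 IH2]]; [cbn; lia|]. assert (P := psize_pos d).
  change (S (psize d + psize (pconj ds)) <= 3 + (psize d + cost ds + S (length ds)) /\ S (length ds) <= psize d + cost ds). lia. }
 rewrite EW. split.
 - cbn [psize]. unfold K. lia.
 - exists s, (map (psubst s) ds). split; [|split].
  + cbn [psubst]. rewrite RA. f_equal. clear. induction ds as [|d ds IH]; [refl|]. cbn. f_equal. exact IH.
  + rewrite length_map. unfold K. lia.
  + intros d Hd. apply in_map_iff in Hd as (d' & <- & Hd). apply Ht in Hd as [_ Hd]. exact Hd.
Qed.
End Instance.

(** * Renaming the variables of a formula *)

Fixpoint vars (A : pform) : list nat :=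
 match A with
 | pvar i => [i]
 | pbot => []
 | pimp A B | pand A B | por A B => vars A ++ vars B
 end.

Fixpoint idx (v : nat) (l : list nat) : nat :=
 match l with [] => 0 | a :: l => if a =? v then 0 else S (idx v l) end.

Lemma nth_idx v l : In v l -> idx v l < length l /\ nth (idx v l) l 0 = v.
Proof.
 induction l as [|a l IH]; [intros []|]. cbn [idx]. destruct (Nat.eqb_spec a v) as [->|H]; [cbn; split; auto; lia|].
 intros [->|Hv]; [tauto|]. apply IH in Hv as [H1 H2]. cbn. split; [lia|auto].
Qed.

(** The variables of [A] may have huge numbers, which no code of polynomial length could mention.
    Positions in the list of occurrences replace them, and the assignment [var_bits] reverses the
    renaming. *)
Definition renamed (A : pform) : pform := psubst (fun v => pvar (idx v (vars A))) A.

Definition var_bits (A : pform) (n : nat) : bits :=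
 map (fun j => if j <? length (vars A) then pvar (nth j (vars A) 0) else pbot) (seq 0 n).

Lemma vars_length A : length (vars A) <= psize A.
Proof. induction A; cbn; rewrite ?length_app; lia. Qed.

Lemma renamed_spec A n : psize A <= n ->
 maxvar (renamed A) <= psize A /\ psize (renamed A) = psize A /\ psubst (nth_bit (var_bits A n)) (renamed A) = A /\
 (tautology A -> tautology (renamed A)).
Proof.
 intros Hn. unfold renamed. set (l := vars A). assert (Hl : length l <= psize A) by apply vars_length.
 assert (G : forall B, (forall v, In v (vars B) -> In v l) ->
  maxvar (psubst (fun v => pvar (idx v l)) B) <= psize A /\ psize (psubst (fun v => pvar (idx v l)) B) = psize B /\
  psubst (nth_bit (var_bits A n)) (psubst (fun v => pvar (idx v l)) B) = B /\
  forall u, peval u (psubst (fun v => pvar (idx v l)) B) = peval (fun v => u (idx v l)) B).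
 { induction B as [v| |B1 IH1 B2 IH2|B1 IH1 B2 IH2|B1 IH1 B2 IH2]; cbn [vars psubst maxvar psize peval]; intros H.
  3-5: destruct IH1 as (A1 & A2 & A3 & A4); [intros v Hv; apply H, in_or_app; auto|];
   destruct IH2 as (B1' & B2' & B3 & B4); [intros v Hv; apply H, in_or_app; auto|];
   repeat split; [lia|lia|congruence|intros u; now rewrite A4, B4].
  - destruct (nth_idx v l) as [H1 H2]; [apply H; now left|]. repeat split; [lia|].
   unfold var_bits. rewrite nth_bit_map by lia. fold l. now rewrite (proj2 (Nat.ltb_lt _ _) H1), H2.
  - repeat split; lia. }
 destruct (G A (fun v H => H)) as (G1 & G2 & G3 & G4). repeat split; auto.
 intros HT v. rewrite G4. apply HT.
Qed.

Definition num (l : list bool) : N := rd 0 (length l) (fun j => nth (length l - 1 - j) l false).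

Lemma num_bits l : (num l < 2 ^ #(length l))%N /\ bits_of (length l) (num l) = l.
Proof.
 split; [eapply N.lt_le_trans; [apply rd_bound|]; lia|].
 rewrite <- (map_seq_nth _ l false) at 3. apply map_ext_in. intros j Hj. apply in_seq in Hj.
 unfold num. rewrite rd_testbit, (proj2 (Nat.ltb_lt _ _)) by lia. f_equal. lia.
Qed.

Lemma pow_blen s : 0 < s -> s < 2 ^ blen s <= 2 * s.
Proof.
 intros Hs. assert (H := blen_lt s). rewrite <- (Nat2N.inj_pow 2) in H. split; [lia|].
 assert (Hb : blen s <> 0). { unfold blen. destruct s; [lia|]. intros E. apply len_zero in E. lia. }
 assert (G : ~ (#s < 2 ^ #(blen s - 1))%N).
 { intros G. apply size_nat_le in G. unfold blen in *. lia. }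
 rewrite <- (Nat2N.inj_pow 2) in G. replace (blen s) with (S (blen s - 1)) by lia. rewrite Nat.pow_succ_r'. lia.
Qed.

Lemma taut_size A : tautology A -> 2 <= psize A.
Proof.
 intros H. specialize (H (fun _ => false)).
 destruct A as [v| |A B|A B|A B]; cbn [peval] in H; try discriminate; cbn [psize];
  assert (P1 := psize_pos A); lia.
Qed.

(** * The instances attached to a family of tautologies *)

Section Assembly.
Variables (F : nat -> pform) (k e0 : nat).
Hypothesis HF : forall i, tautology (F i).
Hypothesis He0 : 6 <= e0.
Hypothesis HS : forall a, e0 <= a -> exists C, len C <= descr_len (2 ^ a) k /\
  forall x y, satb (2 ^ a) x y = true ->
   satb (2 ^ a) x (run (eval_prog k) [N.ones #(2 ^ a); C; x]) = true.

Lemma size_ge i : 2 <= psize (F i).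
Proof. apply taut_size, HF. Qed.

#[local] Instance SC : Scale := {| scale := fun i => psize (F i); scale_ge := size_ge |}.

(** A power of 2, as required for the search circuits. The factor 2 in the exponent makes [n] grow
    quadratically with the size of [F i], leaving room for tokens of logarithmic length; [e0]
    exceeds the threshold from which circuits exist. *)
Definition n (i : nat) : nat := 2 ^ (e0 + 2 * blen (psize (F i))).

Lemma n_pb : pb n.
Proof.
 apply (pb_le _ (fun i => 2 ^ e0 * (2 * psize (F i)) ^ 2)).
 - intros i. unfold n. rewrite Nat.pow_add_r, (Nat.mul_comm 2), Nat.pow_mul_r. apply Nat.mul_le_mono_l, Nat.pow_le_mono_l.
  apply pow_blen. assert (H := size_ge i). lia.
 - apply (pb_mul (fun _ => 2 ^ e0)); [apply pb_const|]. apply (pb_pow (fun i => 2 * psize (F i))).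
  apply (pb_mul (fun _ => 2)); [apply pb_const|exact pb_scale].
Qed.

Lemma n_large i : (psize (F i) + 2) * (3 + blen (n i)) <= n i.
Proof.
 unfold n. rewrite blen_pow2. set (s := psize (F i)). set (u := blen s).
 assert (H2 := size_ge i). fold s in H2. destruct (pow_blen s ltac:(lia)) as [H1 _]. fold u in H1.
 rewrite Nat.pow_add_r, (Nat.mul_comm 2 u), Nat.pow_mul_r. set (t := 2 ^ u) in *.
 assert (Hu : u < t) by apply pow_gt.
 assert (HE : 4 * e0 + 40 <= 2 ^ e0 * 2).
 { clear -He0. induction He0 as [|e H IH]; [cbn; lia|]. rewrite Nat.pow_succ_r'. lia. }
 replace (t ^ 2) with (t * t) by (simpl; lia). set (E := 2 ^ e0) in *. clearbody E t u s.
 assert (A1 : s + 2 <= 2 * t) by lia. assert (A2 : 2 * (3 + S (e0 + u * 2)) <= E * t) by nia.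
 assert (A3 := Nat.mul_le_mono_r _ _ (3 + S (e0 + u * 2)) A1).
 assert (A4 := Nat.mul_le_mono_r _ _ t A2). lia.
Qed.

Lemma size_le_n i : psize (F i) <= n i.
Proof. assert (H := n_large i). nia. Qed.

Definition xs (i : nat) : list bool := encode (n i) (rpn (pneg (renamed (F i)))).

Lemma xs_length i : length (xs i) = n i.
Proof. apply encode_length. Qed.

Definition X (i : nat) : N := num (xs i).

Lemma X_small i : (X i < 2 ^ #(n i))%N.
Proof. unfold X. rewrite <- xs_length. apply num_bits. Qed.

Lemma X_decode i : decode (n i) (bits_of (n i) (X i)) = Some (pneg (renamed (F i))).
Proof.
 unfold X. rewrite <- xs_length at 2. rewrite (proj2 (num_bits _)).
 destruct (renamed_spec (F i) (n i) (size_le_n i)) as (R1 & R2 & _). assert (Hn := size_le_n i).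
 unfold xs. rewrite decode_encode.
 - rewrite rpn_run; [refl|]. cbn [maxvar pneg]. lia.
 - rewrite rpn_length. cbn [psize pneg]. rewrite R2. etrans; [|apply (n_large i)]. apply Nat.mul_le_mono_r. lia.
 - apply Forall_forall. intros t Ht. apply rpn_var in Ht. cbn [maxvar pneg] in Ht.
  assert (B := blen_lt (n i)). lia.
Qed.

Lemma X_unsat i y : satb (n i) (X i) y = false.
Proof.
 unfold satb, SAT2. rewrite X_decode. apply andb_false_iff. right. apply andb_false_iff. right.
 cbn [peval pneg]. destruct (renamed_spec (F i) (n i) (size_le_n i)) as (_ & _ & _ & R). now rewrite (R (HF i)).
Qed.

Definition CN (i : nat) : N := proj1_sig (constructive_indefinite_description _ (HS (e0 + 2 * blen (psize (F i))) (Nat.le_add_r _ _))).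

Lemma CN_spec i : len (CN i) <= descr_len (n i) k /\
 forall x y, satb (n i) x y = true -> satb (n i) x (run (eval_prog k) [N.ones #(n i); CN i; x]) = true.
Proof. unfold CN. destruct (constructive_indefinite_description _ _) as [C HC]. exact HC. Qed.

(** Constants padded to a prescribed length, unlike [bitsN]: the variable blocks of [w_formula] have
    fixed lengths. *)
Definition constb (l : nat) (x : N) : bits := map (fun j => pconst (N.testbit x #j)) (seq 0 l).

Lemma constb_pb (l : nat -> nat) x : pb l -> pb (fun i => length (constb (l i) (x i))).
Proof. intros H. eapply pb_le; [|exact H]. intros i. cbv beta. unfold constb. now rewrite length_map_seq. Qed.

Definition constE l x (H : pb l) : elt := Elt (fun i => constb (l i) (x i)) (constb_pb l x H).

Lemma constE_isc q l x H : (forall i, len (x i) <= l i) -> isc q (constE l x H) x.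
Proof.
 intros Hx. assert (P : pbN x) by (eapply pb_le; [exact Hx|exact H]).
 exists P. apply meq_bits. intros i j _. cbn [fam constE cst]. rewrite bitsN_bit. unfold constb.
 destruct (Nat.lt_ge_cases j (l i)) as [L|L]; [now rewrite nth_bit_map|].
 rewrite nth_bit_over by (rewrite length_map_seq; lia). rewrite testbit_over by (specialize (Hx i); lia). refl.
Qed.

Lemma ones_pb : pb (fun i => length (repeat ptop (n i))).
Proof. eapply pb_le; [|exact n_pb]. intros i. cbv beta. now rewrite repeat_length. Qed.

Definition Ne : elt := Elt _ ones_pb.
Definition Xe : elt := constE n X n_pb.
Definition Ce : elt := constE (fun i => descr_len (n i) k) CN (descr_len_pb n k n_pb).

Lemma Y_pb : pb (fun i => length (var_bits (F i) (n i))).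
Proof. eapply pb_le; [|exact n_pb]. intros i. cbv beta. unfold var_bits. now rewrite length_map_seq. Qed.

Definition Ye : elt := Elt _ Y_pb.

Let ones (i : nat) : N := N.ones #(n i).

Lemma Ne_isc q : isc q Ne ones.
Proof.
 eapply isc_meq; [|apply (constE_isc q n ones n_pb); intros i; unfold ones; now rewrite len_ones].
 apply meq_eq. intros i _. cbn [fam Ne constE]. unfold constb, ones.
 transitivity (map (fun _ => ptop) (seq 0 (n i))).
 - generalize 0. induction (n i) as [|m IH]; intros j; cbn; f_equal. apply IH.
 - apply map_ext_in. intros j Hj. apply in_seq in Hj. rewrite N.ones_spec_low by lia. refl.
Qed.

Lemma Xe_isc q : isc q Xe X.
Proof. apply constE_isc. intros i. apply size_nat_le, X_small. Qed.

Lemma Ce_isc q : isc q Ce CN.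
Proof. apply constE_isc. intros i. apply CN_spec. Qed.

Section Matrix.
Variables (f : poly_fun) (q : cond).
Hypothesis Hq : prv q (fun i => pneg (F i)).

Let evalE z := papp (eval_prog k) [Ne; Ce; z].
Let f1 := papp (fst f) [Ne; Ce].
Let f2 := papp (snd f) [Ne; Ce].

(** Substituting [Ye] undoes the renaming, so the truth value of the encoded formula at [Ye] is
    literally the negation of [F i], which [q] assumes. *)
Lemma formula_sat : prv q (nz (papp sat_prog [Ne; Xe; Ye])).
Proof.
 assert (E : meq q (papp sat_prog [Ne; Xe; Ye]) (sat_value n (fun i => psubst (nth_bit (Ye i))) X)).
 { apply sat_symbolic; [apply Ne_isc|apply Xe_isc|intros; apply X_small|].
  intros i _. cbn [fam Ye]. unfold var_bits. rewrite length_map_seq. lia. }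
 apply nz_proper in E. puses (E, Hq).
 ptaut_by (unfold nz at 2; cbn [fam sat_value]; rewrite X_decode; cbn [psubst pneg pdisj fold_right]; destruct (renamed_spec (F i) (n i) (size_le_n i)) as (_ & _ & R & _); cbn [fam Ye]; rewrite R).
Qed.

(** The output of the circuit on the constant [X] is again a constant, and [F i] is a tautology, so
    this output cannot satisfy its negation. No derivation of [F i] is involved. *)
Lemma formula_unsat : meq q (papp sat_prog [Ne; Xe; evalE Xe]) mnil.
Proof.
 assert (I : isc q (evalE Xe) (fun i => run (eval_prog k) [ones i; CN i; X i])).
 { apply (closed_run _ q _ [ones; CN; X]). constructor; [apply Ne_isc|constructor; [apply Ce_isc|constructor; [apply Xe_isc|constructor]]]. }
 apply (isc_unique _ _ _ (fun _ => 0%N)); [|apply isc_nil].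
 eapply isc_ext; [|apply (pb_const 0)|exact (sat_const q n Ne Xe (evalE Xe) X _ (Ne_isc q) (Xe_isc q) I)].
 intros i _. cbv beta. now rewrite X_unsat.
Qed.

(** Whether [f2] satisfies [f1] is a property of constants and is decided at each index. If it does,
    the circuit finds a satisfying assignment of [f1] too. The two premises are refutations of the
    two possible outcomes, the form needed both for the propositional matrix and for the forced
    sentence. *)
Lemma circuit_correct q0 :
 (forall q', sub q0 q' -> meq q' (papp sat_prog [Ne; f1; f2]) mnil -> bad q') ->
 (forall q', sub q0 q' -> prv q' (nz (papp sat_prog [Ne; f1; evalE f1])) -> bad q') -> bad q0.
Proof.
 intros H1 H2.
 assert (I1 : forall q', isc q' f1 (fun i => run (fst f) [ones i; CN i])).
 { intros q'. apply (closed_run _ q' _ [ones; CN]). constructor; [apply Ne_isc|constructor; [apply Ce_isc|constructor]]. }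
 assert (I2 : forall q', isc q' f2 (fun i => run (snd f) [ones i; CN i])).
 { intros q'. apply (closed_run _ q' _ [ones; CN]). constructor; [apply Ne_isc|constructor; [apply Ce_isc|constructor]]. }
 set (r1 := fun i => run (fst f) [ones i; CN i]) in *. set (r2 := fun i => run (snd f) [ones i; CN i]) in *.
 assert (I3 : forall q', isc q' (evalE f1) (fun i => run (eval_prog k) [ones i; CN i; r1 i])).
 { intros q'. apply (closed_run _ q' _ [ones; CN; r1]). constructor; [apply Ne_isc|constructor; [apply Ce_isc|constructor; [apply I1|constructor]]]. }
 apply prv_split with (fun i => satb (n i) (r1 i) (r2 i) = true).
 - set (q' := restrict q0 _). apply H2; [apply sub_restrict|].
  eapply nz_isc; [exact (sat_const q' n Ne f1 (evalE f1) r1 _ (Ne_isc q') (I1 q') (I3 q'))|].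
  split_case.
  assert (Hi' : satb (n i) (r1 i) (run (eval_prog k) [ones i; CN i; r1 i]) = true) by exact (proj2 (CN_spec i) _ _ Hi).
  cbv beta. rewrite Hi'. discriminate.
 - set (q' := restrict q0 _). apply H1; [apply sub_restrict|].
  apply (isc_unique _ _ _ (fun _ => 0%N)); [|apply isc_nil].
  eapply isc_ext; [|apply (pb_const 0)|exact (sat_const q' n Ne f1 f2 r1 r2 (Ne_isc q') (I1 q') (I2 q'))].
  intros i Hi. apply (live_restrict q0 (fun i => ~ satb (n i) (r1 i) (r2 i) = true)) in Hi. cbv beta.
  now destruct (satb (n i) (r1 i) (r2 i)).
Qed.

Lemma matrix_bad : prv q (fun i => matrix k (n i) f (Xe i) (Ye i) (Ce i)) -> bad q.
Proof.
 intros HM.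
 assert (HM' : prv q (fun i => por (pimp (nz (papp sat_prog [Ne; Xe; Ye]) i) (nz (papp sat_prog [Ne; Xe; evalE Xe]) i))
  (pand (nz (papp sat_prog [Ne; f1; f2]) i) (pneg (nz (papp sat_prog [Ne; f1; evalE f1]) i))))).
 { eapply prv_eq; [|exact HM]. intros i _. unfold matrix, nz, evalE, f1, f2. cbn [fam papp args map Ne]. refl. }
 clear HM. rename HM' into HM.
 assert (A := formula_sat). assert (B := proj2 (nz_false q _) formula_unsat).
 apply circuit_correct; auto.
 - intros q' Sq H. apply nz_false in H. apply (prv_sub Sq) in HM, A, B.
  unfold bad. puses (HM, A, B, H). ptaut0.
 - intros q' Sq H. apply (prv_sub Sq) in HM, A, B.
  unfold bad. puses (HM, A, B, H). ptaut0.
Qed.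

Lemma tv_numeral r m : isc q (tv r (numeral m)) (fun _ => #m).
Proof.
 induction m as [|m IH]; [apply isc_nil|].
 eapply isc_ext; [|apply (pb_const (len #(S m)))|exact (isc_succ _ _ _ IH)]. intros i _. cbv beta. now rewrite Nat2N.inj_succ.
Qed.

Let r : env := scons Ce (scons Ye (scons Xe (scons Ne (fun _ => mnil)))).
Let nt := tlen (tvar 3).

Lemma tv_n : isc q (tv r nt) (fun i => #(n i)).
Proof.
 eapply isc_ext; [| |exact (isc_len _ _ _ (Ne_isc q))].
 - intros i _. unfold ones. cbv beta. now rewrite size_size_nat, len_ones.
 - eapply pb_le; [|exact n_pb]. intros i. apply size_nat_of_nat.
Qed.

Lemma tv_tpow j : isc q (tv r (tpow nt j)) (fun i => #(n i ^ j)).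
Proof.
 induction j as [|j IH]; [exact (tv_numeral r 1)|].
 eapply isc_ext; [| |exact (isc_mul _ _ _ _ _ IH tv_n)].
 - intros i _. cbv beta. cbn [Nat.pow]. lia.
 - eapply pb_le; [|exact (pb_pow n (S j) n_pb)]. intros i. apply size_nat_of_nat.
Qed.

Let pt := tadd (tlen (tpow nt k)) tone.

Lemma tv_p : isc q (tv r pt) (fun i => #(blen (n i ^ k) + 1)).
Proof.
 assert (H := isc_add0 _ _ _ _ _ (isc_len _ _ _ (tv_tpow k)) (tv_numeral r 1)).
 eapply isc_ext; [| |exact H].
 - intros i _. cbv beta. rewrite size_size_nat. unfold blen. lia.
 - eapply pb_le; [|exact (isc_pb H)]. intros i. cbv beta. rewrite size_size_nat. unfold blen.
  rewrite Nat2N.inj_add. refl.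
Qed.

Lemma tv_descr : isc q (tv r (tadd (tmul (tpow nt k) (tadd (numeral 4) (tdbl pt))) (tmul nt pt)))
 (fun i => #(descr_len (n i) k)).
Proof.
 assert (H := isc_add0 _ _ _ _ _
  (isc_mul _ _ _ _ _ (tv_tpow k) (isc_add0 _ _ _ _ _ (tv_numeral r 4) (isc_mul _ _ _ _ _ (tv_numeral r 2) tv_p)))
  (isc_mul _ _ _ _ _ tv_n tv_p)).
 eapply isc_ext; [| |exact H].
 - intros i _. cbv beta. unfold descr_len. cbv zeta. lia.
 - eapply pb_le; [|exact (descr_len_pb n k n_pb)]. intros i. apply size_nat_of_nat.
Qed.

Lemma W_bad n0 : (forall i, n0 < n i) -> force q (fun _ => mnil) (W_sentence k n0 f) -> bad q.
Proof.
 intros Hn0 H. unfold W_sentence in H. cbv zeta in H. cbn [force] in H.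
 specialize (H Ne Xe Ye Ce q (sub_refl q)). fold r in H. fold nt in H. fold pt in H.
 assert (IS : isc q (msucc Ne) (fun i => 2 ^ #(n i))%N).
 { eapply isc_ext; [| |exact (isc_succ _ _ _ (Ne_isc q))].
  - intros i _. unfold ones. cbv beta. rewrite N.ones_equiv, N.succ_pred; auto. apply N.pow_nonzero. discriminate.
  - eapply pb_le; [|apply (pb_S _ n_pb)]. intros i. cbv beta. now rewrite size_nat_pow2. }
 refine (_ (H _)); clear H.
 2: { refine (conj _ (conj _ (conj _ (conj _ _)))).
  - apply (isc_unique _ _ _ _ IS).
   assert (L1 := isc_len_is _ _ _ (tv_numeral r 1)). assert (L2 := isc_len_is _ _ _ (Ne_isc q)).
   assert (PN : pb (fun i => len (ones i))) by (apply (isc_pb (Ne_isc q))).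
   assert (IM := msmash_isc_of q _ _ _ _ L1 L2 (pb_const 1) PN).
   eapply isc_ext; [| |exact IM].
   + intros i _. unfold ones. cbv beta. rewrite len_ones. now rewrite Nat.mul_1_l.
   + exact (isc_pb IS).
  - apply (isc_le _ _ _ _ _ (tv_numeral r (S n0)) tv_n). intros i _. specialize (Hn0 i). lia.
  - apply (isc_le _ _ _ _ _ (isc_len _ _ _ (Xe_isc q)) tv_n). intros i _. rewrite size_size_nat.
   assert (HX := X_small i). apply size_nat_le in HX. lia.
  (* The number [Ye] is symbolic, but a list of [n i] bits is below [2 ^ n i], which is the
     successor of [Ne]; its length is then at most that of [Ne]. *)
  - apply (le_len q Ye Ne). assert (LT : lt_ q Ye (msucc Ne)).
   { apply lt_pow2 with (l := n); [exact n_pb| |exact IS].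
    intros i _. cbn [fam Ye]. unfold var_bits. now rewrite length_map_seq. }
   unfold lt_ in LT. assert (LS := less_succ q Ne Ye). unfold le_. puses (LT, LS). ptaut0.
  - apply (isc_le _ _ _ _ _ (isc_len _ _ _ (Ce_isc q)) tv_descr). intros i _. rewrite size_size_nat.
   assert (HC := proj1 (CN_spec i)). lia. }
 intros H. apply (H q (sub_refl q)); clear H.
 - intros q2 S2 H. assert (A := prv_sub S2 formula_sat). assert (B := meq_sub S2 formula_unsat).
  refine (H q2 (sub_refl q2) _ q2 (sub_refl q2) B).
  intros q3 S3 E. exact (nz_nil_bad q3 _ (prv_sub S3 A) E).
 - intros q2 S2 [H1 H2]. apply (circuit_correct q2).
  + intros q3 S3 E. exact (H1 q3 S3 E).
  + intros q3 S3 E. refine (H2 q3 S3 _). intros q4 S4 E4. exact (nz_nil_bad q4 _ (prv_sub S4 E) E4).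
Qed.
End Matrix.

(** A short contradiction from [~ F i] is a short derivation of [F i], and [ef_of_der] turns the
    count of lines into a proof size. *)
Lemma ef_of_bad Ax (Q : nat -> pform -> Prop) b : pb b ->
 (forall i W s, Q i W -> Ax (psubst s W)) -> (forall i W, Q i W -> psize W <= b i) ->
 bad (addc (fun i A => exists W s, Q i W /\ A = psubst s W) (fun i => pneg (F i))) ->
 exists c, forall i, exists pi, ef_proof Ax (F i) pi /\ proof_size pi <= psize (F i) ^ c.
Proof.
 intros Hb HQ HW HB. apply prv_raa in HB as (h & Hh & Hd). destruct ef_of_der as (K & HK).
 assert (P : pb (fun i => K * (S (h i) * (b i + 40) * (b i + 40) + psize (F i) * psize (F i)))).
 { apply (pb_mul (fun _ => K)); [apply pb_const|]. apply pb_add.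
  - assert (B : pb (fun i => b i + 40)) by (apply pb_add; [exact Hb|apply pb_const]).
   apply (pb_mul (fun i => S (h i) * (b i + 40))); [|exact B]. apply (pb_mul (fun i => S (h i))); [now apply pb_S|exact B].
  - apply (pb_mul (fun i => psize (F i)) (fun i => psize (F i))); exact pb_scale. }
 destruct P as (c & Hc). exists c. intros i.
 destruct (HK Ax (Q i) (F i) (b i) (h i) (HQ i) (HW i) (Hd i)) as (pi & H1 & H2).
 exists pi. split; auto. etrans; [exact H2|exact (Hc i)].
Qed.

Lemma EF_plus_w_bounded f n0 : (forall i, n0 < n i) ->
 exists c, forall i, exists pi, EF_plus_w k f n0 (F i) pi /\ proof_size pi <= psize (F i) ^ c.
Proof.
 intros Hn0. destruct (w_instance k f n n_pb) as (K & HK & HW).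
 apply (ef_of_bad _ (fun i W => W = w_formula k (n i) f) K HK).
 - intros i W s ->. exists (n i), s. auto.
 - intros i W ->. destruct (HW i (Xe i) (Ye i) (Ce i)) as [H _]; auto; cbn [fam Xe Ye Ce constE]; unfold constb, var_bits;
   now rewrite length_map_seq.
 - set (q := addc _ _). apply (matrix_bad f); [apply prv_hyp|].
  assert (HI : forall i, exists ds, q i (pimp (pconj ds) (matrix k (n i) f (Xe i) (Ye i) (Ce i))) /\
   length ds <= K i /\ forall d, In d ds -> exists X, d = piff X X).
  { intros i. destruct (HW i (Xe i) (Ye i) (Ce i)) as (_ & s & ds & E & H1 & H2); cbn [fam Xe Ye Ce constE]; unfold constb, var_bits;
    try now rewrite length_map_seq.
   exists ds. split; auto. right. exists (w_formula k (n i) f), s. auto. }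
  apply choice in HI as (ds & HI).
  apply prv_mp with (fun i => pconj (ds i)).
  + apply pconj_intro; [eapply pb_le; [|exact HK]; intros i; apply HI|].
   intros A q' Sq HA.
   assert (HX : forall i, exists X, live q' i -> A i = piff X X).
   { intros i. destruct (classic (live q' i)) as [Hi|Hi]; [|exists pbot; tauto].
    destruct (proj2 (proj2 (HI i)) _ (HA i Hi)) as (X0 & E). exists X0. auto. }
   apply choice in HX as (X0 & HX). ptaut_by (rewrite (HX i Hi)).
  + apply prv_intro with (fun _ => 1); [apply pb_const|]. intros i _. apply der_ax, HI.
Qed.

Lemma EF_bounded f n0 : (forall i, n0 < n i) -> proves S12 (W_sentence k n0 f) ->
 exists c, forall i, exists pi, EF (F i) pi /\ proof_size pi <= psize (F i) ^ c.
Proof.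
 intros Hn0 HP. apply (ef_of_bad _ (fun _ _ => False) (fun _ => 0) (pb_const 0)).
 - intros i W s [].
 - intros i W [].
 - apply (W_bad f _ (prv_hyp _ _) n0 Hn0).
  apply (soundness S12 [] _ HP); [apply force_S12|intros B []].
Qed.
End Assembly.

(** The tautology with index [c] defeats the bound with exponent [c]; a common exponent for the
    family would fail at its own index. *)
Lemma unbounded_family (P : proof_system) : ~ polynomially_bounded P ->
 exists F : nat -> pform, (forall c, tautology (F c)) /\
  ~ exists c, forall i, exists pi, P (F i) pi /\ proof_size pi <= psize (F i) ^ c.
Proof.
 intros H.
 assert (G : forall c, exists F, tautology F /\ forall pi, P F pi -> ~ proof_size pi <= psize F ^ c + c).
 { intros c. apply NNPP. intros N. apply H. exists c. intros F HF. apply NNPP. intros M. apply N.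
  exists F. split; auto. intros pi H1 H2. apply M. eauto. }
 apply choice in G as (F & HF). exists F. split; [intros c; apply HF|]. intros (c & Hc).
 destruct (Hc c) as (pi & H1 & H2). apply (proj2 (HF c) pi H1). lia.
Qed.

Theorem theorem1p1 :
 exists eps : R, (0 < eps)%R /\
 forall k : nat, 1 <= k ->
  let SAT_hard :=
   forall m : nat, exists n : nat, m < n /\
    ~ SAT_in_Circuit n (Rpower (INR n) (eps * INR k)) in
  (forall (f : poly_fun) (n0 : nat),
    (forall n : nat, n0 < n -> tautology (w_formula k n f)) ->
    ~ polynomially_bounded (EF_plus_w k f n0) ->
    SAT_hard)
  /\
  (forall (f : poly_fun) (n0 : nat),
    proves S12 (W_sentence k n0 f) ->
    ~ polynomially_bounded EF ->
    SAT_hard).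
Proof.
 exists (1 / 8)%R. split; [lra|]. intros k Hk SAT_hard.
 assert (HS : ~ SAT_hard -> exists a0, forall a, a0 <= a -> exists C, len C <= descr_len (2 ^ a) k /\
  forall x y, satb (2 ^ a) x y = true ->
   satb (2 ^ a) x (run (eval_prog k) [N.ones #(2 ^ a); C; x]) = true).
 { intros H. apply search_circuits; auto. apply NNPP. intros N. apply H. intros m. apply NNPP. intros M.
  apply N. exists m. intros n Hn. apply NNPP. intros HC. apply M. eauto. }
 assert (HN : forall F n0 e0 i, n0 < e0 -> n0 < n F e0 i).
 { intros F n0 e0 i H. unfold n. assert (L := pow_gt (e0 + 2 * blen (psize (F i)))). lia. }
 split; intros f n0 H1 H2; apply NNPP; intros H; destruct (HS H) as (a0 & Ha0);
  destruct (unbounded_family _ H2) as (F & HF & HU); apply HU; set (e0 := a0 + n0 + 6).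
 - apply (EF_plus_w_bounded F k e0 HF); [unfold e0; lia|intros a Ha; apply Ha0; unfold e0 in Ha; lia|].
  intros i. apply HN. unfold e0. lia.
 - apply (EF_bounded F k e0 HF) with f n0; [unfold e0; lia|intros a Ha; apply Ha0; unfold e0 in Ha; lia| |exact H1].
  intros i. apply HN. unfold e0. lia.
Qed.
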